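(* Let $0<t_\ast<\infty$ and $\rho>0$. For each type $R_N$ and $t\in(0,t_\ast)$ let $\Xi^{R_N}=\sum_{j=1}^N\delta_{X_j}$ be the $N$-point process whose configuration $\mathbf X$ has law $\mathbf P^{R_N}_t$. Take the scaling limit $N\to\infty$, $r\to\infty$ with $N/(2\pi r)=\rho$ for $A_N$ and $N/(\pi r)=\rho$ for the other six types. Then, in the sense of finite dimensional distributions, the one-parameter families $(\Xi^{R_N},\mathbf P^{R_N}_t,t\in(0,t_\ast))$ converge to four infinite determinantal point processes: $(\Xi^{A_N},\mathbf P^{A_N}_t)\Rightarrow(\Xi^A,\mathbf P^A_t)$ on $\mathbb R$ with correlation kernel $\mathcal K^A_t$; $(\Xi^{R_N},\mathbf P^{R_N}_t)\Rightarrow(\Xi^B,\mathbf P^B_t)$ on $[0,\infty)$ with kernel $\mathcal K^B_t$ for $R_N=B_N,B_N^\vee$; $(\Xi^{R_N},\mathbf P^{R_N}_t)\Rightarrow(\Xi^C,\mathbf P^C_t)$ on $[0,\infty)$ with kernel $\mathcal K^C_t$ for $R_N=C_N,C_N^\vee,BC_N$; and $(\Xi^{D_N},\mathbf P^{D_N}_t)\Rightarrow(\Xi^D,\mathbf P^D_t)$ on $[0,\infty)$ with kernel $\mathcal K^D_t$, $t\in(0,t_\ast)$.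
   Context: Jacobi theta functions: for $v\in\mathbb C$, $\tau\in\mathbb H=\{\Im\tau>0\}$, $z=e^{\pi iv}$, $q=e^{\pi i\tau}$: $\vartheta_1(v;\tau)=i\sum_{n\in\mathbb Z}(-1)^nq^{(n-1/2)^2}z^{2n-1}$, $\vartheta_2(v;\tau)=\sum_{n\in\mathbb Z}q^{(n-1/2)^2}z^{2n-1}$. $\Theta^A(\sigma,z,\tau)=e^{2\pi i\sigma z}\vartheta_2(\sigma\tau+z;\tau)$, $\Theta^B=e^{2\pi i\sigma z}\vartheta_1(\sigma\tau+z;\tau)-e^{-2\pi i\sigma z}\vartheta_1(\sigma\tau-z;\tau)$, $\Theta^C=e^{2\pi i\sigma z}\vartheta_2(\sigma\tau+z;\tau)-e^{-2\pi i\sigma z}\vartheta_2(\sigma\tau-z;\tau)$, $\Theta^D=e^{2\pi i\sigma z}\vartheta_2(\sigma\tau+z;\tau)+e^{-2\pi i\sigma z}\vartheta_2(\sigma\tau-z;\tau)$. $\sharp(R_N)=A,B,B,C,C,C,D$ for $R_N=A_N,B_N,B_N^\vee,C_N,C_N^\vee,BC_N,D_N$; $J^{R_N}(j)=j-1/2$ for $A_N,C_N^\vee$, $j-1$ for $B_N,B_N^\vee,D_N$, $j$ for $C_N,BC_N$; $\mathcal N^{A_N}=N$, $\mathcal N^{B_N}=2N-1$, $\mathcal N^{B_N^\vee}=\mathcal N^{C_N^\vee}=2N$, $\mathcal N^{C_N}=2(N+1)$, $\mathcal N^{BC_N}=2N+1$, $\mathcal N^{D_N}=2(N-1)$. $\xi(x)=x/(2\pi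 r)$, $\tau(t)=it/(2\pi r^2)$; $M^{R_N}_j(x,t)=\Theta^{\sharp(R_N)}(J^{R_N}(j)/\mathcal N^{R_N},\mathcal N^{R_N}\xi(x),(\mathcal N^{R_N})^2\tau(t))$. Constants $m^{R_N}_j(t_\ast)$: for $A_N,C_N,C_N^\vee,BC_N$: $2\pi r\vartheta_2(\mathcal N^{R_N}J^{R_N}(j)\tau(t_\ast);(\mathcal N^{R_N})^2\tau(t_\ast))$; for $B_N,B_N^\vee$: $m_1=4\pi r\vartheta_2(0;(\mathcal N^{R_N})^2\tau(t_\ast))$, $m_j=2\pi r\vartheta_2(\mathcal N^{R_N}J^{R_N}(j)\tau(t_\ast);(\mathcal N^{R_N})^2\tau(t_\ast))$ ($j\ge2$); for $D_N$: $m_1=4\pi r\vartheta_2(0;(\mathcal N^{D_N})^2\tau(t_\ast))$, $m_j=2\pi r\vartheta_2(\mathcal N^{D_N}J^{D_N}(j)\tau(t_\ast);(\mathcal N^{D_N})^2\tau(t_\ast))$ ($2\le j\le N-1$), $m_N=4\pi r\vartheta_2(\mathcal N^{D_N}(N-1)\tau(t_\ast);(\mathcal N^{D_N})^2\tau(t_\ast))$. $\mathbf P^{R_N}_t$: probability measure on $\{0\le x_1<\dots<x_N<2\pi r\}$ (type $A_N$) or $\{0\le x_1<\dots<x_N\le\pi r\}$ (others) with density $\det[\overline{M^{R_N}_j(x_k,t_\ast-t)}]\det[M^{R_N}_\ell(x_m,t)]/\prod_nm^{R_N}_n(t_\ast)$. Limit kernels, with $D(\lambda)=\vartheta_2(\pi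 it_\ast\rho\lambda;2\pi it_\ast\rho^2)$: $\mathcal K^A_t(x,y;t_\ast,\rho)=\int_0^\rho d\lambda\,e^{2\pi i(x-y)\lambda}\vartheta_2(\rho x+2\pi it\rho\lambda;2\pi it\rho^2)\vartheta_2(\rho y-2\pi i(t_\ast-t)\rho\lambda;2\pi i(t_\ast-t)\rho^2)/\vartheta_2(2\pi it_\ast\rho\lambda;2\pi it_\ast\rho^2)$ for $x,y\in\mathbb R$; $\mathcal K^B_t(x,y;t_\ast,\rho)=\frac12[\int_{-\rho}^\rho d\lambda\,e^{\pi i(x-y)\lambda}\vartheta_1(\rho x+\pi it\rho\lambda;2\pi it\rho^2)\vartheta_1(\rho y-\pi i(t_\ast-t)\rho\lambda;2\pi i(t_\ast-t)\rho^2)/D(\lambda)-\int_{-\rho}^\rho d\lambda\,e^{\pi i(x+y)\lambda}\vartheta_1(\rho x+\pi it\rho\lambda;2\pi it\rho^2)\vartheta_1(-\rho y-\pi i(t_\ast-t)\rho\lambda;2\pi i(t_\ast-t)\rho^2)/D(\lambda)]$ for $x,y\ge0$; $\mathcal K^C_t$ is $\mathcal K^B_t$ with every $\vartheta_1$ replaced by $\vartheta_2$; $\mathcal K^D_t$ is $\mathcal K^C_t$ with the minus between the two integrals replaced by plus. A point process is determinantal with kernel $K$ if all its $n$-point correlation functions (densities of factorial moment measures) are $\det_{1\le j,k\le n}[K(x_j,x_k)]$.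
   Formalization: For type A_N the particles in [0,2πr) are viewed on the circle and placed in [-πr,πr) before the limit, since read literally no particle is ever negative and convergence to a process on all of ℝ would fail. *)

(* Defs.v *)
From HB Require Import structures.
From mathcomp Require Import all_boot all_order all_algebra.
From mathcomp Require Import all_classical all_reals all_analysis.
From mathcomp Require Import finmap.
From mathcomp Require complex.
Import complex.
Set Implicit Arguments. Unset Strict Implicit. Unset Printing Implicit Defensive.
Import Order.TTheory GRing.Theory Num.Theory numFieldNormedType.Exports.
Local Open Scope classical_set_scope.
Local Open Scope ring_scope.

Section Defs.
Variable R : realType.
Local Notation C := (complex R).

Definition cR (x : R) : C := Complex x 0.
Definition iC : C := Complex 0 1.
Definition cexp (w : C) : C :=
  Complex (expR (complex.Re w) * cos (complex.Im w)) (expR (complex.Re w) * sin (complex.Im w)).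
Definition zpsum (f : int -> C) (K : nat) : C :=
  \sum_(k < (2 * K).+1) f (k%:Z - K%:Z).
Definition zsum (f : int -> C) : C :=
  Complex (limn (fun K => complex.Re (zpsum f K))) (limn (fun K => complex.Im (zpsum f K))).
Definition cint (a b : R) (g : R -> C) : C :=
  Complex (\int[lebesgue_measure]_(l in `[a, b]) complex.Re (g l))
          (\int[lebesgue_measure]_(l in `[a, b]) complex.Im (g l)).

(* q^{(n-1/2)^2} z^{2n-1} = e^{pi i tau (n-1/2)^2} e^{pi i v (2n-1)} *)
Definition theta_term (v tau : C) (n : int) : C :=
  cexp (cR pi * iC * tau * cR ((n%:~R - 2^-1) ^+ 2)
        + cR pi * iC * v * cR (2 * n%:~R - 1)).
Definition theta1 (v tau : C) : C :=
  iC * zsum (fun n => (-1) ^+ `|n|%N * theta_term v tau n).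
Definition theta2 (v tau : C) : C :=
  zsum (fun n => theta_term v tau n).

Inductive ltype := LA | LB | LC | LD.

Definition Theta (L : ltype) (sigma : R) (z tau : C) : C :=
  let ep := cexp (cR (2 * pi * sigma) * iC * z) in
  let em := cexp (- (cR (2 * pi * sigma) * iC * z)) in
  match L with
  | LA => ep * theta2 (cR sigma * tau + z) tau
  | LB => ep * theta1 (cR sigma * tau + z) tau - em * theta1 (cR sigma * tau - z) tau
  | LC => ep * theta2 (cR sigma * tau + z) tau - em * theta2 (cR sigma * tau - z) tau
  | LD => ep * theta2 (cR sigma * tau + z) tau + em * theta2 (cR sigma * tau - z) tau
  end.

Inductive rtype := A_N | B_N | Bv_N | C_N | Cv_N | BC_N | D_N.

Definition sharp (T : rtype) : ltype :=
  match T with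
  | A_N => LA | B_N | Bv_N => LB | C_N | Cv_N | BC_N => LC | D_N => LD
  end.

Definition Jidx (T : rtype) (j : nat) : R :=
  match T with
  | A_N | Cv_N => j%:R - 2^-1
  | B_N | Bv_N | D_N => j%:R - 1
  | C_N | BC_N => j%:R
  end.

Definition calN (T : rtype) (N : nat) : R :=
  match T with
  | A_N => N%:R
  | B_N => 2 * N%:R - 1
  | Bv_N | Cv_N => 2 * N%:R
  | C_N => 2 * (N%:R + 1)
  | BC_N => 2 * N%:R + 1
  | D_N => 2 * (N%:R - 1)
  end.

Definition xi_of (r x : R) : R := x / (2 * pi * r).
Definition tau_of (r t : R) : C := Complex 0 (t / (2 * pi * r ^+ 2)).

Definition Mfun (T : rtype) (N : nat) (r : R) (j : nat) (x t : R) : C :=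
  Theta (sharp T) (Jidx T j / calN T N) (cR (calN T N * xi_of r x))
        (cR (calN T N ^+ 2) * tau_of r t).

Definition mconst (T : rtype) (N : nat) (r tstar : R) (j : nat) : C :=
  let tau := cR (calN T N ^+ 2) * tau_of r tstar in
  let gen := cR (2 * pi * r) * theta2 (cR (calN T N * Jidx T j) * tau_of r tstar) tau in
  match T with
  | A_N | C_N | Cv_N | BC_N => gen
  | B_N | Bv_N =>
      if j == 1%N then cR (4 * pi * r) * theta2 0 tau else gen
  | D_N =>
      if j == 1%N then cR (4 * pi * r) * theta2 0 tau
      else if j == N then
        cR (4 * pi * r) * theta2 (cR (calN T N * (N%:R - 1)) * tau_of r tstar) tau
      else gen
  end.

(* density of P^{R_N}_t at the configuration x = (x_1,...,x_N)
   (x k stands for x_{k+1}) *)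
Definition density (T : rtype) (N : nat) (r tstar t : R) (x : 'I_N -> R) : C :=
  \det (\matrix_(j < N, k < N) conjc (Mfun T N r j.+1 (x k) (tstar - t)))
  * \det (\matrix_(l < N, m < N) Mfun T N r l.+1 (x m) t)
  / \prod_(n < N) mconst T N r tstar n.+1.

Fixpoint iint (Bs : seq (set R)) (f : seq R -> R) : \bar R :=
  match Bs with
  | [::] => (f [::])%:E
  | B :: Bs' => (\int[lebesgue_measure]_(x in B) iint Bs' (fun s => f (x :: s)))%E
  end.

Definition seqfun (N : nat) (s : seq R) : 'I_N -> R := fun k => nth 0 s k.

Definition ordered_conf (T : rtype) (r : R) (s : seq R) : Prop :=
  (forall k, (k < size s)%N -> 0 <= nth 0 s k) /\
  (forall k, (k.+1 < size s)%N -> nth 0 s k < nth 0 s k.+1) /\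
  (forall k, (k < size s)%N ->
     if T is A_N then nth 0 s k < 2 * pi * r else nth 0 s k <= pi * r).

Definition upper (T : rtype) (r : R) : R :=
  if T is A_N then 2 * pi * r else pi * r.

Definition Pfin (T : rtype) (N : nat) (r tstar t : R) (E : seq R -> Prop) : R :=
  fine (iint (nseq N [set x : R | 0 <= x <= upper T r])
    (fun s => (\1_[set s | ordered_conf T r s /\ E s] s)
              * complex.Re (@density T N r tstar t (@seqfun N s)))).

(* positions as points of the limit space: for A_N the circle [0, 2 pi r)
   is identified with [-pi r, pi r) so that it exhausts R *)
Definition place (T : rtype) (r x : R) : R :=
  if T is A_N then (if x < pi * r then x else x - 2 * pi * r) else x.

Definition nfin (T : rtype) (r : R) (s : seq R) (B : set R) : nat :=
  count (fun y => `[< B (place T r y) >]) s.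

Definition KA (tstar rho t x y : R) : C :=
  cint 0 rho (fun l =>
    cexp (cR (2 * pi * (x - y) * l) * iC)
    * theta2 (cR (rho * x) + cR (2 * pi * t * rho * l) * iC) (cR (2 * pi * t * rho ^+ 2) * iC)
    * theta2 (cR (rho * y) - cR (2 * pi * (tstar - t) * rho * l) * iC)
             (cR (2 * pi * (tstar - t) * rho ^+ 2) * iC)
    / theta2 (cR (2 * pi * tstar * rho * l) * iC) (cR (2 * pi * tstar * rho ^+ 2) * iC)).

Definition Khalf (th : C -> C -> C) (sgn : C) (tstar rho t x y : R) : C :=
  let D l := theta2 (cR (pi * tstar * rho * l) * iC) (cR (2 * pi * tstar * rho ^+ 2) * iC) in
  cR (2^-1) *
  (cint (- rho) rho (fun l =>
      cexp (cR (pi * (x - y) * l) * iC)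
      * th (cR (rho * x) + cR (pi * t * rho * l) * iC) (cR (2 * pi * t * rho ^+ 2) * iC)
      * th (cR (rho * y) - cR (pi * (tstar - t) * rho * l) * iC)
           (cR (2 * pi * (tstar - t) * rho ^+ 2) * iC)
      / D l)
   + sgn *
   cint (- rho) rho (fun l =>
      cexp (cR (pi * (x + y) * l) * iC)
      * th (cR (rho * x) + cR (pi * t * rho * l) * iC) (cR (2 * pi * t * rho ^+ 2) * iC)
      * th (cR (- (rho * y)) - cR (pi * (tstar - t) * rho * l) * iC)
           (cR (2 * pi * (tstar - t) * rho ^+ 2) * iC)
      / D l)).

Definition Klim (L : ltype) (tstar rho t : R) : R -> R -> C :=
  match L with
  | LA => KA tstar rho t
  | LB => Khalf theta1 (-1) tstar rho t
  | LC => Khalf theta2 (-1) tstar rho t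
  | LD => Khalf theta2 1 tstar rho t
  end.

Definition Slim (L : ltype) : set R :=
  if L is LA then setT else `[0, +oo[.

Definition r_scale (T : rtype) (rho : R) (N : nat) : R :=
  if T is A_N then N%:R / (2 * pi * rho) else N%:R / (pi * rho).

Definition npts (X B : set R) : nat := (#|` fset_set (setI X B) |)%N.


Definition point_process d (Omega : measurableType d)
    (P : probability Omega R) (S : set R) (xi : Omega -> set R) : Prop :=
  (forall w, xi w `<=` S) /\
  (forall w (a b : R), finite_set (xi w `&` `[a, b])) /\
  (forall (a b : R) (k : nat), measurable [set w | npts (xi w) `[a, b] = k]).

(* all n-point correlation functions (densities w.r.t. Lebesgue measure of
   the factorial moment measures) equal det[K(x_j,x_k)]: tested on products
   of pairwise disjoint bounded intervals, where the factorial moment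
   measure equals E[prod_i Xi(B_i)]. *)
Definition determinantal d (Omega : measurableType d)
    (P : probability Omega R) (S : set R) (xi : Omega -> set R)
    (K : R -> R -> C) : Prop :=
  (forall n (x : 'I_n -> R), (forall i, S (x i)) ->
     complex.Im (\det (\matrix_(i < n, j < n) K (x i) (x j))) = 0) /\
  (forall n (a b : 'I_n -> R),
     (forall i j, i != j -> `[a i, b i] `&` `[a j, b j] = set0) ->
     (\int[P]_w ((\prod_(i < n) npts (xi w) `[a i, b i])%:R)%:E)%E =
     iint [seq S `&` `[a i, b i] | i <- enum 'I_n]
          (fun s => complex.Re (\det (\matrix_(i < n, j < n) K (nth 0 s i) (nth 0 s j))))).

Definition fdd_conv (T : rtype) (tstar rho t : R) d (Omega : measurableType d)
    (P : probability Omega R) (xi : Omega -> set R) : Prop :=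
  forall m (a b : 'I_m -> R) (k : 'I_m -> nat),
    (fun N : nat => Pfin T N (r_scale T rho N) tstar t
        (fun s => forall i, nfin T (r_scale T rho N) s `[a i, b i] = k i))
    @ \oo --> fine (P [set w | forall i, npts (xi w) `[a i, b i] = k i]).

End Defs.

(* Main.v *)
(** The theta functions are Gaussian series, so each [M_j(x, t)] is, up to
constants, a real series [U_j(x, t) = sum_n +-exp(-t om_n^2 / 2) f(om_n x)].
The [U_j] are orthogonal, hence the density is [det k_N(x_i, x_j)] for a
reproducing kernel [k_N], and the expectation of a symmetric function [G] of
the configuration is [sum_n 1/n! int (Moebius transform of G) det k_N].
Hadamard's inequality dominates these series, and [k_N] converges pointwise
(its sum over [j] is a Riemann sum), so all expectations converge to a
functional [EE] given by the same series with the limit kernel.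

Once [EE] is known to be positive it comes from a point process: it gives
consistent laws for the counts on the intervals between 0 and the rationals,
these are realised on [[0, 1[] by nested intervals, and the points are the jumps
of the counting function; they are simple because second factorial moments of
small intervals are quadratically small.

Positivity of [EE] is inherited from finite [N], for one sequence of systems per
limit type. There [det U_j(x_k, t)] has a constant sign on ordered
configurations, as in Karlin and McGregor: it is a limit of determinants of
absorbed, reflected or periodic simple random walks. In one step an ordered
configuration of walkers with equal parities stays ordered or collides, the
determinant vanishes at collisions, and at time 0 it is supported on one
configuration (up to rotation in the periodic case). *)

Require Import Defs.
From HB Require Import structures.
From mathcomp Require Import all_boot all_order all_algebra.
From mathcomp Require Import all_classical all_reals all_analysis.
From mathcomp Require Import perm spectral measurable_realfun.
From mathcomp Require complex.
From mathcomp Require Import zify ring lra.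
Import complex.
Import Order.TTheory GRing.Theory Num.Theory numFieldNormedType.Exports.
Set Implicit Arguments. Unset Strict Implicit. Unset Printing Implicit Defensive.
Local Open Scope classical_set_scope.
Local Open Scope ring_scope.

(** * Iterated integrals *)

(** The kernel pairs the time [t] with [tstar - t], so it is in general not symmetric, and the
    spectral criterion for the existence of determinantal processes does not apply. Positivity
    therefore comes from the finite systems. Their density is a product of two determinants taken at
    different times: it is not enough that each keeps a sign, the two signs must agree. The walks
    give this because both signs are read off from one initial configuration.

    The class of test functions is dictated by the series: Moebius inversion preserves exponential
    growth in the number of points, and Hadamard's n^(n/2) divided by n! beats every exponential. No
    continuity is asked of test functions, so indicators of counts on closed intervals are
    admissible as they are, and pointwise convergence of the kernels suffices.

    In type A the functions are periodic around the circle for odd [N] only and change sign after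
    one turn for even [N]. Convergence being known along all [N], positivity along the odd ones is
    enough. *)

Lemma cvg_normr_le (R : realType) (u : nat -> R) (l C : R) :
  u n @[n --> \oo] --> l -> (forall n, `|u n| <= C) -> `|l| <= C.
Proof.
move=> /cvg_norm c1 ub; rewrite -(cvg_lim _ c1)//.
apply: limr_le; first by apply/cvg_ex; eexists; exact: c1.
exact: nearW.
Qed.

Section BoundedIntegration.
Context d (T : measurableType d) (R : realType).
Variables (mu : {measure set T -> \bar R}) (D : set T).
Hypotheses (mD : measurable D) (fD : (mu D < +oo)%E).

Lemma bounded_integrable (f : T -> R) (C : R) :
  measurable_fun setT f -> (forall x, D x -> `|f x| <= C) ->
  mu.-integrable D (EFin \o f).
Proof.
move=> mf bf; apply: measurable_bounded_integrable => //.
  exact: measurable_funS mf.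
exists C; split; first exact: num_real.
by move=> M CM x Dx; apply: le_trans (bf x Dx) (ltW CM).
Qed.

Lemma normr_Rintegral_le (f : T -> R) (C : R) :
  measurable_fun setT f -> (forall x, D x -> `|f x| <= C) ->
  `|\int[mu]_(x in D) f x| <= C * fine (mu D).
Proof.
move=> mf bf; have intf := bounded_integrable mf bf.
apply: (le_trans (le_normr_Rintegral mD intf)).
rewrite -Rintegral_cst//; apply: le_Rintegral => //.
  apply: (@bounded_integrable _ C) => [|x Dx]; last by rewrite normr_id bf.
  exact: measurableT_comp.
by apply: (@bounded_integrable _ `|C|).
Qed.

Lemma EFin_Rintegral (f : T -> R) (C : R) :
  measurable_fun setT f -> (forall x, D x -> `|f x| <= C) ->
  (\int[mu]_(x in D) (f x)%:E)%E = (\int[mu]_(x in D) f x)%:E.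
Proof.
move=> mf bf; rewrite /Rintegral fineK//.
by apply: integrable_fin_num => //; exact: bounded_integrable bf.
Qed.

Lemma cvg_Rintegral (f_ : nat -> T -> R) (f : T -> R) (C : R) :
  (forall n, measurable_fun setT (f_ n)) -> measurable_fun setT f ->
  (forall n x, D x -> `|f_ n x| <= C) ->
  (forall x, D x -> f_ n x @[n --> \oo] --> f x) ->
  \int[mu]_(x in D) f_ n x @[n --> \oo] --> \int[mu]_(x in D) f x.
Proof.
move=> mf_ mf bf_ cf.
have bf x : D x -> `|f x| <= C.
  by move=> Dx; apply: (cvg_normr_le (cf x Dx)) => n; exact: bf_.
have intf := bounded_integrable mf bf.
have [|||||_ _ c1] := @dominated_convergence _ _ _ mu D mD
  (fun n => EFin \o f_ n) (EFin \o f) (fun=> C%:E).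
- by move=> n; apply/measurable_EFinP; exact: measurable_funS (mf_ n).
- by apply/measurable_EFinP; exact: measurable_funS mf.
- by apply: aeW => x Dx; apply/fine_cvgP; split; [near=> n|exact: cf].
- by apply: (@bounded_integrable (fun=> C) `|C|).
- by apply: aeW => x n Dx; rewrite lee_fin bf_.
rewrite /Rintegral; apply: fine_cvg; rewrite fineK//.
exact: integrable_fin_num.
Unshelve. all: by end_near. Qed.

End BoundedIntegration.

Section IteratedIntegral.
Variable R : realType.
Notation mu := (@lebesgue_measure R).

Definition bset (B : set R) := measurable B /\ (mu B < +oo)%E.

Lemma leb_integrable B (f : R -> R) (C : R) : bset B -> measurable_fun setT f ->
  (forall x, B x -> `|f x| <= C) -> mu.-integrable B (EFin \o f).
Proof. by move=> [mB fB] mf bf; exact: (@bounded_integrable _ (measurableTypeR R) R mu B mB fB f C mf bf). Qed.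

Lemma leb_normr_le B (f : R -> R) (C : R) : bset B -> measurable_fun setT f ->
  (forall x, B x -> `|f x| <= C) -> `|\int[mu]_(x in B) f x| <= C * fine (mu B).
Proof. by move=> [mB fB] mf bf; exact: (@normr_Rintegral_le _ (measurableTypeR R) R mu B mB fB f C mf bf). Qed.

Lemma leb_EFin B (f : R -> R) (C : R) : bset B -> measurable_fun setT f ->
  (forall x, B x -> `|f x| <= C) ->
  (\int[mu]_(x in B) (f x)%:E)%E = (\int[mu]_(x in B) f x)%:E.
Proof.
move=> [mB fB] mf bf.
exact: (@EFin_Rintegral _ (measurableTypeR R) R mu B mB fB f C).
Qed.

Lemma leb_cvg B (f_ : nat -> R -> R) (f : R -> R) (C : R) : bset B ->
  (forall n, measurable_fun setT (f_ n)) -> measurable_fun setT f ->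
  (forall n x, B x -> `|f_ n x| <= C) ->
  (forall x, B x -> f_ n x @[n --> \oo] --> f x) ->
  \int[mu]_(x in B) f_ n x @[n --> \oo] --> \int[mu]_(x in B) f x.
Proof.
move=> [mB fB] mf_ mf bf cf.
exact: (@cvg_Rintegral _ (measurableTypeR R) R mu B mB fB f_ f C).
Qed.

(** Adding the bound [C] makes the integrand nonnegative, so that Tonelli's measurability statement
    applies; the constant is subtracted afterwards. *)
Lemma integral_param_measurable d (T : measurableType d) (H : T * measurableTypeR R -> R)
    (B : set R) (C : R) : bset B -> measurable_fun setT H ->
  (forall z, `|H z| <= C) ->
  measurable_fun setT (fun w => \int[mu]_(x in B) H (w, x)).
Proof.
move=> bB mH bH; have [mB fB] := bB.
have mHw w : measurable_fun setT (fun x : measurableTypeR R => H (w, x)).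
  exact: measurable_fun_pair2 mH.
pose F (z : T * measurableTypeR R) := ((H z + C) * \1_B z.2)%:E.
have F0 z : (0 <= F z)%E.
  rewrite lee_fin mulr_ge0//; have := bH z; rewrite ler_norml => /andP[+ _].
  by rewrite -lerBlDr sub0r.
have mF : measurable_fun setT F.
  apply/measurable_EFinP; apply: measurable_funM.
    by apply: measurable_funD => //; exact: measurable_cst.
  apply: measurableT_comp; last exact: measurable_snd.
  exact: measurable_indic.
have := @measurable_fun_fubini_tonelli_F _ _ _ _ _ mu F mF F0.
rewrite /fubini_F => m1.
rewrite [X in measurable_fun _ X](_ : _ = fun w =>
  fine (\int[mu]_y F (w, y))%E - C * fine (mu B)).
  apply: measurable_funB; last exact: measurable_cst.
  exact: (measurableT_comp (fine_measurable measurableT) m1).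
apply/funext => w.
have -> : (\int[mu]_y F (w, y))%E = (\int[mu]_(y in B) (H (w, y) + C)%:E)%E.
  rewrite [RHS]integral_mkcond; apply: eq_integral => y _.
  by rewrite /F /patch indicE/=; case: ifP => yB; rewrite (mulr1, mulr0).
rewrite -/(Rintegral mu B (fun y => H (w, y) + C)) RintegralD//.
- by rewrite Rintegral_cst// addrK.
- exact: (leb_integrable bB (mHw w) (fun x _ => bH (w, x))).
- by apply: (leb_integrable (C := `|C|) bB) => //; exact: measurable_cst.
Qed.

Lemma Rintegral_swap (H : measurableTypeR R * measurableTypeR R -> R) (B1 B2 : set R) (C : R) :
  bset B1 -> bset B2 -> measurable_fun setT H -> (forall z, `|H z| <= C) ->
  \int[mu]_(x in B1) \int[mu]_(y in B2) H (x, y) =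
  \int[mu]_(y in B2) \int[mu]_(x in B1) H (x, y).
Proof.
move=> bB1 bB2 mH bH.
have [mB1 fB1] := bB1; have [mB2 fB2] := bB2.
have mHw w : measurable_fun setT (fun x : measurableTypeR R => H (w, x)).
  exact: measurable_fun_pair2 mH.
have mHw1 w : measurable_fun setT (fun x : measurableTypeR R => H (x, w)).
  exact: measurable_fun_pair1 mH.
have C0 : 0 <= C by apply: le_trans (bH (0, 0)).
pose F (z : measurableTypeR R * measurableTypeR R) := (H z * \1_B1 z.1 * \1_B2 z.2)%:E.
have mF : measurable_fun setT F.
  apply/measurable_EFinP; apply: measurable_funM; first apply: measurable_funM => //.
    by apply: measurableT_comp; [exact: measurable_indic|exact: measurable_fst].
  by apply: measurableT_comp; [exact: measurable_indic|exact: measurable_snd].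
have cut (B : set R) (g : R -> R) : 
    (\int[mu]_y (g y * \1_B y)%:E)%E = (\int[mu]_(y in B) (g y)%:E)%E.
  rewrite [RHS]integral_mkcond; apply: eq_integral => y _.
  by rewrite /patch indicE/=; case: ifP => yB; rewrite (mulr1, mulr0).
have mI1 : measurable_fun setT (fun x => \int[mu]_(y in B2) H (x, y)).
  exact: integral_param_measurable bH.
have mI2 : measurable_fun setT (fun y => \int[mu]_(x in B1) H (x, y)).
  apply: (@integral_param_measurable _ _ (fun z => H (z.2, z.1)) _ C) => //.
  apply: measurableT_comp => //; apply: measurable_fun_pair.
    exact: measurable_snd.
  exact: measurable_fst.
have bI1 x : `|\int[mu]_(y in B2) H (x, y)| <= C * fine (mu B2).
  by apply: (leb_normr_le bB2 (mHw x)) => y _; exact: bH.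
have bI2 x : `|\int[mu]_(y in B1) H (y, x)| <= C * fine (mu B1).
  by apply: (leb_normr_le bB1 (mHw1 x)) => y _; exact: bH.
have FE1 x : (\int[mu]_y F (x, y))%E =
    ((\int[mu]_(y in B2) H (x, y)) * \1_B1 x)%:E.
  rewrite /F cut/= (leb_EFin (C := C) bB2).
  - rewrite RintegralZr//.
    by apply: (leb_integrable (C := C) bB2 (mHw x)) => y _; exact: bH.
  - exact: (@measurable_funM _ (measurableTypeR R) _ _ _ _ (mHw x) (measurable_cst _)).
  - move=> y _; rewrite normrM indicE -[leRHS]mulr1; apply: ler_pM => //.
    by case: (_ \in _); rewrite ?normr1 ?normr0.
have FE2 y : (\int[mu]_x F (x, y))%E =
    ((\int[mu]_(x in B1) H (x, y)) * \1_B2 y)%:E.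
  rewrite /F; under eq_integral do rewrite mulrAC; rewrite cut/=.
  rewrite (leb_EFin (C := C) bB1).
  - rewrite RintegralZr//.
    by apply: (leb_integrable (C := C) bB1 (mHw1 y)) => x _; exact: bH.
  - exact: (@measurable_funM _ (measurableTypeR R) _ _ _ _ (mHw1 y) (measurable_cst _)).
  - move=> x _; rewrite normrM indicE -[leRHS]mulr1; apply: ler_pM => //.
    by case: (_ \in _); rewrite ?normr1 ?normr0.
have iF : (mu \x mu)%E.-integrable setT F.
  apply/integrable12ltyP => //.
  apply: (@le_lt_trans _ _ (\int[mu]_x (C * fine (mu B2) * \1_B1 x)%:E)%E).
    apply: ge0_le_integral => //.
    - by move=> x _; exact: integral_ge0.
    - have maF : measurable_fun setT (abse \o F) by exact: measurableT_comp mF.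
      exact: (@measurable_fun_fubini_tonelli_F _ _ _ _ _ mu (abse \o F) maF (fun z => abse_ge0 _)).
    - apply/measurable_EFinP; apply: measurable_funM => //.
    - move=> x _; rewrite /F.
      under eq_integral do rewrite abse_EFin !normrM [X in _ * X]ger0_norm//.
      rewrite cut; apply: (@le_trans _ _ (\int[mu]_(y in B2) (C * \1_B1 x)%:E)%E).
        apply: ge0_le_integral => //.
        + apply/measurable_EFinP; apply: measurable_funM => //.
          by apply: measurableT_comp => //; exact: measurable_funTS.
          exact: (@measurable_cst _ _ (measurableTypeR R) _ B2 (`|\1_B1 x| : R)).
        + by move=> y _; rewrite lee_fin ler_pM// ger0_norm.
      by rewrite integral_cst//= -[mu B2]fineK ?ge0_fin_numE// -EFinM lee_fin mulrAC.
  rewrite cut integral_cst//=.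
  by rewrite -[mu B1]fineK ?ge0_fin_numE// -EFinM ltry.
have := @Fubini _ _ _ _ _ mu mu F iF.
under eq_integral do rewrite FE1.
under [X in _ = X -> _]eq_integral do rewrite FE2.
rewrite !cut (leb_EFin bB1 mI1 (fun x _ => bI1 x)).
by rewrite (leb_EFin bB2 mI2 (fun x _ => bI2 x)) => -[].
Qed.

(** Real-valued counterpart of [iint], for which linearity carries no finiteness conditions;
    [iint_rint] identifies the two on bounded measurable integrands. *)
Fixpoint rint (Bs : seq (set R)) (f : seq R -> R) : R :=
  match Bs with
  | [::] => f [::]
  | B :: Bs' => \int[mu]_(x in B) rint Bs' (fun s => f (x :: s))
  end.

(* Measurability along measurable families of coordinates: no product
   sigma-algebra on lists is needed. *)
Definition nmeas (n : nat) (f : seq R -> R) :=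
  forall d (T : measurableType d) (g : nat -> T -> R),
    (forall i, measurable_fun setT (g i)) ->
    measurable_fun setT (fun w => f (mkseq (g^~ w) n)).

(** Joint measurability in a parameter and the coordinates. In inductions on the number of integrals
    the outermost variable becomes part of the parameter. *)
Definition pmeas d (T : measurableType d) (n : nat) (F : T -> seq R -> R) :=
  forall d' (T' : measurableType d') (phi : T' -> T) (g : nat -> T' -> R),
    measurable_fun setT phi -> (forall i, measurable_fun setT (g i)) ->
    measurable_fun setT (fun w => F (phi w) (mkseq (g^~ w) n)).

Lemma mkseqS (A : Type) (g : nat -> A) n :
  mkseq g n.+1 = g 0%N :: mkseq (fun i => g i.+1) n.
Proof. by rewrite /mkseq/= (iotaDl 1 0) -map_comp. Qed.

Lemma nmeas_cons n f : nmeas n.+1 f -> pmeas n (fun x s => f (x :: s)).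
Proof.
move=> mf d T phi g mphi mg.
have := mf _ _ (fun i => if i is i'.+1 then g i' else phi).
rewrite [X in (_ -> measurable_fun _ X) -> _](_ : _ =
  (fun w => f (phi w :: mkseq (g^~ w) n))).
  by apply; case.
by apply/funext => w; rewrite mkseqS.
Qed.

Lemma pmeas_nmeas d (T : measurableType d) n (F : T -> seq R -> R) (w : T) :
  pmeas n F -> nmeas n (F w).
Proof. by move=> mF d' T' g mg; apply: mF. Qed.

Definition vol (Bs : seq (set R)) : R := \prod_(B <- Bs) fine (mu B).

Definition bsets (Bs : seq (set R)) := forall B, List.In B Bs -> bset B.

Lemma bsets_cons B Bs : bsets (B :: Bs) <-> bset B /\ bsets Bs.
Proof.
split=> [h|[h1 h2] B' /= [<-|]//]; last exact: h2.
by split=> [|B' B'in]; apply: h; [left|right].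
Qed.

Lemma bsets_nseq n B : bset B -> bsets (nseq n B).
Proof. by move=> bB; elim: n => [|n IH]//=; apply/bsets_cons. Qed.

(** Measurability and bound go through the induction together: an integral depends measurably on its
    parameter here only because the inner integral is already known to be bounded. *)
Lemma rint_param Bs : bsets Bs ->
  forall d (T : measurableType d) (F : T -> seq R -> R) (C : R),
  pmeas (size Bs) F -> (forall w s, size s = size Bs -> `|F w s| <= C) ->
  measurable_fun setT (fun w => rint Bs (F w)) /\
  (forall w, `|rint Bs (F w)| <= C * vol Bs).
Proof.
elim: Bs => [|B Bs IH] bBs d T F C mF bF.
  split=> [|w]; last by rewrite /vol big_nil mulr1 bF.
  exact: (mF _ _ id (fun _ _ => 0)).
move/bsets_cons: bBs => [bB bBs].
have [||mI bI] := IH bBs _ (T * measurableTypeR R)%type (fun z s => F z.1 (z.2 :: s)) C.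
- move=> d' T' phi g mphi mg.
  have := mF _ _ (fst \o phi) (fun i => if i is i'.+1 then g i' else snd \o phi).
  rewrite [X in (_ -> _ -> measurable_fun _ X) -> _](_ : _ =
    (fun w => F (phi w).1 ((phi w).2 :: mkseq (g^~ w) (size Bs)))); last first.
    by apply/funext => w; rewrite mkseqS.
  apply; first by apply: measurableT_comp => //; exact: measurable_fst.
  case=> [|i]; last exact: mg.
  by apply: measurableT_comp => //; exact: measurable_snd.
- by move=> z s ss; apply: bF; rewrite /= ss.
split.
  exact: (integral_param_measurable bB mI bI).
move=> w /=; rewrite /vol big_cons -/(vol Bs) mulrCA mulrC.
apply: leb_normr_le => // [|x _]; last exact: (bI (w, x)).
exact: (measurable_fun_pair2 w mI).
Qed.

Lemma rint_bound Bs f (C : R) : bsets Bs -> nmeas (size Bs) f ->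
  (forall s, size s = size Bs -> `|f s| <= C) -> `|rint Bs f| <= C * vol Bs.
Proof.
move=> bBs mf bf.
have [||_ ]:= @rint_param Bs bBs _ R (fun=> f) C; last by apply; exact: 0.
- by move=> d T phi g _ mg; exact: mf.
- by move=> _ s; exact: bf.
Qed.

Definition bnm n (f : seq R -> R) :=
  nmeas n f /\ exists C : R, forall s, size s = n -> `|f s| <= C.

Lemma bnm_cons n f x : bnm n.+1 f -> bnm n (fun s => f (x :: s)).
Proof.
move=> [mf [C bf]]; split; first exact: (pmeas_nmeas x (nmeas_cons mf)).
by exists C => s ss; apply: bf; rewrite /= ss.
Qed.

Lemma rint_cons_meas B Bs f : bsets (B :: Bs) -> bnm (size Bs).+1 f ->
  exists C : R, measurable_fun setT (fun x => rint Bs (fun s => f (x :: s))) /\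
   (forall x, `|rint Bs (fun s => f (x :: s))| <= C).
Proof.
move=> /bsets_cons[bB bBs] [mf [C bf]].
have [||m1 b1] := @rint_param Bs bBs _ R (fun x s => f (x :: s)) C.
- exact: nmeas_cons.
- by move=> x s ss; apply: bf; rewrite /= ss.
by exists (C * vol Bs).
Qed.

Fixpoint inB (Bs : seq (set R)) (s : seq R) : Prop :=
  match Bs, s with
  | [::], [::] => True
  | B :: Bs', x :: s' => B x /\ inB Bs' s'
  | _, _ => False
  end.

Lemma inB_size Bs s : inB Bs s -> size s = size Bs.
Proof. by elim: Bs s => [|B Bs IH] [|x s]//= [_ /IH ->]. Qed.

Lemma eq_rint Bs f g : (forall s, inB Bs s -> f s = g s) -> rint Bs f = rint Bs g.
Proof.
elim: Bs f g => [|B Bs IH] f g fg /=; first exact: fg.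
apply: eq_Rintegral => x /set_mem Bx.
by apply: IH => s Bs_s; exact: fg.
Qed.

Lemma rintD Bs f g : bsets Bs -> bnm (size Bs) f -> bnm (size Bs) g ->
  rint Bs (fun s => f s + g s) = rint Bs f + rint Bs g.
Proof.
elim: Bs f g => [//|B Bs IH] f g bBs bf bg /=.
have [bB bBs'] := (bsets_cons B Bs).1 bBs.
have [C1 [m1 b1]] := rint_cons_meas bBs bf.
have [C2 [m2 b2]] := rint_cons_meas bBs bg.
rewrite -RintegralD//.
- by apply: eq_Rintegral => x _; rewrite IH//; exact: bnm_cons.
- by case: bB.
- exact: (leb_integrable bB m1 (fun x _ => b1 x)).
- exact: (leb_integrable bB m2 (fun x _ => b2 x)).
Qed.

Lemma rintZ Bs f c : bsets Bs -> bnm (size Bs) f ->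
  rint Bs (fun s => c * f s) = c * rint Bs f.
Proof.
elim: Bs f => [//|B Bs IH] f bBs bf /=.
have [bB bBs'] := (bsets_cons B Bs).1 bBs.
have [C1 [m1 b1]] := rint_cons_meas bBs bf.
rewrite -RintegralZl//.
  by apply: eq_Rintegral => x _; rewrite IH//; exact: bnm_cons.
  by case: bB.
exact: (leb_integrable bB m1 (fun x _ => b1 x)).
Qed.

Lemma rint_ge0 Bs f : (forall s, inB Bs s -> 0 <= f s) -> 0 <= rint Bs f.
Proof.
elim: Bs f => [|B Bs IH] f f0 /=; first exact: f0.
by apply: Rintegral_ge0 => x Bx; apply: IH => s ins; exact: f0.
Qed.

Lemma rint_cat Bs1 Bs2 f : rint (Bs1 ++ Bs2) f =
  rint Bs1 (fun s1 => rint Bs2 (fun s2 => f (s1 ++ s2))).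
Proof.
elim: Bs1 f => [//|B Bs IH] f /=.
by apply: eq_Rintegral => x _; rewrite IH.
Qed.

Lemma iint_rint Bs f : bsets Bs -> bnm (size Bs) f -> iint Bs f = (rint Bs f)%:E.
Proof.
elim: Bs f => [//|B Bs IH] f bBs bf /=.
have [bB bBs'] := (bsets_cons B Bs).1 bBs.
have [C1 [m1 b1]] := rint_cons_meas bBs bf.
rewrite -(leb_EFin bB m1 (fun x _ => b1 x)).
by apply: eq_integral => x _; rewrite IH//; exact: bnm_cons.
Qed.

Lemma cvg_rint Bs (f_ : nat -> seq R -> R) f (C : R) : bsets Bs ->
  (forall n, nmeas (size Bs) (f_ n)) -> nmeas (size Bs) f ->
  (forall n s, size s = size Bs -> `|f_ n s| <= C) ->
  (forall s, size s = size Bs -> f_ n s @[n --> \oo] --> f s) ->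
  rint Bs (f_ n) @[n --> \oo] --> rint Bs f.
Proof.
elim: Bs f_ f => [|B Bs IH] f_ f bBs mf_ mf bf_ cf /=; first exact: cf.
have [bB bBs'] := (bsets_cons B Bs).1 bBs.
have m1 n := nmeas_cons (mf_ n).
have bf s : size s = size (B :: Bs) -> `|f s| <= C.
  by move=> ss; apply: (cvg_normr_le (cf s ss)) => n; exact: bf_.
have b1 n x s : size s = size Bs -> `|f_ n (x :: s)| <= C.
  by move=> ss; apply: bf_; rewrite /= ss.
have r1 n := rint_param bBs' (m1 n) (b1 n).
have b2 x s : size s = size Bs -> `|f (x :: s)| <= C.
  by move=> ss; apply: bf; rewrite /= ss.
have r2 := rint_param bBs' (nmeas_cons mf) b2.
apply: (leb_cvg bB (fun n => (r1 n).1) r2.1).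
- by move=> n x _; exact: (r1 n).2.
- move=> x _; apply: IH => //.
  + by move=> n; exact: (pmeas_nmeas x (m1 n)).
  + exact: (pmeas_nmeas x (nmeas_cons mf)).
  + by move=> n s; exact: b1.
  + by move=> s ss; apply: cf; rewrite /= ss.
Qed.

End IteratedIntegral.

(** * Algebra of integrands, Moebius inversion and symmetrisation *)

Section Closure.
Variable R : realType.
Notation mu := (@lebesgue_measure R).

Lemma pmeas_cons d (T : measurableType d) n (F : T -> seq R -> R) :
  pmeas n.+1 F ->
  @pmeas R _ (T * measurableTypeR R)%type n (fun z s => F z.1 (z.2 :: s)).
Proof.
move=> mF d' T' phi g mphi mg.
have := mF _ _ (fst \o phi) (fun i => if i is i'.+1 then g i' else snd \o phi).
rewrite [X in (_ -> _ -> measurable_fun _ X) -> _](_ : _ =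
  (fun w => F (phi w).1 ((phi w).2 :: mkseq (g^~ w) n))); last first.
  by apply/funext => w; rewrite mkseqS.
apply; first by apply: measurableT_comp => //; exact: measurable_fst.
case=> [|i]; last exact: mg.
by apply: measurableT_comp => //; exact: measurable_snd.
Qed.

Lemma bnm_cst n c : @bnm R n (fun=> c).
Proof. by split=> [d T g mg|]; [exact: measurable_cst|exists `|c|]. Qed.

Lemma bnmD n (f g : seq R -> R) : bnm n f -> bnm n g -> bnm n (fun s => f s + g s).
Proof.
move=> [mf [C bf]] [mg [C' bg]]; split.
  by move=> d T h mh; apply: measurable_funD; [exact: mf|exact: mg].
exists (C + C') => s ss; apply: le_trans (ler_normD _ _) _.
by apply: lerD; [exact: bf|exact: bg].
Qed.

Lemma bnmM n (f g : seq R -> R) : bnm n f -> bnm n g -> bnm n (fun s => f s * g s).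
Proof.
move=> [mf [C bf]] [mg [C' bg]]; split.
  by move=> d T h mh; apply: measurable_funM; [exact: mf|exact: mg].
exists (C * C') => s ss; rewrite normrM.
by apply: ler_pM => //; [exact: bf|exact: bg].
Qed.

Lemma bnmZ n (f : seq R -> R) c : bnm n f -> bnm n (fun s => c * f s).
Proof. by move=> bf; apply: bnmM => //; exact: bnm_cst. Qed.

Lemma bnmN n (f : seq R -> R) : bnm n f -> bnm n (fun s => - f s).
Proof.
move=> bf; rewrite (_ : (fun s => _) = (fun s => -1 * f s)); first exact: bnmZ.
by apply/funext => s; rewrite mulN1r.
Qed.

Lemma bnm_sum n (I : Type) (r : seq I) (P : pred I) (F : I -> seq R -> R) :
  (forall i, P i -> bnm n (F i)) -> bnm n (fun s => \sum_(i <- r | P i) F i s).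
Proof.
move=> bF; elim: r => [|i r IH].
  rewrite (_ : (fun s => _) = (fun=> 0)); first exact: bnm_cst.
  by apply/funext => s; rewrite big_nil.
rewrite (_ : (fun s => _) = (fun s => (if P i then F i s else 0) +
   \sum_(i <- r | P i) F i s)).
  by apply: bnmD => //; case: (boolP (P i)) => [/bF//|_]; exact: bnm_cst.
by apply/funext => s; rewrite big_cons; case: ifP => _; rewrite ?add0r.
Qed.

Lemma bnm_prod n (I : Type) (r : seq I) (P : pred I) (F : I -> seq R -> R) :
  (forall i, P i -> bnm n (F i)) -> bnm n (fun s => \prod_(i <- r | P i) F i s).
Proof.
move=> bF; elim: r => [|i r IH].
  rewrite (_ : (fun s => _) = (fun=> 1)); first exact: bnm_cst.
  by apply/funext => s; rewrite big_nil.
rewrite (_ : (fun s => _) = (fun s => (if P i then F i s else 1) *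
   \prod_(i <- r | P i) F i s)).
  by apply: bnmM => //; case: (boolP (P i)) => [/bF//|_]; exact: bnm_cst.
by apply/funext => s; rewrite big_cons; case: ifP => _; rewrite ?mul1r.
Qed.

Lemma take_rcons_le (A : Type) n (s : seq A) x : (n <= size s)%N ->
  take n (rcons s x) = take n s.
Proof. by move=> ns; rewrite -cats1 takel_cat. Qed.

Lemma take_mkseq (A : Type) (g : nat -> A) n N : (n <= N)%N ->
  take n (mkseq g N) = mkseq g n.
Proof. by move=> nN; rewrite /mkseq -map_take take_iota (minn_idPl nN). Qed.

Lemma bnm_take n N (H : seq R -> R) : (n <= N)%N -> bnm n H ->
  bnm N (fun s => H (take n s)).
Proof.
move=> nN [mH [C bH]]; split.
  move=> d T g mg; under eq_fun do rewrite take_mkseq//; exact: mH.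
exists C => s ss; apply: bH; rewrite size_take ss; case: ltnP => // h.
by apply/eqP; rewrite eqn_leq nN h.
Qed.

Lemma bnm_subst n N (f : seq R -> R) (sub : seq R -> seq R) :
  (forall s, size s = N -> size (sub s) = n) ->
  (forall i, (i < n)%N -> exists2 j, (j < N)%N & forall s, size s = N -> nth 0 (sub s) i = nth 0 s j) ->
  bnm n f -> bnm N (fun s => f (sub s)).
Proof.
move=> ssub subE [mf [C bf]]; split; last first.
  by exists C => s ss; apply: bf; exact: ssub.
move=> d T g mg.
have /choice[j jE] : forall i, exists j, (i < n)%N -> (j < N)%N /\
    forall s, size s = N -> nth 0 (sub s) i = nth 0 s j.
  move=> i; have [iN|_] := boolP (i < n)%N; last by exists 0%N.
  by have [j jN jE] := subE i iN; exists j.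
rewrite (_ : (fun w => _) = fun w => f (mkseq (fun i => g (j i) w) n)); first exact: mf.
apply/funext => w; congr f; apply: (@eq_from_nth _ 0).
  by rewrite ssub ?size_mkseq.
rewrite ssub ?size_mkseq// => i iN; have [jN jE'] := jE i iN.
by rewrite jE' ?size_mkseq// !nth_mkseq.
Qed.

Lemma rint_sum Bs (I : Type) (r : seq I) (P : pred I) (F : I -> seq R -> R) :
  bsets Bs -> (forall i, P i -> bnm (size Bs) (F i)) ->
  rint Bs (fun s => \sum_(i <- r | P i) F i s) = \sum_(i <- r | P i) rint Bs (F i).
Proof.
move=> bBs bF; elim: r => [|i r IH].
  rewrite big_nil -[RHS](mul0r (rint Bs (fun=> 1))) -rintZ//; last exact: bnm_cst.
  by apply: eq_rint => s _; rewrite big_nil mul0r.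
rewrite big_cons; case: ifPn => Pi.
  rewrite -IH -rintD//; [|exact: bF|exact: bnm_sum].
  by apply: eq_rint => s _; rewrite big_cons Pi.
by rewrite -IH; apply: eq_rint => s _; rewrite big_cons (negbTE Pi).
Qed.

Definition ins (i : nat) (x : R) (s : seq R) := take i s ++ x :: drop i s.

Lemma size_ins i x s : size (ins i x s) = (size s).+1.
Proof. by rewrite /ins size_cat/= addnS -size_cat cat_take_drop. Qed.

Lemma perm_ins i x s : perm_eq (ins i x s) (x :: s).
Proof. by rewrite /ins perm_catC/= perm_cons perm_catC cat_take_drop. Qed.

Lemma nth_ins i x s j : (i <= size s)%N -> nth 0 (ins i x s) j =
  if (j < i)%N then nth 0 s j else if j == i then x else nth 0 s j.-1.
Proof.
move=> iN; rewrite /ins nth_cat size_take_min (minn_idPl iN).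
case: ltnP => ji; first by rewrite nth_take.
case: eqVneq => [->|ne]; first by rewrite subnn.
have ij : (i < j)%N by rewrite ltn_neqAle eq_sym ne.
rewrite (_ : (j - i = (j.-1 - i).+1)%N)/=; last by lia.
by rewrite nth_drop; congr nth; lia.
Qed.

(** Fubini for a single variable, moved outwards past one neighbour at a time by
    [Rintegral_swap]. *)
Lemma rint_move Bs1 B Bs2 f : bsets (Bs1 ++ B :: Bs2) ->
  bnm (size (Bs1 ++ B :: Bs2)) f ->
  rint (Bs1 ++ B :: Bs2) f =
  \int[mu]_(x in B) rint (Bs1 ++ Bs2) (fun s => f (ins (size Bs1) x s)).
Proof.
elim: Bs1 f => [|B1 Bs1 IH] f bBs bf /=.
  apply: eq_Rintegral => x _; apply: eq_rint => s _.
  by rewrite /ins take0 drop0.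
move/bsets_cons: (bBs) => [bB1 bBs'].
have bB : bset B by apply: bBs; rewrite /= ; right; apply: List.in_or_app; right; left.
have bBs2 : bsets (Bs1 ++ Bs2).
  move=> B' /(@List.in_app_or _ _ _ _) [h|h]; apply: bBs'; apply: List.in_or_app.
    by left.
  by right; right.
have step1 : \int[mu]_(y in B1) rint (Bs1 ++ B :: Bs2) (fun s => f (y :: s)) =
  \int[mu]_(y in B1) \int[mu]_(x in B) rint (Bs1 ++ Bs2)
     (fun s => f (y :: ins (size Bs1) x s)).
  by apply: eq_Rintegral => y _; rewrite IH//; exact: bnm_cons.
rewrite step1.
have sE : size ((B1 :: Bs1) ++ B :: Bs2) = (size (Bs1 ++ Bs2)).+2.
  by rewrite /= !size_cat/= addnS.
rewrite sE in bf.
have [mf [C bf']] := bf.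
pose G := fun (z : measurableTypeR R * measurableTypeR R) s => f (z.1 :: ins (size Bs1) z.2 s).
have [||mI bI] := @rint_param R (Bs1 ++ Bs2) bBs2 _ _ G C.
(* The family [g'] lists the parameter [y], then the coordinates of [s] with [x] inserted at
   position [size Bs1]. *)
- move=> d T phi g mphi mg.
  pose g' i : T -> R := if i is i'.+1 then
     if (i' < size Bs1)%N then g i' else if i' == size Bs1 then snd \o phi else g i'.-1
     else fst \o phi.
  rewrite (_ : (fun w => _) = fun w => f (mkseq (g'^~ w) (size (Bs1 ++ Bs2)).+2)).
    apply: mf => -[|i] /=.
      by apply: measurableT_comp => //; exact: measurable_fst.
    case: ifP => // _; case: ifP => // _.
    by apply: measurableT_comp => //; exact: measurable_snd.
  apply/funext => w; rewrite /G mkseqS; congr (f (_ :: _)).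
  apply: (@eq_from_nth _ 0); first by rewrite size_ins !size_mkseq.
  rewrite size_ins size_mkseq => i iN.
  have s1 : (size Bs1 <= size (Bs1 ++ Bs2))%N by rewrite size_cat leq_addr.
  rewrite nth_ins ?size_mkseq// [RHS]nth_mkseq//=.
  case: ltnP => i1; first by rewrite nth_mkseq// (leq_trans i1).
  case: eqVneq => // ne; rewrite nth_mkseq//.
  by move: iN i1 ne; lia.
- by move=> z s ss; rewrite /G; apply: bf'; rewrite /= size_ins ss.
exact: (Rintegral_swap bB1 bB mI bI).
Qed.

Definition symf (f : seq R -> R) := forall s s', perm_eq s s' -> f s = f s'.

Lemma symf_cons f x : symf f -> symf (fun s => f (x :: s)).
Proof. by move=> sf s s' ss'; apply: sf; rewrite perm_cons. Qed.

(* [SS H s] sums [H] over the sublists of [s]; [Mob] is its Moebius inverse. *)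
Fixpoint SS (H : seq R -> R) (s : seq R) : R :=
  if s is x :: s' then SS H s' + SS (fun T => H (x :: T)) s' else H [::].

Fixpoint Mob (G : seq R -> R) (s : seq R) : R :=
  if s is x :: s' then Mob (fun T => G (x :: T)) s' - Mob G s' else G [::].

Lemma SSB H1 H2 s : SS (fun T => H1 T - H2 T) s = SS H1 s - SS H2 s.
Proof.
elim: s H1 H2 => [//|x s IH] H1 H2 /=.
by rewrite IH (IH (fun T => H1 (x :: T))); ring.
Qed.

Lemma SS_Mob G s : SS (Mob G) s = G s.
Proof.
elim: s G => [//|x s IH] G /=.
by rewrite SSB !IH addrC subrK.
Qed.

Lemma MobD G1 G2 s : Mob (fun T => G1 T + G2 T) s = Mob G1 s + Mob G2 s.
Proof.
elim: s G1 G2 => [//|x s IH] G1 G2 /=.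
by rewrite !IH; ring.
Qed.

Lemma MobZ c G s : Mob (fun T => c * G T) s = c * Mob G s.
Proof.
elim: s G => [//|x s IH] G /=.
by rewrite !IH; ring.
Qed.

Lemma eq_Mob G1 G2 s : G1 =1 G2 -> Mob G1 s = Mob G2 s.
Proof. by move=> /funext ->. Qed.

Lemma Mob_SS H s : Mob (SS H) s = H s.
Proof.
elim: s H => [//|x s IH] H /=.
by rewrite MobD !IH addrAC subrr add0r.
Qed.

(** The transform is a signed sum over sublists, and by the binomial theorem the bounds c^k add up
    to (1 + c)^n. *)
Lemma Mob_bound G A c s : 0 <= A -> 0 <= c ->
  (forall u, `|G u| <= A * c ^+ size u) -> `|Mob G s| <= A * (1 + c) ^+ size s.
Proof.
move=> + c0; elim: s G A => [|x s IH] G A A0 bG /=; first exact: (bG [::]).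
apply: le_trans (ler_normB _ _) _.
have h1 := IH _ _ A0 bG.
have h2 : `|Mob (fun T => G (x :: T)) s| <= A * c * (1 + c) ^+ size s.
  by apply: IH => [|u]; rewrite ?mulr_ge0//; have := bG (x :: u); rewrite /= exprS mulrA.
apply: le_trans (lerD h2 h1) _; rewrite exprS; lra.
Qed.

Lemma Mob_pmeas n : forall d (T : measurableType d) (F : T -> seq R -> R),
  (forall m, pmeas m F) -> pmeas n (fun w => Mob (F w)).
Proof.
elim: n => [|n IH] d T F mF d' T' phi g mphi mg.
  exact: (mF 0%N _ _ phi g mphi mg).
under eq_fun do rewrite mkseqS/=.
apply: measurable_funB.
  have := IH _ _ _ (fun m => pmeas_cons (mF m.+1)) _ _ (fun w => (phi w, g 0%N w)) (fun i => g i.+1).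
  by apply; [exact: measurable_fun_pair mphi (mg 0%N)|move=> i; exact: mg].
by apply: (IH _ _ F mF) => // i; exact: mg.
Qed.

(** Exponential growth in the number of points: it contains products of counts, is stable under
    [Mob], and is summable against the Hadamard bound. *)
Definition expm (A c : R) (F : seq R -> R) :=
  [/\ 0 <= A, 0 <= c, forall m, nmeas m F & forall u, `|F u| <= A * c ^+ size u].

Lemma expm_bnm A c F n : expm A c F -> bnm n F.
Proof.
by move=> [A0 c0 mF bF]; split=> //; exists (A * c ^+ n) => s <-; exact: bF.
Qed.

Lemma expm_cons A c F x : expm A c F -> expm (A * c) c (fun s => F (x :: s)).
Proof.
move=> [A0 c0 mF bF]; split=> //; first exact: mulr_ge0.
  by move=> m; exact: (pmeas_nmeas x (nmeas_cons (mF m.+1))).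
by move=> u; have := bF (x :: u); rewrite /= exprS mulrA.
Qed.

Lemma Mob_expm A c G : expm A c G -> expm A (1 + c) (Mob G).
Proof.
move=> [A0 c0 mG bG]; split=> //; first by rewrite addr_ge0.
  move=> n d T g mg.
  have mF m : @pmeas R _ R m (fun=> G) by move=> d' T' phi h _ mh; exact: mG.
  by have := @Mob_pmeas n _ _ _ mF _ _ (fun=> 0) g; apply => //; exact: measurable_cst.
by move=> u; exact: Mob_bound.
Qed.


Lemma bnm1 (phi : R -> R) (C : R) : measurable_fun setT phi -> (forall x, `|phi x| <= C) ->
  bnm 1 (fun s => phi (nth 0 s 0)).
Proof.
move=> mphi bphi; split; last by exists C.
by move=> d T g mg; exact: (measurableT_comp mphi (mg 0%N)).
Qed.

Lemma rint_last n B f : rint (nseq n.+1 B) f =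
  rint (nseq n B) (fun s => \int[mu]_(x in B) f (rcons s x)).
Proof.
rewrite -[n.+1]addn1 nseqD rint_cat; apply: eq_rint => s _ /=.
by apply: eq_Rintegral => x _; rewrite cats1.
Qed.

Lemma nmeas_rcons n f : nmeas n.+1 f -> forall d (T : measurableType d)
    (g : nat -> T -> R) (h : T -> R), (forall i, measurable_fun setT (g i)) ->
    measurable_fun setT h ->
    measurable_fun setT (fun w => f (rcons (mkseq (g^~ w) n) (h w))).
Proof.
move=> mf d T g h mg mh.
rewrite (_ : (fun w => _) =
    fun w => f (mkseq (fun i => (if (i < n)%N then g i else h) w) n.+1)).
  by apply: mf => i; case: (i < n)%N.
apply/funext => w; congr f.
apply: (@eq_from_nth _ 0); first by rewrite size_rcons !size_mkseq.
rewrite size_rcons size_mkseq => i iN.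
rewrite nth_rcons size_mkseq [RHS]nth_mkseq//; case: ltnP => i1.
  by rewrite nth_mkseq.
by rewrite (_ : i == n)// eqn_leq i1 -ltnS iN.
Qed.

Lemma mkseq_cst (s : seq R) n : size s = n -> mkseq (fun i => nth 0 s i) n = s.
Proof. by move=> <-; exact: mkseq_nth. Qed.

Lemma bnm_int_rcons n B f : bset B -> bnm n.+1 f ->
  bnm n (fun s => \int[mu]_(x in B) f (rcons s x)).
Proof.
move=> bB [mf [C bf]]; split.
  move=> d T g mg.
  pose H (z : T * measurableTypeR R) := f (rcons (mkseq (g^~ z.1) n) z.2).
  apply: (@integral_param_measurable _ _ _ H B C) => //.
    apply: (@nmeas_rcons _ _ mf _ _ (fun i z => g i z.1)).
      by move=> i; apply: measurableT_comp => //; exact: measurable_fst.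
    exact: measurable_snd.
  by move=> z; apply: bf; rewrite size_rcons size_mkseq.
exists (C * fine (mu B)) => s ss; apply: leb_normr_le => //.
  have := @nmeas_rcons _ _ mf _ R (fun i _ => nth 0 s i) id.
  rewrite mkseq_cst//; apply => // i; exact: measurable_cst.
by move=> x _; apply: bf; rewrite size_rcons ss.
Qed.

Lemma SS_expm A c H : expm A c H -> expm A (1 + c) (SS H).
Proof.
move=> eH; have [A0 c0 mH bH] := eH; split=> //; first by rewrite addr_ge0.
  have main : forall n d (T : measurableType d) (F : T -> seq R -> R),
      (forall m, pmeas m F) -> pmeas n (fun w => SS (F w)).
    elim=> [|m IH] d T F mF d' T' phi g mphi mg.
      exact: (mF 0%N _ _ phi g mphi mg).
    under eq_fun do rewrite mkseqS/=.
    apply: measurable_funD.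
      by apply: (IH _ _ F mF) => // i; exact: mg.
    have := IH _ _ _ (fun m => pmeas_cons (mF m.+1)) _ _ (fun w => (phi w, g 0%N w)) (fun i => g i.+1).
    by apply; [exact: measurable_fun_pair mphi (mg 0%N)|move=> i; exact: mg].
  move=> n d T g mg.
  have mF m : @pmeas R _ R m (fun=> H) by move=> d' T' phi h _ mh; exact: mH.
  by have := @main n _ _ _ mF _ _ (fun=> 0) g; apply => //; exact: measurable_cst.
move=> u; elim: u H A {mH eH} A0 bH => [|x s IH] H A A0 bH /=; first exact: (bH [::]).
apply: le_trans (ler_normD _ _) _.
have h1 := IH _ _ A0 bH.
have h2 : `|SS (fun T => H (x :: T)) s| <= A * c * (1 + c) ^+ size s.
  by apply: IH => [|u]; rewrite ?mulr_ge0//; have := bH (x :: u); rewrite /= exprS mulrA.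
apply: le_trans (lerD h1 h2) _; rewrite exprS; lra.
Qed.

Lemma int_rcons_Zl n B f s c : bset B -> bnm n.+1 f -> size s = n ->
  \int[mu]_(x in B) (c * f (rcons s x)) = c * \int[mu]_(x in B) f (rcons s x).
Proof.
move=> bB [mf [C bf]] ss; have mfx : measurable_fun setT (fun x : R => f (rcons s x)).
  have := @nmeas_rcons _ _ mf _ R (fun i _ => nth 0 s i) id.
  by rewrite mkseq_cst//; apply => // i; exact: measurable_cst.
rewrite RintegralZl//; first by case: bB.
by apply: (leb_integrable (C := C) bB mfx) => x _; apply: bf; rewrite size_rcons ss.
Qed.

Lemma bnm_behead n (f : seq R -> R) : bnm n f -> bnm n.+1 (fun s => f (behead s)).
Proof.
apply: bnm_subst => [s ss|i ni]; first by rewrite size_behead ss.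
by exists i.+1 => // s _; rewrite nth_behead.
Qed.

(* Pascal's rule, with the first variable in or out of the sub-list *)
Lemma rint_SS N B : bset B -> forall (f H : seq R -> R) (A c : R),
  symf f -> bnm N f -> expm A c H ->
  rint (nseq N B) (fun s => SS H s * f s) =
  \sum_(n < N.+1) 'C(N, n)%:R * rint (nseq N B) (fun s => H (take n s) * f s).
Proof.
move=> bB; elim: N => [|N IH] f H A c sf bf eH.
  by rewrite big_ord1 /= bin0 mul1r.
have bH n := expm_bnm n eH.
have bS n := expm_bnm n (SS_expm eH).
have bBN n : bsets (nseq n B) by exact: bsets_nseq.
have sz n : size (nseq n B) = n by rewrite size_nseq.
pose a n := rint (nseq N.+1 B) (fun s => H (take n s) * f s).
have bHt n m : (n <= m)%N -> bnm m (fun s => H (take n s)).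
  by move=> nm; apply: bnm_take.
pose f' s := \int[mu]_(x in B) f (rcons s x).
have bf' : bnm N f' by exact: bnm_int_rcons.
have sf' : symf f'.
  move=> s s' ss'; apply: eq_Rintegral => x _; apply: sf.
  by rewrite -!cats1 perm_cat2r.
(* Sublists without the first variable. By symmetry of [f] the ignored variable may be taken to be
   the last; integrating it out leaves the symmetric function [f'] of [N] variables. *)
have E1 : rint (nseq N.+1 B) (fun s => SS H (behead s) * f s) =
    \sum_(n < N.+1) 'C(N, n)%:R * a n.
  transitivity (rint (nseq N B) (fun s => SS H s * f' s)).
    transitivity (rint (nseq N.+1 B) (fun s => SS H (take N s) * f s)).
      rewrite -[in RHS]addn1 nseqD rint_move/=.
      - apply: eq_Rintegral => x _; rewrite cats0.
        apply: eq_rint => s /inB_size; rewrite sz => ss.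
        rewrite (sf _ _ (perm_ins _ _ _)); congr (SS H _ * _).
        by rewrite /ins -ss take_size drop_size cats1 take_rcons_le// take_size.
      - by rewrite -(nseqD N 1); exact: bBN.
      - rewrite size_cat sz/= addn1; apply: bnmM => //.
        exact: bnm_take.
    rewrite rint_last; apply: eq_rint => s /inB_size; rewrite sz => ss.
    rewrite -(int_rcons_Zl _ bB bf ss); apply: eq_Rintegral => x _.
    by rewrite -ss take_rcons_le// take_size.
  rewrite (IH _ _ _ _ sf' bf' eH); apply: eq_bigr => n _; congr (_ * _).
  rewrite /a rint_last; apply: eq_rint => s /inB_size; rewrite sz => ss.
  rewrite -(int_rcons_Zl _ bB bf ss); apply: eq_Rintegral => x _.
  by rewrite take_rcons_le// ss -ltnS.
(* Sublists containing the first variable: it is frozen, and the induction hypothesis is used for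
   the remaining ones. *)
have E2 : rint (nseq N.+1 B) (fun s => (SS H s - SS H (behead s)) * f s) =
    \sum_(n < N.+1) 'C(N, n)%:R * a n.+1.
  transitivity (rint (nseq N.+1 B)
      (fun s => \sum_(n < N.+1) 'C(N, n)%:R * (H (take n.+1 s) * f s))); last first.
    rewrite rint_sum//.
      by apply: eq_bigr => n _; rewrite rintZ// sz; apply: bnmM => //; apply: bHt.
    by move=> n _; rewrite sz; apply: bnmZ; apply: bnmM => //; apply: bHt.
  rewrite /=; apply: eq_Rintegral => x _.
  have bfx := bnm_cons x bf; have eHx := expm_cons x eH.
  transitivity (rint (nseq N B) (fun s => SS (fun T => H (x :: T)) s * f (x :: s))).
    by apply: eq_rint => s _; rewrite [_ + SS _ _]addrC addrK.
  rewrite (IH _ _ _ _ (symf_cons x sf) bfx eHx) rint_sum//.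
    apply: eq_bigr => n _; rewrite rintZ// sz; apply: bnmM => //.
    by apply: (bnm_take (H := fun T => H (x :: T))); [rewrite -ltnS|exact: (expm_bnm _ eHx)].
  move=> n _; rewrite sz; apply: bnmZ; apply: bnmM => //.
  by apply: (bnm_take (H := fun T => H (x :: T))); [rewrite -ltnS|exact: (expm_bnm _ eHx)].
transitivity (rint (nseq N.+1 B) (fun s => SS H (behead s) * f s +
   (SS H s - SS H (behead s)) * f s)).
  by apply: eq_rint => s _; rewrite -mulrDl addrC subrK.
rewrite rintD//; first 1 last.
- by rewrite sz; apply: bnmM => //; exact: bnm_behead.
- rewrite sz; apply: bnmM => //; apply: bnmD; first exact: bS.
  by apply: bnmN; exact: bnm_behead.
rewrite E1 E2 -/(a _).
rewrite [RHS]big_ord_recl [X in X + _ = _]big_ord_recl !bin0 -addrA; congr (_ + _).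
under [RHS]eq_bigr do rewrite binS natrD mulrDl.
rewrite big_split/=; congr (_ + _).
by rewrite [RHS]big_ord_recr/= bin_small// mul0r addr0.
Qed.

Lemma sum_sorted_ins x s : \sum_(i < (size s).+1) ((sorted <%R (ins i x s))%:R : R) =
  (sorted <%R s && (x \notin s))%:R.
Proof.
have tr : transitive (<%R : rel R) by exact: lt_trans.
elim: s => [|y s IH].
  by rewrite big_ord1 /ins/=.
rewrite big_ord_recl.
have step (i : 'I_(size s).+1) : (sorted <%R (ins (lift ord0 i) x (y :: s)))%:R =
   (((y < x) && all (<%R y) s)%:R * (sorted <%R (ins i x s))%:R : R).
  rewrite /ins/= path_sortedE// all_cat/= -natrM mulnb.
  have -> : all (<%R y) s = all (<%R y) (take i s) && all (<%R y) (drop i s).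
    by rewrite -all_cat cat_take_drop.
  congr (_%:R); congr nat_of_bool; rewrite add0n.
  by case: (y < x); rewrite ?andbF//= ?andbT.
under eq_bigr do rewrite step.
rewrite -mulr_sumr IH /ins take0 drop0 /= -!natrM !mulnb -natrD path_sortedE// in_cons negb_or.
congr (_%:R); case: (ltgtP x y) => xy /=.
- case: (boolP (all _ _)) => //= ays; rewrite ?addn0; case: (sorted _ s) => //=.
  rewrite (_ : x \notin s = true)//; apply/negP => xs.
  by have /= := allP ays x xs; rewrite ltNge (ltW xy).
- by case: (all _ _) => //=.
- by rewrite !andbF.
Qed.

Lemma measurable_natr_bool d (T : measurableType d) (b : T -> bool) :
  measurable_fun setT b -> measurable_fun setT (fun w => (b w)%:R : R).
Proof.
move=> mb; apply: (measurableT_comp (f := fun c : bool => c%:R : R)) => //.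
Qed.

Lemma bnm_bool n (b : seq R -> bool) :
  (forall d (T : measurableType d) (g : nat -> T -> R),
    (forall i, measurable_fun setT (g i)) ->
    measurable_fun setT (fun w => b (mkseq (g^~ w) n))) ->
  bnm n (fun s => (b s)%:R).
Proof.
move=> mb; split; last by exists 1 => s _; case: (b s); rewrite ?normr1 ?normr0.
by move=> d T g mg; apply: measurable_natr_bool; exact: mb.
Qed.

Lemma bnm_sorted n : @bnm R n (fun s => (sorted <%R s)%:R).
Proof.
have tr : transitive (<%R : rel R) by exact: lt_trans.
apply: bnm_bool => d T g mg; elim: n g mg => [|n IHn] g mg.
  exact: measurable_cst.
under eq_fun do rewrite mkseqS/= path_sortedE//.
apply: measurable_and; last exact: (IHn (fun i => g i.+1)).
suff aux m (h : nat -> T -> R) : (forall i, measurable_fun setT (h i)) ->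
    measurable_fun setT (fun w => all (<%R (g 0%N w)) (mkseq (h^~ w) m)).
  by apply: (aux n (fun i => g i.+1)) => i; exact: mg.
elim: m h {IHn} => [|m IHm] h mh; first exact: measurable_cst.
under eq_fun do rewrite mkseqS/=.
apply: measurable_and; last exact: (IHm (fun i => h i.+1) (fun i => mh i.+1)).
exact: measurable_fun_ltr.
Qed.

Lemma bnm_mem n : @bnm R n.+1 (fun s => (nth 0 s 0 \in behead s)%:R).
Proof.
apply: bnm_bool => d T g mg; under eq_fun do rewrite mkseqS/=.
suff aux m (h : nat -> T -> R) : (forall i, measurable_fun setT (h i)) ->
    measurable_fun setT (fun w => g 0%N w \in mkseq (h^~ w) m).
  by apply: (aux n (fun i => g i.+1)) => i; exact: mg.
elim: m h => [|m IHm] h mh; first exact: measurable_cst.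
under eq_fun do rewrite mkseqS/= in_cons.
apply: measurable_or; last exact: (IHm (fun i => h i.+1) (fun i => mh i.+1)).
exact: measurable_fun_eqr.
Qed.

Lemma rint_first_last N B f : bset B -> bnm N.+1 f ->
  rint (nseq N.+1 B) f = rint (nseq N B) (fun s => \int[mu]_(x in B) f (x :: s)).
Proof.
move=> bB bf; pose sub s := nth 0 s N :: take N s : seq R.
have sE s x : size s = N -> sub (rcons s x) = x :: s.
  by move=> ss; rewrite /sub nth_rcons ss ltnn eqxx -ss take_rcons_le// take_size.
have bf' : bnm N.+1 (fun s => f (sub s)).
  apply: (bnm_subst (n := N.+1)) bf => [s ss|[|i] iN].
  - by rewrite /= size_take ss ltnSn.
  - by exists N.
  - by exists i => [|s ss]; [exact: ltnW|rewrite /= nth_take].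
transitivity (rint (nseq N.+1 B) (fun s => f (sub s))); last first.
  rewrite rint_last; apply: eq_rint => s /inB_size; rewrite size_nseq => ss.
  by apply: eq_Rintegral => x _; rewrite sE.
rewrite -[in RHS]addn1 nseqD rint_move/=.
- apply: eq_Rintegral => x _; rewrite cats0 size_nseq.
  apply: eq_rint => s /inB_size; rewrite size_nseq => ss.
  by rewrite /ins -{1 2}ss take_size drop_size cats1 sE.
- by rewrite -(nseqD N 1); exact: bsets_nseq.
- by rewrite size_cat size_nseq/= addn1.
Qed.

Lemma int_mem0 B (s : seq R) (phi : R -> R) (C : R) : bset B ->
  measurable_fun setT phi -> (forall x, `|phi x| <= C) ->
  \int[mu]_(x in B) ((x \in s)%:R * phi x) = 0.
Proof.
move=> [mB fB] mphi bphi.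
have cs : countable [set` s] by exact: finite_set_countable.
have ms : measurable [set` s] by exact: countable_measurable.
have m0 : mu (B `&` [set` s]) = 0%E.
  apply: (@subset_measure0 _ _ _ mu _ [set` s]) => //.
  - exact: measurableI.
  - exact: countable_lebesgue_measure0.
transitivity (\int[mu]_(x in B) (phi \_ [set` s]) x).
  by apply: eq_Rintegral => x _; rewrite /patch mem_setE; case: (x \in s); rewrite ?mul1r ?mul0r.
rewrite -Rintegral_mkcondr; apply/eqP; rewrite -normr_le0.
have := @leb_normr_le R (B `&` [set` s]) phi C; rewrite m0 mulr0; apply => //.
split; first exact: measurableI.
by rewrite m0 ltry.
Qed.

Lemma nmeas_cons1 n (f : seq R -> R) s : nmeas n.+1 f -> size s = n ->
  measurable_fun setT (fun x : R => f (x :: s)).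
Proof.
move=> mf ss; have := @nmeas_cons _ _ _ mf _ R id (fun i _ => nth 0 s i).
by rewrite mkseq_cst//; apply => // i; exact: measurable_cst.
Qed.

(* coincidences are null, so a.e. the new point falls in exactly one gap *)
Lemma rint_sorted N B : bset B -> forall f : seq R -> R, symf f -> bnm N f ->
  rint (nseq N B) f = N`!%:R * rint (nseq N B) (fun s => (sorted <%R s)%:R * f s).
Proof.
move=> bB; elim: N => [|N IH] f sf bf; first by rewrite /= fact0 !mul1r.
have bBN n : bsets (nseq n B) by exact: bsets_nseq.
have sz n : size (nseq n B) = n by rewrite size_nseq.
have bsb : bnm N.+1 (fun s => (sorted <%R (behead s))%:R * f s).
  by apply: bnmM => //; apply: (bnm_behead (f := fun s => (sorted <%R s)%:R)); exact: bnm_sorted.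
transitivity (N`!%:R * rint (nseq N.+1 B) (fun s => (sorted <%R (behead s))%:R * f s)).
  rewrite -rintZ ?sz//=; last exact: (bBN N.+1).
  apply: eq_Rintegral => x _; rewrite (IH _ (symf_cons x sf) (bnm_cons x bf)).
  rewrite rintZ// sz; apply: bnmM; [exact: bnm_sorted|exact: bnm_cons bf].
rewrite factS natrM -mulrA mulrCA; congr (_ * _).
have null : rint (nseq N.+1 B) (fun s => (nth 0 s 0 \in behead s)%:R *
    ((sorted <%R (behead s))%:R * f s)) = 0.
  rewrite rint_first_last//; last by apply: bnmM => //; exact: bnm_mem.
  rewrite -[RHS](mul0r (rint (nseq N B) (fun=> 1))) -rintZ//; last exact: bnm_cst.
  apply: eq_rint => s /inB_size; rewrite sz => ss; rewrite mul0r /=.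
  have [mf [C bf1]] := bsb.
  apply: (@int_mem0 B s (fun x => (sorted <%R s)%:R * f (x :: s)) C) => //.
    exact: (nmeas_cons1 mf ss).
  by move=> x; apply: (bf1 (x :: s)); rewrite /= ss.
transitivity (rint (nseq N.+1 B) (fun s =>
   (\sum_(i < N.+1) (sorted <%R (ins i (nth 0 s 0) (behead s)))%:R * f s))).
  rewrite -[LHS]subr0 -[X in _ - X]null -[X in _ - X]mul1r -mulNr -rintZ ?sz; first 1 last.
  - exact: bBN.
  - by apply: bnmM => //; exact: bnm_mem.
  rewrite -rintD ?sz//; last first.
    by apply: bnmZ; apply: bnmM => //; exact: bnm_mem.
  apply: eq_rint => s /inB_size; rewrite sz; case: s => [//|x s] [ss].
  rewrite -mulr_suml /=; have := sum_sorted_ins x s; rewrite ss => ->.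
  by case: (sorted _ s) => /=; case: (x \in s) => /=; ring.
rewrite rint_sum//.
  rewrite [RHS]mulr_natl -[X in _ *+ X]card_ord -sumr_const; apply: eq_bigr => i _.
  have iN : (i <= N)%N by rewrite -ltnS.
  have eN : nseq N.+1 B = nseq i B ++ B :: nseq (N - i) B.
    by rewrite -[B :: _]/(nseq (N - i).+1 B) -nseqD addnS subnKC.
  rewrite [in RHS]eN rint_move -?eN ?sz//; last first.
    by apply: bnmM => //; exact: bnm_sorted.
  rewrite -nseqD subnKC//=; apply: eq_Rintegral => x _; apply: eq_rint => s _.
  by rewrite (sf _ _ (perm_ins i x s)).
move=> i _; rewrite sz; apply: bnmM => //.
apply: (bnm_subst (n := N.+1) (f := fun s => (sorted <%R s)%:R)
  (sub := fun s => ins i (nth 0 s 0) (behead s))); last exact: bnm_sorted.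
  by move=> s ss; rewrite size_ins size_behead ss.
have iN : (i <= N)%N by rewrite -ltnS.
move=> j jN; exists (if (j < i)%N then j.+1 else if j == i :> nat then 0%N else j).
  by case: (ltnP j i) => ji; [rewrite ltnS (leq_trans ji)|case: eqP].
move=> s ss; rewrite nth_ins ?size_behead ?ss//.
case: ltnP => ji; first by rewrite nth_behead.
by case: eqVneq => // ne; rewrite nth_behead; congr nth; lia.
Qed.

End Closure.

(** * Determinantal kernels and the limit functional *)

(** Laplace expansion along the first column and then along the first row of each minor. It isolates
    the occurrences of the first point in a kernel determinant: once on the diagonal, otherwise in
    pairs k(s_i, x) k(x, s_j). *)
Lemma det_bordered (F : comNzRingType) n (M : 'M[F]_n.+1) :
  let A := \matrix_(i < n, j < n) M (lift ord0 i) (lift ord0 j) in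
  \det M = M ord0 ord0 * \det A -
    \sum_i \sum_j M (lift ord0 i) ord0 * M ord0 (lift ord0 j) * cofactor A i j.
Proof.
case: n M => [|n] M A.
  rewrite (expand_det_col M ord0) big_ord_recl !big_ord0 subr0 addr0.
  rewrite /cofactor addn0 expr0 mul1r; congr (_ * \det _).
  by apply/matrixP => -[].
rewrite (expand_det_col M ord0) big_ord_recl; congr (_ + _).
  rewrite /cofactor addn0 expr0 mul1r; congr (_ * \det _).
  by apply/matrixP => i j; rewrite !mxE.
rewrite -sumrN; apply: eq_bigr => i _.
rewrite {1}/cofactor (expand_det_row _ ord0) mulrA mulr_sumr -sumrN.
apply: eq_bigr => j _; rewrite /cofactor !mxE.
have -> : lift (lift ord0 i) ord0 = ord0 :> 'I_n.+2 by apply: val_inj.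
rewrite -[RHS]mulrN -!mulrA; congr (_ * _).
set B1 := row' ord0 _; set B2 := row' i _.
have -> : B1 = B2.
  apply/matrixP => a b; rewrite /B1 /B2 /A !mxE; congr (M _ _); apply: val_inj => /=.
  by rewrite /bump/= !add1n ltnS; case: (i <= a)%N.
by rewrite /= /bump leq0n add1n add0n addn0 exprS exprD; ring.
Qed.

Section Hadamard.
Local Open Scope sesquilinear_scope.

(** Gram-Schmidt writes A = L S with S unitary and L lower triangular. Then |det A| is the product
    of the |L_ii|, and |L_ii|^2 is at most the squared norm of row i of L, which equals that of row
    i of A. *)
Lemma hadamardC (C : numClosedFieldType) n (A : 'M[C]_n) :
  `|\det A| ^+ 2 <= \prod_(i < n) \sum_(j < n) `|A i j| ^+ 2.
Proof.
pose S := schmidt A; have uS : S \is unitarymx by exact: schmidt_unitarymx.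
have sq (M : 'M[C]_n) i : \sum_j `|M i j| ^+ 2 = (M *m M ^t*) i i.
  by rewrite mxE; apply: eq_bigr => j _; rewrite !mxE normCK.
pose L := A *m S ^t*.
have AE : A = L *m S by rewrite /L mulmxKtV.
have gen (L' S' : 'M[C]_n) : S' \is unitarymx ->
    L' *m L' ^t* = (L' *m S') *m (L' *m S') ^t*.
  by move=> uS'; rewrite trmx_mul map_mxM mulmxA mulmxtVK.
have LL : L *m L ^t* = A *m A ^t* by rewrite (gen L S uS) -AE.
have trigL : is_trig_mx L.
  apply/is_trig_mxP => i j ij; rewrite /L.
  have : (row i A <= kermx ((row j S) ^t*))%MS.
    apply: submx_trans (row_schmidt_sub A i) _.
    apply/sumsmx_subP => k ki; rewrite genmxE; apply/sub_kermxP.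
    have /row_unitarymxP/(_ k j) := uS; rewrite dotmxE => e.
    apply/matrixP => a b; rewrite !ord1 e mxE; case: eqP => // kj.
    by move: ki; rewrite kj leqNgt ij.
  move/sub_kermxP => /matrixP/(_ 0 0); rewrite !mxE => e.
  by rewrite -[RHS]e; apply: eq_bigr => k _; rewrite !mxE.
have dS : `|\det S| ^+ 2 = 1.
  rewrite normCK -det_map_mx -[X in _ * X]det_tr.
  rewrite -det_mulmx (_ : S *m _ = 1%:M) ?det1//.
  by rewrite -(unitarymxP uS) map_trmx.
rewrite {1}AE det_mulmx normrM exprMn dS mulr1 (det_trig trigL) normr_prod -prodrXl.
apply: ler_prod => i _; rewrite exprn_ge0//= sq -LL -sq (bigD1 i)//= lerDl.
by apply: sumr_ge0 => j _; exact: exprn_ge0.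
Qed.

End Hadamard.

Lemma hadamard (R : realType) n (A : 'M[R]_n) :
  (\det A) ^+ 2 <= \prod_(i < n) \sum_(j < n) (A i j) ^+ 2.
Proof.
have nE (x : R) : `|(x%:C)%C| ^+ 2 = ((x ^+ 2)%:C)%C :> complex R.
  by rewrite real_normK ?complex_real// rmorphXn.
have := hadamardC (map_mx (real_complex R) A); rewrite det_map_mx nE.
have -> : \prod_(i < n) \sum_(j < n) `|map_mx (real_complex R) A i j| ^+ 2 =
   ((\prod_(i < n) \sum_(j < n) (A i j) ^+ 2)%:C)%C :> complex R.
  rewrite rmorph_prod; apply: eq_bigr => i _; rewrite rmorph_sum; apply: eq_bigr => j _.
  by rewrite mxE nE.
by rewrite lecR.
Qed.

(** * Kernel determinants and Mehta's recursion *)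

Section Kernel.
Variable R : realType.
Notation mu := (@lebesgue_measure R).

Lemma bnm_ext n (f g : seq R -> R) : (forall s, size s = n -> f s = g s) ->
  bnm n f -> bnm n g.
Proof.
move=> fg [mf [C bf]]; split; last by exists C => s ss; rewrite -fg// bf.
by move=> d T h mh; under eq_fun do rewrite -fg ?size_mkseq//; exact: mf.
Qed.

Lemma bnm_catl m (s1 : seq R) f : bnm (size s1 + m) f -> bnm m (fun s2 => f (s1 ++ s2)).
Proof.
elim: s1 f => [//|x s1 IH] f bf /=.
by apply: (IH (fun s => f (x :: s))); exact: bnm_cons bf.
Qed.

Definition Dks (k : R -> R -> R) (s : seq R) : R :=
  \det (\matrix_(i < size s, j < size s) k (nth 0 s i) (nth 0 s j)).

Lemma Dks_size k n s : size s = n ->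
  Dks k s = \det (\matrix_(i < n, j < n) k (nth 0 s i) (nth 0 s j)).
Proof. by move=> <-. Qed.

Lemma Dks_perm k : symf (Dks k).
Proof.
move=> s s' ss'; have sz := perm_size ss'.
have /tuple_permP[p sE] : perm_eq s (in_tuple s') by [].
rewrite (Dks_size _ sz) /Dks.
have nE (i : 'I_(size s')) : nth 0 s i = nth 0 s' (p i).
  rewrite {1}sE (nth_map i) ?size_enum_ord// nth_ord_enum.
  by rewrite (tnth_nth 0).
rewrite (_ : \matrix_(i, j) _ = row_perm p (col_perm p
  (\matrix_(i < size s', j < size s') k (nth 0 s' i) (nth 0 s' j)))); last first.
  by apply/matrixP => i j; rewrite !mxE !nE.
rewrite row_permE col_permE !det_mulmx !det_perm mulrCA mulrA mulrAC.
by rewrite odd_permV -mulrA -expr2 sqrr_sign mulr1.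
Qed.

Definition bker (k : R -> R -> R) (C : R) :=
  measurable_fun setT (fun z : R * R => k z.1 z.2) /\ (forall x y, `|k x y| <= C).

Lemma bnm_Dks k C n : bker k C -> bnm n (Dks k).
Proof.
move=> [mk bk]; apply: (@bnm_ext n (fun s =>
  \det (\matrix_(i < n, j < n) k (nth 0 s i) (nth 0 s j)))).
  by move=> s ss; rewrite (Dks_size _ ss).
rewrite /determinant; apply: bnm_sum => p _; apply: bnmZ; apply: bnm_prod => i _.
split; last by exists C => s _; rewrite mxE.
move=> d T g mg; under eq_fun do rewrite mxE !nth_mkseq//.
apply: (@measurableT_comp _ _ _ _ _ _ (fun z => k z.1 z.2) _ (fun w => (g i w, g (p i) w)) mk).
exact: measurable_fun_pair.
Qed.

Lemma bker_ge0 k C : bker k C -> 0 <= C.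
Proof. by move=> [_ bk]; exact: le_trans (bk 0 0). Qed.

Lemma Dks_bound k C s : bker k C ->
  (Dks k s) ^+ 2 <= ((size s)%:R * C ^+ 2) ^+ size s.
Proof.
move=> bk; apply: le_trans (hadamard _) _.
have -> : ((size s)%:R * C ^+ 2) ^+ size s =
   \prod_(i < size s) \sum_(j < size s) C ^+ 2 :> R.
  by rewrite prodr_const sumr_const card_ord mulr_natl.
apply: ler_prod => i _; apply/andP; split; first by apply: sumr_ge0 => j _; exact: sqr_ge0.
apply: ler_sum => j _; rewrite mxE -real_normK ?num_real//.
by rewrite ler_sqr ?nnegrE ?(bker_ge0 bk)//; exact: bk.2.
Qed.

Lemma leb_lin B (I : finType) (c : I -> R) (F : I -> R -> R) (C : R) : bset B ->
  (forall i, measurable_fun setT (F i)) -> (forall i x, `|F i x| <= C) ->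
  \int[mu]_(x in B) (\sum_i c i * F i x) = \sum_i c i * \int[mu]_(x in B) F i x.
Proof.
move=> bB mF bF; have bF1 i : bnm 1 (fun s => F i (nth 0 s 0)).
  exact: (bnm1 (mF i) (bF i)).
have bB1 : bsets [:: B] by apply: (bsets_nseq (n := 1)).
have := @rint_sum R [:: B] I (index_enum I) xpredT (fun i s => c i * F i (nth 0 s 0)) bB1.
rewrite /= => ->.
  apply: eq_bigr => i _.
  exact: (rintZ (c i) bB1 (bF1 i)).
by move=> i _; exact: bnmZ.
Qed.

Section Mehta.
Variables (B : set R) (k : R -> R -> R) (C : R) (N : nat).
Hypotheses (bB : bset B) (bk : bker k C).
Hypothesis repr : forall x z, \int[mu]_(y in B) (k x y * k y z) = k x z.
Hypothesis tr : \int[mu]_(x in B) k x x = N%:R.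

(** The diagonal term of the bordered determinant integrates to the trace [N]. By the reproducing
    property a pair k(s_i, x) k(x, s_j) integrates to k(s_i, s_j), and summing against cofactors
    gives one copy of the determinant for each of the [size s] rows. *)
Lemma mehta1 s : \int[mu]_(x in B) Dks k (x :: s) = (N%:R - (size s)%:R) * Dks k s.
Proof.
set n := size s; pose A := \matrix_(i < n, j < n) k (nth 0 s i) (nth 0 s j).
(* [None] indexes the diagonal term and [Some (i, j)] the off-diagonal ones, so that linearity of
   the integral is used once. *)
have E x : Dks k (x :: s) = \sum_(o : option ('I_n * 'I_n))
   (if o is Some ij then - cofactor A ij.1 ij.2 else \det A) *
   (if o is Some ij then k (nth 0 s ij.1) x * k x (nth 0 s ij.2) else k x x).
  rewrite /Dks/= det_bordered !mxE /= [RHS](bigD1 None)//= [\det A * _]mulrC.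
  congr (_ * \det _ + _); first by apply/matrixP => i j; rewrite !mxE.
  rewrite (reindex_omap Some id)/=; last by case.
  rewrite pair_big/= -sumrN; apply: eq_big => [[i j]|[i j] _]/=; first by rewrite eqxx.
  rewrite !mxE/= -mulNr mulrC mulNr -mulrN; congr (_ * - _).
  by congr cofactor; apply/matrixP => a b; rewrite !mxE.
have [mk bk'] := bk.
under eq_Rintegral do rewrite E.
have C0 := bker_ge0 bk.
rewrite (@leb_lin B _ _ _ (C + C * C))//; first last.
- case=> [[i j]|] x; last by rewrite (le_trans (bk' _ _))// lerDl mulr_ge0.
  by rewrite normrM ler_wpDl// ler_pM.
- have mkk (u v : R -> R) : measurable_fun setT u -> measurable_fun setT v ->
      measurable_fun setT (fun x => k (u x) (v x)).
    move=> mu1 mv; apply: (@measurableT_comp _ _ _ _ _ _ (fun z => k z.1 z.2) _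
      (fun w => (u w, v w)) mk).
    exact: measurable_fun_pair.
  case=> [[i j]|]; last exact: mkk.
  by apply: measurable_funM; apply: mkk => //; exact: measurable_cst.
rewrite (bigD1 None)//= tr mulrBl mulrC; congr (_ + _).
rewrite (reindex_omap Some id)/=; last by case.
rewrite (eq_bigr (fun ij : 'I_n * 'I_n => - (A ij.1 ij.2 * cofactor A ij.1 ij.2))); last first.
  by move=> [i j] _ /=; rewrite repr mulNr mulrC mxE.
rewrite sumrN; congr (- _).
rewrite (eq_bigl xpredT); last by case=> i j /=; rewrite eqxx.
rewrite -(pair_bigA _ (fun i j => A i j * cofactor A i j))/=.
rewrite (eq_bigr (fun=> \det A)); last by move=> i _; rewrite -expand_det_row.
by rewrite sumr_const card_ord mulr_natl.
Qed.

Lemma mehta m s : (size s + m = N)%N ->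
  rint (nseq m B) (fun s2 => Dks k (s ++ s2)) = m`!%:R * Dks k s.
Proof.
elim: m s => [|m IH] s sN /=; first by rewrite cats0 fact0 mul1r.
have sr x : (size (rcons s x) + m = N)%N by rewrite size_rcons addSnnS.
transitivity (\int[mu]_(x in B) (m`!%:R * Dks k (x :: s))).
  apply: eq_Rintegral => x _.
  transitivity (rint (nseq m B) (fun s2 => Dks k (rcons s x ++ s2))).
    by apply: eq_rint => s2 _; rewrite cat_rcons.
  rewrite IH//; congr (_ * _); by apply: Dks_perm; rewrite perm_rcons.
rewrite RintegralZl; first 1 last.
- by case: bB.
- have [mD [C' bD]] := bnm_Dks (size s).+1 bk.
  apply: (leb_integrable (C := C') bB).
    exact: (nmeas_cons1 mD).
  by move=> x _; apply: bD.
rewrite mehta1 -sN natrD addrAC subrr add0r factS natrM; ring.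
Qed.

(** [G] is the sum of its Moebius transform over sublists. By symmetry the sublists of size n
    contribute equally, binomial(N, n) times, and the other N - n variables integrate to (N - n)! by
    [mehta]. *)
Lemma rint_Mob (G : seq R -> R) (A c : R) : expm A c G ->
  rint (nseq N B) (fun s => G s * Dks k s) =
  N`!%:R * \sum_(n < N.+1) (n`!%:R)^-1 * rint (nseq n B) (fun s => Mob G s * Dks k s).
Proof.
move=> eG; have eM := Mob_expm eG.
have bD n := bnm_Dks n bk; have bM n := expm_bnm n eM.
transitivity (rint (nseq N B) (fun s => SS (Mob G) s * Dks k s)).
  by apply: eq_rint => s _; rewrite SS_Mob.
rewrite (rint_SS bB (@Dks_perm k) (bD N) eM) mulr_sumr; apply: eq_bigr => n _.
have nN : (n <= N)%N by rewrite -ltnS.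
have -> : rint (nseq N B) (fun s => Mob G (take n s) * Dks k s) =
    (N - n)`!%:R * rint (nseq n B) (fun s => Mob G s * Dks k s).
  rewrite -{1}(subnKC nN) nseqD rint_cat -rintZ; first 1 last.
  - exact: bsets_nseq.
  - by rewrite size_nseq; exact: bnmM.
  apply: eq_rint => s /inB_size; rewrite size_nseq => ss.
  rewrite mulrCA -mehta ?ss ?subnKC// -rintZ; first 1 last.
  - exact: bsets_nseq.
  - by rewrite size_nseq; apply: bnm_catl; rewrite ss subnKC.
  by apply: eq_rint => s2 _; rewrite -ss take_size_cat.
rewrite !mulrA; congr (_ * _).
rewrite -(bin_fact nN) !natrM.
have : (n`!%:R : R) != 0 by rewrite pnatr_eq0 -lt0n fact_gt0.
by move=> h; field.
Qed.

End Mehta.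
End Kernel.

(** * Dominated series and the Hadamard majorant *)

Section Series.
Variable R : realType.
Implicit Types (u v g : nat -> R).

Lemma cvg_series_dom u g : (forall n, `|u n| <= g n) -> cvgn (series g) ->
  cvgn (series u).
Proof.
move=> ug cg; apply: normed_cvg; apply: series_le_cvg cg => n.
- exact: normr_ge0.
- exact: le_trans (ug n).
- exact: ug.
Qed.

Lemma series_tail u g m : (forall n, `|u n| <= g n) -> cvgn (series g) ->
  `|limn (series u) - series u m| <= limn (series g) - series g m.
Proof.
move=> ug cg; have cu := cvg_series_dom ug cg.
have g0 n : 0 <= g n by exact: le_trans (ug n).
have ndg : {homo series g : n p / (n <= p)%N >-> n <= p}.
  by apply/nondecreasing_series => n _ _.
have c1 : series u n - series u m @[n --> \oo] --> limn (series u) - series u m.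
  by apply: cvgB => //; exact: cvg_cst.
have c2 := @cvg_norm _ _ _ _ _ _ _ c1.
rewrite -(cvg_lim _ (c2 _))//; apply: limr_le.
  by apply/cvg_ex; eexists; exact: c2.
near=> n; have mn : (m <= n)%N by near: n; exact: nbhs_infty_ge.
rewrite sub_series_geq//; apply: le_trans (ler_norm_sum _ _ _) _.
apply: (@le_trans _ _ (\sum_(m <= k < n) g k)); first exact: ler_sum.
rewrite -(sub_series_geq g mn) lerB//.
exact: nondecreasing_cvgn_le.
Unshelve. all: by end_near. Qed.

Lemma cvg_bigsum (I : Type) (r : seq I) (P : pred I) (f : I -> nat -> R) (l : I -> R) :
  (forall i, f i n @[n --> \oo] --> l i) ->
  \sum_(i <- r | P i) f i n @[n --> \oo] --> \sum_(i <- r | P i) l i.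
Proof.
move=> cf; elim: r => [|i r IH].
  by under eq_fun do rewrite big_nil; rewrite big_nil; exact: cvg_cst.
under eq_fun do rewrite big_cons; rewrite big_cons.
by case: (P i) => //; apply: cvgD.
Qed.

Lemma cvg_bigprod (I : Type) (r : seq I) (P : pred I) (f : I -> nat -> R) (l : I -> R) :
  (forall i, f i n @[n --> \oo] --> l i) ->
  \prod_(i <- r | P i) f i n @[n --> \oo] --> \prod_(i <- r | P i) l i.
Proof.
move=> cf; elim: r => [|i r IH].
  by under eq_fun do rewrite big_nil; rewrite big_nil; exact: cvg_cst.
under eq_fun do rewrite big_cons; rewrite big_cons.
by case: (P i) => //; apply: cvgM.
Qed.

Lemma series_cvgZ u (a l : R) : series u n @[n --> \oo] --> l ->
  series (fun n => a * u n) n @[n --> \oo] --> a * l.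
Proof.
move=> cu; rewrite (_ : series (fun n => a * u n) = fun n => a * series u n).
  by apply: cvgM => //; exact: cvg_cst.
by apply/funext => n; rewrite /series/= mulr_sumr.
Qed.

Lemma series_cvgD u v (l l' : R) : series u n @[n --> \oo] --> l ->
  series v n @[n --> \oo] --> l' ->
  series (fun n => u n + v n) n @[n --> \oo] --> l + l'.
Proof.
move=> cu cv; rewrite (_ : series _ = fun n => series u n + series v n).
  exact: cvgD.
by apply/funext => n; rewrite /series/= big_split.
Qed.

Lemma tannery (u : nat -> nat -> R) v g : (forall N n, `|u N n| <= g n) ->
  cvgn (series g) -> (forall n, u N n @[N --> \oo] --> v n) ->
  limn (series (u N)) @[N --> \oo] --> limn (series v).
Proof.
move=> ug cg cu.
have vg n : `|v n| <= g n by apply: (cvg_normr_le (cu n)).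
apply/cvgrPdist_lt => e e0.
have e3 : 0 < e / 3 by rewrite divr_gt0.
have [m _ gm] : \forall n \near \oo, `|limn (series g) - series g n| < e / 3.
  by move/cvgrPdist_lt : cg; apply.
have /cvgrPdist_lt/(_ _ e3) cm : series (u N) m @[N --> \oo] --> series v m.
  by rewrite /series/=; apply: cvg_bigsum.
have tail (w : nat -> R) : (forall n, `|w n| <= g n) -> `|limn (series w) - series w m| < e / 3.
  move=> wg; apply: le_lt_trans (series_tail m wg cg) _.
  by apply: le_lt_trans (ler_norm _) (gm m (leqnn m)).
near=> N.
have h1 := tail _ vg; have h2 := tail _ (ug N).
have h3 : `|series v m - series (u N) m| < e / 3 by near: N; exact: cm.
rewrite (_ : _ - _ = (limn (series v) - series v m) + (series v m - series (u N) m)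
   - (limn (series (u N)) - series (u N) m)); last by ring.
apply: le_lt_trans (ler_normB _ _) _.
apply: le_lt_trans (lerD (ler_normD _ _) (lexx _)) _.
move: h1 h2 h3; lra.
Unshelve. all: by end_near. Qed.

Lemma lim_series_finite u m : (forall n, (m <= n)%N -> u n = 0) ->
  limn (series u) = series u m.
Proof.
move=> u0; apply: norm_lim_near_cst; near=> n.
have mn : (m <= n)%N by near: n; exact: nbhs_infty_ge.
apply/eqP; rewrite -subr_eq0 sub_series_geq//; apply/eqP.
rewrite big_nat big1// => i /andP[mi _]; exact: u0.
Unshelve. all: by end_near. Qed.

Lemma exp_coeff_le (x : R) n : 0 <= x -> x ^+ n / n`!%:R <= expR x.
Proof.
move=> x0; have e0 k : 0 <= exp_coeff x k by rewrite /exp_coeff/= divr_ge0// exprn_ge0.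
apply: (@le_trans _ _ (series (exp_coeff x) n.+1)).
  by rewrite /series/= big_nat_recr//= lerDr; apply: sumr_ge0 => i _; exact: e0.
apply: nondecreasing_cvgn_le; last exact: is_cvg_series_exp_coeff.
by apply/nondecreasing_series => k _ _.
Qed.

Lemma natrX_le n : (n%:R : R) ^+ n <= expR 1 ^+ n * n`!%:R.
Proof.
rewrite -expRM_natl mulr1 -ler_pdivrMr ?ltr0n ?fact_gt0//.
exact: exp_coeff_le.
Qed.

(* AM-GM turns the Hadamard bound n^(n/2)/n! into an exponential series *)
Definition hbound (X C : R) (n : nat) : R :=
  2^-1 * ((2 * expR 1 * C ^+ 2 * X ^+ 2) ^+ n / n`!%:R + 2^-1 ^+ n).

Lemma cvg_hbound X C : cvgn (series (hbound X C)).
Proof.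
pose l1 := limn (series (exp_coeff (2 * expR 1 * C ^+ 2 * X ^+ 2))).
have c1 : series (exp_coeff (2 * expR 1 * C ^+ 2 * X ^+ 2)) n @[n --> \oo] --> l1.
  exact: is_cvg_series_exp_coeff.
have c2 : series (geometric 1 (2^-1 : R)) n @[n --> \oo] --> (1 / (1 - 2^-1) : R).
  by apply: cvg_geometric_series; rewrite ger0_norm//; lra.
have E : hbound X C = (fun n => 2^-1 *
   (exp_coeff (2 * expR 1 * C ^+ 2 * X ^+ 2) n + geometric 1 2^-1 n)).
  by apply/funext => n; rewrite /hbound /exp_coeff /geometric/= mul1r.
have h := @series_cvgZ _ 2^-1 _ (series_cvgD c1 c2).
by rewrite E; apply/cvg_ex; eexists; exact: h.
Qed.

Lemma hboundP (X C d : R) n : 0 <= X -> 0 <= d -> d ^+ 2 <= (n%:R * C ^+ 2) ^+ n ->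
  X ^+ n * d / n`!%:R <= hbound X C n.
Proof.
move=> X0 d0 dle; set y := X ^+ n * d / n`!%:R.
have f0 : 0 < (n`!%:R : R) by rewrite ltr0n fact_gt0.
have y0 : 0 <= y by rewrite divr_ge0 ?mulr_ge0 ?exprn_ge0.
have y2 : y ^+ 2 <= (expR 1 * C ^+ 2 * X ^+ 2) ^+ n / n`!%:R.
  have -> : y ^+ 2 = (X ^+ 2) ^+ n * d ^+ 2 / n`!%:R ^+ 2.
    by rewrite /y expr_div_n exprMn -!exprM (mulnC n 2).
  have x20 : 0 <= (X ^+ 2) ^+ n by rewrite exprn_ge0// sqr_ge0.
  have c20 : 0 <= (C ^+ 2) ^+ n by rewrite exprn_ge0// sqr_ge0.
  rewrite ler_pdivrMr ?exprn_gt0//.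
  apply: (@le_trans _ _ ((X ^+ 2) ^+ n * ((n%:R * C ^+ 2) ^+ n))).
    exact: ler_wpM2l.
  have -> : (expR 1 * C ^+ 2 * X ^+ 2) ^+ n / n`!%:R * n`!%:R ^+ 2 =
     (X ^+ 2) ^+ n * ((expR 1 ^+ n * n`!%:R) * (C ^+ 2) ^+ n).
    rewrite (exprMn _ (expR 1 * C ^+ 2)) (exprMn _ (expR 1)).
    by field; rewrite gt_eqF.
  rewrite (exprMn _ n%:R) ler_wpM2l// ler_wpM2r//; exact: natrX_le.
have p0 : 0 < (2 : R) ^+ n by rewrite exprn_gt0.
(* The weight 2^n leaves the summable remainder 2^(-n), at the price of a factor 2 inside the n-th
   power. *)
have amgm : 2 * y <= 2 ^+ n * y ^+ 2 + 2^-1 ^+ n.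
  rewrite exprVn; set p := 2 ^+ n in p0 *.
  rewrite -subr_ge0 (_ : _ - _ = p^-1 * (p * y - 1) ^+ 2); last by field; rewrite gt_eqF.
  by rewrite mulr_ge0 ?sqr_ge0// invr_ge0 ltW.
rewrite /hbound -ler_pdivrMl ?invr_gt0// invrK; apply: le_trans amgm _.
rewrite lerD2r -!mulrA [X in _ <= X ^+ n / _](_ : _ = 2 * (expR 1 * C ^+ 2 * X ^+ 2)); last by ring.
by rewrite (exprMn _ 2) -[leRHS]mulrA ler_pM2l.
Qed.

End Series.

(** * The limit functional *)

Section Functional.
Variable R : realType.
Notation mu := (@lebesgue_measure R).
Implicit Types (G : seq R -> R) (k : R -> R -> R) (B S : set R).

Definition loc (M : R) G := forall x s, M < `|x| -> G (x :: s) = G s.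

Definition win S (M : R) : set R := S `&` `[- M, M]%classic.

Lemma bset_itv (a b : R) : bset `[a, b]%classic.
Proof.
split; first exact: measurable_itv.
by rewrite lebesgue_measure_itv/=; case: ifP => // _; rewrite -EFinB ltry.
Qed.

Lemma bsetI B S : bset B -> measurable S -> bset (S `&` B).
Proof.
move=> [mB fB] mS; split; first exact: measurableI.
apply: le_lt_trans fB; apply: (@le_measure _ _ _ mu); last exact: subIsetr.
  by apply: mem_set; exact: measurableI.
exact: mem_set.
Qed.

(** A point outside the window does not change [G], so the sublists with and without it cancel in
    the alternating sum. This is what makes each term an integral over a bounded set. *)
Lemma Mob_loc M G s x : symf G -> loc M G -> x \in s -> M < `|x| -> Mob G s = 0.
Proof.
elim: s G => [//|y s IH] G sG lG; rewrite in_cons => /predU1P[->|xs] Mx /=.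
  by rewrite (@eq_Mob _ (fun T => G (y :: T)) G) ?subrr// => T; exact: lG.
rewrite !(IH _ _ _ xs)// ?subrr//; first exact: symf_cons.
move=> z t Mz; rewrite -[RHS](lG z)//; apply: sG.
by rewrite (perm_catCA [:: y] [:: z] t).
Qed.

Lemma rint_restrict n B D (f : seq R -> R) :
  (forall s x, x \in s -> ~ D x -> f s = 0) ->
  rint (nseq n B) f = rint (nseq n (B `&` D)) f.
Proof.
elim: n f => [//|n IH] f f0 /=.
rewrite Rintegral_mkcondr; apply: eq_Rintegral => x _; rewrite /patch.
case: ifPn => [xD|/negP xD].
  by apply: IH => s y ys yD; apply: (f0 _ y) => //; rewrite in_cons ys orbT.
transitivity (rint (nseq n B) (fun=> 0)).
  apply: eq_rint => s _; apply: (f0 _ x); first by rewrite mem_head.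
  by move=> Dx; apply: xD; exact: mem_set.
elim: n {IH} => [//|n IH] /=.
under eq_Rintegral do rewrite IH.
by rewrite /Rintegral integral0.
Qed.

(** If [G s] is the product of the 1 + g(x), then [Mob G] is the product of the g(x) and the series
    is a Fredholm determinant; in general it pairs [Mob G] with the correlation functions. *)
Definition Eterm S k M G (n : nat) : R :=
  (n`!%:R)^-1 * rint (nseq n (win S M)) (fun s => Mob G s * Dks k s).

Definition Eser S k M G : R := limn (series (Eterm S k M G)).

Lemma vol_nseq n B : vol (nseq n B) = fine (mu B) ^+ n.
Proof.
by rewrite /vol big_nseq; elim: n => [|n IH]//=; rewrite IH exprS.
Qed.

Lemma term_bound B k C A c G n : bset B -> bker k C -> expm A c G ->
  `|(n`!%:R)^-1 * rint (nseq n B) (fun s => Mob G s * Dks k s)| <=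
  A * hbound ((1 + c) * fine (mu B)) C n.
Proof.
move=> bB bk eG; have [A0 c0 mG bG] := eG.
have [_ _ mM bM] := Mob_expm eG.
have f0 : 0 < (n`!%:R : R) by rewrite ltr0n fact_gt0.
pose d := Num.sqrt ((n%:R * C ^+ 2) ^+ n).
have nC0 : 0 <= (n%:R * C ^+ 2) ^+ n by rewrite exprn_ge0// mulr_ge0// sqr_ge0.
have d2 : d ^+ 2 = (n%:R * C ^+ 2) ^+ n by rewrite sqr_sqrtr.
have bD s : size s = n -> `|Dks k s| <= d.
  move=> ss; rewrite -sqrtr_sqr ler_wsqrtr//.
  by have := Dks_bound s bk; rewrite ss.
have := @rint_bound R (nseq n B) (fun s => Mob G s * Dks k s) (A * (1 + c) ^+ n * d).
rewrite size_nseq vol_nseq => h.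
rewrite normrM ger0_norm ?invr_ge0 ?(ltW f0)//.
have /h {h} : bsets (nseq n B) by exact: bsets_nseq.
move=> h; apply: (@le_trans _ _ ((n`!%:R)^-1 * (A * (1 + c) ^+ n * d * fine (mu B) ^+ n))).
  apply: ler_wpM2l; first by rewrite invr_ge0 ltW.
  apply: h => [|s ss].
    exact: (bnmM (expm_bnm n (Mob_expm eG)) (bnm_Dks n bk)).1.
  by rewrite normrM ler_pM//; [rewrite -ss; exact: bM|exact: bD].
have -> : (n`!%:R)^-1 * (A * (1 + c) ^+ n * d * fine (mu B) ^+ n) =
   A * (((1 + c) * fine (mu B)) ^+ n * d / n`!%:R) by rewrite exprMn; ring.
apply: ler_wpM2l => //; apply: hboundP.
- by rewrite mulr_ge0 ?addr_ge0// fine_ge0.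
- exact: sqrtr_ge0.
- by rewrite d2.
Qed.

Lemma cvg_Abound A X (C : R) : cvgn (series (fun n => A * hbound X C n)).
Proof.
have h := @series_cvgZ _ _ A _ (@cvg_hbound R X C).
by apply/cvg_ex; eexists; exact: h.
Qed.

Definition nice (M : R) G := [/\ symf G, loc M G & exists A c, expm A c G].

Variables (S : set R) (k : R -> R -> R) (C : R).
Hypotheses (mS : measurable S) (bk : bker k C).

Lemma bset_win M : bset (win S M).
Proof. by apply: bsetI => //; exact: bset_itv. Qed.

Lemma cvg_Eser M G : nice M G -> cvgn (series (Eterm S k M G)).
Proof.
move=> [_ _ [A [c eG]]].
apply: (@cvg_series_dom _ _ (fun n => A * hbound ((1 + c) * fine (mu (win S M))) C n)).
  by move=> n; exact: (term_bound n (bset_win M) bk eG).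
exact: cvg_Abound.
Qed.

(** The finite sum is read as a full series with zero terms beyond [N]. Tannery's theorem applies
    with the Hadamard majorant, which depends on the kernels only through [C], and each term
    converges by dominated convergence on the window. *)
Lemma Eser_limit (kN : nat -> R -> R -> R) (BN : nat -> set R) M G :
  nice M G -> (forall N, bker (kN N) C) ->
  (forall x y, kN N x y @[N --> \oo] --> k x y) ->
  (\forall N \near \oo, bset (BN N) /\ BN N `&` `[- M, M]%classic = win S M) ->
  \sum_(n < N.+1) (n`!%:R)^-1 * rint (nseq n (BN N)) (fun s => Mob G s * Dks (kN N) s)
   @[N --> \oo] --> Eser S k M G.
Proof.
move=> [sG lG [A [c eG]]] bkN ck BNE.
pose u N n := if (n < N.+1)%N then Eterm S (kN N) M G n else 0.
have [_ _ mM bM] := Mob_expm eG.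
have c1 : limn (series (u N)) @[N --> \oo] --> Eser S k M G.
  apply: (@tannery _ u _ (fun n => A * hbound ((1 + c) * fine (mu (win S M))) C n)); [|exact: cvg_Abound|].
    move=> N n; rewrite /u; case: ifP => _.
      exact: term_bound (bset_win M) (bkN N) eG.
    rewrite normr0 mulr_ge0//; first by case: eG.
    rewrite /hbound mulr_ge0// addr_ge0// ?divr_ge0// exprn_ge0// mulr_ge0 ?sqr_ge0//.
    by rewrite mulr_ge0 ?sqr_ge0// mulr_ge0 ?expR_ge0.
  move=> n; apply: (@cvg_trans _ (Eterm S (kN N) M G n @[N --> \oo])).
    apply: near_eq_cvg; near=> N; rewrite /u ifT// ltnS.
    by near: N; exact: nbhs_infty_ge.
  apply: cvgMr; apply: (@cvg_rint _ _ _ _ (A * (1 + c) ^+ n *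
      Num.sqrt ((n%:R * C ^+ 2) ^+ n))).
  - exact: bsets_nseq (bset_win M).
  - move=> N; rewrite size_nseq.
    exact: (bnmM (expm_bnm n (Mob_expm eG)) (bnm_Dks n (bkN N))).1.
  - by rewrite size_nseq; exact: (bnmM (expm_bnm n (Mob_expm eG)) (bnm_Dks n bk)).1.
  - move=> N s; rewrite size_nseq => ss; rewrite normrM ler_pM//.
      by rewrite -ss; exact: bM.
    by rewrite -sqrtr_sqr ler_wsqrtr//; have := Dks_bound s (bkN N); rewrite ss.
  - move=> s _; apply: cvgMr.
    rewrite /Dks /determinant; apply: cvg_bigsum => p; apply: cvgMr.
    apply: cvg_bigprod => i.
    by under eq_fun do rewrite mxE; rewrite mxE; exact: ck.
apply: cvg_trans c1; apply: near_eq_cvg; near=> N.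
have [bB BE] : bset (BN N) /\ BN N `&` `[- M, M]%classic = win S M by near: N.
rewrite (@lim_series_finite _ (u N) N.+1); last by move=> n nN; rewrite /u ltnNge nN.
rewrite /series/= big_mkord; apply: eq_bigr => n _; rewrite /u ltn_ord /Eterm.
congr (_ * _); rewrite -BE; apply/esym; apply: rint_restrict => s x xs Dx.
rewrite (Mob_loc sG lG xs) ?mul0r// ltNge; apply/negP => h; apply: Dx.
by rewrite /= in_itv/= -ler_norml.
Unshelve. all: by end_near. Qed.

Lemma Eterm_mono M M' G n : M <= M' -> symf G -> loc M G ->
  Eterm S k M' G n = Eterm S k M G n.
Proof.
move=> MM' sG lG; rewrite /Eterm; congr (_ * _).
rewrite (@rint_restrict n (win S M') `[- M, M]%classic).
  congr (rint (nseq n _) _); rewrite /win -setIA; congr (_ `&` _).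
  apply/seteqP; split=> x /=; rewrite !in_itv/=; first by case.
  by move=> /andP[h1 h2]; rewrite h1 h2; split=> //; apply/andP; split; lra.
move=> s x xs Dx; rewrite (Mob_loc sG lG xs) ?mul0r// ltNge; apply/negP => h.
by apply: Dx; rewrite /= in_itv/= -ler_norml.
Qed.

(* Eventually constant in [M] when [G] is nice. *)
Definition EE G : R := limn (fun M : nat => Eser S k M%:R G).

Lemma EE_Eser M G : nice M G -> EE G = Eser S k M G.
Proof.
move=> [sG lG _]; apply: norm_lim_near_cst; near=> m.
have Mm : M <= m%:R by near: m; exact: nbhs_infty_ger.
by rewrite /Eser; congr (limn (series _)); apply/funext => n; exact: Eterm_mono.
Unshelve. all: by end_near. Qed.

Lemma niceS M M' G : M <= M' -> nice M G -> nice M' G.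
Proof.
move=> MM' [sG lG eG]; split=> // x s Mx; apply: lG; exact: le_lt_trans Mx.
Qed.

Lemma expmD A1 c1 G1 A2 c2 G2 : expm A1 c1 G1 -> expm A2 c2 G2 ->
  expm (A1 + A2) (c1 + c2) (fun s => G1 s + G2 s : R).
Proof.
move=> [a1 b1 m1 h1] [a2 b2 m2 h2]; split; [exact: addr_ge0|exact: addr_ge0| |].
  by move=> m d T g mg; apply: measurable_funD; [exact: m1|exact: m2].
move=> u; apply: le_trans (ler_normD _ _) _; rewrite mulrDl; apply: lerD.
  apply: le_trans (h1 u) _; apply: ler_wpM2l => //.
  by apply: lerXn2r; rewrite ?nnegrE ?addr_ge0// lerDl.
apply: le_trans (h2 u) _; apply: ler_wpM2l => //.
by apply: lerXn2r; rewrite ?nnegrE ?addr_ge0// lerDr.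
Qed.

Lemma niceD M G1 G2 : nice M G1 -> nice M G2 -> nice M (fun s => G1 s + G2 s).
Proof.
move=> [s1 l1 [A1 [c1 e1]]] [s2 l2 [A2 [c2 e2]]]; split.
- by move=> s s' ss'; rewrite (s1 _ _ ss') (s2 _ _ ss').
- by move=> x s Mx; rewrite l1// l2.
- by exists (A1 + A2), (c1 + c2); exact: expmD.
Qed.

Lemma niceZ M a G : nice M G -> nice M (fun s => a * G s).
Proof.
move=> [s1 l1 [A1 [c1 [a1 b1 m1 h1]]]]; split.
- by move=> s s' ss'; rewrite (s1 _ _ ss').
- by move=> x s Mx; rewrite l1.
- exists (`|a| * A1), c1; split=> //; first exact: mulr_ge0.
    by move=> m d T g mg; apply: measurable_funM; [exact: measurable_cst|exact: m1].
  by move=> u; rewrite normrM -mulrA ler_wpM2l.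
Qed.

Lemma EED M G1 G2 : nice M G1 -> nice M G2 ->
  EE (fun s => G1 s + G2 s) = EE G1 + EE G2.
Proof.
move=> n1 n2; rewrite (EE_Eser (niceD n1 n2)) (EE_Eser n1) (EE_Eser n2) /Eser.
apply/cvg_lim => //; rewrite [X in X @ _ --> _](_ : _ =
  series (fun n => Eterm S k M G1 n + Eterm S k M G2 n)).
  exact: series_cvgD (cvg_Eser n1) (cvg_Eser n2).
congr series; apply/funext => n; rewrite /Eterm -mulrDr -rintD.
- by congr (_ * _); apply: eq_rint => s _; rewrite MobD mulrDl.
- exact: bsets_nseq (bset_win M).
- case: n1 => _ _ [A [c eG]]; rewrite size_nseq.
  exact: (bnmM (expm_bnm n (Mob_expm eG)) (bnm_Dks n bk)).
- case: n2 => _ _ [A [c eG]]; rewrite size_nseq.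
  exact: (bnmM (expm_bnm n (Mob_expm eG)) (bnm_Dks n bk)).
Qed.

Lemma EEZ M a G : nice M G -> EE (fun s => a * G s) = a * EE G.
Proof.
move=> n1; rewrite (EE_Eser (niceZ a n1)) (EE_Eser n1) /Eser.
apply/cvg_lim => //; rewrite [X in X @ _ --> _](_ : _ =
  series (fun n => a * Eterm S k M G n)); first exact: series_cvgZ (cvg_Eser n1).
congr series; apply/funext => n; rewrite /Eterm mulrCA -[a * rint _ _]rintZ.
- by congr (_ * _); apply: eq_rint => s _; rewrite MobZ mulrA.
- exact: bsets_nseq (bset_win M).
- case: n1 => _ _ [A [c eG]]; rewrite size_nseq.
  exact: (bnmM (expm_bnm n (Mob_expm eG)) (bnm_Dks n bk)).
Qed.

(** When the Moebius transform lives on lists of n points, a single term of the series survives: the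
    integral of [H] against the n-point correlation function. All moment computations go through
    this case. *)
Lemma EE_degree n M G H : nice M G -> G =1 SS H ->
  (forall s, size s != n -> H s = 0) ->
  EE G = (n`!%:R)^-1 * rint (nseq n (win S M)) (fun s => H s * Dks k s).
Proof.
move=> nG GE H0; rewrite (EE_Eser nG) /Eser.
have tE m : Eterm S k M G m = if m == n then
    (n`!%:R)^-1 * rint (nseq n (win S M)) (fun s => H s * Dks k s) else 0.
  have ME s : Mob G s = H s by rewrite (eq_Mob _ GE) Mob_SS.
  rewrite /Eterm; case: eqVneq => [->|mn].
    by congr (_ * _); apply: eq_rint => s _; rewrite ME.
  rewrite -[RHS](mul0r (rint (nseq m (win S M)) (fun=> 1))) -rintZ; first 1 last.
  - exact: bsets_nseq (bset_win M).
  - exact: bnm_cst.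
  rewrite -rintZ; first 1 last.
  - exact: bsets_nseq (bset_win M).
  - case: nG => _ _ [A [c eG]]; rewrite size_nseq.
    exact: (bnmM (expm_bnm m (Mob_expm eG)) (bnm_Dks m bk)).
  apply: eq_rint => s /inB_size; rewrite size_nseq => ss.
  by rewrite ME H0 ?ss// !mul0r mulr0.
rewrite (@lim_series_finite _ _ n.+1).
  rewrite /series/= big_nat_recr//= big_nat big1 ?add0r; last first.
    by move=> i /andP[_ iN]; rewrite tE ltn_eqF.
  by rewrite tE eqxx.
by move=> m nm; rewrite tE gtn_eqF.
Qed.

End Functional.

(** * Construction of the point process *)

Section UnitInterval.
Variable R : realType.
Notation mu := (@lebesgue_measure R).

Definition unitP : set (measurableTypeR R) -> \bar R :=
  mrestr mu (measurable_itv `[0 : R, 1[).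

HB.instance Definition _ := Measure.on unitP.

Lemma unitP_setT : unitP setT = 1%E.
Proof.
rewrite /unitP /mrestr setTI lebesgue_measure_itv/= lte_fin ltr01.
by rewrite oppr0 adde0.
Qed.

HB.instance Definition _ := Measure_isProbability.Build _ _ _ unitP unitP_setT.

Definition Punit : probability (measurableTypeR R) R := unitP.

Lemma Punit_itv (a b : R) : 0 <= a -> a <= b -> b <= 1 ->
  Punit `[a, b[%classic = (b - a)%:E.
Proof.
move=> a0 ab b1; rewrite /Punit/= /unitP /mrestr.
have -> : `[a, b[%classic `&` `[0, 1[%classic = `[a, b[%classic.
  apply/seteqP; split=> x /=; first by case.
  rewrite !in_itv/= => /andP[ax xb]; rewrite ax xb; split=> //; apply/andP; split; lra.
rewrite lebesgue_measure_itv/= lte_fin; case: ltP => // ba.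
have -> : a = b by lra.
by rewrite subrr.
Qed.

End UnitInterval.

(** * Random integer sequences with prescribed finite-dimensional laws *)

Section RandomSequence.
Variables (R : realType) (p : seq nat -> R).
Hypotheses (p0 : forall z, 0 <= p z) (p1 : p [::] = 1).
Hypothesis psum : forall z, series (fun k => p (rcons z k)) n @[n --> \oo] --> p z.

(* [lft z] is the left end of the cell of the word [z]: cells of words of equal
   length partition [[0, 1[] in lexicographic order, with lengths given by [p]. *)
Definition lft (z : seq nat) : R :=
  \sum_(i < size z) \sum_(0 <= k < nth 0%N z i) p (rcons (take i z) k).

Lemma lft_rcons z k : lft (rcons z k) = lft z + \sum_(0 <= j < k) p (rcons z j).
Proof.
rewrite /lft size_rcons big_ord_recr/=; congr (_ + _).
  apply: eq_bigr => i _; rewrite nth_rcons ltn_ord.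
  by rewrite (_ : take i (rcons z k) = take i z)// -cats1 takel_cat// ltnW.
by rewrite nth_rcons ltnn eqxx (_ : take _ _ = z)// -cats1 take_size_cat.
Qed.

Definition cell (z : seq nat) : set R := `[lft z, lft z + p z[%classic.

Lemma series_le_p z n : series (fun k => p (rcons z k)) n <= p z.
Proof.
rewrite -(cvg_lim _ (@psum z))//; apply: nondecreasing_cvgn_le.
  by apply/nondecreasing_series => k _ _; exact: p0.
by apply/cvg_ex; eexists; exact: (@psum z).
Qed.

Lemma cell_rcons z k : cell (rcons z k) `<=` cell z.
Proof.
move=> w; rewrite /cell/= !in_itv/= lft_rcons => /andP[h1 h2].
have s0 : 0 <= \sum_(0 <= j < k) p (rcons z j) by apply: sumr_ge0.
have := series_le_p z k.+1; rewrite /series/= big_nat_recr//= => h3.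
apply/andP; split; lra.
Qed.

(** The lengths of the children add up to the length of the cell, so their partial sums eventually
    pass [w]; the first one to do so closes the child containing [w]. *)
Lemma cell_split z w : cell z w -> exists k, cell (rcons z k) w.
Proof.
rewrite /cell/= in_itv/= => /andP[h1 h2].
have ex : exists K, w < lft z + series (fun k => p (rcons z k)) K.
  have h : w - lft z < p z by lra.
  have [K _ hK] := cvgr_gt (p z) (@psum z) _ h.
  by exists K; have := hK K (leqnn K) => /=; lra.
case: (ex_minnP ex) => -[|K].
  by rewrite /series/= big_geq// addr0 ltNge h1.
move=> hK min; exists K; rewrite /= in_itv/= lft_rcons.
move: hK; rewrite /series/= big_nat_recr//= addrA => ->; rewrite andbT leNgt.
by apply/negP => /min; rewrite ltnn.
Qed.

Lemma cell_inj w z z' : size z = size z' -> cell z w -> cell z' w -> z = z'.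
Proof.
elim/last_ind: z z' => [|z k IH] z'; first by case: z'.
case/lastP: z' => [|z' k']; first by rewrite size_rcons.
rewrite !size_rcons => -[sz] c1 c2.
have zz' : z = z' by apply: IH => //; [exact: cell_rcons c1|exact: cell_rcons c2].
subst z'; congr rcons.
have aux (i j : nat) : (i < j)%N -> cell (rcons z i) w -> ~ cell (rcons z j) w.
  move=> ij; rewrite /cell/= !in_itv/= !lft_rcons => /andP[_ h1] /andP[h2 _].
  have : \sum_(0 <= l < i.+1) p (rcons z l) <= \sum_(0 <= l < j) p (rcons z l).
    by rewrite (big_cat_nat (leq0n i.+1) ij)//= lerDl; apply: sumr_ge0.
  rewrite big_nat_recr//= => h3; clear -h1 h2 h3; lra.
case: (ltngtP k k') => // h; first by have := aux _ _ h c1 c2.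
by have := aux _ _ h c2 c1.
Qed.

Lemma cell_nil w : cell [::] w <-> 0 <= w < 1.
Proof. by rewrite /cell/= in_itv/= /lft big_ord0 p1 add0r. Qed.

Lemma cell_bounds z : 0 <= lft z /\ lft z + p z <= 1.
Proof.
split; first by apply: sumr_ge0 => i _; apply: sumr_ge0.
elim/last_ind: z => [|z k IH]; first by rewrite /lft big_ord0 p1 add0r.
have := series_le_p z k.+1; rewrite /series/= big_nat_recr//= lft_rcons => h; lra.
Qed.

Fixpoint zz (w : R) (n : nat) : seq nat :=
  if n is n'.+1 then rcons (zz w n') (xget 0%N [set k | cell (rcons (zz w n') k) w])
  else [::].

Lemma size_zz w n : size (zz w n) = n.
Proof. by elim: n => [//|n IH] /=; rewrite size_rcons IH. Qed.

Lemma cell_zz w n : 0 <= w < 1 -> cell (zz w n) w.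
Proof.
move=> w01; elim: n => [|n IH]; first exact/cell_nil.
have [k hk] := cell_split IH; rewrite /=.
by case: xgetP => [j -> //|/(_ k)].
Qed.

(** Outside [[0, 1[], a null set for [Punit], the sequence is set to 0 so as to be defined on the
    whole line. *)
Definition Zs (w : R) (i : nat) : nat :=
  if 0 <= w < 1 then nth 0%N (zz w i.+1) i else 0%N.

Lemma mkseqSr (A : Type) (f : nat -> A) n : mkseq f n.+1 = rcons (mkseq f n) (f n).
Proof. by rewrite /mkseq -addn1 iotaD map_cat cats1. Qed.

Lemma mkseq_Zs w n : 0 <= w < 1 -> mkseq (Zs w) n = zz w n.
Proof.
move=> w01; elim: n => [//|n IH].
rewrite mkseqSr IH /=; congr rcons.
by rewrite /Zs w01 /= nth_rcons size_zz ltnn eqxx.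
Qed.

Lemma mkseq_Zs_cell w z : 0 <= w < 1 -> mkseq (Zs w) (size z) = z <-> cell z w.
Proof.
move=> w01; rewrite mkseq_Zs//; split=> [<-|cz]; first exact: cell_zz.
by apply: (@cell_inj w) => //; [rewrite size_zz|exact: cell_zz].
Qed.

Lemma Zs_event z : [set w | 0 <= w < 1 /\ mkseq (Zs w) (size z) = z] = cell z.
Proof.
apply/seteqP; split=> w /=; first by case=> w01 /(mkseq_Zs_cell _ w01).
move=> cw; have w01 : 0 <= w < 1.
  have [h1 h2] := cell_bounds z; move: cw; rewrite /cell/= in_itv/= => /andP[h3 h4].
  apply/andP; split; lra.
by split=> //; exact/mkseq_Zs_cell.
Qed.

(** A half-open cell of length 0 is empty. Hence a prefix of probability 0 never occurs, which later
    turns almost sure relations between finitely many counts into relations valid at every point of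
    [[0, 1[]. *)
Lemma Zs_pos w n : 0 <= w < 1 -> 0 < p (mkseq (Zs w) n).
Proof.
move=> w01; have := cell_zz n w01; rewrite mkseq_Zs// /cell/= in_itv/= => /andP[].
lra.
Qed.

Lemma Zs_measurable n z : measurable ([set w | mkseq (Zs w) n = z] : set R).
Proof.
have [zn|zn] := eqVneq (size z) n; last first.
  rewrite (_ : [set _ | _] = set0); first exact: measurable0.
  by apply/seteqP; split=> w //= e; move/eqP: zn; apply; rewrite -e size_mkseq.
rewrite -zn (_ : [set _ | _] = cell z `|`
   (~` `[0, 1[%classic `&` [set w | mkseq (fun=> 0%N) (size z) = z])).
  apply: measurableU; first exact: measurable_itv.
  apply: measurableI; first by apply: measurableC; exact: measurable_itv.
  have [->|e] := pselect (mkseq (fun=> 0%N) (size z) = z).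
    rewrite (_ : [set _ | _] = setT); first exact: measurableT.
    by apply/seteqP; split.
  rewrite (_ : [set _ | _] = set0); first exact: measurable0.
  by apply/seteqP; split.
rewrite -Zs_event; apply/seteqP; split=> w /=; rewrite in_itv/=.
  have [w01|w01] := boolP (0 <= w < 1); first by left.
  move=> e; right; split; first exact/negP.
  rewrite -[RHS]e; apply: eq_map => i; by rewrite /Zs (negbTE w01).
case=> [[]//|[/negP w01 e]]; rewrite -[RHS]e; apply: eq_map => i.
by rewrite /Zs (negbTE w01).
Qed.

Lemma Zs_prob z : Punit R [set w | mkseq (Zs w) (size z) = z] = (p z)%:E.
Proof.
have [h1 h2] := cell_bounds z.
have -> : Punit R [set w | mkseq (Zs w) (size z) = z] = Punit R (cell z).
  rewrite /Punit/= /unitP /mrestr; congr (lebesgue_measure _).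
  rewrite -Zs_event; apply/seteqP; split=> w /=; rewrite in_itv/=; tauto.
rewrite Punit_itv//; last by rewrite lerDl.
by rewrite addrAC subrr add0r.
Qed.

End RandomSequence.

Lemma measurable_countable_set d (T : measurableType d) (I : countType)
    (X : T -> I) (Q : I -> Prop) : (forall i, measurable [set w | X w = i]) ->
  measurable [set w | Q (X w)].
Proof.
move=> mX.
rewrite (_ : [set _ | _] = \bigcup_n (if @choice.unpickle I n is Some i then
   [set w | X w = i /\ Q i] else set0)).
  apply: bigcup_measurable => n _; case: choice.unpickle => [i|]; last exact: measurable0.
  have [Yi|nYi] := pselect (Q i).
    rewrite (_ : [set _ | _] = [set w | X w = i])//; apply/seteqP; split=> w /=; tauto.
  rewrite (_ : [set _ | _] = set0); first exact: measurable0.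
  by apply/seteqP; split=> w //= [].
apply/seteqP; split=> w /=.
  by move=> Yw; exists (choice.pickle (X w)) => //=; rewrite choice.pickleK.
by move=> [n _]; case: choice.unpickle => [i|//] [-> ].
Qed.

Lemma measurable_countable d (T : measurableType d) (R : realType) (I : countType)
    (X : T -> I) (f : I -> R) : (forall i, measurable [set w | X w = i]) ->
  measurable_fun setT (fun w => f (X w)).
Proof.
move=> mX _ Y mY; rewrite setTI.
exact: (measurable_countable_set (fun i => Y (f i)) mX).
Qed.

(** * Counting statistics and their factorial moments *)

Section Counts.
Variable R : realType.
Notation mu := (@lebesgue_measure R).
Implicit Types (B : set R) (s : seq R).

Definition cnt B s := count (fun x => `[< B x >]) s.
Arguments cnt : simpl never.

Lemma cnt_perm B s s' : perm_eq s s' -> cnt B s = cnt B s'.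
Proof. by move=> /seq.permP; apply. Qed.

Lemma cnt_cons B x s : cnt B (x :: s) = (`[< B x >] + cnt B s)%N.
Proof. by []. Qed.

Lemma cnt_meas B n d (T : measurableType d) (g : nat -> T -> R) k : measurable B ->
  (forall i, measurable_fun setT (g i)) ->
  measurable [set w | cnt B (mkseq (g^~ w) n) = k].
Proof.
move=> mB; elim: n g k => [|n IH] g k mg.
  rewrite /mkseq/=; have [->|k0] := eqVneq k 0%N.
    by rewrite (_ : [set _ | _] = setT) //; apply/seteqP; split.
  rewrite (_ : [set _ | _] = set0) //; apply/seteqP; split=> w //= e.
  by move: k0; rewrite -e.
have mg' : forall i, measurable_fun setT (g i.+1) by move=> i; exact: mg.
have -> : [set w | cnt B (mkseq (g^~ w) n.+1) = k] = [set w |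
    (`[< B (g 0%N w) >] + cnt B (mkseq (fun i => g i.+1 w) n))%N = k].
  by apply/seteqP; split=> w; rewrite /mkset mkseqS cnt_cons.
rewrite (_ : [set _ | _] =
  ((g 0%N @^-1` B) `&` [set w | (cnt B (mkseq (fun i => g i.+1 w) n)).+1 = k]) `|`
  ((g 0%N @^-1` (~` B)) `&` [set w | cnt B (mkseq (fun i => g i.+1 w) n) = k])).
  apply: measurableU; apply: measurableI.
  - by rewrite -[X in measurable X]setTI; exact: mg.
  - case: k => [|k].
      by rewrite (_ : [set _ | _] = set0)//; apply/seteqP; split.
    rewrite (_ : [set _ | _] = [set w | cnt B (mkseq (fun i => g i.+1 w) n) = k]).
      exact: (IH (fun i => g i.+1)).
    by apply/seteqP; split=> w /=; [case|move=> ->].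
  - by rewrite -[X in measurable X]setTI; apply: mg => //; exact: measurableC.
  - exact: (IH (fun i => g i.+1)).
apply/seteqP; split=> w /=.
  have [Bg|Bg] := pselect (B (g 0%N w)).
    by rewrite asboolT//= add1n; left.
  by rewrite asboolF//= add0n; right.
by case=> [[Bg <-]|[Bg <-]]; [rewrite asboolT|rewrite asboolF].
Qed.

Definition cnts (Bs : seq (set R)) s := [seq cnt B s | B <- Bs].

Lemma nice_cnts (M : R) (Bs : seq (set R)) (Phi : seq nat -> R) A c :
  (forall B, List.In B Bs -> measurable B /\ B `<=` `[- M, M]%classic) ->
  0 <= A -> 0 <= c ->
  (forall s, `|Phi (cnts Bs s)| <= A * c ^+ size s) ->
  nice M (fun s => Phi (cnts Bs s)).
Proof.
move=> hB A0 c0 bPhi; split.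
- move=> s s' ss'; congr Phi; rewrite /cnts; elim: Bs {hB bPhi} => [//|B Bs IH] /=.
  by rewrite IH (cnt_perm B ss').
- move=> x s Mx; congr Phi; rewrite /cnts.
  elim: Bs hB {bPhi} => [//|B Bs IH] hB /=; rewrite IH; last first.
    by move=> B' B'in; apply: hB; right.
  rewrite cnt_cons asboolF// => Bx; have [_ sub] := hB B (or_introl erefl).
  have := sub _ Bx; rewrite /= in_itv/= -ler_norml => h.
  by move: Mx; rewrite ltNge h.
- exists A, c; split=> // m d T g mg.
  apply: measurable_countable => z.
  elim: Bs hB z {bPhi} => [|B Bs IH] hB z.
    have [->|z0] := eqVneq z [::].
      by rewrite (_ : [set _ | _] = setT) //; apply/seteqP; split.
    rewrite (_ : [set _ | _] = set0) //; apply/seteqP; split=> w //= e.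
    by move: z0; rewrite -e.
  case: z => [|k z].
    by rewrite (_ : [set _ | _] = set0)//; apply/seteqP; split.
  rewrite (_ : [set _ | _] = [set w | cnt B (mkseq (g^~ w) m) = k] `&`
     [set w | cnts Bs (mkseq (g^~ w) m) = z]).
    apply: measurableI; last by apply: IH => B' B'in; apply: hB; right.
    by apply: cnt_meas => //; exact: (hB B (or_introl erefl)).1.
  by apply/seteqP; split=> w /=; [case|case=> -> ->].
Qed.

Lemma cnt_size B s : (cnt B s <= size s)%N.
Proof. exact: count_size. Qed.

Lemma natr_le_exp n : (n%:R : R) <= 2 ^+ n.
Proof. by rewrite -natrX ler_nat ltnW// ltn_expl. Qed.

Lemma nice_cnt (M : R) B : measurable B -> B `<=` `[- M, M]%classic ->
  nice M (fun s => (cnt B s)%:R).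
Proof.
move=> mB sB; apply: (@nice_cnts M [:: B] (fun z => (nth 0%N z 0)%:R) 1 2) => //.
  by move=> B' /= [<-|//].
move=> s /=; rewrite mul1r ger0_norm//; apply: le_trans (natr_le_exp _).
by rewrite ler_nat cnt_size.
Qed.

Lemma nice_cnt2 (M : R) B : measurable B -> B `<=` `[- M, M]%classic ->
  nice M (fun s => ('C(cnt B s, 2))%:R).
Proof.
move=> mB sB.
apply: (@nice_cnts M [:: B] (fun z => ('C(nth 0%N z 0, 2))%:R) 1 2) => //.
  by move=> B' /= [<-|//].
move=> s /=; rewrite mul1r ger0_norm// -natrX ler_nat.
apply: (@leq_trans (2 ^ cnt B s)); last by rewrite leq_exp2l// cnt_size.
have [lt2|ge2] := ltnP (cnt B s) 2; first by rewrite bin_small.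
rewrite -[X in (X ^ _)%N]/(1 + 1)%N expnDn.
rewrite (bigD1 (Ordinal (n := (cnt B s).+1) (m := 2) ge2))//= !exp1n !muln1.
exact: leq_addr.
Qed.

(** Moebius transform of the binomial statistic, see [SS_delta]: choosing n points in [B] amounts to
    choosing a sublist of size n inside [B]. *)
Fixpoint delta_in B n s : R :=
  match n, s with
  | 0, [::] => 1
  | n'.+1, x :: s' => (`[< B x >])%:R * delta_in B n' s'
  | _, _ => 0
  end.

Lemma SS_zero s : SS (fun=> 0) s = 0 :> R.
Proof. by elim: s => [//|x s IH] /=; rewrite IH addr0. Qed.

Lemma SSZ a H s : SS (fun T => a * H T) s = a * SS H s :> R.
Proof.
elim: s H => [//|x s IH] H /=.
by rewrite IH (IH (fun T => H (x :: T))) mulrDr.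
Qed.

Lemma SS_delta B n s : SS (delta_in B n) s = ('C(cnt B s, n))%:R.
Proof.
elim: s n => [|x s IH] n.
  by case: n => [|n]//=; rewrite bin0n.
rewrite /= IH; case: n => [|n] /=.
  by rewrite SS_zero addr0 !bin0.
rewrite SSZ IH cnt_cons; case: `[< B x >] => /=.
  by rewrite add1n binS natrD mul1r.
by rewrite mul0r addr0 add0n.
Qed.

Lemma delta_size B n s : size s != n -> delta_in B n s = 0.
Proof.
elim: n s => [|n IH] [|x s]//= h; rewrite IH ?mulr0//.
Qed.

Lemma delta_out B n s x : x \in s -> ~ B x -> delta_in B n s = 0.
Proof.
elim: n s => [|n IH] [|y s]//=; rewrite in_cons => /predU1P[<-|xs] Bx.
  by rewrite asboolF// mul0r.
by rewrite (IH _ xs)// mulr0.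
Qed.

Lemma delta_bnm B n m : measurable B -> bnm m (delta_in B n).
Proof.
move=> mB; elim: n m => [|n IH] m.
  case: m => [|m].
    apply: (@bnm_ext _ 0 (fun=> 1)); first by case.
    exact: bnm_cst.
  apply: (@bnm_ext _ m.+1 (fun=> 0)); first by case.
  exact: bnm_cst.
case: m => [|m].
  apply: (@bnm_ext _ 0 (fun=> 0)); first by case.
  exact: bnm_cst.
apply: (@bnm_ext _ m.+1 (fun s => (`[< B (nth 0 s 0) >])%:R * delta_in B n (behead s))).
  by case.
apply: bnmM; last exact: (bnm_behead (IH m)).
split; last by exists 1 => s _; case: `[< _ >]; rewrite ?normr1 ?normr0.
move=> d T g mg; under eq_fun do rewrite mkseqS/=.
rewrite (_ : (fun w => _) = (\1_B \o g 0%N)).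
  by apply: measurableT_comp => //; exact: measurable_indic.
by apply/funext => w; rewrite /= indicE; congr (nat_of_bool _)%:R; rewrite in_setE.
Qed.

Lemma delta_le1 B n s : `|delta_in B n s| <= 1.
Proof.
elim: n s => [|n IH] [|x s]/=; rewrite ?normr0 ?normr1//.
rewrite normrM -[leRHS]mulr1 ler_pM//.
by case: `[< _ >]; rewrite ?normr1 ?normr0.
Qed.

Variables (S : set R) (k : R -> R -> R) (C : R).
Hypotheses (mS : measurable S) (bk : bker k C).
Notation E := (EE S k).

(** The n-th factorial moment is one integral over n points of [B], and Hadamard's inequality bounds
    the determinant by [d]. With n = 1 and n = 2 this gives linear and quadratic smallness in the
    length of [B]. *)
Lemma E_binom_le n M B d : measurable B -> B `<=` `[- M, M]%classic ->
  nice M (fun s => ('C(cnt B s, n))%:R) ->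
  0 <= d -> (n%:R * C ^+ 2) ^+ n <= d ^+ 2 ->
  E (fun s => ('C(cnt B s, n))%:R) <= (n`!%:R)^-1 * d * fine (mu (S `&` B)) ^+ n.
Proof.
move=> mB sB nc d0 dle.
rewrite (EE_degree mS bk (n := n) (H := delta_in B n) nc); first 1 last.
- by move=> s; rewrite SS_delta.
- by move=> s; exact: delta_size.
rewrite (@rint_restrict R n (win S M) B); last first.
  by move=> s x xs Bx; rewrite (delta_out n xs Bx) mul0r.
have wE : win S M `&` B = S `&` B.
  rewrite /win -setIA; congr (_ `&` _); apply/seteqP; split=> x /=; first by case.
  by move=> Bx; split=> //; exact: sB.
have bB : bset B.
  rewrite (_ : B = B `&` `[- M, M]%classic); last by apply/esym/setIidPl.
  by apply: bsetI => //; exact: bset_itv.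
have bSB : bset (S `&` B) by exact: bsetI.
rewrite wE -mulrA ler_wpM2l ?invr_ge0//.
have := @rint_bound R (nseq n (S `&` B)) (fun s => delta_in B n s * Dks k s) d
  (bsets_nseq bSB).
rewrite size_nseq vol_nseq => h; apply: le_trans (ler_norm _) (h _ _).
  exact: (bnmM (delta_bnm _ _ mB) (bnm_Dks n bk)).1.
move=> s ss; rewrite normrM -[leRHS]mul1r ler_pM//; first exact: delta_le1.
rewrite -[leRHS]ger0_norm// -ler_sqr ?nnegrE// !real_normK ?num_real//.
by have := Dks_bound s bk; rewrite ss => /le_trans; apply.
Qed.

Lemma E_cnt_le M B : measurable B -> B `<=` `[- M, M]%classic ->
  E (fun s => (cnt B s)%:R) <= C * fine (mu (S `&` B)).
Proof.
move=> mB sB; have h := nice_cnt mB sB.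
have := @E_binom_le 1 M B C mB sB.
rewrite (_ : (fun s => ('C(cnt B s, 1))%:R) = (fun s => (cnt B s)%:R)); last first.
  by apply/funext => s; rewrite bin1.
rewrite !expr1 mul1r -[1`!]/1%N invr1 mul1r; apply => //; exact: bker_ge0 bk.
Qed.

Lemma E_cnt2_le M B : measurable B -> B `<=` `[- M, M]%classic ->
  E (fun s => ('C(cnt B s, 2))%:R) <= C ^+ 2 * fine (mu (S `&` B)) ^+ 2.
Proof.
move=> mB sB; have h := nice_cnt2 mB sB.
have := @E_binom_le 2 M B (2 * C ^+ 2) mB sB h.
rewrite (_ : (2`!%:R)^-1 * (2 * C ^+ 2) = C ^+ 2); last first.
  by rewrite -[2`!]/2%N mulrA mulVf ?mul1r// pnatr_eq0.
by apply => //; rewrite mulr_ge0// sqr_ge0.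
Qed.

Lemma E_1 : E (fun=> 1) = 1.
Proof.
have n1 : nice (0 : R) (fun=> 1).
  apply: (@nice_cnts 0 [::] (fun=> 1) 1 1) => // s.
  by rewrite normr1 expr1n mulr1.
rewrite (EE_degree mS bk (n := 0) (H := delta_in set0 0) n1).
- by rewrite /= fact0 invr1 !mul1r /Dks det_mx00.
- by move=> s; rewrite SS_delta bin0.
- by move=> s; exact: delta_size.
Qed.

End Counts.

(** * Points recovered as jumps of a counting function *)

Section Jumps.
Variables (R : realType) (qv : nat -> R) (Zf : nat -> int).
Hypothesis dense : forall x y, x < y -> exists i, x < qv i < y.
Hypothesis mono : forall i j, qv i <= qv j -> Zf i <= Zf j.
Hypothesis simple : forall x, exists i j, [/\ qv i < x, x < qv j & Zf j - Zf i <= 1].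

Definition jumps : set R := [set x | forall i j, qv i < x -> x < qv j -> Zf i < Zf j].

(** An increasing integer function whose jumps have size at most one has as many jumps in [a, b] as
    its increment across a slightly larger rational interval. The proof lists the jumps by level:
    the v-th one is where the level [Zf i0 + v] is reached. *)
Lemma npts_jumps a b : a <= b -> exists i0 j0, [/\ qv i0 < a, b < qv j0,
  finite_set (jumps `&` `[a, b]) & forall i j, qv i0 <= qv i -> qv i < a ->
    b < qv j -> qv j <= qv j0 -> (npts jumps `[a, b])%:Z = Zf j - Zf i].
Proof.
move=> ab.
(* [D] is the least increment over rational intervals around [a, b]. At a minimiser (i0, j0) the
   function is constant from [qv i0] up to [a] and from [b] down to [qv j0]. *)
pose Q (D : nat) := `[< exists i j, [/\ qv i < a, b < qv j & Zf j - Zf i = D%:Z] >].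
have sub1 (x : R) : x - 1 < x by rewrite ltrBlDr ltrDl.
have add1 (x : R) : x < x + 1 by rewrite ltrDl.
have exQ : exists D, Q D.
  have [i /andP[_ ia]] := dense (sub1 a).
  have [j /andP[bj _]] := dense (add1 b).
  have ij : Zf i <= Zf j by apply: mono; apply: ltW; rewrite (lt_trans ia)// (le_lt_trans ab).
  exists `|Zf j - Zf i|%N; apply/asboolP; exists i, j; split=> //; lia.
case: (ex_minnP exQ) => D /asboolP[i0 [j0 [i0a bj0 DE]]] Dmin.
have minD i j : qv i < a -> b < qv j -> D%:Z <= Zf j - Zf i.
  move=> ia bj; have ij : Zf i <= Zf j.
    by apply: mono; apply: ltW; rewrite (lt_trans ia)// (le_lt_trans ab).
  have /Dmin : Q `|Zf j - Zf i|%N by apply/asboolP; exists i, j; split=> //; lia.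
  lia.
have lowa i : qv i < a -> Zf i <= Zf i0 by move=> ia; have := minD _ _ ia bj0; lia.
have highb j : b < qv j -> Zf j0 <= Zf j by move=> bj; have := minD _ _ i0a bj; lia.
(* The v-th jump is the supremum of the rationals at which the level [Zf i0 + v] has not been
   reached. *)
pose U (v : nat) : set R := [set qv l | l in [set l | Zf l < Zf i0 + v%:Z]].
pose X v := sup (U v).
have hsup v : (0 < v <= D)%N -> has_sup (U v).
  move=> /andP[v0 vD]; split; first by exists (qv i0); exists i0 => //=; lia.
  exists b => _ [l /= hl <-]; rewrite leNgt; apply/negP => /highb; lia.
have below v x : (0 < v <= D)%N -> x < X v -> exists2 l, x < qv l & Zf l < Zf i0 + v%:Z.
  move=> vD xX; have e0 : 0 < X v - x by rewrite subr_gt0.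
  have [_ [l hl <-]] := sup_adherent e0 (hsup v vD).
  by rewrite -/(X v) opprB addrC subrK => h; exists l.
have above v l : (0 < v <= D)%N -> X v < qv l -> Zf i0 + v%:Z <= Zf l.
  move=> vD Xl; rewrite leNgt; apply/negP => h.
  have : qv l <= X v by apply: (sup_upper_bound (hsup v vD)); exists l.
  by rewrite leNgt Xl.
have belowZ v l : (0 < v <= D)%N -> qv l < X v -> Zf l < Zf i0 + v%:Z.
  move=> vD /(below _ _ vD)[l' ll' hl']; apply: le_lt_trans hl'.
  by apply: mono; exact: ltW.
have Xab v : (0 < v <= D)%N -> a <= X v <= b.
  move=> vD; apply/andP; split.
    rewrite leNgt; apply/negP => Xa; have [l /andP[Xl la]] := dense Xa.
    have := above _ _ vD Xl; have := lowa _ la; move: vD => /andP[v0 _]; lia.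
  apply: ge_sup; first by case: (hsup v vD).
  move=> _ [l /= hl <-]; rewrite leNgt; apply/negP => /highb.
  move: vD => /andP[_]; lia.
have bij : set_bij `I_D (jumps `&` `[a, b]) (fun v => X v.+1).
  split.
  - move=> v /= vD; have vD' : (0 < v.+1 <= D)%N by [].
    split; last by rewrite /= in_itv/=; exact: Xab.
    move=> i j iX Xj; have := belowZ _ _ vD' iX; have := above _ _ vD' Xj; lia.
  - move=> v v' /set_mem/= vD /set_mem/= v'D e.
    have aux (u u' : nat) : (u < u')%N -> (u < D)%N -> (u' < D)%N -> X u.+1 <> X u'.+1.
      move=> uu' uD u'D eX; have [i [j [iX Xj ij]]] := simple (X u.+1).
      have uD' : (0 < u.+1 <= D)%N by [].
      have u'D' : (0 < u'.+1 <= D)%N by [].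
      have := belowZ _ _ uD' iX; rewrite eX in Xj; have := above _ _ u'D' Xj; lia.
    case: (ltngtP v v') => // h; first by have := aux _ _ h vD v'D e.
    by have := aux _ _ h v'D vD (esym e).
  - move=> x [Jx]; rewrite /= in_itv/= => /andP[ax xb].
    have [i1 [j1 [ix xj ij]]] := simple x.
    have J1 := Jx _ _ ix xj.
    have i0x : qv i0 < x by exact: lt_le_trans ax.
    have xj0 : x < qv j0 by exact: le_lt_trans bj0.
    have h1 := Jx _ _ i0x xj; have h2 := Jx _ _ ix xj0.
    (* [Zf j1 - Zf i0] is the rank of the jump [x] counted from [i0]; the predecessor appears
       because the bijection starts at [X 1]. *)
    exists (`|Zf j1 - Zf i0|.-1)%N => /=; first lia.
    have vD : (0 < `|Zf j1 - Zf i0|.-1.+1 <= D)%N by lia.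
    have vE : (`|Zf j1 - Zf i0|.-1.+1)%N%:Z = Zf j1 - Zf i0 by lia.
    apply/eqP; rewrite eq_le; apply/andP; split; rewrite leNgt; apply/negP => h.
      have [l xl hl] := below _ _ vD h; have := Jx _ _ ix xl; lia.
    have [l /andP[Xl lx]] := dense h; have := above _ _ vD Xl.
    have := Jx _ _ lx xj; lia.
have card : (jumps `&` `[a, b] #= `I_D)%card.
  by rewrite card_eq_sym; apply/card_set_bijP; eexists; exact: bij.
exists i0, j0; split=> //.
  by apply/finite_setP; exists D.
move=> i j i0i ia bj jj0; rewrite /npts (card_fset_set card).
have := minD _ _ ia bj; have := mono i0i; have := mono jj0; lia.
Qed.

End Jumps.

Lemma cvg_subl0 (R : realType) (u : nat -> R) (a : R) :
  a - u n @[n --> \oo] --> 0 -> u n @[n --> \oo] --> a.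
Proof.
move=> /cvgrPdist_le h; apply/cvgrPdist_le => e /h; apply: filterS => n.
by rewrite sub0r normrN.
Qed.

(** * Laws of the rational counts and simplicity of the points *)

Section Process.
Variables (R : realType) (S : set R) (kf : R -> R -> R) (C : R).
Notation mu := (@lebesgue_measure R).
Hypotheses (mS : measurable S) (bk : bker kf C).
Notation E := (EE S kf).
Hypothesis Hpos : forall M G, nice M G -> (forall s, 0 <= G s) -> 0 <= E G.

Lemma E_le M G1 G2 : nice M G1 -> nice M G2 -> (forall s, G1 s <= G2 s) -> E G1 <= E G2.
Proof.
move=> n1 n2 h; rewrite -subr_ge0.
have -> : E G2 - E G1 = E (fun s => G2 s + -1 * G1 s).
  by rewrite (EED mS bk n2 (niceZ _ n1)) (EEZ mS bk _ n1) mulN1r.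
apply: (Hpos (niceD n2 (niceZ _ n1))) => s.
by rewrite mulN1r subr_ge0.
Qed.

Definition qv (i : nat) : R := if @choice.unpickle rat i is Some r then ratr r else 0.

Definition idx (r : rat) : nat := choice.pickle r.

Lemma qv_idx r : qv (idx r) = ratr r.
Proof. by rewrite /qv /idx choice.pickleK. Qed.

Lemma qv_dense (x y : R) : x < y -> exists i, x < qv i < y.
Proof.
move=> /rat_in_itvoo[r]; rewrite in_itv/= => h; exists (idx r).
by rewrite qv_idx.
Qed.

Definition Iq (i : nat) : set R :=
  if 0 <= qv i then `]0, qv i]%classic else `]qv i, 0]%classic.

Definition zcounts (n : nat) (s : seq R) : seq nat := mkseq (fun i => cnt (Iq i) s) n.

(* Counts to the left of 0 are taken negatively, so that the signed count
   increases with the rational. *)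
Definition sgq (i : nat) (c : nat) : int := if 0 <= qv i then c%:Z else - c%:Z.

Lemma cnt_diff i j s : qv i <= qv j ->
  sgq j (cnt (Iq j) s) - sgq i (cnt (Iq i) s) = (cnt `]qv i, qv j]%classic s)%:Z.
Proof.
move=> ij; elim: s => [|x s IH].
  by rewrite /sgq /cnt /=; case: ifP; case: ifP.
rewrite !cnt_cons PoszD -IH.
have [v Ev] : exists v : nat -> int, forall l c, sgq l (`[< Iq l x >] + c)%N = v l + sgq l c.
  exists (fun l => sgq l `[< Iq l x >]) => l c; rewrite /sgq; case: ifP; lia.
suff h : sgq j `[< Iq j x >] - sgq i `[< Iq i x >] = `[< `]qv i, qv j]%classic x >]%:Z.
  rewrite -h; rewrite /sgq; case: ifP; case: ifP; lia.
rewrite /sgq /Iq.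
have asE (a b : R) : `[< `]a, b]%classic x >] = (a < x <= b).
  by apply/asboolP/idP; rewrite /= in_itv.
case: (leP 0 (qv i)) => i0; case: (leP 0 (qv j)) => j0; rewrite !asE.
- have h1 : x <= qv i -> x <= qv j by move=> h; exact: le_trans ij.
  have h2 : ~~ (0 < x) -> x <= qv i by rewrite -leNgt => h; exact: le_trans i0.
  move: h1 h2; rewrite (ltNge (qv i)).
  by case: (0 < x); case: (x <= qv j); case: (x <= qv i) => //= h1 h2;
    first [by have := h1 isT | by have := h2 isT].
- by exfalso; have := lt_le_trans j0 (le_trans i0 ij); rewrite ltxx.
- have h1 : 0 < x -> qv i < x by move=> h; exact: lt_trans h.
  have h2 : ~~ (0 < x) -> x <= qv j by rewrite -leNgt => h; exact: le_trans j0.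
  move: h1 h2; rewrite (leNgt x 0).
  by case: (0 < x); case: (x <= qv j); case: (qv i < x) => //= h1 h2;
    first [by have := h1 isT | by have := h2 isT].
- have h1 : qv j < x -> qv i < x by move=> h; exact: le_lt_trans h.
  have h2 : ~~ (qv j < x) -> x <= 0 by rewrite -leNgt => h; exact: le_trans (ltW j0).
  move: h1 h2; rewrite (leNgt x (qv j)).
  by case: (qv j < x); case: (x <= 0); case: (qv i < x) => //= h1 h2;
    first [by have := h1 isT | by have := h2 isT].
Qed.

(** Radius of a window containing the first [n] intervals [Iq]; a sum rather than a maximum, so that
    growth with [n] is immediate. *)
Definition Mn (n : nat) : R := \sum_(i < n) `|qv i|.

Lemma Mn_ge i n : (i < n)%N -> `|qv i| <= Mn n.
Proof.
by move=> iN; rewrite /Mn (bigD1 (Ordinal iN))//= lerDl sumr_ge0.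
Qed.

Lemma Iq_meas i : measurable (Iq i).
Proof. by rewrite /Iq; case: ifP => _; exact: measurable_itv. Qed.

Lemma Iq_sub i n : (i < n)%N -> Iq i `<=` `[- Mn n, Mn n]%classic.
Proof.
move=> /Mn_ge; rewrite ler_norml => /andP[h1 h2] x.
by rewrite /Iq; case: (leP 0 (qv i)) => q0 /=; rewrite !in_itv/= => /andP[h3 h4];
  apply/andP; split; lra.
Qed.

Lemma zc_cnts n s : zcounts n s = cnts (mkseq Iq n) s.
Proof. by rewrite /zcounts /cnts /mkseq -map_comp. Qed.

Lemma In_iota m n i : List.In i (iota m n) -> (i < m + n)%N.
Proof.
elim: n m => [//|n IH] m /= [<-|/IH]; first by rewrite addnS ltnS leq_addr.
by rewrite addSnnS.
Qed.

Lemma nice_zc n (Phi : seq nat -> R) (A : R) : (forall z, `|Phi z| <= A) ->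
  nice (Mn n) (fun s => Phi (zcounts n s)).
Proof.
move=> bPhi; rewrite (_ : (fun s => _) = (fun s => Phi (cnts (mkseq Iq n) s))); last first.
  by apply/funext => s; rewrite zc_cnts.
have A0 : 0 <= A by exact: le_trans (bPhi [::]).
apply: (@nice_cnts R _ _ Phi A 1) => //; last by move=> s; rewrite expr1n mulr1.
move=> B; rewrite /mkseq => /List.in_map_iff[i [<- /In_iota iin]].
by split; [exact: Iq_meas|exact: Iq_sub].
Qed.

Lemma nice_bool n (Q : seq nat -> bool) : nice (Mn n) (fun s => (Q (zcounts n s))%:R).
Proof.
apply: (@nice_zc n (fun z => (Q z)%:R) 1) => z.
by case: (Q z); rewrite ?normr1 ?normr0.
Qed.

Definition pz (z : seq nat) : R := E (fun s => (zcounts (size z) s == z)%:R).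

Lemma pz_ge0 z : 0 <= pz z.
Proof. exact: (Hpos (nice_bool (size z) (fun y => y == z))). Qed.

Lemma pz_nil : pz [::] = 1.
Proof. exact: (E_1 mS bk). Qed.

Lemma zcS n s : zcounts n.+1 s = rcons (zcounts n s) (cnt (Iq n) s).
Proof. by rewrite /zcounts mkseqSr. Qed.

Lemma pz_series z K : series (fun j => pz (rcons z j)) K =
  E (fun s => ((zcounts (size z) s == z) && (cnt (Iq (size z)) s < K)%N)%:R).
Proof.
set n := size z.
have nb K' : nice (Mn n.+1) (fun s => ((zcounts n s == z) && (cnt (Iq n) s < K')%N)%:R).
  rewrite (_ : (fun s => _) = fun s => ((take n (zcounts n.+1 s) == z) &&
     (nth 0%N (zcounts n.+1 s) n < K')%N)%:R).
    exact: (nice_bool n.+1 (fun y => (take n y == z) && (nth 0%N y n < K')%N)).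
  apply/funext => s; rewrite zcS -cats1 takel_cat ?size_mkseq// take_oversize ?size_mkseq//.
  by rewrite nth_cat size_mkseq ltnn subnn.
elim: K => [|K IH].
  rewrite /series/= big_geq//.
  have := EEZ mS bk 0 (nb 0%N); rewrite mul0r => <-.
  by congr E; apply/funext => s; rewrite ltn0 andbF mul0r.
rewrite seriesS IH /pz -(EED mS bk (M := Mn n.+1)) //.
- congr E; apply/funext => s; rewrite size_rcons -/n zcS eqseq_rcons.
  case: (zcounts n s == z) => /=; last by rewrite addr0.
  rewrite [in RHS]ltnS [in RHS]leq_eqVlt; case: eqP => [->|_] /=.
    by rewrite ltnn addr0.
  by rewrite add0r.
- by have := nice_bool (size (rcons z K)) (fun y => y == rcons z K); rewrite size_rcons.
Qed.

(** [E] is a positive linear functional with no countable additivity built in, so mass could escape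
    to infinite counts. Finiteness of the expected count prevents this. *)
Lemma pz_sum z : series (fun j => pz (rcons z j)) m @[m --> \oo] --> pz z.
Proof.
set n := size z.
have nc : nice (Mn n.+1) (fun s => (cnt (Iq n) s)%:R : R).
  by apply: nice_cnt; [exact: Iq_meas|exact: Iq_sub].
have nz : nice (Mn n.+1) (fun s => (zcounts n s == z)%:R : R).
  apply: niceS (nice_bool n (fun y => y == z)).
  by rewrite /Mn big_ord_recr/= lerDl.
have nb K' : nice (Mn n.+1) (fun s => ((zcounts n s == z) && (cnt (Iq n) s < K')%N)%:R).
  rewrite (_ : (fun s => _) = fun s => ((take n (zcounts n.+1 s) == z) &&
     (nth 0%N (zcounts n.+1 s) n < K')%N)%:R).
    exact: (nice_bool n.+1 (fun y => (take n y == z) && (nth 0%N y n < K')%N)).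
  apply/funext => s; rewrite zcS -cats1 takel_cat ?size_mkseq// take_oversize ?size_mkseq//.
  by rewrite nth_cat size_mkseq ltnn subnn.
pose c0 := E (fun s => (cnt (Iq n) s)%:R).
(* Markov's inequality: the mass missing from the first [K] terms is carried by counts that are at
   least [K]. *)
have key K : 0 <= K%:R * (pz z - series (fun j => pz (rcons z j)) K) <= c0.
  rewrite pz_series -/n.
  have -> : pz z - E (fun s => ((zcounts n s == z) && (cnt (Iq n) s < K)%N)%:R) =
      E (fun s => (zcounts n s == z)%:R + -1 * ((zcounts n s == z) && (cnt (Iq n) s < K)%N)%:R).
    by rewrite (EED mS bk nz (niceZ _ (nb K))) (EEZ mS bk _ (nb K)) mulN1r.
  have nd := niceD nz (niceZ (-1) (nb K)).
  apply/andP; split.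
    apply: mulr_ge0 => //; apply: (Hpos nd) => s.
    by case: (zcounts n s == z) => /=; [case: (_ < K)%N => /=|]; rewrite ?mulr0 ?addr0 ?mulr1 ?subrr.
  rewrite -(EEZ mS bk _ nd); apply: (E_le (niceZ _ nd) nc) => s.
  case: (zcounts n s == z) => /=; last by rewrite mulr0 addr0 mulr0.
  by case: ltnP => /= h; rewrite ?mulr1 ?subrr ?mulr0 ?addr0 ?mulr1// ler_nat.
have c00 : 0 <= c0 by have := key 0%N => /andP[+ +]; rewrite mul0r.
apply/cvgrPdist_le => e e0; near=> K.
have K0 : 0 < K%:R :> R by rewrite ltr0n; near: K; exact: nbhs_infty_gt.
have /andP[h1 h2] := key K.
have d0 : 0 <= pz z - series (fun j => pz (rcons z j)) K by rewrite -(pmulr_rge0 _ K0).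
rewrite ger0_norm// -(ler_pM2l K0); apply: le_trans h2 _.
rewrite mulrC -ler_pdivrMl// mulrC; apply: ltW.
by near: K; exact: nbhs_infty_gtr.
Unshelve. all: by end_near. Qed.

Notation Om := (measurableTypeR R).
Notation P := (Punit R).
Definition Z (w : R) (i : nat) : nat := Zs pz w i.
Definition Zf (w : R) (i : nat) : int := sgq i (Z w i).

Lemma Z_meas n z : measurable ([set w | mkseq (Z w) n = z] : set Om).
Proof. exact: (Zs_measurable pz_ge0 pz_nil pz_sum n z). Qed.

Lemma E_0 : E (fun=> 0) = 0.
Proof.
have n1 := nice_bool 0 (fun=> true).
rewrite -[RHS](mul0r (E (fun=> true%:R))) -(EEZ mS bk 0 n1).
by congr E; apply/funext => s; rewrite mul0r.
Qed.

(** A prefix that is not the count vector of any finite configuration has mass [E 0 = 0], and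
    prefixes of mass 0 do not occur. Monotonicity and additivity of the counts thus hold for every
    [w]. *)
Lemma Z_realized w n : 0 <= w < 1 -> exists s, zcounts n s = mkseq (Z w) n.
Proof.
move=> w01; apply: contrapT => nex.
have := Zs_pos pz_nil pz_sum n w01.
rewrite /pz size_mkseq (_ : (fun s => _) = fun=> 0) ?E_0 ?ltxx//.
apply/funext => s; case: eqP => // e; exfalso; apply: nex; by exists s.
Qed.

Lemma Zf_diff w i j : 0 <= w < 1 -> qv i <= qv j ->
  exists s, [/\ forall l, (l <= maxn i j)%N -> Z w l = cnt (Iq l) s &
     Zf w j - Zf w i = (cnt `]qv i, qv j]%classic s)%:Z].
Proof.
move=> w01 ij; have [s hs] := Z_realized (maxn i j).+1 w01; exists s.
have hl l : (l <= maxn i j)%N -> Z w l = cnt (Iq l) s.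
  by move=> lm; have /(congr1 (fun y => nth 0%N y l)) := hs; rewrite !nth_mkseq.
by split=> //; rewrite /Zf !hl ?leq_maxl ?leq_maxr// cnt_diff.
Qed.

Lemma Zf_mono w i j : 0 <= w < 1 -> qv i <= qv j -> Zf w i <= Zf w j.
Proof. by move=> w01 /(Zf_diff w01)[s [_ h]]; rewrite -subr_ge0 h. Qed.

(** A prefix showing a point in the interval has mass at most the expected count there, which is 0,
    so it cannot occur. This confines the points to [S]. *)
Lemma Zf_null w i j : 0 <= w < 1 -> qv i <= qv j ->
  fine (mu (S `&` `]qv i, qv j]%classic)) = 0 -> Zf w i = Zf w j.
Proof.
move=> w01 ij m0; apply: contrapT => ne.
pose n := (maxn i j).+1.
have sub : `]qv i, qv j]%classic `<=` `[- Mn n, Mn n]%classic.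
  have := @Mn_ge i n; have := @Mn_ge j n.
  rewrite !ltnS leq_maxl leq_maxr !ler_norml => /(_ isT)/andP[h1 h2] /(_ isT)/andP[h3 h4].
  by move=> x /=; rewrite !in_itv/= => /andP[h5 h6]; apply/andP; split; lra.
have := Zs_pos pz_nil pz_sum n w01; apply/negP; rewrite -leNgt.
have mI : measurable `]qv i, qv j]%classic by exact: measurable_itv.
have nc := nice_cnt mI sub.
have := E_cnt_le mS bk mI sub; rewrite m0 mulr0; apply: le_trans.
have nb := nice_bool n (fun y => y == mkseq (Z w) n).
rewrite /pz size_mkseq; apply: (E_le nb nc) => s.
case: eqP => e; last by [].
rewrite ler1n lt0n; apply/eqP => c0; apply: ne.
have hl l : (l <= maxn i j)%N -> Z w l = cnt (Iq l) s.
  by move=> lm; have /(congr1 (fun y => nth 0%N y l)) := e; rewrite !nth_mkseq.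
apply/eqP; rewrite eq_sym -subr_eq0 /Zf !hl ?leq_maxl ?leq_maxr//.
by rewrite cnt_diff// c0.
Qed.

(** For functions of finitely many words the identity is linearity together with the definition of
    the cells. In general [Phi] is cut to the first [K] words, and the remainder is at most the one
    of the constant 1. *)
Lemma PZ n (Phi : seq nat -> R) : (forall z, 0 <= Phi z <= 1) ->
  \int[P]_w Phi (mkseq (Z w) n) = E (fun s => Phi (zcounts n s)).
Proof.
move=> bPhi.
have bnorm z : `|Phi z| <= 1 by have /andP[h1 h2] := bPhi z; rewrite ger0_norm.
have mZ (f : seq nat -> R) : measurable_fun setT (fun w : Om => f (mkseq (Z w) n)).
  by apply: measurable_countable => z; exact: Z_meas.
have PT : (P setT < +oo)%E by rewrite probability_setT ltry.
pose cut (f : seq nat -> R) K z := if (choice.pickle z < K)%N then f z else 0.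
have stepE (f : seq nat -> R) K : (forall z, 0 <= f z <= 1) ->
    \int[P]_w cut f K (mkseq (Z w) n) = E (fun s => cut f K (zcounts n s)).
  move=> bf.
  have bc K' z : `|cut f K' z| <= 1.
    rewrite /cut; case: ifP; rewrite ?normr0// => _.
    by have /andP[h1 h2] := bf z; rewrite ger0_norm.
  have nf K' := nice_zc n (bc K').
  elim: K => [|K IH].
    rewrite [X in _ = E X](_ : _ = fun=> 0); last by apply/funext => s; rewrite /cut ltn0.
    under eq_Rintegral do rewrite /cut ltn0.
    by rewrite E_0 Rintegral_cst// mul0r.
  have [[y yK]|nK] := pselect (exists y : seq nat, choice.pickle y = K); last first.
    have cE z : cut f K.+1 z = cut f K z.
      rewrite /cut ltnS leq_eqVlt; case: eqP => //= e; exfalso; apply: nK; by exists z.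
    under eq_Rintegral do rewrite cE; rewrite IH.
    by congr E; apply/funext => s; rewrite cE.
  have cE z : cut f K.+1 z = cut f K z + f y * (z == y)%:R.
    rewrite /cut ltnS leq_eqVlt; case: (eqVneq z y) => [->|zy].
      by rewrite yK eqxx ltnn add0r mulr1.
    rewrite mulr0 addr0; case: eqP => //= e.
    move: zy; rewrite -(inj_eq (pcan_inj (@choice.pickleK _))) yK e eqxx //.
  under eq_Rintegral do rewrite cE.
  have nb := nice_bool n (fun z => z == y).
  rewrite RintegralD//; first 1 last.
  - by apply: (bounded_integrable measurableT PT (C := 1)).
  - apply: (bounded_integrable measurableT PT (C := 1)); first exact: (mZ (fun z => f y * (z == y)%:R)).
    move=> w _; have /andP[h1 h2] := bf y.
    by case: eqP; rewrite ?mulr1 ?mulr0 ?normr0// ger0_norm.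
  rewrite IH RintegralZl//; last first.
    apply: (bounded_integrable measurableT PT (C := 1)); first exact: (mZ (fun z => (z == y)%:R)).
    by move=> w _; case: eqP; rewrite ?normr1 ?normr0.
  rewrite (_ : (fun s => cut f K.+1 (zcounts n s)) = fun s => cut f K (zcounts n s) +
     f y * (zcounts n s == y)%:R); last by apply/funext => s; rewrite cE.
  rewrite (EED mS bk (nf K) (niceZ _ nb)) (EEZ mS bk _ nb); congr (_ + _ * _).
  have -> : \int[P]_w ((mkseq (Z w) n == y)%:R : R) = fine (P [set w | mkseq (Z w) n = y]).
    rewrite -[X in P X]setIT -integral_indic//; last exact: Z_meas.
    rewrite /Rintegral; congr fine; apply: eq_integral => w _; rewrite indicE.
    congr (_%:R%:E); congr nat_of_bool; apply/eqP/idP => h; first exact: mem_set.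
    exact: (set_mem h).
  have [ny|ny] := eqVneq (size y) n.
    by rewrite -ny (Zs_prob pz_ge0 pz_nil pz_sum).
  rewrite (_ : [set _ | _] = set0) ?measure0; last first.
    by apply/seteqP; split=> w //= e; move/eqP: ny; apply; rewrite -e size_mkseq.
  rewrite (_ : (fun s => _) = fun=> 0) ?E_0//.
  apply/funext => s; case: eqP => // e; exfalso; move/eqP: ny; apply.
  by rewrite -e size_mkseq.
have cvgI (f : seq nat -> R) : (forall z, 0 <= f z <= 1) ->
    \int[P]_w cut f K (mkseq (Z w) n) @[K --> \oo] --> \int[P]_w f (mkseq (Z w) n).
  move=> bf; apply: (cvg_Rintegral measurableT PT (C := 1)) => //.
  - by move=> K w _; rewrite /cut; case: ifP; rewrite ?normr0// => _;
      have /andP[h1 h2] := bf (mkseq (Z w) n); rewrite ger0_norm.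
  - move=> w _; apply: (@cvg_trans _ (f (mkseq (Z w) n) @[_ --> \oo])); last exact: cvg_cst.
    apply: near_eq_cvg; near=> K; rewrite /cut ifT//.
    by near: K; exact: nbhs_infty_gt.
have one : forall z : seq nat, 0 <= (fun=> 1 : R) z <= 1 by move=> z; rewrite ler01 lexx.
(* Tightness: for the constant 1 the truncated masses are those of a probability measure, so they
   tend to 1. *)
have cE1 : E (fun s => cut (fun=> 1) K (zcounts n s)) @[K --> \oo] --> (1 : R).
  have := cvgI _ one; under eq_fun do rewrite (stepE _ _ one).
  by rewrite Rintegral_cst// mul1r [X in fine X](@probability_setT _ _ _ P).
suff cv : \int[P]_w cut Phi K (mkseq (Z w) n) @[K --> \oo] --> E (fun s => Phi (zcounts n s)).
  exact: (cvg_unique _ (cvgI _ bPhi) cv).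
under eq_fun do rewrite (stepE _ _ bPhi).
have n0 := nice_zc n bnorm.
have bc1 K z : `|cut (fun=> 1) K z| <= 1 by rewrite /cut; case: ifP; rewrite ?normr0 ?normr1.
have bcP K z : `|cut Phi K z| <= 1 by rewrite /cut; case: ifP; rewrite ?normr0// bnorm.
have n1 K := nice_zc n (bc1 K).
have nP K := nice_zc n (bcP K).
have nn : nice (Mn n) (fun=> 1 : R) by have := nice_bool n (fun=> true).
have sand K : 0 <= E (fun s => Phi (zcounts n s)) - E (fun s => cut Phi K (zcounts n s)) <=
    1 - E (fun s => cut (fun=> 1) K (zcounts n s)).
  have -> : E (fun s => Phi (zcounts n s)) - E (fun s => cut Phi K (zcounts n s)) =
     E (fun s => Phi (zcounts n s) + -1 * cut Phi K (zcounts n s)).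
    by rewrite (EED mS bk n0 (niceZ _ (nP K))) (EEZ mS bk _ (nP K)) mulN1r.
  have -> : 1 - E (fun s => cut (fun=> 1) K (zcounts n s)) =
     E (fun s => 1 + -1 * cut (fun=> 1) K (zcounts n s)).
    by rewrite (EED mS bk nn (niceZ _ (n1 K))) (EEZ mS bk _ (n1 K)) mulN1r (E_1 mS bk).
  have nd1 := niceD n0 (niceZ (-1) (nP K)); have nd2 := niceD nn (niceZ (-1) (n1 K)).
  apply/andP; split.
    apply: (Hpos nd1) => s; rewrite /cut; case: ifP => _; first by rewrite mulN1r subrr.
    by rewrite mulr0 addr0; have /andP[] := bPhi (zcounts n s).
  apply: (E_le nd1 nd2) => s; rewrite /cut; case: ifP => _; first by rewrite !mulN1r !subrr.
  by rewrite !mulr0 !addr0; have /andP[] := bPhi (zcounts n s).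
have c0 : (1 : R) - E (fun s => cut (fun=> 1) K (zcounts n s)) @[K --> \oo] --> (0 : R).
  by rewrite -(subrr (1 : R)); apply: cvgB => //; exact: cvg_cst.
have cd : E (fun s => Phi (zcounts n s)) - E (fun s => cut Phi K (zcounts n s)) @[K --> \oo] --> (0 : R).
  apply: (squeeze_cvgr _ (cvg_cst 0) c0).
  by near=> K; have /andP[-> ->] := sand K.
exact: cvg_subl0 cd.
Unshelve. all: by end_near. Qed.


Lemma P_event n (Q : seq nat -> bool) :
  P [set w | Q (mkseq (Z w) n)] = (E (fun s => (Q (zcounts n s))%:R))%:E.
Proof.
have mQ : measurable ([set w | Q (mkseq (Z w) n)] : set Om).
  exact: (@measurable_countable_set _ Om _ (fun w => mkseq (Z w) n) (fun z => Q z) (fun z => Z_meas n z)).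
rewrite -(PZ n (Phi := fun z => (Q z)%:R)); last first.
  by move=> z; case: (Q z); rewrite ?lexx ?ler01.
rewrite -[X in P X]setIT -integral_indic//.
rewrite /Rintegral fineK.
  apply: eq_integral => w _; rewrite indicE; congr (_%:R%:E); congr nat_of_bool.
  by apply/idP/idP => h; [exact: (set_mem h)|exact: mem_set].
rewrite (_ : (fun x => _) = (fun x => (\1_[set w | Q (mkseq (Z w) n)] x)%:E)).
  by rewrite integral_indic// setIT fin_num_measure.
apply/funext => w; rewrite indicE; congr (_%:R%:E); congr nat_of_bool.
by apply/idP/idP => h; [exact: mem_set|exact: (set_mem h)].
Qed.

Lemma Z2_meas i j (Q : nat -> nat -> Prop) :
  measurable ([set w | Q (Z w i) (Z w j)] : set Om).
Proof.
rewrite (_ : [set _ | _] = [set w | (fun z => Q (nth 0%N z i) (nth 0%N z j))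
   (mkseq (Z w) (maxn i j).+1)]).
  exact: (@measurable_countable_set _ Om _ (fun w => mkseq (Z w) (maxn i j).+1)
    (fun z => Q (nth 0%N z i) (nth 0%N z j)) (fun z => Z_meas _ z)).
apply/seteqP; split=> w; rewrite /mkset !nth_mkseq ?ltnS ?leq_maxl ?leq_maxr//.
Qed.

Lemma itv_sub i j n : (i < n)%N -> (j < n)%N ->
  `]qv i, qv j]%classic `<=` `[- Mn n, Mn n]%classic.
Proof.
move=> /Mn_ge + /Mn_ge; rewrite !ler_norml => /andP[h1 h2] /andP[h3 h4] x /=.
by rewrite !in_itv/= => /andP[h5 h6]; apply/andP; split; lra.
Qed.

Lemma mu_itv_le (A : set R) (u v : R) : u <= v -> A `<=` `[u, v]%classic -> measurable A ->
  fine (mu (S `&` A)) <= v - u.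
Proof.
move=> uv sA mA; rewrite -lee_fin fineK; last first.
  rewrite ge0_fin_numE//; apply: (@le_lt_trans _ _ (mu `[u, v]%classic)).
    apply: (@le_measure _ _ _ mu); try apply: mem_set.
    - exact: measurableI.
    - exact: measurable_itv.
    - by apply: subset_trans sA; exact: subIsetr.
  by case: (bset_itv u v).
apply: (@le_trans _ _ (mu `[u, v]%classic)).
  apply: (@le_measure _ _ _ mu); try apply: mem_set.
  - exact: measurableI.
  - exact: measurable_itv.
  - by apply: subset_trans sA; exact: subIsetr.
rewrite lebesgue_measure_itv/= lte_fin; case: ltP => // _.
by rewrite lee_fin subr_ge0.
Qed.

Lemma P_double i j : qv i <= qv j ->
  (P [set w | (1 < Zf w j - Zf w i)%R] <= (C ^+ 2 * (qv j - qv i) ^+ 2)%:E)%E.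
Proof.
move=> ij; set n := (maxn i j).+1.
pose Q z := 1 < sgq j (nth 0%N z j) - sgq i (nth 0%N z i).
have iN : (i < n)%N by rewrite ltnS leq_maxl.
have jN : (j < n)%N by rewrite ltnS leq_maxr.
rewrite (_ : [set _ | _] = [set w | Q (mkseq (Z w) n)]); last first.
  by apply/seteqP; split=> w; rewrite /mkset /Q /Zf !nth_mkseq.
have mI : measurable `]qv i, qv j]%classic by exact: measurable_itv.
have sI := itv_sub iN jN.
rewrite P_event lee_fin; apply: le_trans (_ : E (fun s => 'C(cnt `]qv i, qv j]%classic s, 2)%:R) <= _).
  apply: (E_le (nice_bool n Q) (nice_cnt2 mI sI)) => s.
  rewrite /Q !nth_mkseq// cnt_diff// ltz_nat; case: ltnP => // c2.
  by rewrite ler1n bin_gt0.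
apply: le_trans (E_cnt2_le mS bk mI sI) _; apply: ler_wpM2l; first exact: sqr_ge0.
rewrite ler_sqr ?nnegrE ?fine_ge0 ?subr_ge0//.
apply: mu_itv_le => // x /=; rewrite !in_itv/= => /andP[h1 ->]; by rewrite (ltW h1).
Qed.

(** The k-th point of the grid of mesh 1 / (l + 1) starting at -M. *)
Definition gr (M l k : nat) : rat := (k%:Z - (M * l.+1)%:Z)%:~R / (l.+1)%:R.

Lemma qv_gr M l k : qv (idx (gr M l k)) = (k%:R - (M * l.+1)%:R) / l.+1%:R.
Proof. by rewrite qv_idx /gr fmorph_div/= rmorph_int rmorph_nat rmorphB/=. Qed.

(** Two adjacent meshes are taken together, so that every real, grid points included, is interior to
    one of the tested intervals. *)
Definition badc M l k (w : R) := 1 < Zf w (idx (gr M l k.+2)) - Zf w (idx (gr M l k)).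

Definition goodw (w : R) := 0 <= w < 1 /\
  forall M : nat, exists l : nat, forall k, (k < (2 * (M * l.+1)).+1)%N -> ~ badc M l k w.

Lemma near_grid (y : R) : 0 < y -> exists k : nat, k%:R < y < k.+2%:R.
Proof.
move=> y0; have /andP[h1 h2] := Num.Theory.truncn_itv (ltW y0).
have [e|ne] := eqVneq (Num.truncn y)%:R y.
  case E' : (Num.truncn y) => [|m]; first by move: y0; rewrite -e E' ltxx.
  by exists m; rewrite -e E' !ltr_nat !ltnS !leqnn.
exists (Num.truncn y); rewrite lt_neqAle ne h1/=; apply: lt_trans h2 _.
by rewrite ltr_nat.
Qed.

Lemma good_simple w : goodw w -> forall x : R, exists i j,
  [/\ qv i < x, x < qv j & Zf w j - Zf w i <= 1].
Proof.
move=> [w01 gw] x.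
pose M := (Num.truncn `|x|).+2.
have /andP[_ hM] := Num.Theory.truncn_itv (normr_ge0 x).
have xM : `|x| + 1 < M%:R by rewrite /M -[_.+2]addn1 natrD ltrD2r.
have [l hl] := gw M; pose L := l.+1%:R : R.
have L1 : 1 <= L by rewrite ler1n.
have L0 : 0 < L by exact: lt_le_trans L1.
have /ltr_normlP[x1 x2] : `|x| < M%:R - 1 by lra.
have y0 : 0 < x * L + M%:R * L.
  rewrite -mulrDl mulr_gt0//; lra.
have [k /andP[k1 k2]] := near_grid y0.
exists (idx (gr M l k)), (idx (gr M l k.+2)); rewrite !qv_gr -/L !natrM -/L; split.
- by rewrite ltr_pdivrMr// ltrBlDr.
- by rewrite ltr_pdivlMr// ltrBrDr.
- rewrite leNgt; apply/negP; apply: hl.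
  rewrite ltnS -(ler_nat R) !natrM -/L; apply: le_trans (ltW k1) _.
  have : x * L <= M%:R * L by rewrite ler_pM2r//; lra.
  lra.
Qed.

Lemma goodw_meas : measurable ([set w | goodw w] : set Om).
Proof.
rewrite (_ : [set _ | _] = `[0, 1[%classic `&` \bigcap_M \bigcup_l
   \bigcap_(k in [set k | (k < (2 * (M * l.+1)).+1)%N]) ~` [set w | badc M l k w]).
  apply: measurableI; first exact: measurable_itv.
  apply: bigcapT_measurable => M; apply: bigcupT_measurable => l.
  apply: bigcap_measurable => [|k _]; first by exists 0%N.
  apply: measurableC; rewrite /badc /Zf.
  exact: (Z2_meas (idx (gr M l k.+2)) (idx (gr M l k))
    (fun a b => 1 < sgq (idx (gr M l k.+2)) a - sgq (idx (gr M l k)) b)).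
apply/seteqP; split=> w.
  move=> [w01 h]; split; first by rewrite /= in_itv.
  by move=> M _; have [l hl] := h M; exists l => // k /= kl; exact: hl.
move=> [/=]; rewrite in_itv/= => w01 h; split=> // M.
by have [l _ hl] := h M I; exists l => k kl; exact: (hl k kl).
Qed.

(** Union bound: the number of double meshes grows like [l] while each holds two points with
    probability of order 1 / l^2. For every [M] the probability that all [l] fail is therefore 0. *)
Lemma P_notgood : P (~` [set w | goodw w]) = 0%E.
Proof.
have mg := goodw_meas.
apply/negligibleP; first exact: measurableC.
pose bad M := \bigcap_l \bigcup_(k < (2 * (M * l.+1)).+1) ([set w | badc M l k w] : set Om).
have mb M l k : measurable ([set w | badc M l k w] : set Om).
  exact: (Z2_meas (idx (gr M l k.+2)) (idx (gr M l k))
    (fun a b => 1 < sgq (idx (gr M l k.+2)) a - sgq (idx (gr M l k)) b)).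
have mU M l : measurable (\bigcup_(k < (2 * (M * l.+1)).+1) ([set w | badc M l k w] : set Om)).
  by apply: bigcup_measurable => k _; exact: mb.
suff H : P.-negligible (~` `[0, 1[%classic `|` \bigcup_M bad M).
  apply: (negligibleS _ H).
  move=> w ng; have [w01|w01] := boolP (0 <= w < 1); last by left; rewrite /= in_itv/=; exact/negP.
  right; apply: contrapT => nb; apply: ng; split=> // M.
  apply: contrapT => nl; apply: nb; exists M => // l _.
  apply: contrapT => nk; apply: nl; exists l => k kl bk'; apply: nk.
  by exists k.
apply: negligibleU.
  apply/negligibleP; first by apply: measurableC; exact: measurable_itv.
  rewrite /Punit/= /unitP /mrestr setICl; exact: measure0.
apply: negligible_bigcup => M; apply/negligibleP.
  by apply: bigcapT_measurable => l.
(* There are 2M(l+1) + 1 double meshes of length 2/(l+1), each bad with probability at most C^2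
   (2/(l+1))^2; their sum is at most c/(l+1). *)
pose c := (2 * M%:R + 1) * (4 * C ^+ 2) : R.
have c0 : 0 <= c by apply: mulr_ge0; [apply: addr_ge0 => //; exact: mulr_ge0|apply: mulr_ge0 => //; exact: sqr_ge0].
have bl l : (P (bad M) <= (c / l.+1%:R)%:E)%E.
  apply: (@le_trans _ _ (P (\bigcup_(k < (2 * (M * l.+1)).+1) [set w | badc M l k w]))).
    apply: le_measure; try apply: mem_set.
    - by apply: bigcapT_measurable => l'.
    - exact: mU.
    - by move=> w; apply.
  rewrite bigcup_mkord; apply: le_trans (@Boole_inequality _ Om _ P (fun k => [set w | badc M l k w]) _ _) _ => //.
  have L0 : 0 < l.+1%:R :> R by [].
  apply: (@le_trans _ _ (\sum_(k < (2 * (M * l.+1)).+1) (C ^+ 2 * (2 / l.+1%:R) ^+ 2)%:E)%E).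
    apply: lee_sum => k _.
    have d : qv (idx (gr M l k.+2)) - qv (idx (gr M l k)) = 2 / l.+1%:R.
      by rewrite !qv_gr -mulrBl -addn2 natrD; congr (_ / _); ring.
    rewrite -d; apply: P_double; rewrite -subr_ge0 d divr_ge0//.
  rewrite sumEFin lee_fin sumr_const card_ord -[leLHS]mulr_natl.
  have -> : (2 * (M * l.+1)).+1%:R = 2 * M%:R * l.+1%:R + 1 :> R.
    by rewrite -addn1 natrD !natrM mulrA.
  rewrite ler_pdivlMr//.
  have -> : (2 * M%:R * l.+1%:R + 1) * (C ^+ 2 * (2 / l.+1%:R) ^+ 2) * l.+1%:R =
     (2 * M%:R + l.+1%:R^-1) * (4 * C ^+ 2) :> R by field.
  apply: ler_wpM2r; first by apply: mulr_ge0 => //; exact: sqr_ge0.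
  rewrite lerD2l invf_le1//.
  by rewrite ler1n.
have fP : P (bad M) \is a fin_num.
  by apply: fin_num_measure; apply: bigcapT_measurable => l.
suff e : P (bad M) = 0%E by exact: e.
rewrite -(fineK fP); congr EFin; apply/eqP; rewrite eq_le fine_ge0// andbT.
rewrite leNgt; apply/negP => x0; set x := fine _ in x0.
pose l := Num.truncn (c / x).
have /andP[_ h] := Num.Theory.truncn_itv (divr_ge0 c0 (ltW x0)).
have := bl l; rewrite -(fineK fP) lee_fin -/x ler_pdivlMr//.
by rewrite mulrC -ler_pdivlMr// leNgt h.
Qed.

Hypothesis HS : forall x, ~ S x -> exists u v : rat,
  ratr u < x < ratr v /\ fine (mu (S `&` `]ratr u, ratr v]%classic)) = 0.

(** The configuration is empty on the null set of bad [w], since local finiteness is required at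
    every [w]. *)
Definition jumpset (w : Om) : set R := if `[< goodw w >] then jumps qv (Zf w) else set0.

Lemma xi_sub w : jumpset w `<=` S.
Proof.
rewrite /jumpset; case: asboolP => [gw x Jx|_ x []]; apply: contrapT => nSx.
have [u [v [/andP[ux xv] m0]]] := HS nSx.
have := Jx (idx u) (idx v); rewrite !qv_idx => /(_ ux xv).
have [w01 _] := gw.
rewrite (@Zf_null w (idx u) (idx v)) ?ltxx// !qv_idx//.
by apply: ltW; exact: lt_trans xv.
Qed.

Lemma xi_npts w a b : goodw w -> a <= b -> exists i0 j0, [/\ qv i0 < a, b < qv j0,
  finite_set (jumpset w `&` `[a, b]) & forall i j, qv i0 <= qv i -> qv i < a ->
    b < qv j -> qv j <= qv j0 -> (npts (jumpset w) `[a, b])%:Z = Zf w j - Zf w i].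
Proof.
move=> gw ab; rewrite /jumpset asboolT//; apply: npts_jumps => //.
- exact: qv_dense.
- by move=> i j; apply: Zf_mono; exact: gw.1.
- exact: good_simple.
Qed.

End Process.

(** * Products of counts over disjoint sets *)

Section DisjointCounts.
Variable R : realType.
Notation mu := (@lebesgue_measure R).
Implicit Types (B W : set R) (s : seq R) (F D : seq R -> R).

Definition del (i : nat) s := take i s ++ drop i.+1 s.

Definition Wd B F s := \sum_(i < size s) (`[< B (nth 0 s i) >])%:R * F (del i s).

(** Moebius transform of the product of the counts over disjoint sets, see [SS_Hm]: a sum over the
    ways of assigning one point of the list to each set. *)
Fixpoint Hm (Bs : seq (set R)) s : R :=
  if Bs is B :: Bs' then Wd B (Hm Bs') s else (size s == 0%N)%:R.

Lemma size_del i s : (i < size s)%N -> size (del i s) = (size s).-1.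
Proof.
move=> h; rewrite /del size_cat size_take size_drop h; lia.
Qed.

Lemma del_ins i x s : (i <= size s)%N -> del i (ins i x s) = s.
Proof.
move=> h; rewrite /del /ins take_size_cat; last by rewrite size_takel.
rewrite -cat_rcons drop_size_cat ?cat_take_drop//.
by rewrite size_rcons size_takel.
Qed.

Lemma Hm_size Bs s : size s != size Bs -> Hm Bs s = 0.
Proof.
elim: Bs s => [|B Bs IH] s /=; first by case: eqP.
move=> h; rewrite /Wd big1// => i _; rewrite IH ?mulr0// size_del//.
by apply: contraNneq h => <-; have := ltn_ord i; lia.
Qed.

Lemma Hm_out Bs x s : x \in s -> (forall B, List.In B Bs -> ~ B x) -> Hm Bs s = 0.
Proof.
elim: Bs s => [|B Bs IH] s xs h /=; first by case: s xs.
rewrite /Wd big1// => i _.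
have [e|ne] := eqVneq (nth 0 s i) x.
  by rewrite e asboolF ?mul0r//; apply: h; left.
rewrite IH ?mulr0//; last by move=> B' h'; apply: h; right.
rewrite /del mem_cat; have : x \in take i s ++ drop i s by rewrite cat_take_drop.
rewrite (drop_nth 0)// !mem_cat inE eq_sym (negPf ne)/=.
by [].
Qed.

Lemma SSD H1 H2 s : SS (fun T => H1 T + H2 T) s = SS H1 s + SS H2 s :> R.
Proof. by elim: s H1 H2 => [//|x s IH] H1 H2 /=; rewrite !IH; ring. Qed.

Lemma Wd_cons B F x s :
  Wd B F (x :: s) = (`[< B x >])%:R * F s + Wd B (fun t => F (x :: t)) s.
Proof. by rewrite /Wd /= big_ord_recl/= /del /= drop0. Qed.

Lemma eq_SS H1 H2 s : H1 =1 H2 -> SS H1 s = SS H2 s :> R.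
Proof.
by move=> /funext ->.
Qed.

(** The left side counts pairs of a point in [B] and a sublist avoiding it. On the right the pairs
    whose point belongs to the sublist are counted as well, but there [F] vanishes. *)
Lemma SS_Wd B F s : (forall x s, x \in s -> B x -> F s = 0) ->
  SS (Wd B F) s = (cnt B s)%:R * SS F s.
Proof.
elim: s F => [|x s IH] F h; first by rewrite /= /Wd big_ord0 mul0r.
rewrite /= IH//.
rewrite (eq_SS s (Wd_cons B F x)) SSD SSZ IH; last first.
  by move=> y t yt By; apply: (h y) => //; rewrite inE yt orbT.
rewrite natrD.
have e0 : (`[< B x >])%:R * SS (fun T => F (x :: T)) s = 0.
  case: asboolP => Bx; last by rewrite mul0r.
  rewrite (@eq_SS _ (fun=> 0)) ?SS_zero ?mulr0// => T.
  by apply: (h x) => //; rewrite inE eqxx.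
by rewrite mulrDl !mulrDr e0; ring.
Qed.

Definition disj (Bs : seq (set R)) :=
  forall i j, (i < size Bs)%N -> (j < size Bs)%N -> i != j -> nth set0 Bs i `&` nth set0 Bs j = set0.

Lemma disj_cons B Bs : disj (B :: Bs) -> disj Bs /\
  forall B', List.In B' Bs -> B `&` B' = set0.
Proof.
move=> h; split=> [i j il jl ij|B']; first exact: (h i.+1 j.+1).
move=> h'; have [j jl <-] : exists2 j, (j < size Bs)%N & nth set0 Bs j = B'.
  elim: Bs h' {h} => [//|B1 Bs IH] /= [->|/IH[j jl e]]; first by exists 0%N.
  by exists j.+1.
exact: (h 0%N j.+1).
Qed.

Lemma SS_Hm Bs s : disj Bs -> SS (Hm Bs) s = \prod_(B <- Bs) (cnt B s)%:R.
Proof.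
elim: Bs s => [|B Bs IH] s h.
  rewrite big_nil (@eq_SS _ (delta_in set0 0)) ?SS_delta ?bin0//.
  by case.
have [dB BB] := disj_cons h.
rewrite big_cons -IH//= SS_Wd// => x t xt Bx; apply: (Hm_out xt) => B' B'i B'x.
by have : (B `&` B') x by []; rewrite BB.
Qed.

Lemma bnm_Hm Bs n : (forall B, List.In B Bs -> measurable B) -> bnm n (Hm Bs).
Proof.
elim: Bs n => [|B Bs IH] n mBs /=.
  apply: (@bnm_ext _ n (fun=> (n == 0%N)%:R)); first by move=> s ->.
  exact: bnm_cst.
case: n => [|n].
  apply: (@bnm_ext _ 0 (fun=> 0)); last exact: bnm_cst.
  by move=> s /eqP/nilP ->; rewrite /Wd big_ord0.
apply: (@bnm_ext _ n.+1 (fun s => \sum_(i < n.+1) (`[< B (nth 0 s i) >])%:R * Hm Bs (del i s))).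
  by move=> s ss; rewrite /Wd ss.
apply: bnm_sum => i _; apply: bnmM.
  split; last by exists 1 => s _; case: `[< _ >]; rewrite ?normr1 ?normr0.
  move=> d T g mg; under eq_fun do rewrite nth_mkseq//.
  rewrite (_ : (fun w => _) = (\1_B \o g i)).
    by apply: measurableT_comp => //; apply: measurable_indic; apply: mBs; left.
  by apply/funext => w; rewrite /= indicE; congr (nat_of_bool _)%:R; rewrite in_setE.
have iN := ltn_ord i.
apply: (@bnm_subst _ n n.+1 (Hm Bs) (del i)).
- by move=> s ss; rewrite size_del ss.
- move=> j jn; exists (bump i j).
    rewrite /bump; case: (i <= j)%N; lia.
  move=> s ss; have si : (i <= size s)%N by rewrite ss ltnW.
  rewrite /del nth_cat size_takel// /bump; case: (ltnP j i) => h; first by rewrite nth_take.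
  by rewrite nth_drop; congr nth; lia.
- by apply: IH => B' h; apply: mBs; right.
Qed.

Lemma rint_Wd n W B F D : bset W -> measurable B -> bnm n F -> symf D -> bnm n.+1 D ->
  rint (nseq n.+1 W) (fun s => Wd B F s * D s) =
  n.+1%:R * \int[mu]_(x in W `&` B) rint (nseq n W) (fun s => F s * D (x :: s)).
Proof.
move=> bW mB bF sD bD.
have bT i : (i < n.+1)%N -> bnm n.+1 (fun s => (`[< B (nth 0 s i) >])%:R * F (del i s) * D s).
  move=> iN; apply: bnmM bD; apply: bnmM.
    split; last by exists 1 => s _; case: `[< _ >]; rewrite ?normr1 ?normr0.
    move=> d T g mg; under eq_fun do rewrite nth_mkseq//.
    rewrite (_ : (fun w => _) = (\1_B \o g i)).
      by apply: measurableT_comp => //; apply: measurable_indic.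
    by apply/funext => w; rewrite /= indicE; congr (nat_of_bool _)%:R; rewrite in_setE.
  apply: (@bnm_subst _ n n.+1 F (del i)) => //.
  - by move=> s ss; rewrite size_del ss.
  - move=> j jn; exists (bump i j).
      rewrite /bump; case: (i <= j)%N; lia.
    move=> s ss; have si : (i <= size s)%N by rewrite ss ltnW.
    rewrite /del nth_cat size_takel// /bump; case: (ltnP j i) => h; first by rewrite nth_take.
    by rewrite nth_drop; congr nth; lia.
transitivity (rint (nseq n.+1 W) (fun s =>
    \sum_(i < n.+1) (`[< B (nth 0 s i) >])%:R * F (del i s) * D s)).
  apply: eq_rint => s /inB_size; rewrite size_nseq => ss.
  by rewrite /Wd ss mulr_suml.
rewrite rint_sum; last 2 first.
- exact: bsets_nseq.
- by move=> i _; rewrite size_nseq; exact: bT.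
rewrite (eq_bigr (fun=> \int[mu]_(x in W `&` B) rint (nseq n W) (fun s => F s * D (x :: s)))).
  by rewrite sumr_const card_ord mulr_natl.
move=> i _; have iN := ltn_ord i.
have nE : nseq n.+1 W = nseq i W ++ W :: nseq (n - i) W.
  by rewrite -[_ :: _]/(nseq (n - i).+1 W) -nseqD; congr nseq; lia.
rewrite nE rint_move; last 2 first.
- by rewrite -nE; exact: bsets_nseq.
- by rewrite -nE size_nseq; exact: bT.
rewrite -nseqD size_nseq (_ : (i + (n - i))%N = n); last by lia.
have [mW _] := bW.
rewrite Rintegral_mkcondr /patch; apply: eq_Rintegral => x _.
have inE' s : inB (nseq n W) s ->
    (`[< B (nth 0 (ins i x s) i) >])%:R * F (del i (ins i x s)) * D (ins i x s) =
    (`[< B x >])%:R * (F s * D (x :: s)).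
  move=> /inB_size; rewrite size_nseq => ss.
  have si : (i <= size s)%N by rewrite ss -ltnS.
  rewrite del_ins// nth_ins//.
  by rewrite ltnn eqxx (sD _ _ (perm_ins i x s)) mulrA.
rewrite (eq_rint inE').
have mE : (x \in B) = `[< B x >] by [].
rewrite mE; case: asboolP => Bx; first by apply: eq_rint => s _; rewrite mul1r.
transitivity (0 * rint (nseq n W) (fun=> 1)); last by rewrite mul0r.
rewrite -rintZ; last 2 first.
- exact: bsets_nseq.
- exact: bnm_cst.
by apply: eq_rint => s _; rewrite !mul0r.
Qed.

Lemma rint_Hm W Bs D : bset W -> (forall B, List.In B Bs -> measurable B) ->
  symf D -> bnm (size Bs) D ->
  rint (nseq (size Bs) W) (fun s => Hm Bs s * D s) =
  (size Bs)`!%:R * rint [seq W `&` B | B <- Bs] D.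
Proof.
move=> bW; elim: Bs D => [|B Bs IH] D mBs sD bD; first by rewrite /= mul1r.
have mB : measurable B by apply: mBs; left.
have mBs' B' : List.In B' Bs -> measurable B' by move=> h; apply: mBs; right.
rewrite [Hm _]/= (rint_Wd bW mB (bnm_Hm _ mBs') sD bD) factS natrM -mulrA; congr (_ * _).
have bWB : bset (W `&` B).
  by rewrite setIC; exact: bsetI.
transitivity (\int[mu]_(x in W `&` B) ((size Bs)`!%:R *
    rint [seq W `&` B0 | B0 <- Bs] (fun s => D (x :: s)))).
  by apply: eq_Rintegral => x _; apply: IH => //; [exact: symf_cons|exact: bnm_cons].
have bW' : bsets ((W `&` B) :: [seq W `&` B0 | B0 <- Bs]).
  apply/bsets_cons; split=> // B' /List.in_map_iff[B1 [<- /mBs' mB1]].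
  by rewrite setIC; exact: bsetI.
have [|C [mf bf]] := @rint_cons_meas R _ _ D bW'; first by rewrite size_map.
rewrite RintegralZl//; first exact: bWB.1.
exact: (leb_integrable bWB mf (fun x _ => bf x)).
Qed.

Variables (S : set R) (k : R -> R -> R) (C : R).
Hypotheses (mS : measurable S) (bk : bker k C).

Lemma EE_prod_cnt (M : R) Bs : disj Bs ->
  (forall B, List.In B Bs -> measurable B /\ B `<=` `[- M, M]%classic) ->
  EE S k (fun s => \prod_(B <- Bs) (cnt B s)%:R) = rint [seq S `&` B | B <- Bs] (Dks k).
Proof.
move=> dB mB.
have mB' B : List.In B Bs -> measurable B by move=> /mB[].
have nG : nice M (fun s => \prod_(B <- Bs) (cnt B s)%:R : R).
  rewrite (_ : (fun s => _) = fun s => (fun z => \prod_(i <- z) i%:R) (cnts Bs s)); last first.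
    by apply/funext => s; rewrite /cnts big_map.
  apply: (@nice_cnts R M Bs (fun z => \prod_(i <- z) i%:R) 1 (2 ^+ size Bs)) => // s.
  rewrite mul1r ger0_norm; last by apply: prodr_ge0.
  rewrite -exprM mulnC exprM /cnts big_map {mB mB' dB}.
  elim: Bs => [|B Bs IH]; first by rewrite big_nil.
  rewrite big_cons exprS ler_pM//; first by apply: prodr_ge0.
  by apply: le_trans (natr_le_exp _ _); rewrite ler_nat cnt_size.
rewrite (EE_degree mS bk (n := size Bs) (H := Hm Bs) nG); first 1 last.
- by move=> s; rewrite SS_Hm.
- by move=> s; exact: Hm_size.
rewrite rint_Hm//; first 1 last.
- exact: bset_win.
- exact: Dks_perm.
- exact: bnm_Dks bk.
rewrite mulrA mulVf ?mul1r ?pnatr_eq0 -?lt0n ?fact_gt0//; congr (rint _ _).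
elim: Bs mB {dB mB' nG} => [//|B Bs IH] mB /=; rewrite IH; last by move=> B' h; apply: mB; right.
congr (_ :: _); rewrite /win -setIA; congr (_ `&` _); apply/setIidPr.
by have [|//] := mB B; left.
Qed.

End DisjointCounts.

(** * From rational intervals to arbitrary closed ones *)

Section Transfer.
Variables (R : realType) (S : set R) (kf : R -> R -> R) (C : R).
Notation mu := (@lebesgue_measure R).
Hypotheses (mS : measurable S) (bk : bker kf C).
Notation E := (EE S kf).
Hypothesis Hpos : forall M G, nice M G -> (forall s, 0 <= G s) -> 0 <= E G.
Hypothesis HS : forall x, ~ S x -> exists u v : rat,
  ratr u < x < ratr v /\ fine (mu (S `&` `]ratr u, ratr v]%classic)) = 0.
Notation Om := (measurableTypeR R).
Notation P := (Punit R).
Notation qv := (@qv R).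
Notation Z := (@Z R S kf).
Notation Zf := (@Zf R S kf).
Notation xi := (@jumpset R S kf).
Notation goodw := (@goodw R S kf).
Notation zc := (@zcounts R).
Notation sgq := (@sgq R).
Implicit Types (ab : seq (R * R)) (c : R * R).

(** Approximation from outside: the endpoints of a closed interval count, so it is enlarged to a
    rational half-open interval exceeding it by less than 1 / (t + 1) on each side. *)
Definition lo (a : R) (t : nat) : nat := xget 0%N [set i | a - t.+1%:R^-1 < qv i < a].
Definition hi (b : R) (t : nat) : nat := xget 0%N [set i | b < qv i < b + t.+1%:R^-1].

Lemma loP a t : a - t.+1%:R^-1 < qv (lo a t) < a.
Proof.
apply: (@xgetPex _ 0%N [set i | a - t.+1%:R^-1 < qv i < a]).
by apply: qv_dense; rewrite ltrBlDr ltrDl invr_gt0.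
Qed.

Lemma hiP b t : b < qv (hi b t) < b + t.+1%:R^-1.
Proof.
apply: (@xgetPex _ 0%N [set i | b < qv i < b + t.+1%:R^-1]).
by apply: qv_dense; rewrite ltrDl invr_gt0.
Qed.

Definition Dc (t : nat) c (z : nat -> nat) : nat :=
  if c.1 <= c.2 then `|sgq (hi c.2 t) (z (hi c.2 t)) - sgq (lo c.1 t) (z (lo c.1 t))|%N else 0%N.

Definition out (t : nat) c : set R :=
  if c.1 <= c.2 then `]qv (lo c.1 t), qv (hi c.2 t)]%classic else set0.

Lemma Dc_cnt t c (s : seq R) : Dc t c (fun i => cnt (Iq i) s) = cnt (out t c) s.
Proof.
rewrite /Dc /out; case: leP => h; last first.
  by elim: s => [//|x s IH]; rewrite cnt_cons asboolF.
have /andP[_ h1] := loP c.1 t; have /andP[h2 _] := hiP c.2 t.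
by rewrite cnt_diff//; apply: ltW; rewrite (lt_trans h1)// (le_lt_trans h).
Qed.

Definition nn (t : nat) ab : nat := (\max_(c <- ab) maxn (lo c.1 t) (hi c.2 t)).+1.

Lemma nn_gt t ab c : c \in ab -> (lo c.1 t < nn t ab)%N /\ (hi c.2 t < nn t ab)%N.
Proof.
move=> cab; rewrite /nn !ltnS; have := @leq_bigmax_seq _ ab (fun c => true)
  (fun c => maxn (lo c.1 t) (hi c.2 t)) c cab isT.
by rewrite geq_max => /andP[].
Qed.

Definition Ds t ab (z : seq nat) : seq nat := [seq Dc t c (nth 0%N z) | c <- ab].

Lemma Ds_mkseq t ab (f : nat -> nat) : Ds t ab (mkseq f (nn t ab)) = [seq Dc t c f | c <- ab].
Proof.
apply/eq_in_map => c /(nn_gt t)[h1 h2]; rewrite /Dc.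
by rewrite !nth_mkseq.
Qed.

Lemma PDs t ab (Phi : seq nat -> R) : (forall z, 0 <= Phi z <= 1) ->
  \int[P]_w Phi [seq Dc t c (Z w) | c <- ab] = E (fun s => Phi (cnts [seq out t c | c <- ab] s)).
Proof.
move=> bPhi.
have := @PZ R S kf C mS bk Hpos (nn t ab) (fun z => Phi (Ds t ab z)) (fun z => bPhi _).
under eq_Rintegral do rewrite Ds_mkseq.
move=> ->; congr E; apply/funext => s; rewrite /zcounts Ds_mkseq; congr Phi.
by rewrite /cnts -map_comp; apply/eq_map => c; rewrite /= Dc_cnt.
Qed.

Definition ins_ (c : R * R) : set R := `[c.1, c.2]%classic.

Definition vw ab (w : R) : seq nat := [seq npts (xi w) (ins_ c) | c <- ab].

Lemma npts0 (X : set R) : npts X set0 = 0%N.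
Proof. by rewrite /npts setI0 fset_set0. Qed.

Lemma inv_near0 (e : R) : 0 < e -> \forall t \near \oo, t.+1%:R^-1 <= e :> R.
Proof.
move=> e0; near=> t; rewrite invf_ple ?posrE//.
apply: (@le_trans _ _ t%:R); last by rewrite ler_nat.
by near: t; exact: nbhs_infty_ger.
Unshelve. all: by end_near. Qed.

Lemma Dc_near w c : goodw w -> \forall t \near \oo, Dc t c (Z w) = npts (xi w) (ins_ c).
Proof.
move=> gw; have [cc|cc] := leP c.1 c.2; last first.
  near=> t; rewrite /Dc leNgt cc/= /ins_ set_itv_ge ?npts0//.
  by rewrite bnd_simp -ltNge.
have [i0 [j0 [h1 h2 _ h3]]] := xi_npts mS bk Hpos gw cc.
near=> t; rewrite /Dc cc.
have /andP[l1 l2] := loP c.1 t; have /andP[u1 u2] := hiP c.2 t.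
have -> : sgq (hi c.2 t) (Z w (hi c.2 t)) - sgq (lo c.1 t) (Z w (lo c.1 t)) =
  Zf w (hi c.2 t) - Zf w (lo c.1 t) by [].
rewrite -h3 ?absz_nat//.
- apply: ltW; apply: le_lt_trans l1; rewrite lerBrDr -lerBrDl.
  by near: t; apply: inv_near0; rewrite subr_gt0.
- apply: ltW; apply: lt_le_trans u2 _; rewrite -lerBrDl.
  by near: t; apply: inv_near0; rewrite subr_gt0.
Unshelve. all: by end_near. Qed.

Lemma Ds_near w ab : goodw w -> \forall t \near \oo, [seq Dc t c (Z w) | c <- ab] = vw ab w.
Proof.
move=> gw; elim: ab => [|c ab IH]; first by near=> t.
near=> t => /=; congr (_ :: _); first by near: t; exact: Dc_near.
by near: t.
Unshelve. all: by end_near. Qed.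

Lemma Ds_meas t ab z : measurable ([set w | [seq Dc t c (Z w) | c <- ab] = z] : set Om).
Proof.
rewrite (_ : [set _ | _] = [set w | Ds t ab (mkseq (Z w) (nn t ab)) = z]); last first.
  by apply/seteqP; split=> w; rewrite /mkset Ds_mkseq.
exact: (@measurable_countable_set _ Om _ (fun w => mkseq (Z w) (nn t ab))
    (fun y => Ds t ab y = z) (fun y => Z_meas mS bk Hpos _ y)).
Qed.

Lemma xi_bad w : ~ goodw w -> xi w = set0.
Proof. by move=> ng; rewrite /jumpset asboolF. Qed.

Lemma vw_meas ab z : measurable ([set w | vw ab w = z] : set Om).
Proof.
have mg := goodw_meas mS bk Hpos.
rewrite (_ : [set _ | _] = ([set w | goodw w] `&`
     \bigcup_T \bigcap_(t in [set t | (T <= t)%N]) [set w | [seq Dc t c (Z w) | c <- ab] = z])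
   `|` (~` [set w | goodw w] `&` (if [seq 0%N | _ <- ab] == z then setT else set0))).
  apply: measurableU; apply: measurableI => //.
  - apply: bigcupT_measurable => T; apply: bigcap_measurable => [|t _].
      by exists T => /=.
    exact: Ds_meas.
  - exact: measurableC.
  - by case: ifP => _; [exact: measurableT|exact: measurable0].
apply/seteqP; split=> w.
- move=> /= vz; have [gw|ng] := pselect (goodw w).
    left; split=> //; have [T _ hT] := Ds_near ab gw; exists T => // t /= Tt.
    by rewrite -vz; apply: hT.
  right; split=> //; rewrite ifT//; apply/eqP; rewrite -vz /vw.
  by apply/eq_map => c; rewrite xi_bad// /npts set0I fset_set0.
- move=> [[/= gw [T _ hT]]|[/= ng]].
    have [T' _ hT'] := Ds_near ab gw.
    by rewrite -(hT' (maxn T T')) ?(hT (maxn T T'))//= ?leq_maxl ?leq_maxr.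
  case: eqP => [<- _|//]; rewrite /vw.
  by apply/eq_map => c; rewrite xi_bad// /npts set0I fset_set0.
Qed.

Lemma PT_fin : (P setT < +oo)%E.
Proof. by rewrite probability_setT ltry. Qed.

Lemma Rint_good (f : R -> R) : measurable_fun setT (f : Om -> R) -> (forall w, `|f w| <= 1) ->
  \int[P]_w f w = \int[P]_(w in [set w | goodw w]) f w.
Proof.
move=> mf bf; rewrite /Rintegral; congr fine.
rewrite (@negligible_integral _ Om R P setT (~` [set w | goodw w])) //.
- by rewrite setTD setCK.
- by apply: measurableC; exact: goodw_meas mS bk Hpos.
- exact: (@bounded_integrable _ Om R P setT measurableT PT_fin f 1 mf (fun w _ => bf w)).
- exact: P_notgood mS bk Hpos.
Qed.

Lemma vw_fun_meas ab (Phi : seq nat -> R) :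
  measurable_fun setT (fun w : Om => Phi (vw ab w)).
Proof.
exact: (@measurable_countable _ Om R _ (vw ab) Phi (fun z => vw_meas ab z)).
Qed.

Lemma cvg_PDs ab (Phi : seq nat -> R) : (forall z, 0 <= Phi z <= 1) ->
  \int[P]_w Phi [seq Dc t c (Z w) | c <- ab] @[t --> \oo] --> \int[P]_w Phi (vw ab w).
Proof.
move=> bPhi.
have bn z : `|Phi z| <= 1 by have /andP[h1 h2] := bPhi z; rewrite ger0_norm.
have mD t : measurable_fun setT (fun w : Om => Phi [seq Dc t c (Z w) | c <- ab]).
  exact: (@measurable_countable _ Om R _ (fun w => [seq Dc t c (Z w) | c <- ab]) Phi
    (fun z => Ds_meas t ab z)).
rewrite (Rint_good (vw_fun_meas ab Phi))//.
under eq_fun do rewrite (Rint_good (mD _))//.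
have mg := goodw_meas mS bk Hpos.
apply: (@cvg_Rintegral _ Om R P _ mg _ (fun t w => Phi [seq Dc t c (Z w) | c <- ab])
  (fun w => Phi (vw ab w)) 1) => //.
- by apply: le_lt_trans PT_fin; apply: le_measure; try exact: mem_set; exact: subsetT.
- exact: vw_fun_meas.
- move=> w gw; apply: (@cvg_trans _ (Phi (vw ab w) @[t --> \oo])); last exact: cvg_cst.
  by apply: near_eq_cvg; have := Ds_near ab gw; apply: filterS => t ->.
Qed.

(** Number of points in the two margins between the closed interval and its rational enlargement;
    its expectation is of order 1 / t. *)
Definition err t c : seq R -> R := fun s =>
  if c.1 <= c.2 then (cnt `]qv (lo c.1 t), c.1[%classic s)%:R +
     (cnt `]c.2, qv (hi c.2 t)]%classic s)%:R else 0.

Lemma err_ge0 t c s : 0 <= err t c s.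
Proof. by rewrite /err; case: ifP. Qed.

Lemma cnt_out t c s : (cnt (out t c) s)%:R = (cnt (ins_ c) s)%:R + err t c s :> R.
Proof.
rewrite /err /out /ins_; case: leP => cc; last first.
  rewrite addr0 set_itv_ge//; by rewrite bnd_simp -ltNge.
rewrite -!natrD; congr _%:R; elim: s => [//|x s IH]; rewrite !cnt_cons IH.
have /andP[_ l2] := loP c.1 t; have /andP[u1 _] := hiP c.2 t.
suff -> : nat_of_bool `[< `]qv (lo c.1 t), qv (hi c.2 t)]%classic x >] =
  (`[< `[c.1, c.2]%classic x >] + `[< `]qv (lo c.1 t), c.1[%classic x >] +
   `[< `]c.2, qv (hi c.2 t)]%classic x >])%N by lia.
have as1 (a b : R) : `[< `]a, b]%classic x >] = (a < x <= b).
  by apply/asboolP/idP; rewrite /= in_itv.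
have as2 (a b : R) : `[< `]a, b[%classic x >] = (a < x < b).
  by apply/asboolP/idP; rewrite /= in_itv.
have as3 (a b : R) : `[< `[a, b]%classic x >] = (a <= x <= b).
  by apply/asboolP/idP; rewrite /= in_itv.
rewrite !as1 as2 as3; set a := qv _ in l2 *; set b := qv _ in u1 *.
have [h1|h1] := ltP x c.1.
  have h2 : x <= c.2 by apply: ltW; exact: lt_le_trans cc.
  rewrite (ltNge c.2) h2/= (le_trans h2 (ltW u1)) andbT.
  by case: (a < x).
rewrite (lt_le_trans l2 h1)/=.
have [h2|h2] := leP x c.2; first by rewrite (le_trans h2 (ltW u1)).
by case: (x <= b).
Qed.

Definition Mc c : R := `|c.1| + `|c.2| + 1.

Lemma ins_sub c : ins_ c `<=` `[- Mc c, Mc c]%classic.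
Proof.
move=> x; rewrite /ins_ /Mc /= !in_itv/= => /andP[h1 h2].
have := ler_norm c.2; have := lerNnormlW (lexx `|c.1|) => h3 h4.
have := normr_ge0 c.1; have := normr_ge0 c.2 => h5 h6.
by apply/andP; split; lra.
Qed.

Lemma inv_le1 t : t.+1%:R^-1 <= 1 :> R.
Proof. by rewrite invf_le1// ler1n. Qed.

Lemma out_sub t c : out t c `<=` `[- Mc c, Mc c]%classic.
Proof.
rewrite /out; case: leP => cc x; last by [].
rewrite /Mc /= !in_itv/= => /andP[h1 h2].
have := ler_norm c.2; have := lerNnormlW (lexx `|c.1|) => h3 h4.
have := normr_ge0 c.1; have := normr_ge0 c.2 => h5 h6.
have /andP[l1 l2] := loP c.1 t; have /andP[u1 u2] := hiP c.2 t.
move: (inv_le1 t) l1 u2; move: (t.+1%:R^-1) => i h7 l1 u3.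
by apply/andP; split; lra.
Qed.

Lemma out_meas t c : measurable (out t c).
Proof. by rewrite /out; case: ifP => _; [exact: measurable_itv|exact: measurable0]. Qed.

Lemma nice_err t c : nice (Mc c) (err t c).
Proof.
have n1 := nice_cnt (out_meas t c) (@out_sub t c).
have n2 := nice_cnt (measurable_itv `[c.1, c.2]) (@ins_sub c).
have := niceD n1 (niceZ (-1) n2); congr nice; apply/funext => s.
by rewrite cnt_out mulN1r addrAC subrr add0r.
Qed.

Lemma C_ge0 : 0 <= C.
Proof. exact: bker_ge0 bk. Qed.

Lemma E_err_le t c : E (err t c) <= 2 * C / t.+1%:R.
Proof.
have i0 : 0 <= t.+1%:R^-1 :> R by rewrite invr_ge0.
have [cc|cc] := leP c.1 c.2; last first.
  rewrite /err (_ : (fun s => _) = fun=> 0).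
    by rewrite (E_0 mS bk) divr_ge0// mulr_ge0// C_ge0.
  by apply/funext => s; rewrite leNgt cc.
have sub1 : `]qv (lo c.1 t), c.1[%classic `<=` out t c.
  rewrite /out cc => x; rewrite /= !in_itv/= => /andP[-> h]/=.
  have /andP[u1 u2] := hiP c.2 t.
  by rewrite (le_trans (ltW h))// (le_trans cc)// ltW.
have sub2 : `]c.2, qv (hi c.2 t)]%classic `<=` out t c.
  rewrite /out cc => x; rewrite /= !in_itv/= => /andP[h ->]/=; rewrite andbT.
  have /andP[u1 u2] := loP c.1 t.
  by rewrite (lt_trans u2)// (le_lt_trans cc).
have m1 := measurable_itv `]qv (lo c.1 t), c.1[.
have m2 := measurable_itv `]c.2, qv (hi c.2 t)].
have s1 := subset_trans sub1 (@out_sub t c).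
have s2 := subset_trans sub2 (@out_sub t c).
have -> : err t c = fun s => (cnt `]qv (lo c.1 t), c.1[%classic s)%:R +
     (cnt `]c.2, qv (hi c.2 t)]%classic s)%:R by apply/funext => s; rewrite /err cc.
rewrite (EED mS bk (nice_cnt m1 s1) (nice_cnt m2 s2)).
have C0 := C_ge0.
have h1 := E_cnt_le mS bk m1 s1; have h2 := E_cnt_le mS bk m2 s2.
have /andP[l1 l2] := loP c.1 t; have /andP[u1 u2] := hiP c.2 t.
have k1 : fine (mu (S `&` `]qv (lo c.1 t), c.1[%classic)) <= t.+1%:R^-1.
  apply: le_trans (_ : c.1 - qv (lo c.1 t) <= _); last by rewrite lerBlDr -lerBlDl ltW.
  apply: (mu_itv_le mS) => //; first exact: ltW.
  by move=> x /=; rewrite !in_itv/= => /andP[h3 h4]; rewrite !ltW.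
have k2 : fine (mu (S `&` `]c.2, qv (hi c.2 t)]%classic)) <= t.+1%:R^-1.
  apply: le_trans (_ : qv (hi c.2 t) - c.2 <= _); last by rewrite lerBlDl ltW.
  apply: (mu_itv_le mS) => //; first exact: ltW.
  by move=> x /=; rewrite !in_itv/= => /andP[h3 h4]; rewrite h4 ltW.
apply: le_trans (lerD h1 h2) _.
rewrite -mulrDr mulrAC mulrC; apply: ler_wpM2r => //.
by rewrite mulr_natl mulr2n lerD.
Qed.

Definition Mab ab : R := \sum_(c <- ab) Mc c.

Lemma Mab_ge ab c : List.In c ab -> Mc c <= Mab ab.
Proof.
have Mc0 d : 0 <= Mc d by rewrite /Mc !addr_ge0.
rewrite /Mab; elim: ab => [//|d ab IH] /= [->|/IH h]; rewrite big_cons.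
  by rewrite lerDl sumr_ge0.
by apply: le_trans h _; rewrite lerDr.
Qed.

Lemma nice_errs t ab : nice (Mab ab) (fun s => \sum_(c <- ab) err t c s) /\
  E (fun s => \sum_(c <- ab) err t c s) <= (size ab)%:R * (2 * C / t.+1%:R).
Proof.
elim: ab => [|c ab [IH1 IH2]].
  rewrite (_ : (fun s => _) = (fun=> 0)); last by apply/funext => s; rewrite big_nil.
  rewrite (E_0 mS bk) mul0r; split=> //.
  apply: (@nice_cnts R _ [::] (fun=> 0) 1 1) => // s.
  by rewrite normr0 expr1n mulr1.
have Mc0 d : 0 <= Mc d by rewrite /Mc !addr_ge0.
have MM : Mab (c :: ab) = Mc c + Mab ab by rewrite /Mab big_cons.
have M0 : 0 <= Mab ab by apply: sumr_ge0.
have -> : (fun s => \sum_(c0 <- c :: ab) err t c0 s) =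
  (fun s => err t c s + \sum_(c <- ab) err t c s) by apply/funext => s; rewrite big_cons.
have n1 : nice (Mab (c :: ab)) (err t c).
  by apply: niceS (nice_err t c); rewrite MM lerDl.
have n2 : nice (Mab (c :: ab)) (fun s => \sum_(c <- ab) err t c s).
  by apply: niceS IH1; rewrite MM lerDr.
split; first exact: niceD.
rewrite (EED mS bk n1 n2) /= -add1n natrD mulrDl mul1r lerD//.
exact: E_err_le.
Qed.

(** If the two count vectors differ, some margin contains a point and the right side is at least 1,
    whereas [Phi] varies by at most 1. *)
Lemma Phi_diff t ab (Phi : seq nat -> R) s : (forall z, 0 <= Phi z <= 1) ->
  `|Phi (cnts [seq out t c | c <- ab] s) - Phi (cnts [seq ins_ c | c <- ab] s)| <=
  \sum_(c <- ab) err t c s.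
Proof.
move=> bPhi.
have e0 : 0 <= \sum_(c <- ab) err t c s by apply: sumr_ge0 => c _; exact: err_ge0.
have [e|ne] := eqVneq (cnts [seq out t c | c <- ab] s) (cnts [seq ins_ c | c <- ab] s).
  by rewrite e subrr normr0.
apply: (@le_trans _ _ 1).
  have /andP[h1 h2] := bPhi (cnts [seq out t c | c <- ab] s).
  have /andP[h3 h4] := bPhi (cnts [seq ins_ c | c <- ab] s).
  by rewrite ler_norml; apply/andP; split; lra.
rewrite leNgt; apply: contra ne => lt1; apply/eqP.
rewrite /cnts -!map_comp; apply/eq_in_map => c cab /=.
have lec : err t c s <= \sum_(c <- ab) err t c s.
  by rewrite (big_rem c)//= lerDl sumr_ge0// => d _; exact: err_ge0.
have := cnt_out t c s => h.
have : (cnt (out t c) s)%:R < (cnt (ins_ c) s).+1%:R :> R by rewrite h -natr1; lra.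
have : (cnt (ins_ c) s)%:R <= (cnt (out t c) s)%:R :> R by rewrite h lerDl err_ge0.
rewrite ler_nat ltr_nat; lia.
Qed.

Lemma nice_Phi (f : R * R -> set R) ab (Phi : seq nat -> R) (A : R) :
  (forall c, measurable (f c)) -> (forall c, f c `<=` `[- Mc c, Mc c]%classic) ->
  (forall z, `|Phi z| <= A) -> nice (Mab ab) (fun s => Phi (cnts [seq f c | c <- ab] s)).
Proof.
move=> mf sf bPhi; have A0 : 0 <= A by exact: le_trans (bPhi [::]).
apply: (@nice_cnts R _ _ Phi A 1) => //; last by move=> s; rewrite expr1n mulr1.
move=> B /List.in_map_iff[c [<- /Mab_ge h]]; split=> // x /sf /=.
by rewrite !in_itv/= => /andP[h1 h2]; apply/andP; split; lra.
Qed.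

(** Both sides are limits of their analogues for the rational enlargements: the left one by bounded
    convergence, the counts being eventually constant at each good [w], and the right one because
    the margins have small expectation. *)
Theorem transfer ab (Phi : seq nat -> R) : (forall z, 0 <= Phi z <= 1) ->
  \int[P]_w Phi (vw ab w) = E (fun s => Phi (cnts [seq ins_ c | c <- ab] s)).
Proof.
move=> bPhi.
have bn z : `|Phi z| <= 1 by have /andP[h1 h2] := bPhi z; rewrite ger0_norm.
suff cv : \int[P]_w Phi [seq Dc t c (Z w) | c <- ab] @[t --> \oo] -->
    E (fun s => Phi (cnts [seq ins_ c | c <- ab] s)).
  have cv' := @cvg_PDs ab Phi bPhi; exact: (cvg_unique _ cv' cv).
under eq_fun do rewrite PDs//.
have n1 t := nice_Phi ab (out_meas t) (@out_sub t) bn.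
have n2 := nice_Phi ab (fun c => measurable_itv `[c.1, c.2]) ins_sub bn.
apply: cvg_subl0; apply/cvgr0Pnorm_le => e e0.
have key t : `|E (fun s => Phi (cnts [seq ins_ c | c <- ab] s)) -
    E (fun s => Phi (cnts [seq out t c | c <- ab] s))| <= (size ab)%:R * (2 * C / t.+1%:R).
  have [n3 le3] := nice_errs t ab; apply: le_trans le3.
  have EB G1 G2 : nice (Mab ab) G1 -> nice (Mab ab) G2 -> 
      (forall s, `|G1 s - G2 s| <= \sum_(c <- ab) err t c s) ->
      E G1 - E G2 <= E (fun s => \sum_(c <- ab) err t c s).
    move=> m1 m2 h.
    have -> : E G1 - E G2 = E (fun s => G1 s + -1 * G2 s).
      by rewrite (EED mS bk m1 (niceZ _ m2)) (EEZ mS bk _ m2) mulN1r.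
    apply: (E_le mS bk Hpos (niceD m1 (niceZ _ m2)) n3) => s.
    by rewrite mulN1r; apply: le_trans (ler_norm _) (h s).
  rewrite ler_norml lerNl opprB; apply/andP; split; apply: EB => // s.
    exact: Phi_diff.
  by rewrite distrC; exact: Phi_diff.
have C0 := C_ge0.
have D0 : 0 < (size ab)%:R * (2 * C) + 1 by rewrite ltr_wpDl// mulr_ge0// mulr_ge0.
near=> t; apply: le_trans (key t) _.
rewrite mulrA; apply: (@le_trans _ _ (((size ab)%:R * (2 * C) + 1) / t.+1%:R)).
  by rewrite ler_wpM2r ?invr_ge0// lerDl.
rewrite [leLHS]mulrC -ler_pdivlMr//; near: t; apply: inv_near0; exact: divr_gt0.
Unshelve. all: by end_near. Qed.


Lemma Pprob ab (Q : seq nat -> bool) :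
  fine (P [set w | Q (vw ab w)]) = E (fun s => (Q (cnts [seq ins_ c | c <- ab] s))%:R).
Proof.
have mQ : measurable ([set w | Q (vw ab w)] : set Om).
  exact: (@measurable_countable_set _ Om _ (vw ab) (fun z => Q z) (fun z => vw_meas ab z)).
rewrite -(@transfer ab (fun z => (Q z)%:R)); last first.
  by move=> z; case: (Q z); rewrite ?lexx ?ler01.
rewrite -[X in P X]setIT -integral_indic// /Rintegral; congr fine.
apply: eq_integral => w _; rewrite indicE; congr (_%:R%:E); congr nat_of_bool.
by apply/idP/idP => h; [exact: (set_mem h)|exact: mem_set].
Qed.

Lemma xi_point_process : point_process P S xi.
Proof.
split; [|split].
- exact: (xi_sub mS bk Hpos HS).
- move=> w a b; have [gw|ng] := pselect (goodw w); last first.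
    by rewrite xi_bad// set0I; exact: finite_set0.
  have [ab|ab] := leP a b; last first.
    by rewrite set_itv_ge ?setI0; [exact: finite_set0|rewrite bnd_simp -ltNge].
  by have [i0 [j0 [_ _ h _]]] := xi_npts mS bk Hpos gw ab.
- move=> a b k; have := vw_meas [:: (a, b)] [:: k].
  by congr measurable; apply/seteqP; split=> w; rewrite /vw /=; [case|move=> ->].
Qed.

(** The product of counts is capped at [K] and scaled into [0, 1], where [transfer] applies;
    dividing by K + 1 keeps the case K = 0 meaningful. *)
Definition pcap (K : nat) (z : seq nat) : R := Num.min (\prod_(i <- z) i)%:R K%:R / K.+1%:R.

Lemma pcap01 K z : 0 <= pcap K z <= 1.
Proof.
rewrite /pcap divr_ge0 ?le_min ?ler0n//= ler_pdivrMr// mul1r.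
by rewrite ge_min orbC ler_nat leqnSn.
Qed.

Definition ivs ab := [seq ins_ c | c <- ab].

Lemma prod_cnts_le ab (s : seq R) :
  ((\prod_(i <- cnts (ivs ab) s) i)%:R : R) <= (2 ^+ size ab) ^+ size s.
Proof.
rewrite -exprM mulnC exprM; elim: ab => [|c ab IH]; first by rewrite /= big_nil expr0.
rewrite /ivs /= big_cons natrM exprS ler_pM//.
by apply: le_trans (natr_le_exp _ _); rewrite ler_nat cnt_size.
Qed.

Lemma nice_prod ab (m : nat) :
  nice (Mab ab) (fun s => ((\prod_(i <- cnts (ivs ab) s) i)%:R : R) ^+ m).
Proof.
apply: (@nice_cnts R _ _ (fun z => ((\prod_(i <- z) i)%:R : R) ^+ m) 1 ((2 ^+ size ab) ^+ m)) => //.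
- move=> B /List.in_map_iff[c [<- /Mab_ge h]]; split; first exact: measurable_itv.
  move=> x /ins_sub /=.
  by rewrite !in_itv/= => /andP[h1 h2]; apply/andP; split; lra.
- move=> s; rewrite mul1r ger0_norm ?exprn_ge0// -exprM mulnC exprM lerXn2r ?nnegrE ?exprn_ge0//.
  exact: prod_cnts_le.
Qed.

(** Monotone convergence is not at hand for [E]; it is replaced by a second moment, finite because
    squares of products of counts still grow exponentially. *)
Lemma E_pcap_cvg ab : E (fun s => Num.min (\prod_(i <- cnts (ivs ab) s) i)%:R K%:R)
  @[K --> \oo] --> E (fun s => (\prod_(i <- cnts (ivs ab) s) i)%:R).
Proof.
set G := fun s => (\prod_(i <- cnts (ivs ab) s) i)%:R : R.
have nG : nice (Mab ab) G by have := nice_prod ab 1.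
have nG2 := nice_prod ab 2.
have nK K : nice (Mab ab) (fun s => Num.min (G s) K%:R).
  have hb z : `|pcap K z| <= 1 by have /andP[h1 h2] := pcap01 K z; rewrite ger0_norm.
  have := niceZ K.+1%:R (@nice_Phi _ ab (pcap K) 1 (fun c => measurable_itv `[c.1, c.2]) ins_sub hb).
  congr nice; apply/funext => s.
  by rewrite /pcap mulrC divfK// pnatr_eq0.
pose c2 := E (fun s => (G s) ^+ 2).
(* Pointwise, G - min(G, K) is at most G^2 / K. *)
have key K : 0 <= E G - E (fun s => Num.min (G s) K.+1%:R) <= c2 / K.+1%:R.
  have -> : E G - E (fun s => Num.min (G s) K.+1%:R) = E (fun s => G s + -1 * Num.min (G s) K.+1%:R).
    by rewrite (EED mS bk nG (niceZ _ (nK K.+1))) (EEZ mS bk _ (nK K.+1)) mulN1r.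
  have nd := niceD nG (niceZ (-1) (nK K.+1)).
  apply/andP; split.
    by apply: (Hpos nd) => s; rewrite mulN1r subr_ge0 ge_min lexx.
  rewrite mulrC -(EEZ mS bk _ nG2); apply: (E_le mS bk Hpos nd (niceZ _ nG2)) => s.
  rewrite mulN1r; have G0 : 0 <= G s by [].
  rewrite minElt; case: ltP => h.
    by rewrite subrr mulr_ge0 ?invr_ge0// exprn_ge0.
  apply: (@le_trans _ _ (G s)); first by rewrite lerBlDr lerDl.
  by rewrite mulrC ler_pdivlMr// expr2 ler_wpM2l.
have c20 : 0 <= c2 by apply: (Hpos nG2) => s; exact: sqr_ge0.
rewrite -(cvg_shiftS (fun K => E (fun s => Num.min (G s) K%:R))); apply: cvg_subl0.
apply/cvgr0Pnorm_le => e e0.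
have D0 : 0 < e / (c2 + 1) by rewrite divr_gt0// ltr_wpDl.
near=> K; have /andP[h1 h2] := key K; rewrite ger0_norm//; apply: le_trans h2 _.
apply: (@le_trans _ _ ((c2 + 1) / K.+1%:R)).
  by rewrite ler_wpM2r ?invr_ge0// lerDl.
rewrite [leLHS]mulrC -ler_pdivlMr ?ltr_wpDl//; near: K; exact: inv_near0.
Unshelve. all: by end_near. Qed.

Lemma int_prod ab :
  (\int[P]_w ((\prod_(i <- vw ab w) i)%:R)%:E)%E =
  (E (fun s => (\prod_(i <- cnts (ivs ab) s) i)%:R))%:E.
Proof.
pose g (K : nat) (w : Om) : \bar R := (Num.min (\prod_(i <- vw ab w) i)%:R K%:R)%:E.
have mf (f : seq nat -> R) : measurable_fun setT (fun w : Om => (f (vw ab w))%:E).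
  by apply: measurableT_comp => //; exact: vw_fun_meas.
have cv1 : (\int[P]_w g K w)%E @[K --> \oo] --> (\int[P]_w ((\prod_(i <- vw ab w) i)%:R)%:E)%E.
  have -> : (\int[P]_w ((\prod_(i <- vw ab w) i)%:R)%:E)%E = (\int[P]_w limn (g^~ w))%E.
    apply: eq_integral => w _; apply/esym/cvg_lim => //.
    apply: (@cvg_trans _ (((\prod_(i <- vw ab w) i)%:R)%:E @[K --> \oo])); last exact: cvg_cst.
    apply: near_eq_cvg; near=> K; rewrite /g; congr EFin; apply/esym/min_idPl.
    by rewrite ler_nat; near: K; exact: nbhs_infty_ge.
  apply: cvg_monotone_convergence => //.
  - by move=> K; exact: (mf (fun z => Num.min (\prod_(i <- z) i)%:R K%:R)).
  - by move=> K w _; rewrite /g lee_fin le_min !ler0n.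
  - move=> w _ K1 K2 K12; rewrite /g lee_fin le_min ge_min lexx/=.
    by rewrite ge_min; apply/orP; right; rewrite ler_nat.
have gE K : (\int[P]_w g K w)%E = (E (fun s => Num.min (\prod_(i <- cnts (ivs ab) s) i)%:R K%:R))%:E.
  have K0 : K.+1%:R != 0 :> R by rewrite pnatr_eq0.
  have gK w : g K w = ((K.+1%:R * pcap K (vw ab w))%R)%:E.
    by rewrite /g /pcap mulrC divfK.
  have hb z : `|pcap K z| <= 1 by have /andP[h1 h2] := pcap01 K z; rewrite ger0_norm.
  have nP := @nice_Phi _ ab (pcap K) 1 (fun c => measurable_itv `[c.1, c.2]) ins_sub hb.
  have -> : (fun s => Num.min (\prod_(i <- cnts (ivs ab) s) i)%:R K%:R) =
      fun s => K.+1%:R * pcap K (cnts (ivs ab) s) :> R.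
    by apply/funext => s; rewrite /pcap mulrC divfK.
  rewrite (EEZ mS bk _ nP) -(transfer ab (pcap01 K)).
  have mp : measurable_fun setT (fun w : Om => K.+1%:R * pcap K (vw ab w)).
    exact: (vw_fun_meas ab (fun z => K.+1%:R * pcap K z)).
  transitivity (\int[P]_w ((K.+1%:R * pcap K (vw ab w))%R)%:E)%E.
    by apply: eq_integral => w _; rewrite gK.
  rewrite (@EFin_Rintegral _ Om R P setT measurableT PT_fin _ K.+1%:R mp); last first.
    by move=> w _; rewrite normrM ger0_norm// -[leRHS]mulr1 ler_wpM2l.
  rewrite RintegralZl//.
  exact: (@bounded_integrable _ Om R P setT measurableT PT_fin _ 1 (vw_fun_meas ab (pcap K)) (fun w _ => hb _)).
have cv2 : (\int[P]_w g K w)%E @[K --> \oo] -->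
    (E (fun s => (\prod_(i <- cnts (ivs ab) s) i)%:R))%:E.
  under eq_fun do rewrite gE.
  by apply: cvg_EFin; [near=> K|exact: E_pcap_cvg].
exact: (cvg_unique _ cv1 cv2).
Unshelve. all: by end_near. Qed.

End Transfer.

Theorem process_exists (R : realType) (S : set R) (kf : R -> R -> R) (C : R) :
  measurable S -> bker kf C ->
  (forall M G, nice M G -> (forall s, 0 <= G s) -> 0 <= EE S kf G) ->
  (forall x, ~ S x -> exists u v : rat, ratr u < x < ratr v /\
     fine (lebesgue_measure (S `&` `]ratr u, ratr v]%classic)) = 0) ->
  exists xi : measurableTypeR R -> set R, point_process (Punit R) S xi /\
  (forall m (a b : 'I_m -> R) (k : 'I_m -> nat),
    fine (Punit R [set w | forall i, npts (xi w) `[a i, b i] = k i]) =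
    EE S kf (fun s => (`[< forall i, cnt `[a i, b i]%classic s = k i >])%:R)) /\
  (forall n (a b : 'I_n -> R),
     (forall i j, i != j -> `[a i, b i] `&` `[a j, b j] = set0) ->
     (\int[Punit R]_w ((\prod_(i < n) npts (xi w) `[a i, b i])%:R)%:E)%E =
     (rint [seq S `&` `[a i, b i]%classic | i <- enum 'I_n] (Dks kf))%:E).
Proof.
move=> mS bk Hpos HS; exists (jumpset S kf); split; [|split].
- exact: xi_point_process mS bk Hpos HS.
- move=> m a b k.
  pose ab := [seq (a i, b i) | i <- enum 'I_m].
  pose kk := [seq k i | i <- enum 'I_m].
  have eqk (f : 'I_m -> nat) : (forall i, f i = k i) <-> [seq f i | i <- enum 'I_m] = kk.
    split=> [h|/eq_in_map h i]; first exact: eq_map.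
    by apply: h; rewrite mem_enum.
  have -> : [set w | forall i, npts (jumpset S kf w) `[a i, b i] = k i] =
      [set w | vw S kf ab w == kk].
    apply/seteqP; split=> w /=.
      move=> /(eqk (fun i => npts (jumpset S kf w) `[a i, b i])) h.
      by rewrite /vw /ab -map_comp; apply/eqP; exact: h.
    move=> /eqP h; apply/(eqk (fun i => npts (jumpset S kf w) `[a i, b i])).
    by rewrite -h /vw /ab -map_comp.
  rewrite (Pprob mS bk Hpos ab (fun z => z == kk)).
  congr EE; apply/funext => s; congr (nat_of_bool _)%:R.
  have -> : cnts [seq ins_ c | c <- ab] s = [seq cnt `[a i, b i]%classic s | i <- enum 'I_m].
    by rewrite /cnts /ab; elim: (enum 'I_m) => //= i l ->.
  by apply/eqP/asboolP => /(eqk (fun i => cnt `[a i, b i]%classic s)).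
- move=> n a b dab.
  pose ab := [seq (a i, b i) | i <- enum 'I_n].
  transitivity (\int[Punit R]_w ((\prod_(i <- vw S kf ab w) i)%:R)%:E)%E.
    by apply: eq_integral => w _; congr (_%:R%:E); rewrite /vw /ab -big_enum; elim: (enum 'I_n) => [|i l IH] /=; rewrite ?big_nil// !big_cons IH.
  rewrite (int_prod mS bk Hpos ab); congr EFin.
  have ivE : ivs ab = [seq `[a i, b i]%classic | i <- enum 'I_n].
    by rewrite /ivs /ab; elim: (enum 'I_n) => //= i l ->.
  have sz : size (enum 'I_n) = n by rewrite size_enum_ord.
  have := @EE_prod_cnt R S kf C mS bk (Mab ab) (ivs ab).
  have -> : (fun s => \prod_(B <- ivs ab) (cnt B s)%:R) =
      (fun s => (\prod_(i <- cnts (ivs ab) s) i)%:R : R).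
    by apply/funext => s; rewrite /cnts big_map natr_prod.
  move=> ->.
  + by rewrite ivE; congr rint; elim: (enum 'I_n) => //= i l ->.
  + rewrite ivE => i j; rewrite size_map sz => iN jN ij.
    have nE l (lN : (l < n)%N) : nth set0 [seq `[a i, b i]%classic | i <- enum 'I_n] l =
        `[a (Ordinal lN), b (Ordinal lN)]%classic.
      rewrite (@nth_map _ (Ordinal lN) _ set0 (fun i => `[a i, b i]%classic) l (enum 'I_n)) ?sz//.
      by have := nth_ord_enum (Ordinal lN) (Ordinal lN) => /= ->.
    by rewrite (nE _ iN) (nE _ jN); exact: dab.
  + move=> B /List.in_map_iff[c [<- /Mab_ge h]]; split; first exact: measurable_itv.
    move=> x /ins_sub /=.
    by rewrite !in_itv/= => /andP[h1 h2]; apply/andP; split; lra.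
Qed.

(** * Theta functions and the finite systems *)

Section ZSeries.
Variable R : realType.
Notation mu := (@lebesgue_measure R).
Implicit Types (f g : int -> R) (A c : R).

(** Folds a two-sided series into a one-sided one by grouping n and -n, which matches the symmetric
    partial sums in [zsum]. *)
Definition zb f (n : nat) : R := if n == 0%N then f 0 else f n%:Z + f (- n%:Z).

Definition zs f : R := limn (series (zb f)).

Definition gb A c f := forall n : int, `|f n| <= A * c ^+ `|n|%N.

Lemma zb_bound A c f n : gb A c f -> 0 <= A * c ^+ n -> `|zb f n| <= geometric (2 * A) c n.
Proof.
move=> h h0; rewrite /zb /geometric /=; case: eqP => [->|_].
  have := h 0; rewrite absz0 !expr0 !mulr1 => h1; have := normr_ge0 (f 0); lra.
apply: le_trans (ler_normD _ _) _; have := h n%:Z; have := h (- n%:Z).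
by rewrite abszN absz_nat => h1 h2; lra.
Qed.

Lemma gb_ge0 A c f : gb A c f -> 0 <= A.
Proof. by move=> /(_ 0); rewrite absz0 expr0 mulr1; apply: le_trans. Qed.

Lemma zb_le A c f : 0 <= c -> gb A c f -> forall n, `|zb f n| <= geometric (2 * A) c n.
Proof.
move=> c0 h n; apply: zb_bound => //; rewrite mulr_ge0 ?exprn_ge0//.
exact: gb_ge0 h.
Qed.

Lemma cvg_geo A c : 0 <= c < 1 -> cvgn (series (geometric A c)).
Proof. by move=> /andP[c0 c1]; apply: is_cvg_geometric_series; rewrite ger0_norm. Qed.

Lemma zs_cvg A c f : 0 <= c < 1 -> gb A c f -> series (zb f) n @[n --> \oo] --> zs f.
Proof.
move=> c01 h; have /andP[c0 _] := c01.
have cs : cvgn (series (zb f)) := cvg_series_dom (zb_le c0 h) (@cvg_geo _ _ c01).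
exact: cs.
Qed.

Lemma eq_zs f g : f =1 g -> zs f = zs g.
Proof. by move=> /funext ->. Qed.

Lemma gbZ A c a f : gb A c f -> gb (`|a| * A) c (fun n => a * f n).
Proof. by move=> h n; rewrite normrM -mulrA ler_wpM2l. Qed.

Lemma zsD A1 A2 c f g : 0 <= c < 1 -> gb A1 c f -> gb A2 c g ->
  zs (fun n => f n + g n) = zs f + zs g.
Proof.
move=> c01 h1 h2; apply/cvg_lim => //.
rewrite (_ : zb _ = fun n => zb f n + zb g n).
  exact: series_cvgD (zs_cvg c01 h1) (zs_cvg c01 h2).
by apply/funext => n; rewrite /zb; case: eqP => // _; ring.
Qed.

Lemma zsZ A c a f : 0 <= c < 1 -> gb A c f -> zs (fun n => a * f n) = a * zs f.
Proof.
move=> c01 h; apply/cvg_lim => //.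
rewrite (_ : zb _ = fun n => a * zb f n); first exact: series_cvgZ (zs_cvg c01 h).
by apply/funext => n; rewrite /zb; case: eqP => // _; ring.
Qed.

Lemma zs_opp f : zs (fun n => f (- n)) = zs f.
Proof.
rewrite /zs (_ : zb _ = zb f)//; apply/funext => n; rewrite /zb oppr0 opprK.
by case: eqP => // _; rewrite addrC.
Qed.

Lemma zsum_series f K : \sum_(k < (2 * K).+1) f (k%:Z - K%:Z) = series (zb f) K.+1.
Proof.
elim: K => [|K IH].
  by rewrite big_ord1 /series/= big_nat1 /zb eqxx; congr f.
rewrite seriesS -IH (_ : (2 * K.+1).+1 = (2 * K).+3); last by lia.
rewrite big_ord_recl big_ord_recr/=.
have -> : \sum_(i < (2 * K).+1) f ((bump 0 i)%:Z - K.+1%:Z) = \sum_(k < (2 * K).+1) f (k%:Z - K%:Z).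
  by apply: eq_bigr => k _; congr f; rewrite /bump /=; lia.
have -> : (bump 0 (2 * K).+1)%:Z - K.+1%:Z = K.+1%:Z by rewrite /bump /=; lia.
have -> : 0%:Z - K.+1%:Z = - K.+1%:Z by lia.
by rewrite /zb /=; ring.
Qed.

(** The reflection n to 1 - n carries the summation range -K, ..., K to 1 - K, ..., K + 1; only the
    two end terms differ, and they tend to 0. *)
Lemma zs_shift A c f : 0 <= c < 1 -> gb A c f -> zs (fun n => f (1 - n)) = zs f.
Proof.
move=> c01 h; have /andP[c0 c1] := c01.
have A0 := gb_ge0 h.
have pE K : series (zb (fun n => f (1 - n))) K.+1 =
    series (zb f) K.+1 + (f K.+1%:Z - f (- K%:Z)).
  rewrite -!zsum_series.
  rewrite (reindex_inj rev_ord_inj)/= [in RHS]big_ord_recl [in LHS]big_ord_recr /=.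
  rewrite (_ : 1 - _ = K.+1%:Z); last by lia.
  rewrite (_ : 0%:Z - K%:Z = - K%:Z); last by lia.
  have -> : forall a b c : R, a + b + (c - a) = b + c by move=> *; ring.
  congr (_ + _).
  by apply: eq_bigr => k _; congr f; rewrite /bump; have := ltn_ord k; lia.
have c1' : `|c| < 1 by rewrite ger0_norm.
have cf (g : nat -> int) : (forall K, (K <= `|g K|)%N) -> f (g K) @[K --> \oo] --> 0.
  move=> hg; apply: norm_cvg0.
  apply: (@squeeze_cvgr _ _ _ _ (fun=> 0) (fun K => A * c ^+ K)).
  - near=> K; rewrite normr_ge0/=; apply: le_trans (h _) _.
    by rewrite ler_wpM2l// ler_wiXn2l// ltW.
  - exact: cvg_cst.
  - by rewrite -(mulr0 A); apply: cvgM; [exact: cvg_cst|exact: cvg_expr].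
have cv : series (zb f) K.+1 + (f K.+1%:Z - f (- K%:Z)) @[K --> \oo] --> zs f + (0 - 0).
  apply: cvgD; first by have := zs_cvg c01 h; rewrite -cvg_shiftS.
  apply: cvgB.
  - by apply: (cf (fun K => K.+1%:Z)) => K; rewrite absz_nat.
  - by apply: (cf (fun K => - K%:Z)) => K; rewrite abszN absz_nat.
apply/cvg_lim => //; rewrite -cvg_shiftS.
move: cv; rewrite subr0 addr0; apply: cvg_trans; apply: near_eq_cvg; near=> K.
by rewrite /= pE.
Unshelve. all: by end_near. Qed.

Lemma zs_bound A c f : 0 <= c < 1 -> gb A c f -> `|zs f| <= 2 * A / (1 - c).
Proof.
move=> c01 h; have /andP[c0 c1] := c01; have A0 := gb_ge0 h.
have := series_tail 0 (zb_le c0 h) (@cvg_geo _ _ c01).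
rewrite /series/= !big_geq// !subr0 => /le_trans; apply.
have c1' : `|c| < 1 by rewrite ger0_norm.
have := @cvg_geometric_series _ (2 * A) c c1'.
by move/cvg_lim => ->.
Qed.

Lemma zs_tannery (u : nat -> int -> R) v A c : 0 <= c < 1 -> (forall N, gb A c (u N)) ->
  (forall n, u N n @[N --> \oo] --> v n) -> zs (u N) @[N --> \oo] --> zs v.
Proof.
move=> c01 h cu; have /andP[c0 _] := c01.
apply: (tannery (g := geometric (2 * A) c)).
- by move=> N n; exact: zb_le.
- exact: cvg_geo.
- by move=> n; rewrite /zb; case: eqP => _; [exact: cu|apply: cvgD; exact: cu].
Qed.

Lemma zs_single (n : int) (a : R) : zs (fun m => if m == n then a else 0) = a.
Proof.
rewrite /zs (lim_series_finite (m := `|n|.+1)); last first.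
  move=> k nk; rewrite /zb; case: eqP => [k0|_]; first by lia.
  by rewrite !ifF ?addr0//; apply/negP => /eqP; lia.
rewrite -zsum_series.
pose i0 := absz (n + (absz n)%:Z)%R.
have i0lt : (i0 < (2 * `|n|).+1)%N by rewrite /i0; lia.
rewrite (bigD1 (Ordinal i0lt))//= ifT; last by apply/eqP; rewrite /i0; lia.
rewrite big1 ?addr0// => k; rewrite -val_eqE/= => ki.
by rewrite ifF//; apply/negP => /eqP h; move/negP: ki; apply; apply/eqP; rewrite /i0; lia.
Qed.

Lemma zs_ge1 A c f : 0 <= c < 1 -> gb A c f -> (forall n, 0 <= f n) -> f 1 <= zs f.
Proof.
move=> c01 h f0; have zc := zs_cvg c01 h.
have zb0 n : 0 <= zb f n by rewrite /zb; case: eqP => // _; rewrite addr_ge0.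
apply: (@le_trans _ _ (series (zb f) 2)).
  rewrite /series/= big_nat_recr//= big_nat1 {2}/zb/= addrA.
  by have := zb0 0%N; have := f0 (- (1)) => h1 h2; lra.
apply: nondecreasing_cvgn_le; last by apply/cvg_ex; exists (zs f).
by apply/nondecreasing_seqP => n; rewrite seriesS lerDr.
Qed.

Lemma zs_measurable d (T : measurableType d) (F : T -> int -> R) A c : 0 <= c < 1 ->
  (forall x, gb A c (F x)) -> (forall n, measurable_fun setT (F^~ n)) ->
  measurable_fun setT (fun x => zs (F x)).
Proof.
move=> c01 h mF; apply: (@measurable_fun_cvg _ T R setT (fun n x => series (zb (F x)) n)).
- move=> m; rewrite /series/=; apply: measurable_sum => n.
  rewrite /zb; case: eqP => _; first exact: mF.
  by apply: measurable_funD; exact: mF.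
- by move=> x _; exact: zs_cvg c01 (h x).
Qed.

Lemma zs_integral B (F : R -> int -> R) A c : bset B -> 0 <= c < 1 ->
  (forall x, gb A c (F x)) -> (forall n, measurable_fun setT (F^~ n)) ->
  \int[mu]_(x in B) zs (F x) = zs (fun n => \int[mu]_(x in B) F x n).
Proof.
move=> bB c01 h mF; have /andP[c0 c1] := c01.
have A0 := gb_ge0 (h 0).
have mz : measurable_fun setT (fun x : R => zs (F x)) by exact: zs_measurable c01 h mF.
have mzb n : measurable_fun setT (fun x : R => zb (F x) n).
  rewrite /zb; case: eqP => _; first exact: mF.
  by apply: measurable_funD; exact: mF.
have iF n : mu.-integrable B (EFin \o F^~ n).
  by apply: (leb_integrable (C := A * c ^+ `|n|%N) bB (mF n)) => x _; exact: h.
have izb n : mu.-integrable B (EFin \o (fun x => zb (F x) n)).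
  apply: (leb_integrable (C := geometric (2 * A) c n) bB (mzb n)) => x _; exact: zb_le.
have zbE n : \int[mu]_(x in B) zb (F x) n = zb (fun n => \int[mu]_(x in B) F x n) n.
  rewrite /zb; case: eqP => _ //; rewrite RintegralD//; exact: bB.1.
have c1' : `|c| < 1 by rewrite ger0_norm.
have cv : \int[mu]_(x in B) series (zb (F x)) n @[n --> \oo] --> \int[mu]_(x in B) zs (F x).
  apply: (leb_cvg (C := 2 * A / (1 - c)) bB) => //.
  - by move=> m; rewrite /series/=; apply: measurable_sum => n.
  - move=> m x _; apply: le_trans (_ : series (geometric (2 * A) c) m <= _).
      rewrite /series/=; apply: le_trans (ler_norm_sum _ _ _) _.
      by apply: ler_sum => n _; exact: zb_le.
    have cg := @cvg_geometric_series _ (2 * A) c c1'.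
    rewrite -(cvg_lim (@Rhausdorff R) cg); apply: nondecreasing_cvgn_le.
      apply/nondecreasing_seqP => n; rewrite seriesS lerDr /geometric/=.
      by rewrite mulr_ge0 ?exprn_ge0// mulr_ge0.
    exact: cvg_geo.
  - by move=> x _; exact: zs_cvg c01 (h x).
apply/esym/cvg_lim => //.
suff <- : (fun n => \int[mu]_(x in B) series (zb (F x)) n) =
   series (zb (fun n => \int[mu]_(x in B) F x n)) by [].
apply/funext => m; rewrite /series/=.
elim: m => [|m IH].
  rewrite big_geq//; under eq_Rintegral do rewrite big_geq//.
  by rewrite Rintegral_cst ?mul0r//; exact: bB.1.
rewrite big_nat_recr//= -IH -zbE -RintegralD//.
- by apply: eq_Rintegral => x _; rewrite big_nat_recr.
- exact: bB.1.
- apply: (leb_integrable (C := \sum_(0 <= n < m) geometric (2 * A) c n) bB).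
    by apply: measurable_sum => n.
  move=> x _; apply: le_trans (ler_norm_sum _ _ _) _.
  by apply: ler_sum => n _; exact: zb_le.
Qed.

End ZSeries.

(** * Gaussian sums over shifted half-integers *)

Section Gauss.
Variable R : realType.
Implicit Types (h w t x : R) (n : int).

(** The n-th frequency: the half-integer n - 1/2 of the theta series scaled by [h], with the shift
    [w] coming from the argument. *)
Definition om h w n : R := h * (n%:~R - 2^-1) + w.
Definition eg h w t n : R := expR (- (t * om h w n ^+ 2 / 2)).
Definition sgn (b : bool) n : R := if b then (-1) ^+ `|n|%N else 1.
(** For [f] among [cos], [sin] and their sum, each term solves the heat equation in (t, x). *)
Definition V b (f : R -> R) h w t x := zs (fun n => sgn b n * eg h w t n * f (om h w n * x)).
Definition ZZ h w t := zs (eg h w t).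

Lemma eg_gt0 h w t n : 0 < eg h w t n.
Proof. exact: expR_gt0. Qed.

Lemma sgn_norm b n : `|sgn b n| = 1.
Proof. by rewrite /sgn; case: b; rewrite ?normrX ?normrN normr1 ?expr1n. Qed.

Definition gA t W : R := expR (t / 2 + t * W).
Definition gc t h0 : R := expR (- (t * h0)).

Lemma gc01 t h0 : 0 < t -> 0 < h0 -> 0 <= gc t h0 < 1.
Proof.
by move=> t0 h00; rewrite expR_ge0/= /gc -expR0 ltr_expR oppr_lt0 mulr_gt0.
Qed.

(** From om^2 >= 2 |om| - 1 and |om| >= h0 |n| - W. Gaussian decay is traded for geometric decay
    with constants depending on [h] and [w] only through [h0] and [W], hence uniform along the
    systems. *)
Lemma gauss_le t h0 h w W n : 0 <= t -> 0 < h0 <= h -> h / 2 + `|w| <= W ->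
  eg h w t n <= gA t W * gc t h0 ^+ `|n|%N.
Proof.
move=> t0 /andP[h00 h0h] hW.
rewrite /eg /gA /gc -expRM_natl -expRD ler_expR.
have nE : `|n%:~R| = `|n|%N%:R :> R by rewrite natr_absz intr_norm.
have hn : h0 * `|n|%N%:R - W <= `|om h w n|.
  have e1 : h * `|n|%N%:R = `|om h w n + (h / 2 - w)|.
    rewrite -nE -[X in X * _]gtr0_norm ?(lt_le_trans h00)// -normrM; congr `|_|.
    by rewrite /om; field.
  have e2 : `|h / 2 - w| <= h / 2 + `|w|.
    apply: le_trans (ler_normB _ _) _; rewrite lerD2r ger0_norm// divr_ge0//.
    exact: le_trans (ltW h00) h0h.
  have e3 := ler_normD (om h w n) (h / 2 - w).
  have e4 : h0 * `|n|%N%:R <= h * `|n|%N%:R by rewrite ler_wpM2r.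
  move: e1 e2 e3 e4 hW; move: (`|n|%N%:R : R) => m.
  by clear; move=> *; lra.
have sq : 2 * `|om h w n| - 1 <= om h w n ^+ 2.
  rewrite -[X in _ <= X]real_normK ?num_real//.
  have := sqr_ge0 (`|om h w n| - 1); rewrite sqrrB1 -mulr_natl; lra.
have : 0 <= t * (om h w n ^+ 2 - (2 * (h0 * `|n|%N%:R - W) - 1)).
  apply: mulr_ge0 => //; move: hn sq; move: (`|n|%N%:R : R) => m; clear; move=> *; lra.
rewrite [X in _ <= _ + X]mulr_natl -[X in _ <= _ + X]mulr_natl.
move: (`|n|%N%:R : R) => m; clear; move=> hh.
have -> : t / 2 + t * W + m * - (t * h0) =
  - (t * om h w n ^+ 2 / 2) + t * (om h w n ^+ 2 - (2 * (h0 * m - W) - 1)) / 2 by field.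
by rewrite lerDl divr_ge0.
Qed.

Lemma gb_eg t h0 h w W : 0 <= t -> 0 < h0 <= h -> h / 2 + `|w| <= W ->
  gb (gA t W) (gc t h0) (eg h w t).
Proof. by move=> *; move=> n; rewrite gtr0_norm ?eg_gt0//; exact: gauss_le. Qed.

(** The bound 2 covers [cos], [sin] and their sum at once. *)
Lemma gb_sgn_eg b (g : int -> R) t h0 h w W : (forall n, `|g n| <= 2) -> 0 <= t ->
  0 < h0 <= h -> h / 2 + `|w| <= W ->
  gb (2 * gA t W) (gc t h0) (fun n => sgn b n * eg h w t n * g n).
Proof.
move=> bf t0 hh hW n; rewrite !normrM sgn_norm mul1r gtr0_norm ?eg_gt0//.
rewrite -mulrA mulrC; apply: ler_pM => //; first exact: expR_ge0.
exact: gauss_le.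
Qed.

Lemma gb_V b (f : R -> R) t h0 h w W x : (forall y, `|f y| <= 2) -> 0 <= t -> 0 < h0 <= h ->
  h / 2 + `|w| <= W ->
  gb (2 * gA t W) (gc t h0) (fun n => sgn b n * eg h w t n * f (om h w n * x)).
Proof. by move=> bf; apply: gb_sgn_eg => n. Qed.

Lemma V_bound b f t h0 h w W x : (forall y, `|f y| <= 2) -> 0 < t -> 0 < h0 <= h ->
  h / 2 + `|w| <= W -> `|V b f h w t x| <= 2 * (2 * gA t W) / (1 - gc t h0).
Proof.
move=> bf t0 hh hW; apply: zs_bound; first by apply: gc01 => //; case/andP: hh.
exact: gb_V (ltW t0) hh hW.
Qed.

Lemma V_meas b (f : R -> R) t h w : measurable_fun setT f -> (forall y, `|f y| <= 2) -> 0 < t -> 0 < h ->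
  measurable_fun setT (V b f h w t).
Proof.
move=> mf bf t0 h0.
apply: (@zs_measurable R _ _ (fun x n => sgn b n * eg h w t n * f (om h w n * x))
   (2 * gA t (h / 2 + `|w|)) (gc t h)); first exact: gc01.
  by move=> x; apply: gb_V; rewrite ?(ltW t0) ?h0 ?lexx.
move=> n; apply: measurable_funM; first exact: measurable_cst.
apply: measurableT_comp => //; apply: measurable_funM => //; exact: measurable_cst.
Qed.

(** All terms are positive, and the one of index 1 has frequency h/2 + w, of modulus at most [W].
    This keeps the denominators of the kernels uniformly away from 0. *)
Lemma ZZ_ge t h0 h w W : 0 < t -> 0 < h0 <= h -> h / 2 + `|w| <= W ->
  expR (- (t * W ^+ 2 / 2)) <= ZZ h w t.
Proof.
move=> t0 hh hW; have /andP[h00 h0h] := hh.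
have := @zs_ge1 R _ _ _ (gc01 t0 h00) (gb_eg (ltW t0) hh hW).
move=> /(_ (fun n => ltW (eg_gt0 _ _ _ n))); apply: le_trans.
rewrite /eg ler_expR lerN2 ler_pM2r ?invr_gt0// ler_pM2l//.
have h0' : 0 <= h by exact: le_trans (ltW h00) h0h.
have oW : `|om h w 1| <= W.
  apply: le_trans hW; rewrite /om; apply: le_trans (ler_normD _ _) _; rewrite lerD2r.
  rewrite (_ : h * (1%:~R - 2^-1) = h / 2); last by field.
  by rewrite ger0_norm// divr_ge0.
rewrite -[leLHS]real_normK ?num_real// lerXn2r ?nnegrE//.
exact: le_trans oW.
Qed.

Lemma ZZ_gt0 t h w : 0 < t -> 0 < h -> 0 < ZZ h w t.
Proof.
move=> t0 h0; apply: lt_le_trans (ZZ_ge (h0 := h) t0 _ (lexx _)); first exact: expR_gt0.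
by rewrite h0 lexx.
Qed.

Lemma cvg_eg t (hN wN : nat -> R) h w n : hN N @[N --> \oo] --> h -> wN N @[N --> \oo] --> w ->
  om (hN N) (wN N) n @[N --> \oo] --> om h w n /\
  eg (hN N) (wN N) t n @[N --> \oo] --> eg h w t n.
Proof.
move=> ch cw.
have co : om (hN N) (wN N) n @[N --> \oo] --> om h w n.
  by apply: cvgD => //; apply: cvgM => //; exact: cvg_cst.
split; first exact: co.
rewrite /eg; apply: continuous_cvg; first exact: continuous_expR.
apply: cvgN; apply: cvgM; last exact: cvg_cst.
apply: cvgM; first exact: cvg_cst.
by rewrite expr2; under eq_fun do rewrite expr2; exact: cvgM.
Qed.

Lemma cvg_V b (f : R -> R) t x (hN wN : nat -> R) h0 W h w : continuous f -> (forall y, `|f y| <= 2) ->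
  0 < t -> 0 < h0 -> (forall N, h0 <= hN N) -> (forall N, hN N / 2 + `|wN N| <= W) ->
  hN N @[N --> \oo] --> h -> wN N @[N --> \oo] --> w ->
  V b f (hN N) (wN N) t x @[N --> \oo] --> V b f h w t x.
Proof.
move=> cf bf t0 h00 hh hW ch cw.
apply: (zs_tannery (A := 2 * gA t W) (gc01 t0 h00)).
  by move=> N; apply: gb_V => //; [exact: ltW|rewrite h00 hh].
move=> n; have [co ce] := cvg_eg t n ch cw.
apply: cvgM; first by apply: cvgM => //; exact: cvg_cst.
apply: continuous_cvg; first exact: cf.
by apply: cvgM => //; exact: cvg_cst.
Qed.

Lemma cvg_ZZ t (hN wN : nat -> R) h0 W h w :
  0 < t -> 0 < h0 -> (forall N, h0 <= hN N) -> (forall N, hN N / 2 + `|wN N| <= W) ->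
  hN N @[N --> \oo] --> h -> wN N @[N --> \oo] --> w ->
  ZZ (hN N) (wN N) t @[N --> \oo] --> ZZ h w t.
Proof.
move=> t0 h00 hh hW ch cw.
apply: (zs_tannery (A := gA t W) (gc01 t0 h00)).
  by move=> N; apply: gb_eg => //; [exact: ltW|rewrite h00 hh].
by move=> n; have [] := cvg_eg t n ch cw.
Qed.

End Gauss.

(** * Theta functions as Gaussian sums *)

Section ThetaV.
Variable R : realType.
Local Notation C := (complex R).
Implicit Types (h w t x l : R) (n : int).

Lemma ReD (u v : C) : complex.Re (u + v) = complex.Re u + complex.Re v.
Proof. by case: u; case: v. Qed.
Lemma ImD (u v : C) : complex.Im (u + v) = complex.Im u + complex.Im v.
Proof. by case: u; case: v. Qed.

Lemma complex_eq (a b c d : R) : a = c -> b = d -> Complex a b = Complex c d.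
Proof. by move=> -> ->. Qed.

Lemma mulcE (a b c d : R) : Complex a b * Complex c d = Complex (a * c - b * d) (a * d + b * c) :> C.
Proof. by []. Qed.

Lemma addcE (a b c d : R) : Complex a b + Complex c d = Complex (a + c) (b + d) :> C.
Proof. by []. Qed.

Lemma oppcE (a b : R) : - Complex a b = Complex (- a) (- b) :> C.
Proof. by []. Qed.

Lemma divcR (a b k : R) : Complex a b / cR k = Complex (a / k) (b / k).
Proof.
rewrite /cR (_ : (Complex k 0)^-1 = Complex k^-1 0 :> C).
  by rewrite mulcE !mulr0 subr0 add0r.
have [->|k0] := eqVneq k 0; first by rewrite !invr0 (_ : Complex 0 0 = 0 :> C)// invr0.
apply: (@mulfI _ (Complex k 0 : C)).
  by rewrite eq_complex/= negb_and k0.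
rewrite mulfV; last by rewrite eq_complex/= negb_and k0.
by rewrite mulcE !mulr0 subr0 mul0r addr0 mulfV.
Qed.

Lemma cR_rmorph : (forall a b : R, cR (a + b) = cR a + cR b) * (forall a b : R, cR (a * b) = cR a * cR b).
Proof. by split=> a b; rewrite /cR ?addcE ?mulcE; apply: complex_eq; ring. Qed.

Lemma zsum_zs (a b : int -> R) A c : 0 <= c < 1 -> gb A c a -> gb A c b ->
  zsum (fun n => Complex (a n) (b n)) = Complex (zs a) (zs b).
Proof.
move=> c01 ga gb_; rewrite /zsum.
have ReE K : complex.Re (zpsum (fun n => Complex (a n) (b n)) K) = series (zb a) K.+1.
  rewrite -zsum_series /zpsum; elim/big_rec2: _ => //= i y1 y2 _ <-.
  by rewrite ReD.
have ImE K : complex.Im (zpsum (fun n => Complex (a n) (b n)) K) = series (zb b) K.+1.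
  rewrite -zsum_series /zpsum; elim/big_rec2: _ => //= i y1 y2 _ <-.
  by rewrite ImD.
apply: complex_eq; apply/cvg_lim => //.
  under eq_fun do rewrite ReE.
  by have := zs_cvg c01 ga; rewrite -cvg_shiftS.
under eq_fun do rewrite ImE.
by have := zs_cvg c01 gb_; rewrite -cvg_shiftS.
Qed.

Lemma sgnC b n : (if b then (-1) ^+ `|n|%N else 1 : C) = cR (sgn R b n).
Proof.
rewrite /sgn; case: b => //; rewrite -signr_odd -[in RHS]signr_odd.
by case: odd; rewrite ?expr1 ?expr0// /cR oppcE oppr0.
Qed.

Lemma norm_trig (f : R -> R) : f = cos \/ f = sin -> forall y, `|f y| <= 2.
Proof.
move=> [->|->] y; apply: (@le_trans _ _ 1); rewrite ?ler1n//.
  by rewrite ler_norml cos_geN1 cos_le1.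
by rewrite ler_norml sin_geN1 sin_le1.
Qed.

Lemma thetaV b t h w x (v1 v2 bb al : R) : 0 < t -> 0 < h ->
  v1 = h * x / (2 * pi) -> v2 = t * h * w / (2 * pi) -> bb = t * h ^+ 2 / (2 * pi) ->
  al = w * x ->
  cexp (Complex 0 al) *
  zsum (fun n => (if b then (-1) ^+ `|n|%N else 1) * theta_term (Complex v1 v2) (Complex 0 bb) n) =
  cR (expR (t * w ^+ 2 / 2)) * Complex (V b cos h w t x) (V b sin h w t x).
Proof.
move=> t0 h0 v1E v2E bbE alE.
have pi0 : pi != 0 :> R by rewrite gt_eqF ?pi_gt0.
pose th n := om h w n * x - al.
pose e0 := expR (t * w ^+ 2 / 2).
have termE n : theta_term (Complex v1 v2) (Complex 0 bb) n =
    Complex (e0 * eg h w t n * cos (th n)) (e0 * eg h w t n * sin (th n)).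
  rewrite /theta_term /cR /iC !mulcE addcE /cexp.
  set a := complex.Re _; set b' := complex.Im _.
  have aE : a = t * w ^+ 2 / 2 - t * om h w n ^+ 2 / 2.
    by rewrite /a /= v1E v2E bbE /om; move: (pi : R) pi0 => p p0; field.
  have bE : b' = th n by rewrite /b' /= v1E v2E bbE /th alE /om; move: (pi : R) pi0 => p p0; field.
  by rewrite aE bE expRD.
have bc y : `|cos y| <= 2 :> R by apply: norm_trig; left.
have bs y : `|sin y| <= 2 :> R by apply: norm_trig; right.
have hh : 0 < h <= h by rewrite h0 lexx.
have hW := lexx (h / 2 + `|w|).
have c01 := gc01 t0 h0.
have g1 := @gb_sgn_eg R b (fun n => cos (th n)) t h h w _ (fun n => bc _) (ltW t0) hh hW.
have g2 := @gb_sgn_eg R b (fun n => sin (th n)) t h h w _ (fun n => bs _) (ltW t0) hh hW.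
have g1' := gbZ e0 g1; have g2' := gbZ e0 g2.
have -> : (fun n => (if b then (-1) ^+ `|n|%N else 1) * theta_term (Complex v1 v2) (Complex 0 bb) n) =
   fun n => Complex (e0 * (sgn R b n * eg h w t n * cos (th n))) (e0 * (sgn R b n * eg h w t n * sin (th n))).
  apply/funext => n; rewrite termE sgnC /cR mulcE; apply: complex_eq; ring.
rewrite (zsum_zs c01 g1' g2') (zsZ _ c01 g1) (zsZ _ c01 g2).
have cE : V b cos h w t x = cos al * zs (fun n => sgn R b n * eg h w t n * cos (th n)) +
    - sin al * zs (fun n => sgn R b n * eg h w t n * sin (th n)).
  rewrite -(zsZ _ c01 g1) -(zsZ _ c01 g2) -(zsD c01 (gbZ _ g1) (gbZ _ g2)).
  apply: eq_zs => n; rewrite (_ : om h w n * x = th n + al) ?cosD; last by rewrite /th; ring.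
  ring.
have sE : V b sin h w t x = sin al * zs (fun n => sgn R b n * eg h w t n * cos (th n)) +
    cos al * zs (fun n => sgn R b n * eg h w t n * sin (th n)).
  rewrite -(zsZ _ c01 g1) -(zsZ _ c01 g2) -(zsD c01 (gbZ _ g1) (gbZ _ g2)).
  apply: eq_zs => n; rewrite (_ : om h w n * x = th n + al) ?sinD; last by rewrite /th; ring.
  ring.
rewrite cE sE /cexp /= expR0 /cR !mulcE /e0; apply: complex_eq; ring.
Qed.

Lemma theta2V t h w x (v1 v2 bb al : R) : 0 < t -> 0 < h ->
  v1 = h * x / (2 * pi) -> v2 = t * h * w / (2 * pi) -> bb = t * h ^+ 2 / (2 * pi) ->
  al = w * x ->
  cexp (Complex 0 al) * theta2 (Complex v1 v2) (Complex 0 bb) =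
  cR (expR (t * w ^+ 2 / 2)) * Complex (V false cos h w t x) (V false sin h w t x).
Proof.
move=> t0 h0 e1 e2 e3 e4; rewrite -(thetaV false t0 h0 e1 e2 e3 e4); congr (_ * _).
by rewrite /theta2; congr zsum; apply/funext => n; rewrite mul1r.
Qed.

Lemma theta1V t h w x (v1 v2 bb al : R) : 0 < t -> 0 < h ->
  v1 = h * x / (2 * pi) -> v2 = t * h * w / (2 * pi) -> bb = t * h ^+ 2 / (2 * pi) ->
  al = w * x ->
  cexp (Complex 0 al) * theta1 (Complex v1 v2) (Complex 0 bb) =
  iC R * cR (expR (t * w ^+ 2 / 2)) * Complex (V true cos h w t x) (V true sin h w t x).
Proof.
move=> t0 h0 e1 e2 e3 e4; rewrite -[RHS]mulrA -(thetaV true t0 h0 e1 e2 e3 e4).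
by rewrite /theta1 mulrCA.
Qed.

Lemma theta2_0 t h w (v2 bb : R) : 0 < t -> 0 < h ->
  v2 = t * h * w / (2 * pi) -> bb = t * h ^+ 2 / (2 * pi) ->
  theta2 (Complex 0 v2) (Complex 0 bb) = cR (expR (t * w ^+ 2 / 2) * ZZ h w t).
Proof.
move=> t0 h0 e2 e3.
have e1 : 0 = h * 0 / (2 * pi) :> R by rewrite mulr0 mul0r.
have e4 : 0 = w * 0 :> R by rewrite mulr0.
have := theta2V t0 h0 e1 e2 e3 e4.
rewrite /cexp /= expR0 cos0 sin0 !mulr1 mulr0 (_ : Complex 1 0 = 1 :> C)// mul1r => ->.
rewrite cR_rmorph; congr (_ * _); rewrite /cR; apply: complex_eq.
  by apply: eq_zs => n; rewrite /sgn mulr0 cos0 mulr1 mul1r.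
rewrite /V (_ : (fun n => _) = fun m => if m == 0 then 0 else 0) ?zs_single//.
by apply/funext => n; rewrite mulr0 sin0 mulr0; case: ifP.
Qed.

Lemma V_oppx b h w t x (f : R -> R) (e : R) : 0 < t -> 0 < h -> (forall y, `|f y| <= 2) ->
  (forall y, f (- y) = e * f y) -> V b f h w t (- x) = e * V b f h w t x.
Proof.
move=> t0 h0 bf fe; have hh : 0 < h <= h by rewrite h0 lexx.
rewrite /V -(zsZ _ (gc01 t0 h0) (gb_V b x bf (ltW t0) hh (lexx _))).
by apply: eq_zs => n; rewrite mulrN fe; ring.
Qed.

(** This reflection of the frequencies and the one of [om_compl] yield, respectively, the parity in
    the integration variable of the limit kernels of types B, C, D, and in type A the symmetries of
    j to N + 1 - j and of l to rho - l. *)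
Lemma om_opp h w n : om h (- w) (1 - n) = - om h w n.
Proof. by rewrite /om rmorphB/=; field. Qed.

Lemma om_compl h w n : om h (h - w) (- n) = - om h w n.
Proof. by rewrite /om rmorphN/=; field. Qed.

Lemma eg_opp h w t n : eg h (- w) t (1 - n) = eg h w t n.
Proof. by rewrite /eg om_opp sqrrN. Qed.

Lemma eg_compl h w t n : eg h (h - w) t (- n) = eg h w t n.
Proof. by rewrite /eg om_compl sqrrN. Qed.

Lemma sgn1 b n : sgn R b (1 - n) = (if b then -1 else 1) * sgn R b n.
Proof.
rewrite /sgn; case: b; last by rewrite mulr1.
rewrite -signr_odd -[in RHS]signr_odd.
have -> : odd `|1 - n|%N = ~~ odd `|n|%N by lia.
by case: odd; rewrite ?expr1 ?expr0 ?mulrNN ?mulr1.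
Qed.

Lemma V_oppw b h w t x (f : R -> R) (e : R) : 0 < t -> 0 < h -> (forall y, `|f y| <= 2) ->
  (forall y, f (- y) = e * f y) ->
  V b f h (- w) t x = (if b then -1 else 1) * e * V b f h w t x.
Proof.
move=> t0 h0 bf fe; have hh : 0 < h <= h by rewrite h0 lexx.
have g := @gb_V R b f t h h (- w) _ x bf (ltW t0) hh (lexx _).
rewrite /V -(zs_shift (gc01 t0 h0) g).
rewrite -(zsZ _ (gc01 t0 h0) (gb_V b x bf (ltW t0) hh (lexx _))).
by apply: eq_zs => n; rewrite sgn1 eg_opp om_opp mulNr fe; ring.
Qed.

Lemma V_complw h w t x (f : R -> R) (e : R) : 0 < t -> 0 < h -> (forall y, `|f y| <= 2) ->
  (forall y, f (- y) = e * f y) -> V false f h (h - w) t x = e * V false f h w t x.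
Proof.
move=> t0 h0 bf fe; have hh : 0 < h <= h by rewrite h0 lexx.
rewrite /V -zs_opp -(zsZ _ (gc01 t0 h0) (gb_V false x bf (ltW t0) hh (lexx _))).
by apply: eq_zs => n; rewrite eg_compl om_compl mulNr fe /sgn; ring.
Qed.

Lemma ZZ_oppw h w t : 0 < t -> 0 < h -> ZZ h (- w) t = ZZ h w t.
Proof.
move=> t0 h0; have hh : 0 < h <= h by rewrite h0 lexx.
rewrite /ZZ -(zs_shift (gc01 t0 h0) (gb_eg (ltW t0) hh (lexx _))).
by apply: eq_zs => n; rewrite eg_opp.
Qed.

Lemma ZZ_complw h w t : ZZ h (h - w) t = ZZ h w t.
Proof. by rewrite /ZZ -zs_opp; apply: eq_zs => n; rewrite eg_compl. Qed.

End ThetaV.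

(** * The finite systems as real determinantal ensembles *)

Section FiniteN.
Variable R : realType.
Local Notation C := (complex R).
Implicit Types (h w t x y r ts : R) (T : rtype) (L : ltype).

(* Hartley's [cas] in place of [exp (i y)] keeps the kernel of type A real. *)
Definition cas y : R := cos y + sin y.
Definition bL L : bool := if L is LB then true else false.
Definition fL L : R -> R := match L with LA => cas | LB | LC => sin | LD => cos end.
Definition U L h w t x := V (bL L) (fL L) h w t x.

Definition hT T N r : R := calN R T N / r.
Definition wT T r j : R := Jidx R T j / r.
(** Equal to 2 exactly when the frequencies of index [j] are symmetric about 0, that is for w = 0,
    or w = h/2 at j = N in type D. It accounts for 4 pi r in place of 2 pi r among the constants
    m_j. *)
Definition mult T N j : R := match T with
  | B_N | Bv_N => if j == 1%N then 2 else 1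
  | D_N => if (j == 1%N) || (j == N) then 2 else 1
  | _ => 1 end.
(** The pairing of U_j at two times adding up to [ts], see [U_ortho]. Outside type A the factor pi r
    / 2 is 2 pi r divided by the 4 that arises because [Theta] is 2 U up to a unit and a Gaussian
    factor. *)
Definition kap T N r ts j : R :=
  (if T is A_N then 2 * pi * r else mult T N j * (pi * r / 2)) * ZZ (hT T N r) (wT T r j) ts.
Definition kN T N r ts t x y : R :=
  \sum_(j < N) U (sharp T) (hT T N r) (wT T r j.+1) t x *
     U (sharp T) (hT T N r) (wT T r j.+1) (ts - t) y / kap T N r ts j.+1.

Lemma cos_le2 y : `|cos y| <= 2 :> R. Proof. by apply: norm_trig; left. Qed.
Lemma sin_le2 y : `|sin y| <= 2 :> R. Proof. by apply: norm_trig; right. Qed.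

Lemma fL_le2 L y : `|fL L y| <= 2.
Proof.
case: L => /=; try exact: sin_le2; last exact: cos_le2.
apply: le_trans (ler_normD _ _) _.
by have := cos_max y; have := sin_max y; lra.
Qed.

Lemma fL_cont L : continuous (fL L).
Proof.
case: L => /=; try exact: continuous_sin; last exact: continuous_cos.
by move=> y; apply: cvgD; [exact: continuous_cos|exact: continuous_sin].
Qed.

Lemma fL_meas L : measurable_fun setT (fL L).
Proof. by apply: continuous_measurable_fun; exact: fL_cont. Qed.

Lemma U_meas L h w t : 0 < t -> 0 < h -> measurable_fun setT (U L h w t).
Proof. by move=> t0 h0; apply: V_meas => //; [exact: fL_meas|exact: fL_le2]. Qed.

Lemma U_LA h w t x : 0 < t -> 0 < h ->
  U LA h w t x = V false cos h w t x + V false sin h w t x.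
Proof.
move=> t0 h0; have hh : 0 < h <= h by rewrite h0 lexx.
rewrite /U /V -(zsD (gc01 t0 h0) (gb_V false x cos_le2 (ltW t0) hh (lexx _))
   (gb_V false x sin_le2 (ltW t0) hh (lexx _))).
by apply: eq_zs => n; rewrite mulrDr.
Qed.

Definition ThV L h w t x : C :=
  let e0 := expR (t * w ^+ 2 / 2) in
  match L with
  | LA => Complex (e0 * V false cos h w t x) (e0 * V false sin h w t x)
  | LB => Complex (- 2 * e0 * U LB h w t x) 0
  | LC => Complex 0 (2 * e0 * U LC h w t x)
  | LD => Complex (2 * e0 * U LD h w t x) 0
  end.

Lemma ThetaV L h w t x : 0 < t -> 0 < h ->
  Theta L (w / h) (cR (h * x / (2 * pi))) (Complex 0 (t * h ^+ 2 / (2 * pi))) = ThV L h w t x.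
Proof.
move=> t0 h0.
have pi0 : pi != 0 :> R by rewrite gt_eqF ?pi_gt0.
have hn0 : h != 0 by rewrite gt_eqF.
rewrite /Theta.
have e1 : h * x / (2 * pi) = h * x / (2 * pi) :> R by [].
have e1' : - (h * x / (2 * pi)) = h * (- x) / (2 * pi) :> R by rewrite mulrN mulNr.
have e2 : w / h * (t * h ^+ 2 / (2 * pi)) = t * h * w / (2 * pi) :> R.
  by move: (pi : R) pi0 => p p0; field; rewrite ?p0 ?hn0.
have e3 : t * h ^+ 2 / (2 * pi) = t * h ^+ 2 / (2 * pi) :> R by [].
have e4 : 2 * pi * (w / h) * (h * x / (2 * pi)) = w * x :> R.
  by move: (pi : R) pi0 => p p0; field; rewrite ?p0 ?hn0.
have e4' : - (2 * pi * (w / h) * (h * x / (2 * pi))) = w * - x :> R by rewrite e4 mulrN.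
have E1 : cR (2 * pi * (w / h)) * iC R * cR (h * x / (2 * pi)) =
    Complex 0 (2 * pi * (w / h) * (h * x / (2 * pi))).
  by rewrite /cR /iC !mulcE; apply: complex_eq; ring.
have E2 : cR (w / h) * Complex 0 (t * h ^+ 2 / (2 * pi)) + cR (h * x / (2 * pi)) =
    Complex (h * x / (2 * pi)) (w / h * (t * h ^+ 2 / (2 * pi))).
  by rewrite /cR !mulcE addcE; apply: complex_eq; ring.
have E3 : cR (w / h) * Complex 0 (t * h ^+ 2 / (2 * pi)) - cR (h * x / (2 * pi)) =
    Complex (- (h * x / (2 * pi))) (w / h * (t * h ^+ 2 / (2 * pi))).
  by rewrite /cR !mulcE oppcE addcE; apply: complex_eq; ring.
have E1' : - (cR (2 * pi * (w / h)) * iC R * cR (h * x / (2 * pi))) =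
    Complex 0 (- (2 * pi * (w / h) * (h * x / (2 * pi)))) by rewrite E1 oppcE oppr0.
rewrite E1' E1 E2 E3.
have T2 := theta2V t0 h0 e1 e2 e3 e4; have T2' := theta2V t0 h0 e1' e2 e3 e4'.
have T1 := theta1V t0 h0 e1 e2 e3 e4; have T1' := theta1V t0 h0 e1' e2 e3 e4'.
have cN y : cos (- y) = 1 * cos y :> R by rewrite cosN mul1r.
have sN y : sin (- y) = -1 * sin y :> R by rewrite sinN mulN1r.
have Vc b : V b cos h w t (- x) = V b cos h w t x.
  by rewrite (V_oppx b _ _ t0 h0 cos_le2 cN) mul1r.
have Vs b : V b sin h w t (- x) = - V b sin h w t x.
  by rewrite (V_oppx b _ _ t0 h0 sin_le2 sN) mulN1r.
rewrite Vc Vs in T2'; rewrite Vc Vs in T1'.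
case: L => /=.
- by rewrite T2 /cR mulcE; apply: complex_eq; ring.
- by rewrite T1 T1' /cR /iC !mulcE oppcE addcE /U /=; apply: complex_eq; ring.
- by rewrite T2 T2' /cR !mulcE oppcE addcE /U /=; apply: complex_eq; ring.
- by rewrite T2 T2' /cR !mulcE addcE /U /=; apply: complex_eq; ring.
Qed.

Lemma calN_gt0 T N : (1 < N)%N -> 0 < calN R T N.
Proof.
move=> N1; have : 1 < N%:R :> R by rewrite ltr1n.
by case: T => /=; move: (N%:R : R) => z; clear; lra.
Qed.

Lemma hT_gt0 T N r : (1 < N)%N -> 0 < r -> 0 < hT T N r.
Proof. by move=> N1 r0; rewrite divr_gt0// calN_gt0. Qed.

Lemma MfunE T N r j x t : (1 < N)%N -> 0 < r -> 0 < t ->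
  Mfun T N r j x t = ThV (sharp T) (hT T N r) (wT T r j) t x.
Proof.
move=> N1 r0 t0; rewrite -ThetaV ?hT_gt0//.
have cN0 : calN R T N != 0 by rewrite gt_eqF// calN_gt0.
have rn0 : r != 0 by rewrite gt_eqF.
have pi0 : pi != 0 :> R by rewrite gt_eqF ?pi_gt0.
have e1 : Jidx R T j / calN R T N = wT T r j / hT T N r.
  by rewrite /hT /wT; move: (Jidx R T j) (calN R T N) cN0 => J c c0; field; rewrite ?rn0 ?c0.
have e2 : calN R T N * xi_of r x = hT T N r * x / (2 * pi).
  rewrite /hT /xi_of; move: (calN R T N) cN0 => c c0.
  by move: (pi : R) pi0 => p p0; field; rewrite ?rn0 ?p0.
have e3 : cR (calN R T N ^+ 2) * tau_of r t = Complex 0 (t * hT T N r ^+ 2 / (2 * pi)).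
  rewrite /tau_of /cR mulcE; apply: complex_eq; first by ring.
  rewrite /hT; move: (calN R T N) cN0 => c c0.
  by move: (pi : R) pi0 => p p0; field; rewrite ?rn0 ?p0.
by rewrite /Mfun e1 e2 e3.
Qed.

Lemma mconstE T N r ts j : (1 < N)%N -> 0 < r -> 0 < ts ->
  mconst T N r ts j = cR (mult T N j * (2 * pi * r) *
    (expR (ts * wT T r j ^+ 2 / 2) * ZZ (hT T N r) (wT T r j) ts)).
Proof.
move=> N1 r0 t0.
have cN0 : calN R T N != 0 by rewrite gt_eqF// calN_gt0.
have rn0 : r != 0 by rewrite gt_eqF.
have pi0 : pi != 0 :> R by rewrite gt_eqF ?pi_gt0.
have bbE : cR (calN R T N ^+ 2) * tau_of r ts = Complex 0 (ts * hT T N r ^+ 2 / (2 * pi)).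
  rewrite /tau_of /cR mulcE; apply: complex_eq; first by ring.
  rewrite /hT; move: (calN R T N) cN0 => c c0.
  by move: (pi : R) pi0 => p p0; field; rewrite ?rn0 ?p0.
have thE J w : w = J / r -> theta2 (cR (calN R T N * J) * tau_of r ts) (cR (calN R T N ^+ 2) * tau_of r ts) =
    cR (expR (ts * w ^+ 2 / 2) * ZZ (hT T N r) w ts).
  move=> wE; rewrite bbE -(@theta2_0 R ts (hT T N r) w _ _ t0 (hT_gt0 T N1 r0) (erefl _) (erefl _)).
  suff -> : cR (calN R T N * J) * tau_of r ts = Complex 0 (ts * hT T N r * w / (2 * pi)) by [].
  rewrite /tau_of /cR mulcE; apply: complex_eq; first by ring.
  rewrite wE /hT; move: (calN R T N) cN0 => c c0.
  by move: (pi : R) pi0 => p p0; field; rewrite ?rn0 ?p0.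
have gE : theta2 (cR (calN R T N * Jidx R T j) * tau_of r ts) (cR (calN R T N ^+ 2) * tau_of r ts) =
    cR (expR (ts * wT T r j ^+ 2 / 2) * ZZ (hT T N r) (wT T r j) ts) by apply: thE.
have th0 : theta2 0 (cR (calN R T N ^+ 2) * tau_of r ts) =
    cR (expR (ts * 0 ^+ 2 / 2) * ZZ (hT T N r) 0 ts).
  rewrite -(thE 0 0); last by rewrite mul0r.
  suff -> : cR (calN R T N * 0) * tau_of r ts = 0 by [].
  by rewrite mulr0 (_ : cR 0 = 0)// mul0r.
rewrite /mconst /mult; case: T cN0 bbE thE gE th0 => cN0 bbE thE gE th0;
  rewrite ?gE -?cR_rmorph ?mul1r//.
- case: eqP => [->|_]; last by rewrite mul1r.
  rewrite th0 -cR_rmorph /wT /= subrr mul0r; congr cR; ring.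
- case: eqP => [->|_]; last by rewrite mul1r.
  rewrite th0 -cR_rmorph /wT /= subrr mul0r; congr cR; ring.
- case: eqP => [->|_] /=.
    rewrite th0 -cR_rmorph /wT /= subrr mul0r; congr cR; ring.
  case: eqP => [->|_]; last by rewrite mul1r.
  rewrite (thE (N%:R - 1) (wT D_N r N))// -cR_rmorph; congr cR; ring.
Qed.

Lemma mult_gt0 T N j : 0 < mult T N j.
Proof. by rewrite /mult; case: T => //; case: ifP. Qed.

Lemma kap_gt0 T N r ts j : (1 < N)%N -> 0 < r -> 0 < ts -> 0 < kap T N r ts j.
Proof.
move=> N1 r0 t0; have pi0 := pi_gt0 R; have m0 := mult_gt0 T N j.
rewrite /kap; apply: mulr_gt0; last by apply: ZZ_gt0 => //; exact: hT_gt0.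
by case: T m0 => m0; rewrite ?mulr_gt0// ?divr_gt0// ?mulr_gt0.
Qed.

Lemma mulcE_div (a b c d k : R) : Complex a b * Complex c d / cR k =
  Complex ((a * c - b * d) / k) ((a * d + b * c) / k) :> C.
Proof. by rewrite mulcE divcR. Qed.

Lemma expR_split ts t w : expR (t * w ^+ 2 / 2) * expR ((ts - t) * w ^+ 2 / 2) =
  expR (ts * w ^+ 2 / 2) :> R.
Proof. by rewrite -expRD; congr expR; field. Qed.

Lemma ThV_entry L h w t t' x y m p r Z : L <> LA -> 0 < m -> 0 < p -> 0 < r -> 0 < Z ->
  conjc (ThV L h w t' y) * ThV L h w t x /
    cR (m * (2 * p * r) * (expR (t * w ^+ 2 / 2) * expR (t' * w ^+ 2 / 2) * Z)) =
  cR (U L h w t x * U L h w t' y / (m * (p * r / 2) * Z)).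
Proof.
move=> LA_ m0 p0 r0 Z0; rewrite /ThV.
move: (expR_gt0 (t * w ^+ 2 / 2)) (expR_gt0 (t' * w ^+ 2 / 2)).
move: (expR (t * w ^+ 2 / 2)) (expR (t' * w ^+ 2 / 2)) => a b a0 b0.
have ne : [/\ m != 0, Z != 0, a != 0, b != 0 & p != 0] by split; rewrite gt_eqF.
case: ne => m1 Z1 a1 b1 p1; have r1 : r != 0 by rewrite gt_eqF.
case: L LA_ => // _; rewrite [conjc _]/= mulcE_div /cR;
  apply: complex_eq; move: (U _ _ _ _ _) (U _ _ _ _ _) => u u'; field;
  by rewrite ?m1 ?Z1 ?a1 ?b1 ?p1 ?r1.
Qed.

Lemma entryE T N r ts t j x y : T <> A_N -> (1 < N)%N -> 0 < r -> 0 < t < ts ->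
  conjc (Mfun T N r j y (ts - t)) * (mconst T N r ts j)^-1 * Mfun T N r j x t =
  cR (U (sharp T) (hT T N r) (wT T r j) t x *
     U (sharp T) (hT T N r) (wT T r j) (ts - t) y / kap T N r ts j).
Proof.
move=> TA N1 r0 /andP[t0 tts]; have t1 : 0 < ts - t by rewrite subr_gt0.
have ts0 : 0 < ts by exact: lt_trans tts.
rewrite !MfunE// mconstE// mulrAC.
have k0 := mult_gt0 T N j; have pi0 := pi_gt0 R.
have Z0 : 0 < ZZ (hT T N r) (wT T r j) ts by apply: ZZ_gt0 => //; exact: hT_gt0.
have E := expR_split ts t (wT T r j).
have e1 := expR_gt0 (t * wT T r j ^+ 2 / 2); have e2 := expR_gt0 ((ts - t) * wT T r j ^+ 2 / 2).
rewrite -E.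
have -> : kap T N r ts j = mult T N j * (pi * r / 2) * ZZ (hT T N r) (wT T r j) ts.
  by rewrite /kap; case: T TA {k0 Z0 E e1 e2}.
by apply: ThV_entry => //; case: T TA {k0 Z0 E e1 e2}.
Qed.

Lemma ReIm_sum (I : finType) (F : I -> C) :
  \sum_i F i = Complex (\sum_i complex.Re (F i)) (\sum_i complex.Im (F i)).
Proof.
elim/big_rec3: _ => //= i a b c _ ->; by case: (F i).
Qed.

Lemma wT_rev N r (j : 'I_N) : r != 0 ->
  wT A_N r (rev_ord j).+1 = hT A_N N r - wT A_N r j.+1.
Proof.
move=> r0; rewrite /wT /hT /= -mulrBl; congr (_ / _).
have -> : (N - j.+1).+1%:R = N%:R - j%:R :> R.
  by rewrite -natrB 1?ltnW//; congr _%:R; have := ltn_ord j; lia.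
by rewrite -natr1; field.
Qed.

Lemma sum_anti N (F : 'I_N -> R) : (forall j, F (rev_ord j) = - F j) -> \sum_j F j = 0.
Proof.
move=> h; have : \sum_j F j = - \sum_j F j.
  rewrite [LHS](reindex_inj rev_ord_inj)/= -sumrN; exact: eq_bigr.
by move: (\sum_j F j) => z; lra.
Qed.

(** Exchanging j and N + 1 - j negates the frequencies: cosine series are kept and sine series
    change sign. Mixed products therefore cancel in the sum over j, both in the imaginary part and
    in the product of two [cas] series. *)
Lemma entryA N r ts t x y : (1 < N)%N -> 0 < r -> 0 < t < ts ->
  \sum_(j < N) conjc (Mfun A_N N r j.+1 y (ts - t)) * (mconst A_N N r ts j.+1)^-1 * Mfun A_N N r j.+1 x t =
  cR (kN A_N N r ts t x y).
Proof.
move=> N1 r0 /andP[t0 tts]; have t1 : 0 < ts - t by rewrite subr_gt0.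
have ts0 : 0 < ts by exact: lt_trans tts.
have pi0 := pi_gt0 R; have h0 := hT_gt0 A_N N1 r0; have rn0 : r != 0 by rewrite gt_eqF.
pose c (j : 'I_N) z s := V false cos (hT A_N N r) (wT A_N r j.+1) s z.
pose s_ (j : 'I_N) z s := V false sin (hT A_N N r) (wT A_N r j.+1) s z.
pose kk (j : 'I_N) := kap A_N N r ts j.+1.
have cN z : cos (- z) = 1 * cos z :> R by rewrite cosN mul1r.
have sN z : sin (- z) = -1 * sin z :> R by rewrite sinN mulN1r.
have crev j z s : 0 < s -> c (rev_ord j) z s = c j z s.
  by move=> s0; rewrite /c wT_rev// (V_complw _ _ s0 h0 cos_le2 cN) mul1r.
have srev j z s : 0 < s -> s_ (rev_ord j) z s = - s_ j z s.
  by move=> s0; rewrite /s_ wT_rev// (V_complw _ _ s0 h0 sin_le2 sN) mulN1r.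
have krev j : kk (rev_ord j) = kk j.
  by rewrite /kk /kap wT_rev// ZZ_complw.
have kE (j : 'I_N) : conjc (Mfun A_N N r j.+1 y (ts - t)) * (mconst A_N N r ts j.+1)^-1 * Mfun A_N N r j.+1 x t =
   Complex ((c j x t * c j y (ts - t) + s_ j x t * s_ j y (ts - t)) / kk j)
           ((s_ j x t * c j y (ts - t) - c j x t * s_ j y (ts - t)) / kk j).
  rewrite !MfunE// mconstE// mulrAC.
  have Z0 : 0 < ZZ (hT A_N N r) (wT A_N r j.+1) ts by exact: ZZ_gt0.
  have E := expR_split ts t (wT A_N r j.+1).
  have e1 := expR_gt0 (t * wT A_N r j.+1 ^+ 2 / 2).
  have e2 := expR_gt0 ((ts - t) * wT A_N r j.+1 ^+ 2 / 2).
  rewrite -E /kk /kap /= /c /s_ mul1r.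
  move: (ZZ _ _ _) (expR _) (expR _) Z0 e1 e2 => Z a b Z0 a0 b0.
  move: (pi : R) pi0 => p p0.
  have ne : [/\ Z != 0, a != 0, b != 0 & p != 0] by split; rewrite gt_eqF.
  case: ne => Z1 a1 b1 p1.
  by rewrite mulcE_div; apply: complex_eq; field; rewrite ?Z1 ?a1 ?b1 ?p1 ?rn0.
rewrite (eq_bigr _ (fun j _ => kE j)) ReIm_sum/=; apply: complex_eq; last first.
  apply: sum_anti => j; rewrite krev !crev// !srev//; ring.
rewrite /kN.
have -> : \sum_(j < N) U (sharp A_N) (hT A_N N r) (wT A_N r j.+1) t x *
    U (sharp A_N) (hT A_N N r) (wT A_N r j.+1) (ts - t) y / kap A_N N r ts j.+1 =
  \sum_(j < N) (c j x t * c j y (ts - t) + s_ j x t * s_ j y (ts - t)) / kk j +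
  \sum_(j < N) (c j x t * s_ j y (ts - t) + s_ j x t * c j y (ts - t)) / kk j.
  rewrite -big_split; apply: eq_bigr => j _ /=; rewrite !U_LA// -/(c j x t) -/(c j y (ts - t)).
  rewrite -/(s_ j x t) -/(s_ j y (ts - t)) -/(kk j); ring.
rewrite (_ : \sum_(j < N) (c j x t * s_ j y (ts - t) + s_ j x t * c j y (ts - t)) / kk j = 0).
  by rewrite addr0.
by apply: sum_anti => j; rewrite krev !crev// !srev//; ring.
Qed.

(** The two determinants and the constants merge into the determinant of A^T D B, with D the
    diagonal matrix of the 1 / m_j; its entries are those of the kernel, transposed. *)
Lemma densityE T N r ts t s : (1 < N)%N -> 0 < r -> 0 < t < ts -> size s = N ->
  complex.Re (@density R T N r ts t (@seqfun R N s)) = Dks (kN T N r ts t) s.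
Proof.
move=> N1 r0 tt sN; rewrite (Dks_size _ sN) /density.
set A := \matrix_(j, k) conjc _; set B := \matrix_(l, m) Mfun _ _ _ _ _ _.
pose d : 'rV[C]_N := \row_n (mconst T N r ts n.+1)^-1.
have -> : \det A * \det B / \prod_(n < N) mconst T N r ts n.+1 = \det (A^T *m diag_mx d *m B).
  rewrite !det_mulmx det_tr det_diag mulrAC; congr (_ * _ * _).
  by rewrite -prodfV; apply: eq_bigr => n _; rewrite mxE.
have -> : A^T *m diag_mx d *m B =
   (map_mx (real_complex R) (\matrix_(i < N, j < N) kN T N r ts t (nth 0 s i) (nth 0 s j)))^T.
  apply/matrixP => k m; rewrite !mxE.
  have eE : \sum_(j < N) (A^T *m diag_mx d) k j * B j m = 
     \sum_(j < N) conjc (Mfun T N r j.+1 (nth 0 s k) (ts - t)) * (mconst T N r ts j.+1)^-1 * Mfun T N r j.+1 (nth 0 s m) t.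
    by apply: eq_bigr => j _; rewrite mul_mx_diag !mxE.
  rewrite eE; have [->|TA] : T = A_N \/ T <> A_N by case: T {A B d eE} => //; (try by left); right.
    by rewrite entryA.
  rewrite (eq_bigr _ (fun j _ => entryE _ _ _ TA N1 r0 tt)).
  rewrite -[RHS]/(cR _) /kN ReIm_sum /=; apply: complex_eq => //.
  by rewrite big1.
by rewrite det_tr det_map_mx.
Qed.

End FiniteN.

(** * Trigonometric integrals over a period *)

Section Trig.
Variable R : realType.
Notation mu := (@lebesgue_measure R).

Lemma sin_intpi (k : int) : sin (k%:~R * pi) = 0 :> R.
Proof.
have nat_ n : sin (n%:R * pi) = 0 :> R.
  elim: n => [|n IH]; first by rewrite mul0r sin0.
  by rewrite -natr1 mulrDl mul1r sinDpi IH oppr0.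
case: k => n; first exact: nat_.
by rewrite NegzE mulrNz mulNr sinN -pmulrn nat_ oppr0.
Qed.

Lemma cos_int2pi (k : int) : cos (k%:~R * (2 * pi)) = 1 :> R.
Proof.
have nat_ n : cos (n%:R * (2 * pi)) = 1 :> R.
  elim: n => [|n IH]; first by rewrite mul0r cos0.
  have -> : n.+1%:R * (2 * pi) = n%:R * (2 * pi) + pi + pi :> R.
    by rewrite -natr1; move: (pi : R) => p; ring.
  by rewrite !cosDpi opprK.
case: k => n; first exact: nat_.
by rewrite NegzE mulrNz mulNr cosN -pmulrn nat_.
Qed.

Lemma int_derive (F f : R -> R) (b : R) : 0 < b -> continuous f ->
  (forall x, is_derive x (1 : R) F (f x)) ->
  \int[mu]_(x in `[0, b]) f x = F b - F 0.
Proof.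
move=> b0 cf dF.
have cF : continuous F.
  move=> x; apply: differentiable_continuous; apply/derivable1_diffP.
  by have [] := dF x.
rewrite /Rintegral (@continuous_FTC2 R f F 0 b b0) //.
- by apply: continuous_subspaceT => x; exact: cf.
- split.
  + by move=> x _; have [] := dF x.
  + by apply: cvg_at_right_filter; exact: cF.
  + by apply: cvg_at_left_filter; exact: cF.
- by move=> x _; rewrite derive1E; have [_ ->] := dF x.
Qed.

Lemma is_derive_lin (a x : R) : is_derive x (1 : R) (fun y => a * y) a.
Proof.
have := @is_deriveZ R R^o R^o id a x 1 1 (is_derive_id x 1).
by rewrite /GRing.scale/= mulr1.
Qed.

Lemma int_cos (a b : R) : 0 < b -> a != 0 ->
  \int[mu]_(x in `[0, b]) cos (a * x) = sin (a * b) / a.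
Proof.
move=> b0 a0.
have cf : continuous (fun x => cos (a * x)).
  move=> x; apply: continuous_comp; last exact: continuous_cos.
  by apply: cvgM; [exact: cvg_cst|exact: cvg_id].
suff dF x : is_derive x (1 : R) (fun x => a^-1 * sin (a * x)) (cos (a * x)).
  by rewrite (int_derive b0 cf dF) mulr0 sin0 mulr0 subr0 mulrC.
have ds := is_derive1_comp (is_derive_sin (a * x)) (is_derive_lin a x).
have := @is_deriveZ R R^o R^o _ a^-1 x 1 _ ds.
by rewrite /GRing.scale/= mulrCA mulVf// mulr1.
Qed.

Lemma int_sin (a b : R) : 0 < b -> a != 0 ->
  \int[mu]_(x in `[0, b]) sin (a * x) = (1 - cos (a * b)) / a.
Proof.
move=> b0 a0.
have cf : continuous (fun x => sin (a * x)).
  move=> x; apply: continuous_comp; last exact: continuous_sin.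
  by apply: cvgM; [exact: cvg_cst|exact: cvg_id].
suff dF x : is_derive x (1 : R) (fun x => - a^-1 * cos (a * x)) (sin (a * x)).
  rewrite (int_derive b0 cf dF) mulr0 cos0 mulr1 opprK mulNr addrC mulrBl mul1r.
  by rewrite [cos _ / a]mulrC.
have ds := is_derive1_comp (is_derive_cos (a * x)) (is_derive_lin a x).
have := @is_deriveZ R R^o R^o _ (- a^-1) x 1 _ ds.
by rewrite /GRing.scale/= (_ : - a^-1 * (- sin (a * x) * a) = sin (a * x))//; field.
Qed.

Lemma int_cos_period (k : int) (r : R) (m : nat) : 0 < r -> (0 < m)%N ->
  \int[mu]_(x in `[0, m%:R * pi * r]) cos (k%:~R / r * x) =
  if k == 0 then m%:R * pi * r else 0.
Proof.
move=> r0 m0; have b0 : 0 < m%:R * pi * r by rewrite !mulr_gt0 ?pi_gt0 ?ltr0n.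
case: eqVneq => [->|k0].
  under eq_Rintegral do rewrite !mul0r cos0.
  have muE : mu `[0, m%:R * pi * r]%classic = (m%:R * pi * r)%:E.
    by rewrite lebesgue_measure_itv/= lte_fin b0 oppr0 adde0.
  by rewrite Rintegral_cst// mul1r [X in fine X]muE.
have kr : k%:~R / r != 0 :> R by rewrite mulf_neq0 ?intr_eq0// invr_neq0// gt_eqF.
rewrite int_cos// (_ : k%:~R / r * (m%:R * pi * r) = (k * m%:Z)%:~R * pi).
  by rewrite sin_intpi mul0r.
by rewrite intrM; move: (pi : R) => p; field; rewrite gt_eqF.
Qed.

Lemma int_sin_period (k : int) (r : R) : 0 < r ->
  \int[mu]_(x in `[0, 2 * pi * r]) sin (k%:~R / r * x) = 0.
Proof.
move=> r0; have b0 : 0 < 2 * pi * r by rewrite !mulr_gt0 ?pi_gt0 ?ltr0n.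
case: (eqVneq k 0) => [->|k0].
  under eq_Rintegral do rewrite !mul0r sin0.
  by rewrite Rintegral_cst// mul0r.
have kr : k%:~R / r != 0 :> R by rewrite mulf_neq0 ?intr_eq0// invr_neq0// gt_eqF.
rewrite int_sin// (_ : k%:~R / r * (2 * pi * r) = k%:~R * (2 * pi)).
  by rewrite cos_int2pi subrr mul0r.
by move: (pi : R) => p; field; rewrite gt_eqF.
Qed.

End Trig.

(** * Biorthogonality of the functions at complementary times *)

Section Ortho.
Variable R : realType.
Notation mu := (@lebesgue_measure R).
Implicit Types (h w t x y r ts : R) (T : rtype) (L : ltype) (n m : int).

(** Integer forms of [calN] and, in [js], of J_j + J_l. Sums and differences of frequencies are
    integers divided by [r], so orthogonality becomes an arithmetic question. *)
Definition cNn T N : nat := match T with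
  | A_N => N | B_N => (2 * N).-1 | Bv_N | Cv_N => 2 * N
  | C_N => (2 * N).+2 | BC_N => (2 * N).+1 | D_N => (2 * N) - 2 end.
Definition js T (j l : nat) : int := match T with
  | A_N | Cv_N => (j + l)%N%:Z - 1 | B_N | Bv_N | D_N => (j + l)%N%:Z - 2
  | C_N | BC_N => (j + l)%N%:Z end.

Lemma calNE T N : (0 < N)%N -> calN R T N = (cNn T N)%:R.
Proof.
case: N => // N _; case: T; rewrite /calN /cNn.
- by [].
- rewrite (_ : (2 * N.+1).-1 = (2 * N).+1); last by lia.
  by rewrite -[in RHS]natr1 natrM -natr1; ring.
- by rewrite natrM.
- by rewrite -[in RHS]natr1 -[in RHS]natr1 natrM; ring.
- by rewrite natrM.
- by rewrite -[in RHS]natr1 natrM.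
- rewrite (_ : (2 * N.+1 - 2 = 2 * N)%N); last by lia.
  by rewrite natrM -natr1; ring.
Qed.

Lemma JB T j l : Jidx R T j - Jidx R T l = (j%:Z - l%:Z)%:~R.
Proof. by rewrite rmorphB/=; case: T => /=; ring. Qed.

Lemma JD T j l : Jidx R T j + Jidx R T l = (js T j l)%:~R.
Proof. by case: T => /=; rewrite ?rmorphB/= -?pmulrn natrD; field. Qed.

Lemma omB T N r j l n m : (0 < N)%N -> r != 0 ->
  om (hT T N r) (wT T r j) n - om (hT T N r) (wT T r l) m =
  ((cNn T N)%:Z * (n - m) + (j%:Z - l%:Z))%:~R / r.
Proof.
move=> N0 r0; rewrite rmorphD/= -(JB T) rmorphM/= rmorphB/= -pmulrn -calNE// /om /hT /wT.
by field.
Qed.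

Lemma omD T N r j l n m : (0 < N)%N -> r != 0 ->
  om (hT T N r) (wT T r j) n + om (hT T N r) (wT T r l) m =
  ((cNn T N)%:Z * (n + m - 1) + js T j l)%:~R / r.
Proof.
move=> N0 r0; rewrite rmorphD/= -(JD T) rmorphM/= rmorphB/= rmorphD/= -pmulrn -calNE// /om /hT /wT.
by field.
Qed.

Definition c0T T r : R := if T is A_N then 2 * pi * r else pi * r / 2.
Definition epsT T : R := match T with A_N => 0 | D_N => 1 | _ => -1 end.
(** Where [mult] is 2, the index of the frequency opposite to the n-th one: 1 - n if the shift is 0,
    and -n if it is h/2. *)
Definition part T (j : nat) n : int := if T is D_N then (if j == 1%N then 1 - n else - n) else 1 - n.

Lemma k1E T N j l n m : (1 < N)%N -> (0 < j <= N)%N -> (0 < l <= N)%N ->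
  ((cNn T N)%:Z * (n - m) + (j%:Z - l%:Z) == 0) = (j == l) && (n == m).
Proof.
move=> N1 /andP[j0 jN] /andP[l0 lN].
have cN : (N <= cNn T N)%N by case: T => /=; lia.
apply/eqP/andP => [h|[/eqP -> /eqP ->]]; last by rewrite !subrr mulr0.
have nm : n = m.
  apply/eqP; apply: contraT => nm.
  have : (1 <= n - m) || (n - m <= -1) by lia.
  case/orP => h1.
    have : (cNn T N)%:Z * 1 <= (cNn T N)%:Z * (n - m) by rewrite ler_wpM2l.
    by lia.
  have : (cNn T N)%:Z * (n - m) <= (cNn T N)%:Z * (-1) by rewrite ler_wpM2l.
  by lia.
by split; apply/eqP => //; move: h; rewrite nm subrr mulr0; lia.
Qed.

(** J_j + J_l lies between 0 and [calN], so two frequencies can be opposite only at the extremes: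
    both J vanish, or, in type D, both equal N - 1. *)
Lemma k2E T N j l n m : (1 < N)%N -> (0 < j <= N)%N -> (0 < l <= N)%N -> T <> A_N ->
  ((cNn T N)%:Z * (n + m - 1) + js T j l == 0) =
  [&& j == l, mult R T N j == 2 & m == part T j n].
Proof.
move=> N1 /andP[j0 jN] /andP[l0 lN] TA.
have two1 : (1 == 2 :> R) = false by apply/negbTE; rewrite eq_sym pnatr_eq1.
have lo : (1 <= n + m - 1) -> (cNn T N)%:Z * 1 <= (cNn T N)%:Z * (n + m - 1) by move=> ?; rewrite ler_wpM2l.
have hi : (n + m - 1 <= -2) -> (cNn T N)%:Z * (n + m - 1) <= (cNn T N)%:Z * (-2) by move=> ?; rewrite ler_wpM2l.
have mid : n + m - 1 = 0 \/ n + m - 1 = -1 \/ (1 <= n + m - 1) \/ (n + m - 1 <= -2) by lia.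
have tot : (0 <= js T j l) && (js T j l <= (cNn T N)%:Z - (if T is D_N then 0 else 1)).
  by case: T TA {lo hi mid} => //= _; lia.
apply/eqP/and3P => [h|[/eqP jl mu2 /eqP mE]].
  have {}mid : n + m - 1 = 0 \/ n + m - 1 = -1.
    by case: mid => [|[|[/lo|/hi]]]; auto; case: T TA tot h {lo hi} => //= _; lia.
  case: mid => e; rewrite e ?mulr0 ?mulrN1 in h.
    case: T TA tot h {lo hi} => //= _ tot h; try by lia.
    + have [j1 l1] : j = 1%N /\ l = 1%N by lia.
      by rewrite j1 l1 /= eqxx; split=> //; lia.
    + have [j1 l1] : j = 1%N /\ l = 1%N by lia.
      by rewrite j1 l1 /= eqxx; split=> //; lia.
    + have [j1 l1] : j = 1%N /\ l = 1%N by lia.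
      by rewrite j1 l1 /= eqxx; split=> //; lia.
  case: T TA tot h {lo hi} => //= _ tot h; try by lia.
  have [j1 l1] : j = N /\ l = N by lia.
  have N2 : (N == 1%N) = false by lia.
  by rewrite j1 l1 eqxx orbT eqxx N2; split=> //; lia.
subst l m; case: T TA mu2 {lo hi mid tot} => //= _; rewrite ?two1//.
- case: (eqVneq j 1%N) => [-> _|_]; last by rewrite two1.
  by rewrite (_ : n + (1 - n) - 1 = 0) ?mulr0//; lia.
- case: (eqVneq j 1%N) => [-> _|_]; last by rewrite two1.
  by rewrite (_ : n + (1 - n) - 1 = 0) ?mulr0//; lia.
- case: (eqVneq j 1%N) => [-> _|_] /=.
    by rewrite (_ : n + (1 - n) - 1 = 0) ?mulr0//; lia.
  case: (eqVneq j N) => [-> _|_]; last by rewrite two1.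
  by rewrite (_ : n - n - 1 = -1) ?mulrN1; lia.
Qed.

(** Product to sum: the difference of the frequencies detects equality, their sum detects opposite
    frequencies. In type A the sum enters through a sine, whose integral over the period is 0. *)
Lemma int_fL T N r j l n m : (1 < N)%N -> (0 < j <= N)%N -> (0 < l <= N)%N -> 0 < r ->
  \int[mu]_(x in `[0, upper T r]) (fL (sharp T) (om (hT T N r) (wT T r j) n * x) *
     fL (sharp T) (om (hT T N r) (wT T r l) m * x)) =
  c0T T r * (((j == l) && (n == m))%:R +
    epsT T * [&& j == l, mult R T N j == 2 & m == part T j n]%:R).
Proof.
move=> N1 j0 l0 r0; have rn0 : r != 0 by rewrite gt_eqF.
have N0 : (0 < N)%N by exact: ltnW.
set p := om _ _ n; set q := om _ _ m.
have pB := omB T j l n m N0 rn0; have pD := omD T j l n m N0 rn0.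
rewrite -/p -/q in pB pD.
have pi0 := pi_gt0 R.
have bU : bset (`[0, upper T r]%classic : set R) by exact: bset_itv.
have mlin a : measurable_fun setT (fun x : R => a * x) by exact: measurable_funM.
have mcos a : measurable_fun setT (fun x : R => cos (a * x)).
  by apply: (@measurableT_comp _ _ _ _ _ _ cos); [exact: continuous_measurable_fun (@continuous_cos R)|exact: mlin].
have msin a : measurable_fun setT (fun x : R => sin (a * x)).
  by apply: (@measurableT_comp _ _ _ _ _ _ sin); [exact: continuous_measurable_fun (@continuous_sin R)|exact: mlin].
have icos a : mu.-integrable `[0, upper T r] (EFin \o (fun x : R => cos (a * x))).
  by apply: (leb_integrable (C := 2) bU (mcos a)) => x _; exact: cos_le2.
have isin a : mu.-integrable `[0, upper T r] (EFin \o (fun x : R => sin (a * x))).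
  by apply: (leb_integrable (C := 2) bU (msin a)) => x _; exact: sin_le2.
have [TA|TA] : T = A_N \/ T <> A_N by case: T {p q pB pD bU icos isin}; (try by left); right.
  have -> : \int[mu]_(x in `[0, upper T r]) (fL (sharp T) (p * x) * fL (sharp T) (q * x)) =
      \int[mu]_(x in `[0, upper T r]) (cos ((p - q) * x) + sin ((p + q) * x)).
    apply: eq_Rintegral => x _; rewrite TA /= /cas (mulrBl x p q) (mulrDl p q x) cosB sinD; ring.
  rewrite RintegralD// pB pD TA /= -{1}[2 * pi * r]/((2%:R : R) * pi * r).
  rewrite (int_cos_period _ r0 (ltn0Sn 1)) int_sin_period// addr0 mul0r addr0.
  have := k1E A_N n m N1 j0 l0; rewrite /= => ->.
  by case: (_ && _); rewrite ?mulr1 ?mulr0.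
have upE : upper T r = 1%:R * pi * r by rewrite mul1r; case: T TA {p q pB pD bU icos isin}.
have c0E : c0T T r = pi * r / 2 by case: T TA {p q pB pD bU icos isin upE}.
have -> : \int[mu]_(x in `[0, upper T r]) (fL (sharp T) (p * x) * fL (sharp T) (q * x)) =
    \int[mu]_(x in `[0, upper T r]) (2^-1 * (cos ((p - q) * x) + epsT T * cos ((p + q) * x))).
  apply: eq_Rintegral => x _; rewrite (mulrBl x p q) (mulrDl p q x) cosB cosD.
  move: (p * x) (q * x) => a b.
  by case: T TA {pB pD bU icos isin upE c0E p q} => //= _; field.
have iE a : mu.-integrable `[0, upper T r] (EFin \o (fun x : R => epsT T * cos (a * x))).
  apply: (leb_integrable (C := 2) bU) => [|x _]; first exact: measurable_funM.
  rewrite normrM -[leRHS]mul1r ler_pM// ?cos_le2//.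
  by case: T TA {pB pD bU icos isin upE c0E p q} => //= _; rewrite ?normrN ?normr1.
rewrite RintegralZl//; last first.
  apply: (leb_integrable (C := 4) bU) => [|x _]; first by apply: measurable_funD => //; exact: measurable_funM.
  apply: le_trans (ler_normD _ _) _.
  have -> : 4 = 2 + 2 :> R by ring.
  apply: lerD; first exact: cos_le2.
  rewrite normrM -[leRHS]mul1r ler_pM// ?cos_le2//.
  by case: T TA {pB pD bU icos isin upE c0E p q iE} => //= _; rewrite ?normrN ?normr1.
rewrite RintegralD// RintegralZl// pB pD upE !int_cos_period//.
rewrite k1E// k2E// c0E mul1r.
by case: (_ && _); case: [&& _, _ & _] => /=; ring.
Qed.

Lemma zs_pair (n n' : int) (a b : R) :
  zs (fun m => (if m == n then a else 0) + (if m == n' then b else 0)) = a + b.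
Proof.
have g k c : gb (`|c| / 2^-1 ^+ `|k|%N) (2^-1 : R) (fun m => if m == k then c else 0).
  move=> m; case: eqP => [->|_]; last by rewrite normr0 mulr_ge0 ?divr_ge0 ?exprn_ge0.
  by rewrite divfK// expf_neq0.
have c01 : 0 <= (2^-1 : R) < 1 by lra.
by rewrite (zsD c01 (g n a) (g n' b)) !zs_single.
Qed.

Lemma part_om T N r j n : (1 < N)%N -> r != 0 -> T <> A_N -> (0 < j <= N)%N ->
  mult R T N j = 2 ->
  eg (hT T N r) (wT T r j) ^~ (part T j n) = eg (hT T N r) (wT T r j) ^~ n /\
  epsT T * sgn R (bL (sharp T)) (part T j n) = sgn R (bL (sharp T)) n.
Proof.
move=> N1 r0 TA jN m2; have N0 : (0 < N)%N by exact: ltnW.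
have h := @k2E T N j j n (part T j n) N1 jN jN TA.
rewrite eqxx m2 !eqxx /= in h; have {}h := eqP h.
have o := omD T j j n (part T j n) N0 r0; rewrite h mul0r in o.
have o' : om (hT T N r) (wT T r j) (part T j n) = - om (hT T N r) (wT T r j) n.
  by apply/eqP; rewrite -addr_eq0 addrC o.
split; first by apply/funext => s; rewrite /eg o' sqrrN.
have two1 : (1 = 2 :> R) -> False by move=> /eqP; rewrite eq_sym pnatr_eq1.
have s1 := sgn1 R true n; rewrite /sgn in s1.
case: T TA m2 {h o o' jN} => //= _.
- by case: eqP => [_ _|_ /two1//]; rewrite s1 mulrA mulrNN !mul1r.
- by case: eqP => [_ _|_ /two1//]; rewrite s1 mulrA mulrNN !mul1r.
- by move=> _; rewrite mul1r.
Qed.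

Lemma mult12 T N j : mult R T N j = 1 \/ mult R T N j = 2.
Proof. by rewrite /mult; case: T; (try by left); case: ifP => _; auto. Qed.

Lemma inner T N r j l n t : (1 < N)%N -> (0 < j <= N)%N -> (0 < l <= N)%N -> 0 < r ->
  zs (fun m => sgn R (bL (sharp T)) m * eg (hT T N r) (wT T r l) t m *
    (c0T T r * (((j == l) && (n == m))%:R +
      epsT T * [&& j == l, mult R T N j == 2 & m == part T j n]%:R))) =
  if j == l then c0T T r * mult R T N j * (sgn R (bL (sharp T)) n * eg (hT T N r) (wT T r j) t n) else 0.
Proof.
move=> N1 jN lN r0; have rn0 : r != 0 by rewrite gt_eqF.
have two1 : (1 == 2 :> R) = false by apply/negbTE; rewrite eq_sym pnatr_eq1.
case: (eqVneq j l) => [<-|jl] /=; last first.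
  rewrite (_ : (fun m => _) = fun m => if m == 0 then 0 else 0) ?zs_single//.
  by apply/funext => m; rewrite mulr0 addr0 !mulr0; case: ifP.
set sg := sgn R _; set e := eg _ _ _.
have [m1|m2] := mult12 T N j.
  rewrite m1 two1 /= (_ : (fun m => _) = fun m => if m == n then c0T T r * (sg n * e n) else 0).
    by rewrite zs_single mulr1.
  apply/funext => m; rewrite mulr0 addr0 eq_sym; case: eqP => [->|_]; first by rewrite mulr1 mulrC.
  by rewrite !mulr0.
have TA : T <> A_N by move=> E; move: m2; rewrite E /= => /eqP; rewrite two1.
have [pe ps] := @part_om T N r j n N1 rn0 TA jN m2.
rewrite m2 eqxx /= (_ : (fun m => _) = fun m => (if m == n then c0T T r * (sg n * e n) else 0) +
   (if m == part T j n then c0T T r * (sg n * e n) else 0)).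
  by rewrite zs_pair; ring.
apply/funext => m; rewrite eq_sym; case: (eqVneq m n) => [->|mn] /=.
  case: eqVneq => [E|_]; last by rewrite mulr0 !addr0 mulr1 mulrC.
  have e1 : epsT T * sg n = sg n by rewrite /sg -[in RHS]ps -E.
  transitivity (c0T T r * (sg n * e n) + c0T T r * ((epsT T * sg n) * e n)); first by rewrite /=; ring.
  by rewrite e1.
rewrite !add0r; case: eqVneq => [->|_]; last by rewrite !mulr0.
have ps' : epsT T * sg (part T j n) = sg n := ps.
have pe' : e (part T j n) = e n := congr1 (fun g => g t) pe.
by rewrite -ps' pe' /=; ring.
Qed.

(** Termwise integration leaves, for each n, the index n and possibly its opposite; they contribute
    equally, hence [mult]. The Gaussian factors at a common frequency multiply, which adds the
    times. *)
Lemma U_ortho T N r j l t t' : (1 < N)%N -> (0 < j <= N)%N -> (0 < l <= N)%N -> 0 < r ->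
  0 < t -> 0 < t' ->
  \int[mu]_(x in `[0, upper T r]) (U (sharp T) (hT T N r) (wT T r j) t x *
     U (sharp T) (hT T N r) (wT T r l) t' x) =
  if j == l then kap T N r (t + t') j else 0.
Proof.
move=> N1 jN lN r0 t0 t'0.
have h0 := @hT_gt0 R T N r N1 r0.
have hh : 0 < hT T N r <= hT T N r by rewrite h0 lexx.
have bU : bset (`[0, upper T r]%classic : set R) by exact: bset_itv.
set L := sharp T; set h := hT T N r in h0 hh *.
have mf w n : measurable_fun setT (fun x : R => fL L (om h w n * x)).
  by apply: measurableT_comp; [exact: fL_meas|exact: measurable_funM].
have gj := fun x => @gb_V R (bL L) (fL L) t h h (wT T r j) _ x (@fL_le2 R L) (ltW t0) hh (lexx _).
have gl := fun x => @gb_V R (bL L) (fL L) t' h h (wT T r l) _ x (@fL_le2 R L) (ltW t'0) hh (lexx _).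
have c01 := gc01 t0 h0; have c01' := gc01 t'0 h0.
pose K := 2 * (2 * gA t' (h / 2 + `|wT T r l|)) / (1 - gc t' h).
have bUl x : `|U L h (wT T r l) t' x| <= K by apply: V_bound => //; exact: fL_le2.
have mUl : measurable_fun setT (U L h (wT T r l) t') by exact: U_meas.
pose A1 := 2 * gA t (h / 2 + `|wT T r j|).
have K0 : 0 <= K by exact: le_trans (bUl 0).
have inn n : \int[mu]_(x in `[0, upper T r]) (fL L (om h (wT T r j) n * x) * U L h (wT T r l) t' x) =
    if j == l then c0T T r * mult R T N j * (sgn R (bL L) n * eg h (wT T r j) t' n) else 0.
  rewrite -(inner _ _ _ N1 jN lN r0).
  have -> : \int[mu]_(x in `[0, upper T r]) (fL L (om h (wT T r j) n * x) * U L h (wT T r l) t' x) =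
    \int[mu]_(x in `[0, upper T r]) zs (fun m => fL L (om h (wT T r j) n * x) *
      (sgn R (bL L) m * eg h (wT T r l) t' m * fL L (om h (wT T r l) m * x))).
    by apply: eq_Rintegral => x _; rewrite (zsZ _ c01' (gl x)).
  rewrite (@zs_integral R _ _ (2 * (2 * gA t' (h / 2 + `|wT T r l|))) (gc t' h))//; first 1 last.
  - move=> x m; rewrite normrM -[leRHS]mulrA; apply: ler_pM => //; first exact: fL_le2.
    exact: gl.
  - by move=> m; apply: measurable_funM => //; apply: measurable_funM.
  apply: eq_zs => m; rewrite -(@int_fL T N r j l n m N1 jN lN r0) -RintegralZl//.
    by apply: eq_Rintegral => x _; rewrite mulrCA.
  apply: (leb_integrable (C := 4) bU) => [|x _]; first exact: measurable_funM.
  rewrite normrM (_ : 4 = 2 * 2 :> R); last by ring.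
  by apply: ler_pM => //; exact: fL_le2.
have -> : \int[mu]_(x in `[0, upper T r]) (U L h (wT T r j) t x * U L h (wT T r l) t' x) =
  \int[mu]_(x in `[0, upper T r]) zs (fun n => U L h (wT T r l) t' x *
     (sgn R (bL L) n * eg h (wT T r j) t n * fL L (om h (wT T r j) n * x))).
  by apply: eq_Rintegral => x _; rewrite (zsZ _ c01 (gj x)) mulrC.
rewrite (@zs_integral R _ _ (K * A1) (gc t h))//; first 1 last.
- move=> x m; rewrite normrM -[leRHS]mulrA; apply: ler_pM => //; exact: gj.
- by move=> m; apply: measurable_funM => //; apply: measurable_funM.
have nE n : \int[mu]_(x in `[0, upper T r]) (U L h (wT T r l) t' x *
     (sgn R (bL L) n * eg h (wT T r j) t n * fL L (om h (wT T r j) n * x))) =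
  sgn R (bL L) n * eg h (wT T r j) t n *
   (if j == l then c0T T r * mult R T N j * (sgn R (bL L) n * eg h (wT T r j) t' n) else 0).
  rewrite -inn -RintegralZl//.
    by apply: eq_Rintegral => x _; rewrite [LHS]mulrC -[LHS]mulrA.
  apply: (leb_integrable (C := 2 * K) bU) => [|x _]; first exact: measurable_funM.
  by rewrite normrM; apply: ler_pM => //; exact: fL_le2.
rewrite (eq_zs nE); case: (eqVneq j l) => jl; last first.
  rewrite (_ : (fun m => _) = fun m => if m == 0 then 0 else 0) ?zs_single//.
  by apply/funext => m; rewrite mulr0; case: ifP.
have egE n : sgn R (bL L) n * eg h (wT T r j) t n *
   (c0T T r * mult R T N j * (sgn R (bL L) n * eg h (wT T r j) t' n)) =
   c0T T r * mult R T N j * eg h (wT T r j) (t + t') n.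
  have ss : sgn R (bL L) n * sgn R (bL L) n = 1.
    by rewrite /sgn; case: (bL L); rewrite ?mulr1// -expr2 sqrr_sign.
  have ee : eg h (wT T r j) t n * eg h (wT T r j) t' n = eg h (wT T r j) (t + t') n.
    by rewrite /eg -expRD; congr expR; field.
  rewrite -ee -[RHS]mul1r -{1}ss; ring.
rewrite (eq_zs egE) (@zsZ R (gA (t + t') (h / 2 + `|wT T r j|)) (gc (t + t') h)); last 2 first.
- by apply: gc01 => //; exact: addr_gt0.
- by apply: gb_eg => //; apply: ltW; exact: addr_gt0.
rewrite /kap -/h -/(ZZ h (wT T r j) (t + t')); congr (_ * _).
by case: T {L h h0 hh bU mf gj gl c01 c01' K bUl mUl A1 K0 inn nE egE} => /=; rewrite ?mulr1 ?mul1r// mulrC.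
Qed.

End Ortho.

(** * Riemann sums *)

Section Riemann.
Variable R : realType.
Notation mu := (@lebesgue_measure R).

Definition rcell (rho : R) (N j : nat) : set R :=
  `[rho / N%:R * j%:R, rho / N%:R * j.+1%:R[%classic.

Definition cellx (rho l : R) (N : nat) : nat := Num.truncn (l * N%:R / rho).

Lemma cellP (rho l : R) N j : 0 < rho -> (0 < N)%N -> 0 <= l ->
  `[< rcell rho N j l >] = (j == cellx rho l N).
Proof.
move=> r0 N0 l0; have NR : 0 < N%:R :> R by rewrite ltr0n.
have rN : 0 < rho / N%:R by rewrite divr_gt0.
have y0 : 0 <= l * N%:R / rho by rewrite divr_ge0 ?mulr_ge0// ltW.
have lE : l = rho / N%:R * (l * N%:R / rho) by field; rewrite !gt_eqF.
have e1 i : (rho / N%:R * i%:R <= l) = (i%:R <= l * N%:R / rho) by rewrite {1}lE ler_pM2l.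
have e2 i : (l < rho / N%:R * i%:R) = (l * N%:R / rho < i%:R) by rewrite {1}lE ltr_pM2l.
apply/asboolP/eqP; rewrite /rcell /= in_itv /= e1 e2.
  by move=> h; apply/esym/eqP; rewrite /cellx truncn_eq.
by move=> ->; rewrite /cellx truncn_itv.
Qed.

Lemma cellx_lt (rho l : R) N : 0 < rho -> (0 < N)%N -> 0 <= l < rho -> (cellx rho l N < N)%N.
Proof.
move=> r0 N0 /andP[l0 lr]; have NR : 0 < N%:R :> R by rewrite ltr0n.
have y0 : 0 <= l * N%:R / rho by rewrite divr_ge0 ?mulr_ge0// ltW.
have /andP[h _] := Num.Theory.truncn_itv y0.
rewrite -(ltr_nat R); apply: le_lt_trans h _.
by rewrite ltr_pdivrMr// mulrC ltr_pM2l.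
Qed.

(** Dominated convergence for step functions; measurability of the limit is inherited from them.
    Convergence is asked on the open interval only, as the multiplicities disturb the first and the
    last index. *)
Lemma riemann (rho C : R) (phi : nat -> nat -> R) (g : R -> R) : 0 < rho ->
  (forall N j, (j < N)%N -> `|phi N j| <= C) ->
  (forall l, 0 < l < rho -> phi N (cellx rho l N) @[N --> \oo] --> g l) ->
  \sum_(j < N) rho / N%:R * phi N j @[N --> \oo] --> \int[mu]_(l in `[0, rho]) g l.
Proof.
move=> r0 bphi cphi.
have C0 : 0 <= C by exact: le_trans (bphi 1 0 isT)%N.
pose G (N : nat) (l : R) : R := \sum_(j < N) phi N j * (`[< rcell rho N j l >])%:R.
have mcell N j : measurable (rcell rho N j) by exact: measurable_itv.
have mind N j : measurable_fun setT (fun l : R => (`[< rcell rho N j l >])%:R : R).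
  rewrite (_ : (fun l => _) = \1_(rcell rho N j)); first exact: measurable_indic.
  by apply/funext => l; rewrite indicE; congr (nat_of_bool _)%:R; rewrite in_setE.
have mG N : measurable_fun setT (G N).
  by apply: measurable_sum => j; apply: measurable_funM => //; exact: measurable_cst.
have GE N l : (0 < N)%N -> 0 <= l < rho -> G N l = phi N (cellx rho l N).
  move=> N0 lr; have /andP[l0 _] := lr; have cN := cellx_lt r0 N0 lr.
  rewrite /G (bigD1 (Ordinal cN))//= cellP// eqxx mulr1 big1 ?addr0// => j.
  by rewrite -val_eqE /= => jn; rewrite cellP// (negbTE jn) mulr0.
have bG N l : 0 <= l < rho -> `|G N l| <= C.
  case: N => [|N] lr; first by rewrite /G big_ord0 normr0.
  by rewrite GE//; apply: bphi; exact: cellx_lt.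
have cG l : 0 < l < rho -> G N l @[N --> \oo] --> g l.
  move=> lr; have /andP[l0 lr'] := lr; apply: cvg_trans (cphi l lr).
  apply: near_eq_cvg; near=> N; rewrite GE ?(ltW l0)//; near: N.
  exact: nbhs_infty_gt.
pose D : set R := `]0, rho[%classic.
have bD : bset D.
  split; first exact: measurable_itv.
  by rewrite /D lebesgue_measure_itv/= lte_fin r0 oppr0 adde0 ltry.
have Din l : D l -> 0 < l < rho by rewrite /D /= in_itv.
have mgD : measurable_fun D g.
  apply: (@measurable_fun_cvg _ _ R D G); first by move=> N; exact: measurable_funTS.
  by move=> l /Din; exact: cG.
pose gr := g \_ D.
have mgr : measurable_fun setT gr.
  by apply/(measurable_restrictT _ _).1 => //; exact: bD.1.
have cv : \int[mu]_(l in D) G N l @[N --> \oo] --> \int[mu]_(l in D) gr l.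
  apply: (leb_cvg (C := C) bD) => //.
  - by move=> N l /Din/andP[h1 h2]; apply: bG; rewrite (ltW h1).
  - move=> l Dl; rewrite /gr patchE mem_set//; exact: cG (Din _ Dl).
have -> : \int[mu]_(l in `[0, rho]) g l = \int[mu]_(l in D) gr l.
  rewrite /Rintegral integral_itv_bndoo; last exact/measurable_EFinP.
  congr fine; apply: eq_integral => l lD; rewrite /gr patchE lD//.
suff -> : (fun N => \sum_(j < N) rho / N%:R * phi N j) = (fun N => \int[mu]_(l in D) G N l) by [].
apply/funext => N.
have b0 : bset (`[0, rho[%classic : set R).
  split; first exact: measurable_itv.
  by rewrite lebesgue_measure_itv/= lte_fin r0 oppr0 adde0 ltry.
have -> : \int[mu]_(l in D) G N l = \int[mu]_(l in `[0, rho[) G N l.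
  apply: Rintegral_itv_obnd_cbnd.
  apply: (leb_integrable (C := C) bD (mG N)) => l /Din/andP[h1 h2].
  by apply: bG; rewrite (ltW h1).
rewrite /G (leb_lin (C := 1) _ b0); last 2 first.
- by move=> j; exact: mind.
- by move=> j x; case: `[< _ >]; rewrite ?normr1 ?normr0.
apply: eq_bigr => j _; rewrite mulrC; congr (_ * _).
have N0 : (0 < N)%N by exact: leq_ltn_trans (ltn_ord j).
have NR : 0 < N%:R :> R by rewrite ltr0n.
have rN : 0 < rho / N%:R by rewrite divr_gt0.
have -> : \int[mu]_(l in `[0, rho[) (`[< rcell rho N j l >])%:R =
    \int[mu]_(l in `[0, rho[) (\1_(rcell rho N j) l : R).
  by apply: eq_Rintegral => l _; rewrite indicE; congr (nat_of_bool _)%:R; rewrite in_setE.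
have sub : rcell rho N j `<=` `[0, rho[%classic.
  move=> l; rewrite /rcell /= !in_itv/= => /andP[h1 h2]; apply/andP; split.
    by apply: le_trans h1; rewrite mulr_ge0// ltW.
  apply: lt_le_trans h2 _; have e : rho = rho / N%:R * N%:R by rewrite divfK// gt_eqF.
  by rewrite {2}e ler_pM2l// ler_nat.
rewrite /Rintegral (@integral_indic _ (measurableTypeR R) R mu _ b0.1 _ (mcell N j)).
have muE : mu (rcell rho N j) = (rho / N%:R)%:E.
  rewrite /rcell lebesgue_measure_itv/= lte_fin ltr_pM2l// ltr_nat ltnSn -EFinB.
  by congr EFin; rewrite -mulrBr -natr1 addrAC subrr add0r mulr1.
by rewrite (setIidl sub) [X in fine X]muE.
Unshelve. all: by end_near. Qed.

End Riemann.

(** * Convergence of the kernels *)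

Section KernelLimit.
Variables (R : realType) (ts rho t : R).
Hypotheses (rho0 : 0 < rho) (tts : 0 < t < ts).
Notation mu := (@lebesgue_measure R).
Implicit Types (T : rtype) (L : ltype).

(** The shift J_j / r tends to [al L * l] when j rho / N tends to l. The constant [cL] is what
    remains of 1 / [kap] once rho / N, 1 / [mult] and 1 / [ZZ] are taken out. *)
Definition al L : R := if L is LA then 2 * pi else pi.
Definition cL L : R := if L is LA then 1 else 2.
Definition hinf : R := 2 * pi * rho.

Definition gl L (x y l : R) : R :=
  cL L * (U L hinf (al L * l) t x * U L hinf (al L * l) (ts - t) y / ZZ hinf (al L * l) ts).

Definition klim L (x y : R) : R := \int[mu]_(l in `[0, rho]) gl L x y l.

(** The difference between [calN] and its leading term, N for type A and 2N otherwise. *)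
Definition bT T : R := match T with A_N | Bv_N | Cv_N => 0 | B_N => -1 | C_N => 2 | BC_N => 1 | D_N => -2 end.

Lemma pi0_ : pi != 0 :> R.
Proof. by rewrite gt_eqF ?pi_gt0. Qed.

Lemma r_scale_gt0 T N : (0 < N)%N -> 0 < r_scale T rho N.
Proof.
move=> N0; have NR : 0 < N%:R :> R by rewrite ltr0n.
by rewrite /r_scale; case: T; rewrite divr_gt0// !mulr_gt0 ?pi_gt0.
Qed.

Lemma hTE T N : (0 < N)%N -> hT T N (r_scale T rho N) = hinf + bT T * (pi * rho) / N%:R.
Proof.
move=> N0; have NR : N%:R != 0 :> R by rewrite pnatr_eq0 -lt0n.
have r1 : rho != 0 by rewrite gt_eqF.
rewrite /hT /hinf /r_scale; case: T => /=; move: (pi : R) pi0_ (N%:R : R) NR => p p0 z z0;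
  by field; rewrite ?z0 ?p0 ?r1.
Qed.

Lemma wTE T N j : (0 < N)%N ->
  wT T (r_scale T rho N) j = al (sharp T) * (rho / N%:R * Jidx R T j).
Proof.
move=> N0; have NR : N%:R != 0 :> R by rewrite pnatr_eq0 -lt0n.
have r1 : rho != 0 by rewrite gt_eqF.
rewrite /wT /al /r_scale; move: (Jidx R T j) => J; case: T => /=;
  move: (pi : R) pi0_ (N%:R : R) NR => p p0 z z0; by field; rewrite ?z0 ?p0 ?r1.
Qed.

Lemma J_bnd T j : j%:R <= Jidx R T j.+1 <= j.+1%:R.
Proof.
have e : j.+1%:R = j%:R + 1 :> R by rewrite natr1.
by case: T; rewrite /Jidx e; move: (j%:R : R) => z; apply/andP; split; lra.
Qed.

(** Both h/2 and |w| are at most 2 pi rho, since [bT] is at most 2 and J_j lies between 0 and N. *)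
Definition WW : R := 4 * (pi * rho).

Lemma hT_ge T N : (1 < N)%N -> pi * rho <= hT T N (r_scale T rho N).
Proof.
move=> N1; rewrite hTE 1?ltnW// /hinf.
have pr : 0 < pi * rho by rewrite mulr_gt0 ?pi_gt0.
have N2 : 0 < (N%:R^-1 : R) <= 2^-1.
  by rewrite invr_gt0 ltr0n ltnW//= lef_pV2 ?posrE ?ltr0n 1?ltnW// ler_nat.
rewrite (_ : bT T * (pi * rho) / N%:R = bT T * N%:R^-1 * (pi * rho)); last by rewrite mulrAC.
rewrite -(mulrA 2).
have : -1 <= bT T * N%:R^-1.
  by move: (N%:R^-1 : R) N2 => z /andP[h1 h2]; case: T => /=; lra.
move: (bT T * N%:R^-1) (pi * rho) pr => z q pr hz.
rewrite -subr_ge0 (_ : _ - _ = (1 + z) * q); last by ring.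
by apply: mulr_ge0; [lra|exact: ltW].
Qed.

Lemma hw_le T N j : (1 < N)%N -> (j < N)%N ->
  hT T N (r_scale T rho N) / 2 + `|wT T (r_scale T rho N) j.+1| <= WW.
Proof.
move=> N1 jN; have N0 : (0 < N)%N by exact: ltnW.
have pr : 0 < pi * rho by rewrite mulr_gt0 ?pi_gt0.
have NR : 0 < N%:R :> R by rewrite ltr0n.
have /andP[J1 J2] := J_bnd T j.
have wle : `|wT T (r_scale T rho N) j.+1| <= 2 * (pi * rho).
  have J0 : 0 <= Jidx R T j.+1 by exact: le_trans J1.
  have u0 : 0 <= rho / N%:R * Jidx R T j.+1 by rewrite mulr_ge0// divr_ge0 ?ltW.
  have u1 : rho / N%:R * Jidx R T j.+1 <= rho.
    rewrite mulrAC ler_pdivrMr// ler_pM2l//; apply: le_trans J2 _.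
    by rewrite ler_nat.
  have a0 : 0 <= al (sharp T) <= 2 * pi by rewrite /al; have := pi_gt0 R; case: sharp; lra.
  have /andP[a1 a2] := a0.
  rewrite wTE// ger0_norm; last exact: mulr_ge0.
  by apply: le_trans (ler_pM a1 u0 a2 u1) _; rewrite mulrA.
have hle : hT T N (r_scale T rho N) <= 4 * (pi * rho).
  rewrite hTE// /hinf.
  have N2 : 0 < (N%:R^-1 : R) <= 1.
    by rewrite invr_gt0 NR/= invf_le1// ler1n.
  rewrite (_ : bT T * (pi * rho) / N%:R = bT T * N%:R^-1 * (pi * rho)); last by rewrite mulrAC.
  rewrite -(mulrA 2).
  have : bT T * N%:R^-1 <= 2.
    by move: (N%:R^-1 : R) N2 => z /andP[h1 h2]; case: T {J1 J2 wle} => /=; lra.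
  move: (bT T * N%:R^-1) (pi * rho) pr => z q pr hz.
  rewrite -subr_ge0 (_ : _ - _ = (2 - z) * q); last by ring.
  by apply: mulr_ge0; [lra|exact: ltW].
by rewrite /WW; move: (pi * rho) (`|_|) wle hle => a b; lra.
Qed.

Lemma hT_cvg T : hT T N (r_scale T rho N) @[N --> \oo] --> hinf.
Proof.
have c0 : bT T * (pi * rho) / N%:R @[N --> \oo] --> (0 : R).
  rewrite -[X in _ --> X](mulr0 (bT T * (pi * rho))); apply: cvgM; first exact: cvg_cst.
  apply/cvgr0Pnorm_le => e e0; near=> N.
  rewrite ger0_norm ?invr_ge0//.
  have N0 : 0 < N%:R :> R by rewrite ltr0n; near: N; exact: nbhs_infty_gt.
  rewrite invf_ple ?posrE//; near: N; exact: nbhs_infty_ger.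
have cv : hinf + bT T * (pi * rho) / N%:R @[N --> \oo] --> hinf + 0.
  by apply: cvgD => //; exact: cvg_cst.
rewrite addr0 in cv; apply: cvg_trans cv.
apply: near_eq_cvg; near=> N; rewrite /= hTE//; near: N; exact: nbhs_infty_gt.
Unshelve. all: by end_near. Qed.

(** Set to 0 for N at most 1, where [calN] may fail to be positive, so that the bounds hold for all
    [N]. *)
Definition phi T x y (N j : nat) : R := if (1 < N)%N then
  cL (sharp T) / mult R T N j.+1 *
  (U (sharp T) (hT T N (r_scale T rho N)) (wT T (r_scale T rho N) j.+1) t x *
   U (sharp T) (hT T N (r_scale T rho N)) (wT T (r_scale T rho N) j.+1) (ts - t) y /
   ZZ (hT T N (r_scale T rho N)) (wT T (r_scale T rho N) j.+1) ts) else 0.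

Definition kN' T (N : nat) x y : R := if (1 < N)%N then kN T N (r_scale T rho N) ts t x y else 0.

Lemma kN_phi T N x y : kN' T N x y = \sum_(j < N) rho / N%:R * phi T x y N j.
Proof.
rewrite /kN' /phi; case: ifP => N1; last by rewrite big1// => j _; rewrite mulr0.
apply: eq_bigr => j _; have /andP[t0 _] := tts.
have N0 : (0 < N)%N by exact: ltnW.
have Z0 : ZZ (hT T N (r_scale T rho N)) (wT T (r_scale T rho N) j.+1) ts != 0.
  rewrite gt_eqF// ZZ_gt0//; first by case/andP: tts => h1 h2; exact: lt_trans h2.
  by apply: hT_gt0 => //; exact: r_scale_gt0.
have NR : N%:R != 0 :> R by rewrite pnatr_eq0 -lt0n.
have r1 : rho != 0 by rewrite gt_eqF.
have m0 : mult R T N j.+1 != 0 by rewrite gt_eqF// mult_gt0.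
rewrite /kap; move: (ZZ _ _ _) Z0 (U _ _ _ _ _) (U _ _ _ _ _) => Z Z0 a b.
rewrite /r_scale /cL.
case: T m0 => m0; move: m0; [move=> _; rewrite /mult /=|..];
 try move: (mult R _ _ _) => m m0 /=;
 move: (pi : R) pi0_ (N%:R : R) NR => p p0 z z0; field; by rewrite ?z0 ?p0 ?r1 ?Z0 ?m0.
Qed.

Definition KU s : R := 2 * (2 * gA s WW) / (1 - gc s (pi * rho)).
Definition KK : R := 2 * (KU t * KU (ts - t) * expR (ts * WW ^+ 2 / 2)).

Lemma U_le T N j s x : (1 < N)%N -> (j < N)%N -> 0 < s ->
  `|U (sharp T) (hT T N (r_scale T rho N)) (wT T (r_scale T rho N) j.+1) s x| <= KU s.
Proof.
move=> N1 jN s0; apply: V_bound => //; [exact: fL_le2| |exact: hw_le].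
by rewrite mulr_gt0 ?pi_gt0//= hT_ge.
Qed.

Lemma phi_le T x y N j : (j < N)%N -> `|phi T x y N j| <= KK.
Proof.
move=> jN; have /andP[t0 t1] := tts; have t2 : 0 < ts - t by rewrite subr_gt0.
have ts0 : 0 < ts by exact: lt_trans t1.
have ku s : 0 < s -> 0 <= KU s.
  move=> s0; rewrite divr_ge0// ?mulr_ge0// ?expR_ge0// subr_ge0.
  by have /andP[_ /ltW] := gc01 s0 (mulr_gt0 (pi_gt0 R) rho0).
rewrite /phi; case: ifP => N1; last first.
  rewrite normr0; apply: mulr_ge0 => //; apply: mulr_ge0; last exact: expR_ge0.
  by apply: mulr_ge0; exact: ku.
rewrite normrM; apply: ler_pM => //.
  have m0 := mult_gt0 R T N j.+1.
  rewrite normrM normfV (gtr0_norm m0) ler_pdivrMr//.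
  have m1 : 1 <= mult R T N j.+1 by have [->|->] : mult R T N j.+1 = 1 \/ mult R T N j.+1 = 2;
    rewrite ?lexx ?ler1n// /mult; case: T {m0}; (try by left); case: ifP => _; auto.
  by rewrite /cL; case: sharp; rewrite ger0_norm//; lra.
rewrite normrM normrM; apply: ler_pM => //.
  by apply: ler_pM => //; exact: U_le.
have hh : 0 < pi * rho <= hT T N (r_scale T rho N) by rewrite mulr_gt0 ?pi_gt0//= hT_ge.
have Zge := ZZ_ge ts0 hh (hw_le T N1 jN).
have Z0 := lt_le_trans (expR_gt0 _) Zge.
rewrite normfV gtr0_norm// -[X in _ <= X]invrK lef_pV2 ?posrE// ?invr_gt0 ?expR_gt0//.
by rewrite -expRN.
Qed.

Lemma phi_cvg T x y l : 0 < l < rho ->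
  phi T x y N (cellx rho l N) @[N --> \oo] --> gl (sharp T) x y l.
Proof.
move=> lr; have /andP[l0 lrho] := lr; have /andP[t0 t1] := tts.
have t2 : 0 < ts - t by rewrite subr_gt0.
have ts0 : 0 < ts by exact: lt_trans t1.
have l01 : 0 <= l < rho by rewrite ltW.
have pr : 0 < pi * rho by rewrite mulr_gt0 ?pi_gt0.
pose hN N := if (1 < N)%N then hT T N (r_scale T rho N) else pi * rho.
pose wN N := if (1 < N)%N then wT T (r_scale T rho N) (cellx rho l N).+1 else 0.
have hN0 N : pi * rho <= hN N by rewrite /hN; case: ifP => // N1; exact: hT_ge.
have hwN N : hN N / 2 + `|wN N| <= WW.
  rewrite /hN /wN; case: ifP => N1; first by apply: hw_le => //; apply: cellx_lt => //; exact: ltnW.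
  by rewrite normr0 addr0 /WW; lra.
have chN : hN N @[N --> \oo] --> hinf.
  apply: cvg_trans (hT_cvg T); apply: near_eq_cvg; near=> N; rewrite /hN ifT//.
  by near: N; exact: nbhs_infty_gt.
have cwN : wN N @[N --> \oo] --> al (sharp T) * l.
  have inv0 : rho / N%:R @[N --> \oo] --> (0 : R).
    rewrite -[X in _ --> X](mulr0 rho); apply: cvgM; first exact: cvg_cst.
    apply/cvgr0Pnorm_le => e e0; near=> N.
    rewrite ger0_norm ?invr_ge0//.
    have N0 : 0 < N%:R :> R by rewrite ltr0n; near: N; exact: nbhs_infty_gt.
    rewrite invf_ple ?posrE//; near: N; exact: nbhs_infty_ger.
  have cu : (rho / N%:R * Jidx R T (cellx rho l N).+1) @[N --> \oo] --> l.
    apply: (@squeeze_cvgr _ _ _ _ (fun N : nat => l - rho / N%:R) (fun N : nat => l + rho / N%:R)).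
    - near=> N; have N0 : (0 < N)%N by near: N; exact: nbhs_infty_gt.
      have NR : 0 < N%:R :> R by rewrite ltr0n.
      have rN : 0 < rho / N%:R by rewrite divr_gt0.
      have := cellP (cellx rho l N) rho0 N0 (ltW l0); rewrite eqxx => /asboolP.
      rewrite /rcell /= in_itv/= -natr1 mulrDr mulr1 => /andP[c1 c2].
      have /andP[j1 j2] := J_bnd T (cellx rho l N).
      have d1 : rho / N%:R * (cellx rho l N)%:R <= rho / N%:R * Jidx R T (cellx rho l N).+1 by rewrite ler_pM2l.
      have d2 : rho / N%:R * Jidx R T (cellx rho l N).+1 <= rho / N%:R * (cellx rho l N)%:R + rho / N%:R.
        by rewrite -[X in _ + X]mulr1 -mulrDr natr1 ler_pM2l.
      move: c1 c2 d1 d2; move: (rho / N%:R * Jidx R T (cellx rho l N).+1) (rho / N%:R * (cellx rho l N)%:R) (rho / N%:R).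
      move=> a b c c1 c2 d1 d2; clear -c1 c2 d1 d2.
      by apply/andP; split; lra.
    - by rewrite -[X in _ --> X]subr0; apply: cvgB => //; exact: cvg_cst.
    - by rewrite -[X in _ --> X]addr0; apply: cvgD => //; exact: cvg_cst.
  have cv : al (sharp T) * (rho / N%:R * Jidx R T (cellx rho l N).+1) @[N --> \oo] --> al (sharp T) * l.
    by apply: cvgM => //; exact: cvg_cst.
  apply: cvg_trans cv; apply: near_eq_cvg; near=> N; rewrite /wN ifT; last by near: N; exact: nbhs_infty_gt.
  rewrite /= wTE//; near: N; exact: nbhs_infty_gt.
have cU s z : 0 < s -> U (sharp T) (hN N) (wN N) s z @[N --> \oo] --> U (sharp T) hinf (al (sharp T) * l) s z.
  move=> s0; exact: (@cvg_V R _ _ s z hN wN (pi * rho) WW _ _ (@fL_cont R _) (@fL_le2 R _) s0 pr hN0 hwN chN cwN).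
have cZ := @cvg_ZZ R ts hN wN (pi * rho) WW _ _ ts0 pr hN0 hwN chN cwN.
have Zn0 : ZZ hinf (al (sharp T) * l) ts != 0.
  by rewrite gt_eqF// ZZ_gt0// /hinf !mulr_gt0 ?pi_gt0.
have cv : cL (sharp T) * (U (sharp T) (hN N) (wN N) t x * U (sharp T) (hN N) (wN N) (ts - t) y /
    ZZ (hN N) (wN N) ts) @[N --> \oo] --> gl (sharp T) x y l.
  apply: cvgM; first exact: cvg_cst.
  apply: cvgM; last exact: cvgV.
  by apply: cvgM; exact: cU.
apply: cvg_trans cv; apply: near_eq_cvg; near=> N.
have N1 : (1 < N)%N by near: N; exact: nbhs_infty_gt.
have N0 : (0 < N)%N by exact: ltnW.
rewrite /= /phi N1 /hN /wN N1; congr (_ * _).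
(* For l inside ]0, rho[ the index is eventually neither 1 nor [N]. *)
have -> : mult R T N (cellx rho l N).+1 = 1; last by rewrite divr1.
have NR : 0 < N%:R :> R by rewrite ltr0n.
have := cellP (cellx rho l N) rho0 N0 (ltW l0); rewrite eqxx => /asboolP.
rewrite /rcell /= in_itv/= => /andP[c1 c2].
have jn0 : (cellx rho l N).+1 != 1%N.
  apply/eqP => -[e]; move: c2; rewrite e mulr1 ltr_pdivlMr// mulrC -ltr_pdivlMr// ltNge => /negP; apply.
  by near: N; exact: nbhs_infty_ger.
have jnN : (cellx rho l N).+1 != N.
  apply/eqP => e; have : rho / N%:R * N%:R <= l + rho / N%:R.
    by rewrite -{2}e -natr1 mulrDr mulr1 lerD2r.
  rewrite divfK ?gt_eqF// -lerBlDl ler_pdivlMr// mulrC -ler_pdivlMr ?subr_gt0// leNgt => /negP; apply.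
  by near: N; exact: nbhs_infty_gtr.
by rewrite /mult (negbTE jn0) (negbTE jnN); case: T {hN wN hN0 hwN chN cwN cU cZ Zn0}.
Unshelve. all: by end_near. Qed.

Lemma kN'_cvg T x y : kN' T N x y @[N --> \oo] --> klim (sharp T) x y.
Proof.
under eq_fun do rewrite kN_phi.
exact: (riemann rho0 (@phi_le T x y) (@phi_cvg T x y)).
Qed.

Lemma bker_kN' T N : bker (kN' T N) (rho * KK).
Proof.
have /andP[t0 t1] := tts; have t2 : 0 < ts - t by rewrite subr_gt0.
have K0 : 0 <= KK by exact: le_trans (@phi_le A_N 0 0 1 0 isT).
split.
  have [N1|N1] := boolP (1 < N)%N; last first.
    rewrite (_ : (fun z => _) = fun=> 0); first exact: measurable_cst.
    by apply/funext => z; rewrite /kN' (negbTE N1).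
  rewrite (_ : (fun z => _) = fun z => kN T N (r_scale T rho N) ts t z.1 z.2); last first.
    by apply/funext => z; rewrite /kN' N1.
  have h0 := @hT_gt0 R T N _ N1 (r_scale_gt0 T (ltnW N1)).
  apply: measurable_sum => j; apply: measurable_funM; last exact: measurable_cst.
  apply: measurable_funM; (apply: measurableT_comp; first exact: U_meas).
    exact: measurable_fst.
  exact: measurable_snd.
move=> x y; rewrite kN_phi; case: N => [|N].
  by rewrite big_ord0 normr0 mulr_ge0// ltW.
apply: le_trans (ler_norm_sum _ _ _) _.
apply: le_trans (_ : \sum_(j < N.+1) rho / N.+1%:R * KK <= _).
  apply: ler_sum => j _; rewrite normrM ger0_norm; last by rewrite divr_ge0// ltW.
  by rewrite ler_wpM2l ?divr_ge0 ?phi_le// ltW.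
rewrite sumr_const card_ord -[leLHS]mulr_natl mulrA [_ * (rho / _)]mulrC divfK//.
Qed.

Lemma bker_klim T : bker (klim (sharp T)) (rho * KK).
Proof.
split; last first.
  move=> x y; apply: (cvg_normr_le (@kN'_cvg T x y)) => N.
  by have [_] := bker_kN' T N.
apply: (@measurable_fun_cvg _ _ R setT (fun N z => kN' T N z.1 z.2)).
  by move=> N; have [] := bker_kN' T N.
by move=> z _; exact: kN'_cvg.
Qed.

End KernelLimit.

Section Isometry.
Variable R : realType.
Notation mu := (@lebesgue_measure R).

(** Uniqueness of Lebesgue measure: a map preserving the measure of half-open intervals pushes it
    forward to itself. *)
Lemma leb_isom (phi : R -> R) (D : set R) (f : R -> R) (C : R) :
  measurable_fun setT phi ->
  (forall a b, mu (phi @^-1` `]a, b]%classic) = mu `]a, b]%classic) ->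
  bset D -> bset (phi @^-1` D) -> measurable_fun setT f -> (forall x, D x -> `|f x| <= C) ->
  \int[mu]_(x in D) f x = \int[mu]_(x in phi @^-1` D) f (phi x).
Proof.
move=> mphi hphi bD bD' mf bf.
have mphi' : measurable_fun setT (phi : measurableTypeR R -> measurableTypeR R) by exact: mphi.
pose nu : {measure set (measurableTypeR R) -> \bar R} :=
  measure_function_pushforward__canonical__measure_function_Measure mu mphi'.
have nuE A : measurable A -> mu A = pushforward mu phi A.
  move=> mA; apply: (@lebesgue_measure_unique R nu) => // X [[a b] _ <-] /=.
  by rewrite /pushforward hphi.
rewrite /Rintegral; congr fine.
have mfE : measurable_fun setT (EFin \o (f : measurableTypeR R -> R)) by apply/measurable_EFinP.
have ifE : mu.-integrable (phi @^-1` D) ((EFin \o f) \o phi).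
  apply: (leb_integrable (C := C) bD'); first exact: measurableT_comp.
  by move=> x; exact: bf.
have := @integral_pushforward _ _ (measurableTypeR R) (measurableTypeR R) R phi mphi' mu D
  (EFin \o f) mfE ifE bD.1.
move=> <-; apply: eq_measure_integral => A mA _; exact: nuE.
Qed.

Lemma preimage_shift (c a b : R) : (fun x => x - c) @^-1` `]a, b]%classic = `]a + c, b + c]%classic.
Proof. by apply/seteqP; split=> x /=; rewrite !in_itv/= ltrBrDr lerBlDr. Qed.

Lemma preimage_refl (c a b : R) : (fun x => c - x) @^-1` `]a, b]%classic = `[c - b, c - a[%classic.
Proof.
apply/seteqP; split=> x /=; rewrite !in_itv/=.
  by move=> /andP[h1 h2]; apply/andP; split; lra.
by move=> /andP[h1 h2]; apply/andP; split; lra.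
Qed.

Lemma int_shift (c a b : R) (f : R -> R) (C : R) : measurable_fun setT f -> (forall x, `|f x| <= C) ->
  \int[mu]_(x in `[a, b[) f x = \int[mu]_(x in `[a + c, b + c[) f (x - c).
Proof.
move=> mf bf.
have bi u v : bset (`[u, v[%classic : set R).
  split; first exact: measurable_itv.
  by rewrite lebesgue_measure_itv/=; case: ifP => _; rewrite ?ltry// -EFinD ltry.
rewrite (@leb_isom (fun x => x - c) _ f C)//.
- congr Rintegral; apply/seteqP; split=> x /=; rewrite !in_itv/=; move=> /andP[h1 h2]; apply/andP; split; lra.
- by apply: measurable_funB => //; exact: measurable_cst.
- move=> u v; rewrite preimage_shift !lebesgue_measure_itv/= !lte_fin ltrD2r.
  by case: ifP => // _; rewrite -!EFinD; congr EFin; ring.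
- rewrite (_ : _ @^-1` _ = `[a + c, b + c[%classic)//.
  by apply/seteqP; split=> x /=; rewrite !in_itv/=; move=> /andP[h1 h2]; apply/andP; split; lra.
Qed.

Lemma int_refl (c a b : R) (f : R -> R) (C : R) : measurable_fun setT f ->
  (forall x, a <= x <= b -> `|f x| <= C) ->
  \int[mu]_(x in `[a, b]) f x = \int[mu]_(x in `[c - b, c - a]) f (c - x).
Proof.
move=> mf bf.
have pE : (fun x => c - x) @^-1` `[a, b]%classic = `[c - b, c - a]%classic.
  by apply/seteqP; split=> x /=; rewrite !in_itv/=; move=> /andP[h1 h2]; apply/andP; split; lra.
rewrite (@leb_isom (fun x => c - x) _ f C) ?pE//.
- by apply: measurable_funB => //; exact: measurable_cst.
- move=> u v; rewrite preimage_refl !lebesgue_measure_itv/= !lte_fin ltrD2l ltrN2.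
  by case: ifP => // _; rewrite -!EFinD; congr EFin; ring.
- exact: bset_itv.
- exact: bset_itv.
Qed.

End Isometry.

(** * Convergence of the finite processes *)

Section FiniteProcess.
Variables (R : realType) (ts rho t : R).
Hypotheses (rho0 : 0 < rho) (tts : 0 < t < ts).
Notation mu := (@lebesgue_measure R).
Implicit Types (T : rtype) (L : ltype) (N : nat).
Notation rN T N := (r_scale T rho N).

Definition rng T (r : R) : set R := [set x | if T is A_N then x < 2 * pi * r else True].
Definition BT T (r : R) : set R := `[0, upper T r]%classic `&` rng T r.

Lemma BTE T r : BT T r = if T is A_N then `[0, 2 * pi * r[%classic else `[0, pi * r]%classic.
Proof.
rewrite /BT /rng; case: T => /=; last 6 first.
1-6: by apply/seteqP; split=> x /=; [case|].
apply/seteqP; split=> x /=; rewrite !in_itv/=.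
  by move=> [/andP[-> _] ->].
by move=> /andP[-> h]; rewrite h ltW.
Qed.

Lemma rng_meas T r : measurable (rng T r).
Proof.
rewrite /rng; case: T; last 6 first.
1-6: by rewrite (_ : [set _ | _] = setT)//; apply/seteqP; split.
by rewrite (_ : [set _ | _] = `]-oo, 2 * pi * r[%classic) //; apply/seteqP; split=> x; rewrite /= in_itv.
Qed.

Lemma rng_of T (r x : R) : (if T is A_N then x < 2 * pi * r else x <= pi * r) -> rng T r x.
Proof. by rewrite /rng /=; case: T. Qed.

Lemma of_rng T (r x : R) : rng T r x -> 0 <= x <= upper T r ->
  if T is A_N then x < 2 * pi * r else x <= pi * r.
Proof. by rewrite /rng /upper /=; case: T => //= _ /andP[]. Qed.

Lemma bset_BT T r : bset (BT T r).
Proof.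
rewrite BTE; case: T; try exact: bset_itv.
split; first exact: measurable_itv.
by rewrite lebesgue_measure_itv/=; case: ifP => _; rewrite ?ltry// -EFinD ltry.
Qed.

Lemma int_BT T r (f : R -> R) (C : R) : measurable_fun setT f -> (forall x, `|f x| <= C) ->
  \int[mu]_(x in BT T r) f x = \int[mu]_(x in `[0, upper T r]) f x.
Proof.
move=> mf bf; rewrite BTE; case: T => //=; apply: Rintegral_itv_bndo_bndc.
have bB := bset_BT A_N r; rewrite BTE in bB.
by apply: (leb_integrable (C := C) bB mf) => x _.
Qed.

(** The U_j at time ts - t and the U_l at time t form a biorthogonal system whose norms at total
    time [ts] are the denominators of the kernel. *)
Lemma kN_repr T N x z : (1 < N)%N ->
  \int[mu]_(y in BT T (rN T N)) (kN' ts rho t T N x y * kN' ts rho t T N y z) = kN' ts rho t T N x z.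
Proof.
move=> N1; have /andP[t0 t1] := tts; have t2 : 0 < ts - t by rewrite subr_gt0.
have ts0 : 0 < ts by exact: lt_trans t1.
have N0 : (0 < N)%N by exact: ltnW.
have r0 := r_scale_gt0 rho0 T N0.
have h0 := hT_gt0 T N1 r0.
rewrite /kN' N1 /kN.
pose Uj (j : 'I_N) s v := U (sharp T) (hT T N (rN T N)) (wT T (rN T N) j.+1) s v.
pose kp (j : 'I_N) := kap T N (rN T N) ts j.+1.
have kp0 j : kp j != 0 by rewrite gt_eqF// kap_gt0.
pose c (p : 'I_N * 'I_N) := Uj p.1 t x * Uj p.2 (ts - t) z / (kp p.1 * kp p.2).
pose F (p : 'I_N * 'I_N) y := Uj p.1 (ts - t) y * Uj p.2 t y.
have -> : \int[mu]_(y in BT T (rN T N)) ((\sum_(j < N) Uj j t x * Uj j (ts - t) y / kp j) *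
    (\sum_(j < N) Uj j t y * Uj j (ts - t) z / kp j)) =
  \int[mu]_(y in BT T (rN T N)) \sum_p c p * F p y.
  apply: eq_Rintegral => y _; rewrite mulr_suml.
  under eq_bigr do rewrite mulr_sumr.
  rewrite pair_bigA; apply: eq_bigr => -[j l] _ /=.
  by rewrite /c /F /=; field; rewrite !kp0.
have mU (j : 'I_N) s : 0 < s -> measurable_fun setT (Uj j s) by move=> s0; exact: U_meas.
have mF p : measurable_fun setT (F p) by apply: measurable_funM; exact: mU.
have bF p y : `|F p y| <= KU rho (ts - t) * KU rho t.
  by rewrite normrM; apply: ler_pM => //; apply: U_le => //; exact: ltn_ord.
rewrite (leb_lin (C := KU rho (ts - t) * KU rho t) _ (bset_BT T _) mF bF).
have FE p : \int[mu]_(y in BT T (rN T N)) F p y = if p.1 == p.2 then kp p.1 else 0.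
  rewrite (int_BT _ _ (mF p) (bF p)) U_ortho ?ltn_ord//.
  by rewrite eqSS val_eqE subrK.
under eq_bigr do rewrite FE.
rewrite -(pair_bigA _ (fun j l => c (j, l) * (if j == l then kp j else 0)))/=.
apply: eq_bigr => j _; rewrite (bigD1 j)//= eqxx big1 ?addr0; last first.
  by move=> l lj; rewrite eq_sym (negbTE lj) mulr0.
change (Uj j t x * Uj j (ts - t) z / (kp j * kp j) * kp j = Uj j t x * Uj j (ts - t) z / kp j).
by move: (Uj j t x) (Uj j (ts - t) z) (kp j) (kp0 j) => a b k k0; field.
Qed.

Lemma kN_tr T N : (1 < N)%N -> \int[mu]_(x in BT T (rN T N)) kN' ts rho t T N x x = N%:R.
Proof.
move=> N1; have /andP[t0 t1] := tts; have t2 : 0 < ts - t by rewrite subr_gt0.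
have ts0 : 0 < ts by exact: lt_trans t1.
have N0 : (0 < N)%N by exact: ltnW.
have r0 := r_scale_gt0 rho0 T N0.
have h0 := hT_gt0 T N1 r0.
rewrite /kN' N1 /kN.
pose Uj (j : 'I_N) s v := U (sharp T) (hT T N (rN T N)) (wT T (rN T N) j.+1) s v.
pose kp (j : 'I_N) := kap T N (rN T N) ts j.+1.
have kp0 j : kp j != 0 by rewrite gt_eqF// kap_gt0.
have mU (j : 'I_N) s : 0 < s -> measurable_fun setT (Uj j s) by move=> s0; exact: U_meas.
pose F (j : 'I_N) y := Uj j t y * Uj j (ts - t) y.
have mF p : measurable_fun setT (F p) by apply: measurable_funM; exact: mU.
have bF p y : `|F p y| <= KU rho t * KU rho (ts - t).
  by rewrite normrM; apply: ler_pM => //; apply: U_le => //; exact: ltn_ord.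
have -> : \int[mu]_(x in BT T (rN T N)) (\sum_(j < N) Uj j t x * Uj j (ts - t) x / kp j) =
  \int[mu]_(y in BT T (rN T N)) \sum_j (kp j)^-1 * F j y.
  by apply: eq_Rintegral => y _; apply: eq_bigr => j _; rewrite mulrC.
rewrite (leb_lin (C := KU rho t * KU rho (ts - t)) _ (bset_BT T _) mF bF).
rewrite (eq_bigr (fun=> 1)) ?sumr_const ?card_ord// => j _.
rewrite (int_BT _ _ (mF j) (bF j)) U_ortho ?ltn_ord// eqxx addrC subrK.
by rewrite mulVf// kp0.
Qed.

Definition pl T N := place T (rN T N).

Lemma place_meas T r : measurable_fun setT (place T r : R -> R).
Proof.
rewrite /place; case: T; try exact: measurable_id.
apply: measurable_fun_ifT => //; last first.
  by apply: measurable_funB => //; exact: measurable_cst.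
by apply: measurable_fun_ltr => //; exact: measurable_cst.
Qed.

Lemma expm_place A c (G : seq R -> R) T r : expm A c G -> expm A c (fun s => G (map (place T r) s)).
Proof.
case=> A0 c0 mG bG; split=> //; last by move=> u; apply: le_trans (bG _) _; rewrite size_map.
move=> m d T' g mg; rewrite (_ : (fun w => _) = fun w => G (mkseq (fun i => place T r (g i w)) m)).
  apply: (mG m _ _ (fun i w => place T r (g i w))) => i.
  by apply: measurableT_comp => //; exact: place_meas.
by apply/funext => w; rewrite /mkseq -map_comp.
Qed.

Definition Efin T N (G : seq R -> R) : R :=
  rint (nseq N (BT T (rN T N))) (fun s => (sorted <%R s)%:R *
    (G (map (pl T N) s) * Dks (kN' ts rho t T N) s)).

Lemma Efin_sum T N G A c : (1 < N)%N -> symf G -> expm A c G ->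
  Efin T N G = \sum_(n < N.+1) (n`!%:R)^-1 * rint (nseq n (BT T (rN T N)))
    (fun s => Mob (fun u => G (map (pl T N) u)) s * Dks (kN' ts rho t T N) s).
Proof.
move=> N1 sG eG; have bk := bker_kN' rho0 tts T N.
have eG' := expm_place T (rN T N) eG.
have sf : symf (fun s => G (map (pl T N) s) * Dks (kN' ts rho t T N) s).
  move=> s s' ss'; rewrite (sG _ _ (perm_map (pl T N) ss')); congr (_ * _).
  exact: Dks_perm.
have bf : bnm N (fun s => G (map (pl T N) s) * Dks (kN' ts rho t T N) s).
  by apply: bnmM; [exact: expm_bnm eG'|exact: bnm_Dks bk].
have h1 := rint_sorted (bset_BT T (rN T N)) sf bf.
have h2 := rint_Mob (bset_BT T (rN T N)) bk (fun x z => kN_repr T x z N1) (kN_tr T N1) eG'.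
have f0 : N`!%:R != 0 :> R by rewrite pnatr_eq0 -lt0n fact_gt0.
by apply: (mulfI f0); rewrite -h2 -h1.
Qed.

Lemma Mob_map (p : R -> R) G s : Mob (fun u => G (map p u)) s = Mob G (map p s).
Proof. by elim: s G => [//|x s IH] G /=; rewrite IH (IH (fun u => G (p x :: u))). Qed.

Definition B' T r : set R := if T is A_N then `[- (pi * r), pi * r[%classic else `[0, pi * r]%classic.

Lemma bset_B' T r : bset (B' T r).
Proof.
rewrite /B'; case: T; try exact: bset_itv.
split; first exact: measurable_itv.
by rewrite lebesgue_measure_itv/=; case: ifP => _; rewrite ?ltry// -EFinD ltry.
Qed.

Lemma int_place T r (f : R -> R) (C : R) : 0 < r -> measurable_fun setT f -> (forall x, `|f x| <= C) ->
  \int[mu]_(x in BT T r) f (place T r x) = \int[mu]_(x in B' T r) f x.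
Proof.
move=> r0 mf bf; rewrite BTE /B' /place; case: T => //.
have pr : 0 < pi * r by rewrite mulr_gt0 ?pi_gt0.
have prE : 2 * pi * r = pi * r + pi * r by rewrite -mulrA mulr_natl mulr2n.
have bi u v : bset (`[u, v[%classic : set R).
  split; first exact: measurable_itv.
  by rewrite lebesgue_measure_itv/=; case: ifP => _; rewrite ?ltry// -EFinD ltry.
have mp : measurable_fun setT (fun x : R => f (if x < pi * r then x else x - 2 * pi * r)).
  by apply: measurableT_comp => //; have := place_meas A_N r.
have split_ (g : R -> R) (a b c : R) : measurable_fun setT g -> (forall x, `|g x| <= C) ->
    a <= b -> b <= c ->
    \int[mu]_(x in `[a, c[) g x = \int[mu]_(x in `[a, b[) g x + \int[mu]_(x in `[b, c[) g x.
  move=> mg bg ab bc; rewrite -Rintegral_setU//.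
  - congr Rintegral; apply/seteqP; split=> x /=; rewrite !in_itv/=.
      move=> /andP[-> ->]/=; rewrite andbT; case: (ltP x b) => _; [by left|by right].
    by move=> [/andP[h1 h2]|/andP[h1 h2]]; apply/andP; split; lra.
  - apply: (leb_integrable (C := C) _ mg) => [|x _]; last exact: bg.
    split; first by apply: measurableU; exact: measurable_itv.
    rewrite (_ : _ `|` _ = `[a, c[%classic); first exact: (bi a c).2.
    apply/seteqP; split=> x /=; rewrite !in_itv/=.
      by move=> [/andP[h1 h2]|/andP[h1 h2]]; apply/andP; split; lra.
    move=> /andP[-> ->]/=; rewrite andbT; case: (ltP x b) => _; [by left|by right].
  - apply/disj_setPLR => x /=; rewrite !in_itv/= => /andP[_ h1] /andP[h2 _]; lra.
rewrite (split_ _ 0 (pi * r))//; [|lra|lra].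
rewrite (split_ f _ 0)//; [|lra|lra].
rewrite addrC; congr (_ + _).
  have -> : \int[mu]_(x in `[- (pi * r), 0[) f x =
      \int[mu]_(x in `[- (pi * r) + 2 * pi * r, 0 + 2 * pi * r[) f (x - 2 * pi * r).
    exact: int_shift mf bf.
  rewrite (_ : - (pi * r) + 2 * pi * r = pi * r) ?add0r; last by rewrite prE; ring.
  by apply: eq_Rintegral => x /set_mem /=; rewrite in_itv/= => /andP[h1 _]; rewrite ltNge h1.
by apply: eq_Rintegral => x /set_mem /=; rewrite in_itv/= => /andP[_ ->].
Qed.

Lemma rint_place T r n (F : seq R -> R) : 0 < r -> bnm n F ->
  rint (nseq n (BT T r)) (fun s => F (map (place T r) s)) = rint (nseq n (B' T r)) F.
Proof.
move=> r0; elim: n F => [//|n IH] F bF /=.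
have bs : bsets (B' T r :: nseq n (B' T r)).
  by apply/bsets_cons; split; [exact: bset_B'|exact: bsets_nseq (bset_B' T r)].
have [|C [mf bf]] := @rint_cons_meas R _ _ F bs; first by rewrite size_nseq.
rewrite -(int_place T r0 mf bf).
by apply: eq_Rintegral => x _; rewrite -(IH (fun s => F (place T r x :: s)))//; exact: bnm_cons.
Qed.

Lemma cas_shift (y : R) (k : int) : cas (y - (2 * k - 1)%:~R * pi) = - cas y.
Proof.
have -> : y - (2 * k - 1)%:~R * pi = y + pi - k%:~R * (2 * pi).
  by rewrite intrB intrM; move: (pi : R) => p; ring.
rewrite /cas cosB sinB cos_int2pi (_ : k%:~R * (2 * pi) = (k * 2)%:~R * pi); last first.
  by rewrite intrM; move: (pi : R) => p; ring.
by rewrite sin_intpi !mulr1 !mulr0 addr0 subr0 cosDpi sinDpi opprD.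
Qed.

Lemma cas_shift0 (y : R) (k : int) : cas (y - (2 * k)%:~R * pi) = cas y.
Proof.
have -> : y - (2 * k)%:~R * pi = y - k%:~R * (2 * pi).
  by rewrite intrM; move: (pi : R) => p; ring.
rewrite /cas cosB sinB cos_int2pi (_ : k%:~R * (2 * pi) = (k * 2)%:~R * pi); last first.
  by rewrite intrM; move: (pi : R) => p; ring.
by rewrite sin_intpi !mulr1 !mulr0 addr0 subr0.
Qed.

(** Over a full turn the phase grows by pi times N (2n - 1) + 2 j + 1, whose parity is opposite to
    that of [N]: the functions are periodic for odd [N] and antiperiodic for even [N]. *)
Lemma U_shift N j s x : (1 < N)%N -> 0 < s ->
  U LA (hT A_N N (rN A_N N)) (wT A_N (rN A_N N) j.+1) s (x - 2 * pi * rN A_N N) =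
  (if odd N then 1 else -1) * U LA (hT A_N N (rN A_N N)) (wT A_N (rN A_N N) j.+1) s x.
Proof.
move=> N1 s0; have r0 := r_scale_gt0 rho0 A_N (ltnW N1); have h0 := hT_gt0 A_N N1 r0.
have hh : 0 < hT A_N N (rN A_N N) <= hT A_N N (rN A_N N) by rewrite h0 lexx.
rewrite /U /V -(zsZ _ (gc01 s0 h0) (gb_V _ x (@fL_le2 R LA) (ltW s0) hh (lexx _))).
apply: eq_zs => n; rewrite [RHS]mulrCA; congr (_ * _).
have rn0 : rN A_N N != 0 by rewrite gt_eqF.
pose kk : int := N%:Z * (2 * n - 1) + (2 * j.+1%:Z - 1).
have -> : om (hT A_N N (rN A_N N)) (wT A_N (rN A_N N) j.+1) n * (x - 2 * pi * rN A_N N) =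
    om (hT A_N N (rN A_N N)) (wT A_N (rN A_N N) j.+1) n * x - kk%:~R * pi.
  have kkE : kk%:~R = N%:R * (2 * n%:~R - 1) + (2 * j.+1%:R - 1) :> R.
    by rewrite /kk !(intrD, intrB, intrM).
  rewrite kkE /om /hT /wT /calN /Jidx.
  move: (r_scale A_N rho N) rn0 (pi : R) (N%:R : R) (j.+1%:R : R) (n%:~R : R) => r r1 p m q v.
  by field.
rewrite /= ; case: (boolP (odd N)) => oN.
  have [k kE] : exists k, kk = 2 * k.
    exists (n * N%:Z - (N./2)%:Z + j%:Z); rewrite /kk; have := odd_double_half N; rewrite oN; lia.
  by rewrite kE cas_shift0 mul1r.
have [k kE] : exists k, kk = 2 * k - 1.
  exists (n * N%:Z - (N./2)%:Z + j.+1%:Z); rewrite /kk; have := odd_double_half N; rewrite (negbTE oN); lia.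
by rewrite kE cas_shift mulN1r.
Qed.

(** A full turn multiplies the row and the column of a point by the same sign, so the determinant
    does not notice where the circle is cut. *)
Lemma Dks_place T N s : (1 < N)%N ->
  Dks (kN' ts rho t T N) (map (pl T N) s) = Dks (kN' ts rho t T N) s.
Proof.
move=> N1; have /andP[t0 t1] := tts; have t2 : 0 < ts - t by rewrite subr_gt0.
have [->|TA] : T = A_N \/ T <> A_N by case: T; (try by left); right.
2: by congr Dks; rewrite -[RHS]map_id; apply: eq_map => x; rewrite /pl /place; case: T TA.
pose e (x : R) : R := if x < pi * rN A_N N then 1 else (if odd N then 1 else -1).
have ee x : e x * e x = 1 by rewrite /e; case: ifP => _; [|case: odd]; rewrite ?mulrNN ?mulr1.
have Ue j s0 x : 0 < s0 -> U LA (hT A_N N (rN A_N N)) (wT A_N (rN A_N N) j.+1) s0 (pl A_N N x) =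
    e x * U LA (hT A_N N (rN A_N N)) (wT A_N (rN A_N N) j.+1) s0 x.
  by move=> s00; rewrite /pl /place /e; case: ifP => _; rewrite ?mul1r// U_shift.
have kE x y : kN' ts rho t A_N N (pl A_N N x) (pl A_N N y) = e x * e y * kN' ts rho t A_N N x y.
  rewrite /kN' N1 /kN mulr_sumr; apply: eq_bigr => j _; rewrite /= !Ue//.
  by move: (U _ _ _ _ x) (U _ _ _ _ y) (kap _ _ _ _ _) => a b c; ring.
rewrite (@Dks_size R _ (size s)) ?size_map// /Dks.
pose d : 'rV[R]_(size s) := \row_i e (nth 0 s i).
have -> : \matrix_(i < size s, j < size s) kN' ts rho t A_N N (nth 0 (map (pl A_N N) s) i) (nth 0 (map (pl A_N N) s) j) =
    diag_mx d *m (\matrix_(i < size s, j < size s) kN' ts rho t A_N N (nth 0 s i) (nth 0 s j)) *m diag_mx d.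
  apply/matrixP => i j; rewrite mul_mx_diag mul_diag_mx !mxE !(nth_map 0)// kE.
  by move: (e _) (e _) (kN' _ _ _ _ _ _ _) => a b c; ring.
rewrite !det_mulmx det_diag mulrAC -big_split /= big1 ?mul1r// => i _.
by rewrite mxE ee.
Qed.

Lemma Slim_meas L : measurable (@Slim R L).
Proof. by case: L => /=; try exact: measurable_itv; exact: measurableT. Qed.

Lemma win_eq T (r M : R) : M < pi * r ->
  B' T r `&` `[- M, M]%classic = win (@Slim R (sharp T)) M.
Proof.
move=> h; rewrite /win /B'; case: T => /=; apply/seteqP; split=> x /=; rewrite !in_itv/= ?andbT.
- by move=> [].
- by move=> [_ /andP[h1 h2]]; rewrite h1 h2; split=> //; apply/andP; split; lra.
all: try by move=> [/andP[-> _]].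
all: by move=> [h1 /andP[h2 h3]]; rewrite h1 h2 h3; split=> //=; lra.
Qed.

Lemma win_near T M : \forall N \near \oo, bset (B' T (rN T N)) /\
  B' T (rN T N) `&` `[- M, M]%classic = win (@Slim R (sharp T)) M.
Proof.
have rbig (K : R) : \forall N \near \oo, K < pi * rN T N.
  have c0 : exists2 c : R, 0 < c & forall N : nat, pi * rN T N = c * N%:R.
    have pi0 := pi_gt0 R; have pn : pi != 0 :> R by rewrite gt_eqF.
    have rn : rho != 0 by rewrite gt_eqF.
    exists (if T is A_N then (2 * rho)^-1 else rho^-1).
      by case: T; rewrite invr_gt0// mulr_gt0.
    by case: T => N; rewrite /r_scale; move: (pi : R) (N%:R : R) pn => p z pn; field; rewrite ?rn ?pn.
  have [c cp cE] := c0; near=> N; rewrite cE mulrC -ltr_pdivrMr//.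
  by near: N; exact: nbhs_infty_gtr.
near=> N; split; first exact: bset_B'.
have h : M < pi * rN T N by near: N; exact: rbig.
exact: win_eq.
Unshelve. all: by end_near. Qed.

Lemma Efin_cvg T M G : nice M G -> Efin T N G @[N --> \oo] --> EE (@Slim R (sharp T)) (klim ts rho t (sharp T)) G.
Proof.
move=> nG; have bk := bker_klim rho0 tts T; have mS := Slim_meas (sharp T).
rewrite (@EE_Eser R _ _ M G nG); have [sG _ [A [c eG]]] := nG.
have := @Eser_limit R _ _ _ mS bk (kN' ts rho t T) (fun N => B' T (rN T N)) M G nG
  (bker_kN' rho0 tts T) (fun x y => @kN'_cvg R ts rho t rho0 tts T x y) (win_near T M).
apply: cvg_trans; apply: near_eq_cvg; near=> N.
have N1 : (1 < N)%N by near: N; exact: nbhs_infty_gt.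
rewrite (Efin_sum _ N1 sG eG); apply: eq_bigr => n _; congr (_ * _).
have eM := Mob_expm eG.
rewrite -(@rint_place T (rN T N) n (fun s => Mob G s * Dks (kN' ts rho t T N) s)).
- by apply: eq_rint => s _; rewrite Mob_map Dks_place.
- by apply: r_scale_gt0 => //; exact: ltnW.
- by apply: bnmM; [exact: expm_bnm eM|exact: bnm_Dks (bker_kN' rho0 tts T N)].
Unshelve. all: by end_near. Qed.

Lemma eq_iint (Bs : seq (set R)) (f g : seq R -> R) : (forall s, inB Bs s -> f s = g s) ->
  iint Bs f = iint Bs g.
Proof.
elim: Bs f g => [|B Bs IH] f g h /=; first by rewrite h.
apply: eq_integral => x /set_mem Bx; apply: IH => s hs.
by apply: h.
Qed.

Lemma inB_nseq N (B : set R) s x : inB (nseq N B) s -> x \in s -> B x.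
Proof.
elim: N s => [|N IH] [|y s] //= [By h]; rewrite inE => /orP[/eqP ->//|].
exact: IH.
Qed.

Lemma bnm_ind N (B : set R) i : measurable B -> (i < N)%N ->
  bnm N (fun s => (`[< B (nth 0 s i) >])%:R).
Proof.
move=> mB iN; split; last by exists 1 => s _; case: `[< _ >]; rewrite ?normr1 ?normr0.
move=> d T g mg; under eq_fun do rewrite nth_mkseq//.
rewrite (_ : (fun w => _) = (\1_B \o g i)).
  by apply: measurableT_comp => //; apply: measurable_indic.
by apply/funext => w; rewrite /= indicE; congr (nat_of_bool _)%:R; rewrite in_setE.
Qed.

Definition cylind m (a b : 'I_m -> R) (k : 'I_m -> nat) (s : seq R) : R :=
  (`[< forall i, cnt `[a i, b i]%classic s = k i >])%:R.

Lemma nice_cylind m (a b : 'I_m -> R) (k : 'I_m -> nat) :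
  nice (\sum_i (`|a i| + `|b i|)) (cylind a b k).
Proof.
pose kk := [seq k i | i <- enum 'I_m].
pose Bs := [seq (`[a i, b i]%classic : set R) | i <- enum 'I_m].
rewrite (_ : cylind a b k = fun s => (fun z => (z == kk)%:R) (cnts Bs s)).
  apply: (@nice_cnts R _ Bs (fun z => (z == kk)%:R) 1 1) => //; last first.
    by move=> s; rewrite expr1n mulr1; case: eqP; rewrite ?normr1 ?normr0.
  move=> B /List.in_map_iff[i [<- _]]; split; first exact: measurable_itv.
  have h : `|a i| + `|b i| <= \sum_i (`|a i| + `|b i|).
    by rewrite (bigD1 i)//= lerDl sumr_ge0// => l _; rewrite addr_ge0.
  move=> x /=; rewrite !in_itv/= => /andP[h1 h2].
  have h3 := ler_norm (b i); have h4 := lerNnormlW (lexx `|a i|).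
  have h5 := normr_ge0 (a i); have h6 := normr_ge0 (b i).
  by apply/andP; split; lra.
apply/funext => s; congr (nat_of_bool _)%:R.
have -> : cnts Bs s = [seq cnt `[a i, b i]%classic s | i <- enum 'I_m].
  by rewrite /cnts /Bs; elim: (enum 'I_m) => //= i l ->.
apply/asboolP/eqP => [h|/eq_in_map h i]; first exact: eq_map.
by apply: h; rewrite mem_enum.
Qed.

Lemma Pfin_Efin T N m (a b : 'I_m -> R) (k : 'I_m -> nat) : (1 < N)%N ->
  Pfin T N (rN T N) ts t (fun s => forall i, nfin T (rN T N) s `[a i, b i] = k i) =
  Efin T N (cylind a b k).
Proof.
move=> N1; have r0 := r_scale_gt0 rho0 T (ltnW N1).
set r := rN T N in r0 *.
pose D0 : set R := [set x : R | 0 <= x <= upper T r].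
(* [Pfin] integrates over a closed box and excludes the right end of the circle inside the event;
   [ind] isolates this condition so that it can be moved into the domain [BT]. *)
pose ind (s : seq R) : R := \prod_(x <- s) (`[< rng T r x >])%:R.
pose f1 s := (sorted <%R s)%:R * (ind s * (cylind a b k (map (pl T N) s) * Dks (kN' ts rho t T N) s)).
have D0E : D0 = `[0, upper T r]%classic by apply/seteqP; split=> x; rewrite /D0 /= in_itv.
have bD0 : bset D0 by rewrite D0E; exact: bset_itv.
have [_ _ [A [c eG]]] := nice_cylind a b k.
have bk := bker_kN' rho0 tts T N.
have mrng := rng_meas T r.
have bf1 : bnm N f1.
  apply: bnmM; first exact: bnm_sorted.
  apply: bnmM.
    apply: (@bnm_ext _ N (fun s => \prod_(i < N) (`[< rng T r (nth 0 s i) >])%:R)).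
      by move=> s <-; rewrite /ind (big_nth 0) big_mkord.
    by apply: bnm_prod => i _; exact: bnm_ind.
  by apply: bnmM; [exact: expm_bnm (expm_place T r eG)|exact: bnm_Dks bk].
have step1 : iint (nseq N D0) (fun s => (\1_[set s | ordered_conf T r s /\
      (forall i, nfin T r s `[a i, b i] = k i)] s) * complex.Re (@density R T N r ts t (@seqfun R N s))) =
    iint (nseq N D0) f1.
  apply: eq_iint => s inS; have sN := inB_size inS; rewrite size_nseq in sN.
  rewrite densityE//.
  have -> : Dks (kN T N r ts t) s = Dks (kN' ts rho t T N) s.
    rewrite (_ : kN T N r ts t = kN' ts rho t T N)//.
    by apply/funext => x; apply/funext => y; rewrite /kN' N1.
  rewrite /f1 !mulrA; congr (_ * _); rewrite indicE /cylind /ind.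
  have rE : \prod_(x <- s) (`[< rng T r x >])%:R = (`[< forall i, (i < N)%N -> rng T r (nth 0 s i) >])%:R :> R.
    rewrite (big_nth 0) sN big_mkord; case: asboolP => h.
      by rewrite big1// => i _; rewrite asboolT//; apply: h.
    have [i [iN ni]] : exists i, (i < N)%N /\ ~ rng T r (nth 0 s i).
      apply: contrapT => nh; apply: h => i iN; apply: contrapT => ni; apply: nh; by exists i.
    by rewrite (bigD1 (Ordinal iN))//= asboolF// mul0r.
  rewrite rE -!natrM !mulnb; congr (nat_of_bool _)%:R.
  have nfE i : nfin T r s `[a i, b i] = cnt `[a i, b i]%classic (map (pl T N) s).
    by rewrite /nfin /cnt count_map.
  apply/idP/idP => [/set_mem[[h1 [h2 h3]] h4]|].
    apply/andP; split; [apply/andP; split|].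
    - by apply/(sortedP 0) => i; exact: h2.
    - apply/asboolP => i iN; have := h3 i; rewrite sN => /(_ iN).
      exact: rng_of.
    - by apply/asboolP => i; rewrite -nfE.
  move=> /andP[/andP[/(sortedP 0) h1 /asboolP h2] /asboolP h3]; apply: mem_set.
  have h0 i : (i < size s)%N -> 0 <= nth 0 s i <= upper T r.
    by move=> iN; exact: (inB_nseq inS (mem_nth 0 iN)).
  split; last by move=> i; rewrite nfE.
  split; first by move=> i /h0/andP[].
  split=> // i iN; have := h0 i iN; rewrite sN in iN; exact: of_rng (h2 i iN).
rewrite /Pfin -/r [X in fine X]step1 iint_rint; last 2 first.
- exact: bsets_nseq.
- by rewrite size_nseq.
rewrite /= /Efin -/r; have -> : BT T r = D0 `&` rng T r by rewrite /BT D0E.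
rewrite (@rint_restrict R N D0 (rng T r)); last first.
  by move=> s x xs nx; rewrite /f1 /ind (big_rem x)//= asboolF// !mul0r mulr0.
apply: eq_rint => s inS; rewrite /f1 /ind big_seq big1 ?mul1r// => x xs.
by have [_ h] := inB_nseq inS xs; rewrite asboolT.
Qed.

End FiniteProcess.

(** * Real form of the limit kernels *)

Section KlimReal.
Variables (R : realType) (ts rho t : R).
Hypotheses (rho0 : 0 < rho) (tts : 0 < t < ts).
Notation mu := (@lebesgue_measure R).
Local Notation C := (complex R).
Notation h := (hinf rho).

Let t0 : 0 < t. Proof. by case/andP: tts. Qed.
Let t2 : 0 < ts - t. Proof. by rewrite subr_gt0; case/andP: tts. Qed.
Let ts0 : 0 < ts. Proof. by case/andP: tts => h1 h2; exact: lt_trans h2. Qed.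
Let h0 : 0 < h. Proof. by rewrite /hinf !mulr_gt0 ?pi_gt0. Qed.

Lemma zs_measurable_ptw d (X : measurableType d) (F : X -> int -> R) (A : X -> R) c : 0 <= c < 1 ->
  (forall x, gb (A x) c (F x)) -> (forall n, measurable_fun setT (F^~ n)) ->
  measurable_fun setT (fun x => zs (F x)).
Proof.
move=> c01 g mF; apply: (@measurable_fun_cvg _ X R setT (fun n x => series (zb (F x)) n)).
- move=> m; rewrite /series/=; apply: measurable_sum => n.
  rewrite /zb; case: eqP => _; first exact: mF.
  by apply: measurable_funD; exact: mF.
- by move=> x _; exact: zs_cvg c01 (g x).
Qed.

Lemma om_meas (a : R) n : measurable_fun setT (fun l : R => om h (a * l) n).
Proof.
by apply: measurable_funD; [exact: measurable_cst|apply: measurable_funM => //; exact: measurable_cst].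
Qed.

Lemma eg_meas (a s : R) n : measurable_fun setT (fun l : R => eg h (a * l) s n).
Proof.
apply: (@measurableT_comp _ _ _ _ _ _ expR); first exact: measurable_expR.
apply: measurable_funN; apply: measurable_funM; last exact: measurable_cst.
apply: measurable_funM; first exact: measurable_cst.
by apply: measurable_funX; exact: om_meas.
Qed.

Lemma V_meas_w b (f : R -> R) (a s x : R) : measurable_fun setT f -> (forall y, `|f y| <= 2) ->
  0 < s -> measurable_fun setT (fun l => V b f h (a * l) s x).
Proof.
move=> mf bf s0; apply: (@zs_measurable_ptw _ _ (fun l n => sgn R b n * eg h (a * l) s n * f (om h (a * l) n * x))
   (fun l => 2 * gA s (h / 2 + `|a * l|)) (gc s h)); first exact: gc01.
  by move=> l; apply: gb_V; rewrite ?(ltW s0) ?h0 ?lexx.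
move=> n; apply: measurable_funM.
  by apply: measurable_funM; [exact: measurable_cst|exact: eg_meas].
apply: measurableT_comp => //; apply: measurable_funM; last exact: measurable_cst.
exact: om_meas.
Qed.

Lemma ZZ_meas_w (a : R) : measurable_fun setT (fun l => (ZZ h (a * l) ts)^-1).
Proof.
have mZ : measurable_fun setT (fun l => ZZ h (a * l) ts).
  apply: (@zs_measurable_ptw _ _ (fun l n => eg h (a * l) ts n)
     (fun l => gA ts (h / 2 + `|a * l|)) (gc ts h)); first exact: gc01.
    by move=> l; apply: gb_eg; rewrite ?(ltW ts0) ?h0 ?lexx.
  by move=> n; exact: eg_meas.
rewrite (_ : (fun l => _) = fun l => expR (- ln (ZZ h (a * l) ts))).
  apply: (@measurableT_comp _ _ _ _ _ _ expR); first exact: measurable_expR.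
  by apply: measurable_funN; apply: measurableT_comp => //; exact: measurable_ln.
by apply/funext => l; rewrite expRN lnK// posrE ZZ_gt0.
Qed.

(** For [f1] and [f2] ranging over [cos] and [sin], the four products into which the integrands of
    the limit kernels split. *)
Definition Q b (f1 f2 : R -> R) (a x y l : R) : R :=
  V b f1 h (a * l) t x * V b f2 h (a * l) (ts - t) y / ZZ h (a * l) ts.

Definition trig (f : R -> R) := f = cos \/ f = sin.

Lemma trig_meas f : trig f -> measurable_fun setT f.
Proof.
by move=> [->|->]; apply: continuous_measurable_fun; [exact: continuous_cos|exact: continuous_sin].
Qed.

Lemma Q_meas b f1 f2 a x y : trig f1 -> trig f2 -> measurable_fun setT (Q b f1 f2 a x y).
Proof.
move=> h1 h2; apply: measurable_funM; last exact: ZZ_meas_w.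
by apply: measurable_funM; apply: V_meas_w => //; [exact: trig_meas|exact: norm_trig|exact: trig_meas|exact: norm_trig].
Qed.

Lemma Q_bound b f1 f2 a x y : trig f1 -> trig f2 -> exists K : R, forall l, `|l| <= rho ->
  `|Q b f1 f2 a x y l| <= K.
Proof.
move=> h1 h2; pose W := h / 2 + `|a| * rho.
pose k s : R := 2 * (2 * gA s W) / (1 - gc s h).
have hh : 0 < h <= h by rewrite h0 lexx.
exists (k t * k (ts - t) * expR (ts * W ^+ 2 / 2)) => l lr.
have hW : h / 2 + `|a * l| <= W by rewrite lerD2l normrM ler_wpM2l.
rewrite normrM; apply: ler_pM => //.
  by rewrite normrM; apply: ler_pM => //; apply: V_bound => //; exact: norm_trig.
have Zge := ZZ_ge ts0 hh hW; have Z0 := lt_le_trans (expR_gt0 _) Zge.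
rewrite normfV gtr0_norm// -[X in _ <= X]invrK lef_pV2 ?posrE// ?invr_gt0 ?expR_gt0//.
by rewrite -expRN.
Qed.

Definition par (f : R -> R) (e : R) := trig f /\ forall y, f (- y) = e * f y.

Lemma par_cos : par cos 1. Proof. by split; [left|move=> y; rewrite cosN mul1r]. Qed.
Lemma par_sin : par sin (-1). Proof. by split; [right|move=> y; rewrite sinN mulN1r]. Qed.

Lemma Q_opp b f1 f2 e1 e2 a x y l : par f1 e1 -> par f2 e2 ->
  Q b f1 f2 a x y (- l) = e1 * e2 * Q b f1 f2 a x y l.
Proof.
move=> [q1 p1] [q2 p2]; rewrite /Q mulrN ZZ_oppw//.
rewrite (V_oppw b _ _ t0 h0 (norm_trig q1) p1) (V_oppw b _ _ t2 h0 (norm_trig q2) p2).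
move: (V _ _ _ _ _ _) (V _ _ _ _ _ _) (ZZ _ _ _)^-1 => u v z.
by case: b; ring.
Qed.

Lemma Q_compl f1 f2 e1 e2 x y l : par f1 e1 -> par f2 e2 ->
  Q false f1 f2 (2 * pi) x y (rho - l) = e1 * e2 * Q false f1 f2 (2 * pi) x y l.
Proof.
move=> [q1 p1] [q2 p2]; rewrite /Q.
have -> : 2 * pi * (rho - l) = h - 2 * pi * l by rewrite /hinf mulrBr.
rewrite ZZ_complw (V_complw _ _ t0 h0 (norm_trig q1) p1) (V_complw _ _ t2 h0 (norm_trig q2) p2).
by move: (V _ _ _ _ _ _) (V _ _ _ _ _ _) (ZZ _ _ _)^-1 => u v z; ring.
Qed.

Definition bmf (F : R -> R) := measurable_fun setT F /\ exists K : R, forall l, `|l| <= rho -> `|F l| <= K.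

Lemma bmf_Q b f1 f2 a x y : trig f1 -> trig f2 -> bmf (Q b f1 f2 a x y).
Proof. by move=> h1 h2; split; [exact: Q_meas|exact: Q_bound]. Qed.

Lemma bmf_int F a b : - rho <= a -> b <= rho -> bmf F -> mu.-integrable `[a, b] (EFin \o F).
Proof.
move=> ha hb [mF [K bF]]; apply: (leb_integrable (C := K) (bset_itv a b) mF) => x.
by rewrite /= in_itv/= => /andP[h1 h2]; apply: bF; rewrite ler_norml; apply/andP; split; lra.
Qed.

Lemma int_odd F : bmf F -> (forall l, F (- l) = - F l) -> \int[mu]_(l in `[- rho, rho]) F l = 0.
Proof.
move=> bF oF; have [mF [K hK]] := bF.
have := @int_refl R 0 (- rho) rho F K mF.
rewrite !sub0r opprK => e.
have : \int[mu]_(l in `[- rho, rho]) F l = - \int[mu]_(l in `[- rho, rho]) F l.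
  rewrite {1}e; last by move=> x hx; apply: hK; rewrite ler_norml.
  rewrite -[RHS]mulN1r -RintegralZl//; last exact: bmf_int.
  by apply: eq_Rintegral => x _; rewrite sub0r oF mulN1r.
by move: (\int[mu]_(l in `[- rho, rho]) F l) => z; lra.
Qed.

Lemma int_even F : bmf F -> (forall l, F (- l) = F l) ->
  \int[mu]_(l in `[- rho, rho]) F l = 2 * \int[mu]_(l in `[0, rho]) F l.
Proof.
move=> bF eF; have [mF [K hK]] := bF.
have i0 : mu.-integrable `[- rho, 0[ (EFin \o F).
  apply: integrableS (bmf_int (lexx (- rho)) (lexx rho) bF); try exact: measurable_itv.
  by move=> x /=; rewrite !in_itv/= => /andP[h1 h2]; apply/andP; split; lra.
have UE : `[- rho, 0[%classic `|` `[0, rho]%classic = `[- rho, rho]%classic.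
  apply/seteqP; split=> x /=; rewrite !in_itv/=.
    by move=> [/andP[h1 h2]|/andP[h1 h2]]; apply/andP; split; lra.
  by move=> /andP[-> ->]; rewrite andbT /=; case: (ltP x 0) => _; [left|right].
rewrite -UE Rintegral_setU//.
- rewrite Rintegral_itv_bndo_bndc//.
  rewrite (@int_refl R 0 (- rho) 0 F K mF); last first.
    by move=> x /andP[h1 h2]; apply: hK; rewrite ler_norml; apply/andP; split; lra.
  rewrite subr0 sub0r opprK mulr_natl mulr2n; congr (_ + _).
  by apply: eq_Rintegral => x _; rewrite sub0r eF.
- by rewrite UE; exact: bmf_int.
- clear UE i0; apply/disj_setPLR => x /=; rewrite !in_itv/= => /andP[_ h1] /andP[h2 _]; lra.
Qed.

Lemma int_anti F : bmf F -> (forall l, F (rho - l) = - F l) -> \int[mu]_(l in `[0, rho]) F l = 0.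
Proof.
move=> bF oF; have [mF [K hK]] := bF.
have nr : - rho <= 0 by rewrite oppr_le0 ltW.
have := @int_refl R rho 0 rho F K mF.
rewrite subrr subr0 => e.
have : \int[mu]_(l in `[0, rho]) F l = - \int[mu]_(l in `[0, rho]) F l.
  rewrite {1}e; last first.
    by move=> x /andP[h1 h2]; apply: hK; rewrite ler_norml; apply/andP; split; lra.
  rewrite -[RHS]mulN1r -RintegralZl//; last exact: bmf_int.
  by apply: eq_Rintegral => x _; rewrite oF mulN1r.
by move: (\int[mu]_(l in `[0, rho]) F l) => z; lra.
Qed.

Lemma bmfD F G : bmf F -> bmf G -> bmf (fun l => F l + G l).
Proof.
move=> [mF [K hK]] [mG [K' hK']]; split; first exact: measurable_funD.
exists (K + K') => l lr; apply: le_trans (ler_normD _ _) _.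
by apply: lerD; [exact: hK|exact: hK'].
Qed.

Lemma bmfN F : bmf F -> bmf (fun l => - F l).
Proof.
move=> [mF [K hK]]; split; first exact: measurable_funN.
by exists K => l lr; rewrite normrN; exact: hK.
Qed.

Lemma int_bmfD F G a b : - rho <= a -> b <= rho -> bmf F -> bmf G ->
  \int[mu]_(l in `[a, b]) (F l + G l) = \int[mu]_(l in `[a, b]) F l + \int[mu]_(l in `[a, b]) G l.
Proof. by move=> ha hb bF bG; rewrite RintegralD//; exact: bmf_int. Qed.

Lemma int_bmfB F G a b : - rho <= a -> b <= rho -> bmf F -> bmf G ->
  \int[mu]_(l in `[a, b]) (F l - G l) = \int[mu]_(l in `[a, b]) F l - \int[mu]_(l in `[a, b]) G l.
Proof. by move=> ha hb bF bG; rewrite RintegralB//; exact: bmf_int. Qed.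

Definition thb b : C -> C -> C := if b then @theta1 R else @theta2 R.

Lemma thbV b s w x (v1 v2 bb al : R) : 0 < s ->
  v1 = h * x / (2 * pi) -> v2 = s * h * w / (2 * pi) -> bb = s * h ^+ 2 / (2 * pi) ->
  al = w * x ->
  cexp (Complex 0 al) * thb b (Complex v1 v2) (Complex 0 bb) =
  (if b then iC R else 1) * (cR (expR (s * w ^+ 2 / 2)) * Complex (V b cos h w s x) (V b sin h w s x)).
Proof.
move=> s0 e1 e2 e3 e4; case: b => /=.
  by rewrite (theta1V s0 h0 e1 e2 e3 e4) mulrA.
by rewrite (theta2V s0 h0 e1 e2 e3 e4) mul1r.
Qed.

Lemma cexpD (a b : R) : cexp (Complex 0 (a + b)) = cexp (Complex 0 a) * cexp (Complex 0 b) :> C.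
Proof.
by rewrite /cexp /= expR0 cosD sinD mulcE; apply: complex_eq; ring.
Qed.

(** The phase is shared by the two theta factors, whose squares are completed with w and -w. As t +
    (ts - t) = ts, their Gaussian prefactors cancel the one of the denominator. The flag [sg]
    replaces y by -y, as in the second integral of [Khalf]. *)
Lemma prodE b (sg : bool) (x y w : R) (al v1 v2 v1' v2' v3 b1 b2 b3 : R) :
  v1 = h * x / (2 * pi) -> v2 = t * h * w / (2 * pi) -> b1 = t * h ^+ 2 / (2 * pi) ->
  v1' = h * (if sg then - y else y) / (2 * pi) -> v2' = - ((ts - t) * h * w / (2 * pi)) ->
  b2 = (ts - t) * h ^+ 2 / (2 * pi) ->
  v3 = ts * h * w / (2 * pi) -> b3 = ts * h ^+ 2 / (2 * pi) ->
  al = w * (x - (if sg then - y else y)) ->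
  let c := V b cos h w t x in let s := V b sin h w t x in
  let c' := V b cos h w (ts - t) y in let s' := V b sin h w (ts - t) y in
  let Z := ZZ h w ts in
  cexp (Complex 0 al) * thb b (Complex v1 v2) (Complex 0 b1) *
   thb b (Complex v1' v2') (Complex 0 b2) / theta2 (Complex 0 v3) (Complex 0 b3) =
  if sg then Complex ((c * c' - s * s') / Z) ((s * c' + c * s') / Z)
  else Complex ((c * c' + s * s') / Z) ((s * c' - c * s') / Z).
Proof.
move=> e1 e2 e3 e4 e5 e6 e7 e8 e9 /=.
set y' := if sg then - y else y in e4 e9.
have e5' : v2' = (ts - t) * h * (- w) / (2 * pi) by rewrite e5 mulrN mulNr.
have e9' : al = w * x + (- w) * y' by rewrite e9; ring.
have T1 := thbV b t0 e1 e2 e3 (erefl (w * x)).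
have T2 := thbV b t2 e4 e5' e6 (erefl (- w * y')).
rewrite e9' cexpD (theta2_0 ts0 h0 e7 e8).
rewrite -[X in X / _]mulrA mulrACA T1 T2 sqrrN.
have [pc nc] := par_cos; have [ps ns] := par_sin.
have Vc' : V b cos h (- w) (ts - t) y' = (if b then -1 else 1) * V b cos h w (ts - t) y.
  rewrite (V_oppw b _ _ t2 h0 (norm_trig pc) nc) mulr1 /y'; case: sg {y' e4 e9 e9' T2} => //.
  by rewrite (V_oppx b _ _ t2 h0 (norm_trig pc) nc) mul1r.
have Vs' : V b sin h (- w) (ts - t) y' = (if b then -1 else 1) * (if sg then 1 else -1) * V b sin h w (ts - t) y.
  rewrite (V_oppw b _ _ t2 h0 (norm_trig ps) ns) /y'; case: sg {y' e4 e9 e9' T2 Vc'} => //.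
  by rewrite (V_oppx b _ _ t2 h0 (norm_trig ps) ns); ring.
rewrite Vc' Vs' -(expR_split ts t w).
have Z0 : ZZ h w ts != 0 by rewrite gt_eqF// ZZ_gt0.
have a0 : expR (t * w ^+ 2 / 2) != 0 :> R by rewrite gt_eqF// expR_gt0.
have b0 : expR ((ts - t) * w ^+ 2 / 2) != 0 :> R by rewrite gt_eqF// expR_gt0.
move: (expR (t * w ^+ 2 / 2)) (expR ((ts - t) * w ^+ 2 / 2)) (ZZ h w ts) a0 b0 Z0 => A B Z A0 B0 Z0.
move: (V b cos h w t x) (V b sin h w t x) (V b cos h w (ts - t) y) (V b sin h w (ts - t) y) => c s c' s'.
rewrite mulrACA [cR A * _ * _]mulrACA [X in _ * (_ * X)]mulcE [_ * (_ * Complex _ _)]mulrA.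
have -> : (if b then iC R else 1) * (if b then iC R else 1) * (cR A * cR B) = cR ((if b then -1 else 1) * (A * B)).
  case: b {T1 T2 Vc' Vs'}; rewrite /iC /cR ?mul1r !mulcE; apply: complex_eq; ring.
rewrite {1}/cR mulcE_div.
by case: sg {y' e4 e9 e9' T2 Vc' Vs'}; apply: complex_eq; case: b {T1}; field; rewrite ?A0 ?B0 ?Z0.
Qed.

Lemma cmulI (a : R) : cR a * iC R = Complex 0 a.
Proof. by rewrite /cR /iC mulcE; apply: complex_eq; ring. Qed.

Lemma caddI (a b : R) : cR a + Complex 0 b = Complex a b.
Proof. by rewrite /cR addcE; apply: complex_eq; ring. Qed.

Lemma csubI (a b : R) : cR a - Complex 0 b = Complex a (- b).
Proof. by rewrite /cR oppcE addcE; apply: complex_eq; ring. Qed.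

Let pi0 : pi != 0 :> R. Proof. by rewrite gt_eqF ?pi_gt0. Qed.

(** The mixed sine-cosine products are odd under l to rho - l. This kills the imaginary part and
    lets the mixed terms of the [cas] form be added at no cost. *)
Lemma KA_real x y : KA ts rho t x y = cR (klim ts rho t LA x y).
Proof.
have E l : cexp (cR (2 * pi * (x - y) * l) * iC R)
    * theta2 (cR (rho * x) + cR (2 * pi * t * rho * l) * iC R) (cR (2 * pi * t * rho ^+ 2) * iC R)
    * theta2 (cR (rho * y) - cR (2 * pi * (ts - t) * rho * l) * iC R)
             (cR (2 * pi * (ts - t) * rho ^+ 2) * iC R)
    / theta2 (cR (2 * pi * ts * rho * l) * iC R) (cR (2 * pi * ts * rho ^+ 2) * iC R) =
   Complex (Q false cos cos (2 * pi) x y l + Q false sin sin (2 * pi) x y l)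
           (Q false sin cos (2 * pi) x y l - Q false cos sin (2 * pi) x y l).
  rewrite !cmulI caddI csubI.
  rewrite (@prodE false false x y (2 * pi * l)) /hinf; first by rewrite -mulrDl -mulrBl.
  1-9: by move: (pi : R) pi0 => p p0; field.
have nr : - rho <= 0 by rewrite oppr_le0 ltW.
have tc : trig cos by left.
have tsn : trig sin by right.
rewrite /KA /cint; apply: complex_eq.
  have -> : klim ts rho t LA x y = \int[mu]_(l in `[0, rho]) (
      (Q false cos cos (2 * pi) x y l + Q false sin sin (2 * pi) x y l) +
      (Q false cos sin (2 * pi) x y l + Q false sin cos (2 * pi) x y l)).
    apply: eq_Rintegral => l _; rewrite /gl /= mul1r !U_LA//.
    by rewrite /Q; move: (V _ _ _ _ _ _) (V _ _ _ _ _ _) (V _ _ _ _ _ _) (V _ _ _ _ _ _) (ZZ _ _ _)^-1 => *; ring.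
  rewrite (@int_bmfD (fun l => Q false cos cos (2 * pi) x y l + Q false sin sin (2 * pi) x y l)
    (fun l => Q false cos sin (2 * pi) x y l + Q false sin cos (2 * pi) x y l))//; last 2 first.
  - by apply: bmfD; exact: bmf_Q.
  - by apply: bmfD; exact: bmf_Q.
  rewrite [X in _ = _ + X]int_anti ?addr0.
  - by apply: eq_Rintegral => l _; rewrite E.
  - by apply: bmfD; exact: bmf_Q.
  - move=> l; rewrite (Q_compl _ _ _ par_cos par_sin) (Q_compl _ _ _ par_sin par_cos); ring.
rewrite -[RHS](@int_anti (fun l => Q false sin cos (2 * pi) x y l - Q false cos sin (2 * pi) x y l)).
- by apply: eq_Rintegral => l _; rewrite E.
- by apply: bmfD; [exact: bmf_Q|apply: bmfN; exact: bmf_Q].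
- move=> l; rewrite (Q_compl _ _ _ par_cos par_sin) (Q_compl _ _ _ par_sin par_cos); ring.
Qed.

Lemma half_comb (a b c d p : R) : cR 2^-1 * (Complex a b + Complex p 0 * Complex c d) =
  Complex (2^-1 * (a + p * c)) (2^-1 * (b + p * d)) :> C.
Proof.
by rewrite /cR [Complex p 0 * _]mulcE addcE mulcE; apply: complex_eq; ring.
Qed.

(** On the symmetric interval the mixed products are odd and integrate to 0. The half sum of the two
    integrals keeps the cosine products, the half difference the sine products. *)
Lemma Khalf_real b (pm : bool) x y :
  Khalf (thb b) (if pm then 1 else -1) ts rho t x y =
  cR (\int[mu]_(l in `[- rho, rho]) (if pm then Q b cos cos pi x y l else Q b sin sin pi x y l)).
Proof.
have E1 l : cexp (cR (pi * (x - y) * l) * iC R)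
      * thb b (cR (rho * x) + cR (pi * t * rho * l) * iC R) (cR (2 * pi * t * rho ^+ 2) * iC R)
      * thb b (cR (rho * y) - cR (pi * (ts - t) * rho * l) * iC R)
           (cR (2 * pi * (ts - t) * rho ^+ 2) * iC R)
      / theta2 (cR (pi * ts * rho * l) * iC R) (cR (2 * pi * ts * rho ^+ 2) * iC R) =
   Complex (Q b cos cos pi x y l + Q b sin sin pi x y l)
           (Q b sin cos pi x y l - Q b cos sin pi x y l).
  rewrite !cmulI caddI csubI.
  rewrite (@prodE b false x y (pi * l)) /hinf; first by rewrite -mulrDl -mulrBl.
  1-9: by move: (pi : R) pi0 => p p0; field.
have E2 l : cexp (cR (pi * (x + y) * l) * iC R)
      * thb b (cR (rho * x) + cR (pi * t * rho * l) * iC R) (cR (2 * pi * t * rho ^+ 2) * iC R)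
      * thb b (cR (- (rho * y)) - cR (pi * (ts - t) * rho * l) * iC R)
           (cR (2 * pi * (ts - t) * rho ^+ 2) * iC R)
      / theta2 (cR (pi * ts * rho * l) * iC R) (cR (2 * pi * ts * rho ^+ 2) * iC R) =
   Complex (Q b cos cos pi x y l - Q b sin sin pi x y l)
           (Q b sin cos pi x y l + Q b cos sin pi x y l).
  rewrite !cmulI caddI csubI.
  rewrite (@prodE b true x y (pi * l)) /hinf; first by rewrite -mulrDl -mulrBl.
  1-9: by move: (pi : R) pi0 => p p0; field.
have tc : trig cos by left.
have tsn : trig sin by right.
pose I_ f g := \int[mu]_(l in `[- rho, rho]) Q b f g pi x y l.
have csE : I_ cos sin = 0.
  apply: int_odd; first exact: bmf_Q.
  by move=> l; rewrite (Q_opp _ _ _ _ _ par_cos par_sin); ring.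
have scE : I_ sin cos = 0.
  apply: int_odd; first exact: bmf_Q.
  by move=> l; rewrite (Q_opp _ _ _ _ _ par_sin par_cos); ring.
have C1 : cint (- rho) rho (fun l => cexp (cR (pi * (x - y) * l) * iC R)
      * thb b (cR (rho * x) + cR (pi * t * rho * l) * iC R) (cR (2 * pi * t * rho ^+ 2) * iC R)
      * thb b (cR (rho * y) - cR (pi * (ts - t) * rho * l) * iC R)
           (cR (2 * pi * (ts - t) * rho ^+ 2) * iC R)
      / theta2 (cR (pi * ts * rho * l) * iC R) (cR (2 * pi * ts * rho ^+ 2) * iC R)) =
   Complex (I_ cos cos + I_ sin sin) (I_ sin cos - I_ cos sin).
  rewrite /cint; under eq_Rintegral do rewrite E1.
  under [X in Complex _ X]eq_Rintegral do rewrite E1.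
  by rewrite /= int_bmfD ?int_bmfB//; exact: bmf_Q.
have C2 : cint (- rho) rho (fun l => cexp (cR (pi * (x + y) * l) * iC R)
      * thb b (cR (rho * x) + cR (pi * t * rho * l) * iC R) (cR (2 * pi * t * rho ^+ 2) * iC R)
      * thb b (cR (- (rho * y)) - cR (pi * (ts - t) * rho * l) * iC R)
           (cR (2 * pi * (ts - t) * rho ^+ 2) * iC R)
      / theta2 (cR (pi * ts * rho * l) * iC R) (cR (2 * pi * ts * rho ^+ 2) * iC R)) =
   Complex (I_ cos cos - I_ sin sin) (I_ sin cos + I_ cos sin).
  rewrite /cint; under eq_Rintegral do rewrite E2.
  under [X in Complex _ X]eq_Rintegral do rewrite E2.
  by rewrite /= int_bmfB ?int_bmfD//; exact: bmf_Q.
rewrite /Khalf C1 C2 csE scE.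
have sE : (if pm then 1 else -1 : C) = Complex (if pm then 1 else -1) 0.
  by case: pm; rewrite // -[1]/(Complex 1 0) oppcE oppr0.
rewrite sE half_comb; case: pm {sE}; apply: complex_eq; rewrite ?subrr ?addr0 ?mulr0 ?addr0 ?mulr0//.
  by rewrite -/(I_ cos cos); field.
by rewrite -/(I_ sin sin); field.
Qed.

Theorem Klim_real L x y : Klim L ts rho t x y = cR (klim ts rho t L x y).
Proof.
have tc : trig cos by left.
have tsn : trig sin by right.
have nr : - rho <= 0 by rewrite oppr_le0 ltW.
case: L; first exact: KA_real.
- have := Khalf_real true false x y; rewrite /thb /= => ->; congr cR.
  rewrite int_even.
  + rewrite -RintegralZl//; first exact: bmf_int (bmf_Q _ _ _ _ tsn tsn).
  + exact: bmf_Q.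
  + by move=> l; rewrite (Q_opp _ _ _ _ _ par_sin par_sin); ring.
- have := Khalf_real false false x y; rewrite /thb /= => ->; congr cR.
  rewrite int_even.
  + rewrite -RintegralZl//; first exact: bmf_int (bmf_Q _ _ _ _ tsn tsn).
  + exact: bmf_Q.
  + by move=> l; rewrite (Q_opp _ _ _ _ _ par_sin par_sin); ring.
- have := Khalf_real false true x y; rewrite /thb /= => ->; congr cR.
  rewrite int_even.
  + rewrite -RintegralZl//; first exact: bmf_int (bmf_Q _ _ _ _ tc tc).
  + exact: bmf_Q.
  + by move=> l; rewrite (Q_opp _ _ _ _ _ par_cos par_cos); ring.
Qed.

End KlimReal.

(** * Positivity through lattice walks *)

Section Walk.
Variables (R : realType) (N : nat) (w : nat -> 'I_N -> int -> R).
Hypothesis wS : forall n j a, w n.+1 j a = (w n j (a - 1) + w n j (a + 1)) / 2.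
Implicit Types (a b : 'I_N -> int).

Definition wdet n a : R := \det (\matrix_(k, j) w n j (a k)).

Definition stp (e : {ffun 'I_N -> bool}) a (k : 'I_N) : int := a k + (if e k then 1 else -1).

(** Multilinearity in the rows: the determinant of one-walker functions is averaged over the 2^N
    joint steps of independent walkers. *)
Lemma wdetS n a : wdet n.+1 a = (2^-1) ^+ N * \sum_(e : {ffun 'I_N -> bool}) wdet n (stp e a).
Proof.
rewrite /wdet mulr_sumr /determinant.
transitivity (\sum_(s : 'S_N) \sum_(e : {ffun 'I_N -> bool})
   (2^-1) ^+ N * ((-1) ^+ s * \prod_k w n (s k) (stp e a k))).
  apply: eq_bigr => s _.
  have -> : \prod_i (\matrix_(k, j) w n.+1 j (a k)) i (s i) =
      \prod_i \sum_(b : bool) 2^-1 * w n (s i) (a i + (if b then 1 else -1)).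
    by apply: eq_bigr => i _; rewrite mxE wS big_bool /=; field.
  rewrite bigA_distr_bigA /= mulr_sumr; apply: eq_bigr => e _.
  by rewrite big_split /= prodr_const card_ord mulrCA.
rewrite exchange_big; apply: eq_bigr => e _; rewrite mulr_sumr.
apply: eq_bigr => s _; congr (_ * (_ * _)).
by apply: eq_bigr => k _; rewrite mxE.
Qed.

Lemma wdet_eq n a b : (forall j k, w n j (a k) = w n j (b k)) -> wdet n a = wdet n b.
Proof. by move=> h; congr (\det _); apply/matrixP => k j; rewrite !mxE. Qed.

Lemma wdet_rep n a i k : i != k -> (forall j, w n j (a i) = w n j (a k)) -> wdet n a = 0.
Proof. by move=> ik h; apply: (determinant_alternate ik) => j; rewrite !mxE. Qed.

Lemma wdet_zero n a k : (forall j, w n j (a k) = 0) -> wdet n a = 0.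
Proof.
move=> h; rewrite /wdet /determinant big1// => s _.
by rewrite (bigD1 k)//= mxE h mul0r mulr0.
Qed.

Lemma wdet_step n a (sg : R) : (forall e, 0 <= sg * wdet n (stp e a)) -> 0 <= sg * wdet n.+1 a.
Proof.
move=> h; rewrite wdetS mulrCA mulr_ge0 ?exprn_ge0// ?invr_ge0//.
by rewrite mulr_sumr sumr_ge0// => e _.
Qed.

Definition nondec a := forall i k : 'I_N, (i <= k)%N -> a i <= a k.

Section Interval.
Variable La : int.
Hypotheses (La2 : 2 <= La) (Laeven : odd `|La|%N = false).
Hypothesis lowH : (forall n j, w n j 0 = 0) \/ (forall n j, w n j (-1) = w n j 1).
Hypothesis uppH : (forall n j, w n j La = 0) \/ (forall n j, w n j (La + 1) = w n j (La - 1)).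

(** Closed Weyl chamber of the interval. A position carries the parity of its time [n], and the
    recursion moves from [n.+1] back to [n], towards the initial data. *)
Definition chI n a := [/\ nondec a, (forall k, 0 <= a k <= La) & (forall k, odd `|a k|%N = odd n)].

(** Folds a step beyond a reflecting wall back inside. At an absorbing wall nothing has to be
    folded, since the row of a walker standing there is 0. *)
Definition fd (z : int) : int := if z < 0 then - z else if La < z then La + La - z else z.

Lemma walk_interval (sg : R) : (forall a, chI 0 a -> 0 <= sg * wdet 0 a) ->
  forall n a, chI n a -> 0 <= sg * wdet n a.
Proof.
move=> base; elim=> [//|n IH] a [ma ra pa].
have [[i [k [ik aik]]]|inj] := pselect (exists i k : 'I_N, i != k /\ a i = a k).
  by rewrite (@wdet_rep n.+1 a i k)// ?mulr0// => j; rewrite aik.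
have [[k hk]|nz] := pselect (exists k, forall j, w n.+1 j (a k) = 0).
  by rewrite (wdet_zero hk) mulr0.
(* Distinct walkers of equal parity are two apart, so one step can make them meet but not cross. *)
have sa (i k : 'I_N) : (i < k)%N -> a i + 2 <= a k.
  move=> ik; have le := ma _ _ (ltnW ik); have pi := pa i; have pk := pa k.
  have ne : a i <> a k.
    move=> e; apply: inj; exists i, k; split=> //; apply/eqP => ek; move: ik; rewrite ek ltnn//.
  by lia.
apply: wdet_step => e.
have := ra; move=> ra'.
have step k : fd (stp e a k) = stp e a k \/ (stp e a k = -1 /\ a k = 0) \/ (stp e a k = La + 1 /\ a k = La).
  by rewrite /fd /stp; have := ra k; case: (e k); case: ifP => ?; try case: ifP => ?; lia.
rewrite (@wdet_eq n _ (fun k => fd (stp e a k))); last first.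
  move=> j k; case: (step k) => [->//|[[e1 e2]|[e1 e2]]]; rewrite e1 /fd.
    case: lowH => h; last by rewrite h.
    by exfalso; apply: nz; exists k => j'; rewrite e2 h.
  rewrite ifF; last by lia.
  rewrite ifT; last by lia.
  rewrite (_ : La + La - (La + 1) = La - 1); last by lia.
  case: uppH => h; last by rewrite h.
  by exfalso; apply: nz; exists k => j'; rewrite e2 h.
apply: IH; split.
- move=> i k; rewrite leq_eqVlt => /orP[/eqP/val_inj ->//|ik].
  have := sa i k ik; have := ra i; have := ra k; rewrite /fd /stp.
  by case: (e i); case: (e k); repeat case: ifP => ?; lia.
- move=> k; have := ra k; rewrite /fd /stp.
  by case: (e k); repeat case: ifP => ?; lia.
- move=> k; have := pa k; have := ra k; rewrite /fd /stp /=.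
  by case: (e k); repeat case: ifP => ?; lia.
Qed.

End Interval.

Section Cyclic.
Variable La : int.
Hypotheses (La2 : 2 <= La) (Laeven : odd `|La|%N = false).
Hypothesis wper : forall n j z, w n j (z + La) = w n j z.

Definition chC n a := [/\ nondec a, (forall i k, a k <= a i + La) & (forall k, odd `|a k|%N = odd n)].

Lemma walk_cyclic (sg : R) : (forall a, chC 0 a -> 0 <= sg * wdet 0 a) ->
  forall n a, chC n a -> 0 <= sg * wdet n a.
Proof.
move=> base; elim=> [//|n IH] a [ma ra pa].
have [[i [k [ik aik]]]|inj] := pselect (exists i k : 'I_N, i != k /\ a i = a k).
  by rewrite (@wdet_rep n.+1 a i k)// ?mulr0// => j; rewrite aik.
(* On the circle a walker may also collide with the image of another one a period away. *)
have [[i [k aik]]|inj'] := pselect (exists i k : 'I_N, a k = a i + La).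
  have ik : k != i by apply/eqP => E; move: aik; rewrite E; lia.
  by rewrite (@wdet_rep n.+1 a k i)// ?mulr0// => j; rewrite aik wper.
apply: wdet_step => e; apply: IH; split.
- move=> i k; rewrite leq_eqVlt => /orP[/eqP/val_inj ->//|ik].
  have le := ma _ _ (ltnW ik); have pi := pa i; have pk := pa k.
  have ne : a i <> a k.
    move=> E; apply: inj; exists i, k; split=> //; apply/eqP => ek; move: ik; rewrite ek ltnn//.
  by rewrite /stp; case: (e i); case: (e k); lia.
- move=> i k; have le := ra i k; have pi := pa i; have pk := pa k.
  have ne : a k <> a i + La by move=> E; apply: inj'; exists i, k.
  by rewrite /stp; case: (e i); case: (e k); lia.
- by move=> k; have := pa k; rewrite /stp /=; case: (e k); lia.
Qed.

End Cyclic.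

Lemma mono_ord_id (f : 'I_N -> 'I_N) : (forall i k : 'I_N, (i < k)%N -> (f i < f k)%N) -> f =1 id.
Proof.
move=> mf.
have lo (i : 'I_N) : (i <= f i)%N.
  case: i => m mN /=; elim: m mN => [//|m IH] mN.
  have mN' : (m < N)%N by exact: ltnW.
  by apply: leq_ltn_trans (IH mN') _; apply: mf.
have hi d (i : 'I_N) : (i + d = N.-1)%N -> (f i <= i)%N.
  elim: d i => [|d IH] i e; first by have := ltn_ord (f i); lia.
  have iN : (i.+1 < N)%N by have := ltn_ord i; lia.
  have := IH (Ordinal iN); rewrite /= => h.
  have := mf i (Ordinal iN) (ltnSn i) => h2.
  by have := h _; lia.
move=> i; apply: val_inj => /=; apply/eqP; rewrite eqn_leq lo andbT.
by apply: (hi (N.-1 - i)%N); have := ltn_ord i; lia.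
Qed.


(** A sign that is never 0, so that it cancels when two determinants sharing it are multiplied. *)
Definition sgD (D : R) : R := if 0 <= D then 1 else -1.

Lemma sgDP D : 0 <= sgD D * D.
Proof. rewrite /sgD; case: ifP => [h|/negbT]; first by rewrite mul1r.
by rewrite -ltNge mulN1r oppr_ge0 => /ltW. Qed.

Lemma sgD_mul D (u v : R) : 0 <= sgD D * u -> 0 <= sgD D * v -> 0 <= u * v.
Proof.
rewrite /sgD; case: ifP => _; rewrite ?mul1r ?mulN1r ?oppr_ge0 => hu hv; first exact: mulr_ge0.
exact: mulr_le0.
Qed.

Lemma base_strict a : nondec a -> wdet 0 a = 0 \/
  ((forall k, exists j, w 0 j (a k) <> 0) /\ forall i k : 'I_N, (i < k)%N -> a i < a k).
Proof.
move=> ma; have [[k hk]|nz] := pselect (exists k, forall j, w 0 j (a k) = 0).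
  by left; exact: wdet_zero hk.
have [[i [k [ik aik]]]|inj] := pselect (exists i k : 'I_N, i != k /\ a i = a k).
  by left; apply: (wdet_rep ik) => j; rewrite aik.
right; split=> [k|i k ik].
  by apply: contrapT => h; apply: nz; exists k => j; apply: contrapT => h2; apply: h; exists j.
rewrite lt_neqAle (ma _ _ (ltnW ik)) andbT; apply/eqP => E; apply: inj; exists i, k; split=> //.
by apply/eqP => ek; move: ik; rewrite ek ltnn.
Qed.

(** Initial data supported on N ordered sites: a strictly ordered configuration on them must be [c]
    itself, so at time 0 every determinant in the chamber has the sign of the one at [c]. The
    recursion carries this sign to all times. *)
Lemma walk_interval_pos (La : int) (c : 'I_N -> int) : 2 <= La -> odd `|La|%N = false ->
  ((forall n j, w n j 0 = 0) \/ (forall n j, w n j (-1) = w n j 1)) ->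
  ((forall n j, w n j La = 0) \/ (forall n j, w n j (La + 1) = w n j (La - 1))) ->
  (forall i k : 'I_N, (i < k)%N -> c i < c k) ->
  (forall z j, 0 <= z <= La -> odd `|z|%N = false -> w 0 j z <> 0 -> exists k, z = c k) ->
  forall n n' a, chI La n a -> chI La n' a -> 0 <= wdet n a * wdet n' a.
Proof.
move=> La2 Lae lo up mc hc n n' a ha ha'.
have base b : chI La 0 b -> 0 <= sgD (wdet 0 c) * wdet 0 b.
  move=> [mb rb pb]; have [->|[nz st]] := base_strict mb; first by rewrite mulr0.
  have /choice[f fP] : forall k, exists k', b k = c k'.
    by move=> k; have [j hj] := nz k; apply: (hc _ j) => //; exact: pb.
  have mc' (i k : 'I_N) : (i <= k)%N -> c i <= c k.
    by rewrite leq_eqVlt => /orP[/eqP/val_inj ->//|/mc/ltW].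
  have fid := @mono_ord_id f.
  rewrite (@wdet_eq 0 b c) ?sgDP// => j k; rewrite fP fid// => i k' ik.
  rewrite ltnNge; apply/negP => /mc'; rewrite -!fP leNgt => /negP; apply; exact: st.
by apply: sgD_mul; apply: (walk_interval La2 Lae lo up base).
Qed.

Section CyclicBase.
Variable D : int.
Hypotheses (D2 : 2 <= D) (Deven : odd `|D|%N = false) (Nodd : odd N).
Hypothesis wper : forall n j z, w n j (z + D * N%:Z) = w n j z.

Let d (m : int) : R := wdet 0 (fun k => D * (m + k%:Z)).

(** By periodicity, moving the comb by one tooth permutes its rows cyclically. *)
Lemma comb_shift : exists e : bool, forall m, d (m + 1) = (-1) ^+ e * d m.
Proof.
have inj : injective (@ordS N) by exact: ordS_inj.
exists (perm inj) => m; rewrite /d /wdet -det_perm -det_mulmx -row_permE.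
congr (\det _); apply/matrixP => k j; rewrite !mxE permE /=.
have kN := ltn_ord k; have [e|kl] : k.+1 = N \/ (k.+1 < N)%N by lia.
  rewrite e modnn addr0 -(wper 0 j (D * m)); congr (w _ _ _); lia.
rewrite modn_small//; congr (w _ _ _); lia.
Qed.

(* One shift multiplies [d] by a sign [e], [N] shifts by [e ^+ N = e]; since [d]
   is [N]-periodic, [e * d = d]. *)
Lemma comb_const m : d m = d 0.
Proof.
have [e he] := comb_shift.
have S z : d (z + 1) = d z.
  have hn n : d (z + n%:Z) = (-1) ^+ e ^+ n * d z.
    elim: n => [|n IH]; first by rewrite addr0 mul1r.
    by rewrite -addn1 PoszD addrA he IH addn1 exprS mulrA.
  have hN : d (z + N%:Z) = d z.
    apply: wdet_eq => j k; rewrite -(wper 0 j (D * (z + k%:Z))); congr (w _ _ _); lia.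
  move: hN; rewrite hn he; case: e {he hn} => /=; rewrite ?expr0 ?expr1 ?expr1n ?mul1r//.
  by rewrite -signr_odd Nodd.
have Sn z n : d (z + n%:Z) = d z.
  elim: n => [|n IH]; first by rewrite addr0.
  by rewrite -addn1 PoszD addrA S.
case: m => n; first by rewrite -(Sn 0 n) add0r.
by rewrite -(Sn (Negz n) n.+1); congr d; lia.
Qed.

Lemma walk_cyclic_pos :
  (forall z j, odd `|z|%N = false -> w 0 j z <> 0 -> exists m, z = D * m) ->
  forall n n' a, chC (D * N%:Z) n a -> chC (D * N%:Z) n' a -> 0 <= wdet n a * wdet n' a.
Proof.
move=> hc n n' a ha ha'.
have N0 : (0 < N)%N by case: (N) Nodd.
have base b : chC (D * N%:Z) 0 b -> 0 <= sgD (d 0) * wdet 0 b.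
  move=> [mb rb pb]; have [->|[nz st]] := base_strict mb; first by rewrite mulr0.
  have /choice[f fP] : forall k, exists m, b k = D * m.
    by move=> k; have [j hj] := nz k; apply: (hc _ j) => //; exact: pb.
  pose o0 := Ordinal N0.
  have [[i [k E]]|np] := pselect (exists i k, b k = b i + D * N%:Z).
    have ik : k != i by apply/eqP => e; move: E; rewrite e; nia.
    by rewrite (wdet_rep ik) ?mulr0// => j; rewrite E wper.
  (* No two walkers being a full period apart, all teeth lie in one period starting at the first
     walker; N increasing teeth among N must be consecutive. *)
  have fr (k : 'I_N) : 0 <= f k - f o0 < N%:Z.
    have h1 : b o0 <= b k by apply: mb.
    have h2 := rb o0 k.
    have h3 : b k <> b o0 + D * N%:Z by move=> E; apply: np; exists o0, k.
    by move: h1 h2 h3; rewrite !fP; nia.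
  have gl (k : 'I_N) : (`|f k - f o0| < N)%N by have := fr k; lia.
  have gid := @mono_ord_id (fun k => Ordinal (gl k)).
  have fE k : f k = f o0 + k%:Z.
    have -> : k%:Z = (Ordinal (gl k))%:Z.
      rewrite gid// => i k' ik /=; have := st _ _ ik; rewrite !fP.
      by have := fr i; have := fr k'; nia.
    by have := fr k; rewrite /=; lia.
  rewrite (@wdet_eq 0 b (fun k => D * (f o0 + k%:Z))); last by move=> j k; rewrite fP fE.
  by rewrite -/(d _) comb_const sgDP.
apply: sgD_mul; apply: (walk_cyclic _ _ _ base) => //; (try by nia); by lia.
Qed.

End CyclicBase.

End Walk.

(** * Powers of cosines against Gaussians *)

Section TrigBounds.
Variable R : realType.
Implicit Types (u s : R).

Lemma sin_mvt u : 0 <= u -> exists c, 0 <= c <= u /\ sin u = u * cos c.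
Proof.
move=> u0; have [c cu E] := @MVT_segment R (@sin R) (@cos R) 0 u u0
  (fun x _ => is_derive_sin x) (continuous_subspaceT (@continuous_sin R)).
exists c; split; first by move: cu; rewrite in_itv.
by move: E; rewrite sin0 !subr0 mulrC.
Qed.

Lemma ler_norm_sin u : `|sin u| <= `|u|.
Proof.
wlog u0 : u / 0 <= u.
  move=> H; have [|/ltW u0] := leP 0 u; first exact: H.
  by rewrite -normrN -sinN -(normrN u); apply: H; rewrite oppr_ge0.
have [c [_ ->]] := sin_mvt u0; rewrite normrM ler_piMr//; exact: cos_max.
Qed.

Lemma cos_half u : cos u = 1 - 2 * sin (u / 2) ^+ 2.
Proof.
have -> : cos u = cos ((u / 2) *+ 2) by congr cos; rewrite -mulr_natl; field.
by rewrite cos_mulr2n sin2cos2 -mulr_natl; ring.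
Qed.

Lemma sin_cubic u : `|sin u - u| <= `|u| ^+ 3.
Proof.
wlog u0 : u / 0 <= u.
  move=> H; have [|/ltW u0] := leP 0 u; first exact: H.
  rewrite -normrN opprB addrC -sinN -(normrN u).
  by have := H (- u); rewrite opprK; apply; rewrite oppr_ge0.
have [c [/andP[c0 cu] ->]] := sin_mvt u0.
rewrite (_ : u * cos c - u = u * - (2 * sin (c / 2) ^+ 2)); last by rewrite (cos_half c); ring.
rewrite normrM exprS ler_wpM2l// normrN ger0_norm; last by apply: mulr_ge0 => //; exact: sqr_ge0.
have := ler_norm_sin (c / 2); rewrite (ger0_norm (divr_ge0 c0 _))// (ger0_norm u0) => h.
have h2 : sin (c / 2) ^+ 2 <= (c / 2) ^+ 2.
  by rewrite -(real_normK (num_real (sin _))); apply: lerXn2r => //; rewrite nnegrE ?divr_ge0.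
have h3 : c ^+ 2 <= u ^+ 2 by apply: lerXn2r => //; rewrite nnegrE.
have := sqr_ge0 c; move: h2; rewrite expr_div_n; lra.
Qed.

Definition csin : R := cos (pi / 4) / pi.

Lemma csin_gt0 : 0 < csin.
Proof.
have p0 := pi_gt0 R; rewrite divr_gt0// cos_gt0_pihalf//; apply/andP; split; lra.
Qed.

(** Up to pi/4 the mean value theorem gives slope at least cos(pi/4); from there to 3 pi/4 the sine
    itself is at least cos(pi/4). The division by pi in [csin] covers both ranges. *)
Lemma sin_lower u : `|u| <= 3 * pi / 4 -> csin * `|u| <= `|sin u|.
Proof.
have p2 := pi_ge2 R.
wlog u0 : u / 0 <= u.
  move=> H; have [|/ltW u0] := leP 0 u; first exact: H.
  by rewrite -(normrN (sin u)) -sinN -(normrN u); apply: H; rewrite oppr_ge0.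
have c0 : 0 < cos (pi / 4) :> R by rewrite cos_gt0_pihalf//; apply/andP; split; lra.
have cle (v : R) : 0 <= v <= pi / 4 -> cos (pi / 4) <= cos v.
  move=> /andP[v0 v1]; rewrite leNgt; apply/negP.
  rewrite ltr_cos ?in_itv/=; [lra|apply/andP; split; lra|apply/andP; split; lra].
rewrite (ger0_norm u0) => u1.
apply: le_trans (ler_norm _).
rewrite /csin mulrAC -mulrA.
have [u4|u4] := leP u (pi / 4).
  have [c [/andP[h1 h2] ->]] := sin_mvt u0.
  have {cle}h := cle c; rewrite mulrC ler_pM// ?(ltW c0)//; last first.
    by apply: h; rewrite h1 (le_trans h2).
    by rewrite ler_pdivrMr ?pi_gt0//; nra.
  by rewrite divr_ge0// pi_ge0.
have h : cos (pi / 4) <= sin u.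
  rewrite -cosBpihalf -(cos_norm (u - _)); apply: cle; rewrite normr_ge0/= ler_norml.
  apply/andP; split; lra.
apply: le_trans h; rewrite ler_piMr ?(ltW c0)// ler_pdivrMr ?pi_gt0//; lra.
Qed.

(** From cos^2 = 1 - sin^2 <= exp(- sin^2) and the lower bound on the sine. This is the majorant for
    the damping factors of the walks, uniform in the mesh. *)
Lemma cos_pow_le n u : `|u| <= 3 * pi / 4 ->
  `|cos u ^+ n| <= expR (- (csin ^+ 2 * u ^+ 2 / 2 * n%:R)).
Proof.
move=> hu; have h := sin_lower hu.
rewrite normrX -mulNr mulrC expRM_natl; apply: lerXn2r; rewrite ?nnegrE ?expR_ge0//.
rewrite -(@ler_pXn2r _ 2)// ?nnegrE ?expR_ge0// real_normK ?num_real// -expRM_natl cos2sin2.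
have -> : 2%:R * - (csin ^+ 2 * u ^+ 2 / 2) = - (csin ^+ 2 * u ^+ 2) by field.
apply: le_trans (expR_ge1Dx _); rewrite lerD2l lerN2.
rewrite -exprMn -(real_normK (num_real (sin u))) -(real_normK (num_real (csin * u))).
apply: lerXn2r; rewrite ?nnegrE// normrM (gtr0_norm csin_gt0)//.
Qed.

Lemma cvg_dom (u b : nat -> R) (l : R) : (forall i, `|u i - l| <= b i) ->
  b i @[i --> \oo] --> 0 -> u i @[i --> \oo] --> l.
Proof.
move=> h cb; apply: (@squeeze_cvgr _ _ _ _ (fun i => l - b i) (fun i => l + b i)).
- by near=> i; have := h i; rewrite ler_distl.
- by rewrite -[X in _ --> X]subr0; apply: cvgB => //; exact: cvg_cst.
- by rewrite -[X in _ --> X]addr0; apply: cvgD => //; exact: cvg_cst.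
Unshelve. all: by end_near. Qed.

(** Squeezed between exp(- n y / (1 - y)) and exp(- n y). *)
Lemma cvg_pow_exp (y : nat -> R) (n : nat -> nat) (L : R) : (forall i, 0 <= y i) ->
  y i @[i --> \oo] --> 0 -> (n i)%:R * y i @[i --> \oo] --> L ->
  (1 - y i) ^+ n i @[i --> \oo] --> expR (- L).
Proof.
move=> y0 cy cn.
have cup : expR (- ((n i)%:R * y i)) @[i --> \oo] --> expR (- L).
  by apply: continuous_cvg; [exact: continuous_expR|exact: cvgN].
have clo : expR (- ((n i)%:R * y i * (1 - y i)^-1)) @[i --> \oo] --> expR (- L).
  apply: continuous_cvg; first exact: continuous_expR.
  apply: cvgN; rewrite -[X in _ --> X]mulr1; apply: cvgM => //.
  rewrite -[X in _ --> X]invr1; apply: cvgV; first exact: oner_neq0.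
  by rewrite -[X in _ --> X]subr0; apply: cvgB => //; exact: cvg_cst.
apply: squeeze_cvgr clo cup.
have : \forall i \near \oo, y i < 1.
  exact: (cvgr_lt _ cy).
apply: filterS => i y1.
have p1 : 0 < 1 - y i by rewrite subr_gt0.
apply/andP; split.
  rewrite -mulrA -mulrN expRM_natl; apply: lerXn2r; rewrite ?nnegrE ?expR_ge0 ?(ltW p1)//.
  rewrite expRN -[leRHS]invrK lef_pV2 ?posrE ?invr_gt0 ?expR_gt0//.
  apply: le_trans (expR_ge1Dx _).
  have -> : 1 + y i / (1 - y i) = (1 - y i)^-1 by field; rewrite gt_eqF.
  by [].
rewrite -mulrN expRM_natl; apply: lerXn2r; rewrite ?nnegrE ?expR_ge0 ?(ltW p1)//.
exact: expR_ge1Dx.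
Qed.

Lemma cvg_cos_pow (w s : R) (dl : nat -> R) (n : nat -> nat) : (forall i, 0 < dl i) ->
  dl i @[i --> \oo] --> 0 -> (n i)%:R * dl i ^+ 2 @[i --> \oo] --> s ->
  cos (w * dl i) ^+ n i @[i --> \oo] --> expR (- (s * w ^+ 2 / 2)).
Proof.
move=> d0 cd cn.
have csn : sin (w * dl i / 2) / dl i @[i --> \oo] --> w / 2.
  apply: (@cvg_dom _ (fun i => `|w / 2| ^+ 3 * (dl i * dl i))) => [i|]; last first.
    rewrite -(mulr0 (`|w / 2| ^+ 3)); apply: cvgMr; rewrite -(mulr0 0); exact: cvgM.
  have di := d0 i; have dn : dl i != 0 by rewrite gt_eqF.
  rewrite (_ : _ - _ = (sin (w * dl i / 2) - w * dl i / 2) / dl i); last by field.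
  rewrite normrM normfV (gtr0_norm di) ler_pdivrMr//.
  apply: le_trans (sin_cubic _) _.
  rewrite (_ : w * dl i / 2 = w / 2 * dl i); last by field.
  by rewrite normrM (gtr0_norm di) le_eqVlt; apply/orP; left; apply/eqP; ring.
have E i : cos (w * dl i) ^+ n i = (1 - 2 * sin (w * dl i / 2) ^+ 2) ^+ n i by rewrite cos_half.
rewrite (eq_cvg _ _ E).
apply: cvg_pow_exp => [i||]; first by apply: mulr_ge0 => //; exact: sqr_ge0.
  apply: (@cvg_dom _ (fun i => 2 * ((w / 2) ^+ 2 * (dl i * dl i)))) => [i|]; last first.
    rewrite -(mulr0 2); apply: cvgMr; rewrite -(mulr0 ((w / 2) ^+ 2)); apply: cvgMr.
    by rewrite -(mulr0 0); exact: cvgM.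
  rewrite subr0 ger0_norm; last by apply: mulr_ge0 => //; exact: sqr_ge0.
  apply: ler_wpM2l => //.
  rewrite -expr2 -exprMn (_ : w * dl i / 2 = w / 2 * dl i); last by field.
  rewrite -(real_normK (num_real (sin _))) -(real_normK (num_real (_ * _))).
  by apply: lerXn2r; rewrite ?nnegrE// ler_norm_sin.
have F i : (n i)%:R * (2 * sin (w * dl i / 2) ^+ 2) =
    (n i)%:R * dl i ^+ 2 * (2 * (sin (w * dl i / 2) / dl i * (sin (w * dl i / 2) / dl i))).
  have dn : dl i != 0 by rewrite gt_eqF.
  by field.
rewrite (eq_cvg _ _ F).
rewrite (_ : s * w ^+ 2 / 2 = s * (2 * (w / 2 * (w / 2)))); last by field.
by apply: cvgM => //; apply: cvgMr; exact: cvgM.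
Qed.

Lemma tele_sum (m : nat) (G : nat -> R) : \sum_(i < m) (G i.+1 - G i) = G m - G 0%N.
Proof.
elim: m => [|m IH]; first by rewrite big_ord0 subrr.
by rewrite big_ord_recr /= IH addrC addrA subrK.
Qed.

(** Multiplication by 2 sin(a/2) makes the sum telescope, and periodicity of [g] closes it. *)
Lemma sum_periodic (f g : R -> R) (a p : R) (m : nat) :
  (forall x, 2 * sin (a / 2) * f x = g (x + a / 2) - g (x - a / 2)) ->
  sin (a / 2) != 0 -> (forall x, g (x + a * m%:R) = g x) ->
  \sum_(i < m) f (a * i%:R + p) = 0.
Proof.
move=> fg s0 gp.
have n0 : 2 * sin (a / 2) != 0 by rewrite mulf_neq0.
apply: (mulfI n0); rewrite mulr0 mulr_sumr.
rewrite (eq_bigr (fun i : 'I_m => g (a * i.+1%:R + p - a / 2) - g (a * i%:R + p - a / 2))); last first.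
  move=> i _; rewrite fg; by congr (g _ - _); rewrite -natr1; field.
rewrite (tele_sum m (fun i => g (a * i%:R + p - a / 2))) mulr0 add0r.
apply/eqP; rewrite subr_eq0; apply/eqP.
by rewrite -(gp (p - a / 2)); congr g; ring.
Qed.

Lemma sin_zero_int (a : int) (Q : nat) : (0 < Q)%N -> sin (a%:~R * pi / (2 * Q%:R)) = 0 :> R ->
  exists m : int, a = (2 * Q)%:Z * m.
Proof.
move=> Q0; have QR : 0 < Q%:R :> R by rewrite ltr0n.
have Qn : Q%:R != 0 :> R by rewrite gt_eqF.
have qz : (2 * Q)%:Z != 0 by lia.
have E := divz_eq a (2 * Q)%:Z.
have b0 := modz_ge0 a qz; have b1 := ltz_mod a qz.
move: E b0 b1; move: (a %/ _)%Z (a %% _)%Z => k b E b0 b1.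
have -> : a%:~R * pi / (2 * Q%:R) = b%:~R * pi / (2 * Q%:R) + k%:~R * pi :> R.
  rewrite E intrD intrM PoszM intrM.
  by move: (pi : R) => p; rewrite -!pmulrn /=; field.
rewrite sinD sin_intpi mulr0 addr0 => /eqP; rewrite mulf_eq0 => /orP[/eqP sb|/eqP ck].
  have [bz|bn] := eqVneq b 0; first by exists k; rewrite E bz addr0 mulrC.
  have bp : 0 < b by lia.
  have : 0 < sin (b%:~R * pi / (2 * Q%:R)) :> R.
    apply: sin_gt0_pi; rewrite divr_gt0 ?mulr_gt0 ?ltr0z ?pi_gt0//=.
    rewrite ltr_pdivrMr ?mulr_gt0// mulrC ltr_pM2l ?pi_gt0//.
    have -> : 2 * Q%:R = (2 * Q)%:Z%:~R :> R by rewrite -pmulrn natrM.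
    by rewrite ltr_int; lia.
  by rewrite sb ltxx.
have := cos2Dsin2 (k%:~R * pi : R); rewrite ck sin_intpi expr0n addr0 => /eqP.
by rewrite eq_sym oner_eq0.
Qed.

Lemma zs_finite (g : int -> R) (q : nat) :
  zs (fun p => if (1 - q%:Z <= p) && (p <= q%:Z) then g p else 0) = \sum_(i < 2 * q) g (i%:Z + 1 - q%:Z).
Proof.
rewrite /zs (lim_series_finite (m := q.+1)); last first.
  move=> k qk; rewrite /zb; case: eqP => [k0|_]; first by lia.
  by rewrite !ifF ?addr0//; lia.
rewrite -zsum_series big_ord_recl ifF ?add0r; last by rewrite /=; lia.
apply: eq_bigr => i _; rewrite ifT; last by have := ltn_ord i; rewrite /= /bump; lia.
by congr g; rewrite /= /bump; lia.
Qed.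

End TrigBounds.

(** * Lattice walks built from trigonometric modes *)

Section LatticeWalk.
Variable R : realType.
Implicit Types (T : rtype) (L : ltype) (x y : R).

Lemma fL_step L (u v : R) : fL L (u - v) + fL L (u + v) = 2 * cos v * fL L u.
Proof. by case: L; rewrite /= /cas ?(cosB, sinB) ?(cosD, sinD); ring. Qed.

Lemma fL_shift L (u : R) (k : int) : fL L (u + k%:~R * (2 * pi)) = fL L u.
Proof.
have s0 : sin (k%:~R * (2 * pi)) = 0 :> R.
  by rewrite mulrA (_ : k%:~R * 2 = (k * 2)%:~R) ?sin_intpi// intrM.
by case: L; rewrite /= /cas ?cosD ?sinD cos_int2pi s0; ring.
Qed.

Lemma fL_alt L (u : R) : fL L (u + pi) = - fL L u.
Proof. by case: L; rewrite /= /cas ?cosDpi ?sinDpi //; ring. Qed.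

Definition gL L (u : R) : R := match L with LA => sin u - cos u | LB | LC => - cos u | LD => sin u end.

Lemma gL_prim L (u v : R) : 2 * sin v * fL L u = gL L (u + v) - gL L (u - v).
Proof. by case: L; rewrite /= /cas ?(cosB, sinB) ?(cosD, sinD); ring. Qed.

Lemma gL_shift L (u : R) (k : int) : gL L (u + k%:~R * (2 * pi)) = gL L u.
Proof.
have s0 : sin (k%:~R * (2 * pi)) = 0 :> R.
  by rewrite mulrA (_ : k%:~R * 2 = (k * 2)%:~R) ?sin_intpi// intrM.
by case: L; rewrite /= /cas ?cosD ?sinD cos_int2pi s0; ring.
Qed.

(** The alternating sign of [theta1] is a phase pi per index, so the sums over frequencies stay sums
    along arithmetic progressions. *)
Lemma sgn_fL b L (i : nat) (k : int) (u : R) :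
  sgn R b (i%:Z + k) * fL L u = sgn R b k * fL L (u + (if b then pi else 0) * i%:R).
Proof.
case: b; last by rewrite /sgn mul0r addr0.
have sS (m : int) : sgn R true (m + 1) = - sgn R true m.
  rewrite /sgn -signr_odd -[in RHS]signr_odd (_ : odd `|m + 1| = ~~ odd `|m|); last by lia.
  by case: odd; rewrite ?expr0 ?expr1 ?opprK.
elim: i => [|i IH]; first by rewrite add0r mulr0 addr0.
rewrite (_ : i.+1%:Z + k = i%:Z + k + 1); last by lia.
by rewrite sS mulNr IH -natr1 mulrDr mulr1 addrA fL_alt mulrN.
Qed.

Section OneWalk.
Variables (T : rtype) (N : nat) (r : R).
Hypotheses (N1 : (1 < N)%N) (r0 : 0 < r).
Local Notation L := (sharp T).
Local Notation h := (hT T N r).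

(* The mesh puts both walls (or the period) on the lattice. *)
Definition dlt (q : nat) : R := pi * r / (calN R T N * (2 * q)%:R).
Definition theta_ (q j : nat) (p : int) : R := om h (wT T r j) p * dlt q.
(** Lattice version of U_j: the heat factor becomes cos^n, the power of the eigenvalue of one
    averaging step, and the frequencies are cut to the 2q indices from 1 - q to q. *)
Definition wk (q n : nat) (j : 'I_N) (a : int) : R :=
  \sum_(i < 2 * q) (fun p => sgn R (bL L) p * cos (theta_ q j.+1 p) ^+ n * fL L (theta_ q j.+1 p * a%:~R))
    (i%:Z + 1 - q%:Z).

Lemma wkS q n j a : wk q n.+1 j a = (wk q n j (a - 1) + wk q n j (a + 1)) / 2.
Proof.
rewrite /wk -big_split mulr_suml; apply: eq_bigr => i _ /=.
set th := theta_ _ _ _.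
rewrite -mulrDr (_ : th * (a - 1)%:~R = th * a%:~R - th); last by rewrite intrB; ring.
rewrite (_ : th * (a + 1)%:~R = th * a%:~R + th); last by rewrite intrD; ring.
by rewrite fL_step exprS; field.
Qed.

Lemma dlt_gt0 q : (0 < q)%N -> 0 < dlt q.
Proof.
by move=> q0; rewrite divr_gt0 ?mulr_gt0 ?pi_gt0 ?calN_gt0// ltr0n muln_gt0.
Qed.

Lemma theta_E q j p : (0 < q)%N ->
  theta_ q j p = pi / (2 * q)%:R * (p%:~R - 2^-1 + Jidx R T j / calN R T N).
Proof.
move=> q0; rewrite /theta_ /dlt /om /hT /wT.
have c0 : calN R T N != 0 by rewrite gt_eqF ?calN_gt0.
have n0 : (2 * q)%:R != 0 :> R by rewrite pnatr_eq0; lia.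
have rn : r != 0 by rewrite gt_eqF.
by move: (calN R T N) c0 ((2 * q)%:R : R) n0 (Jidx R T j) (pi : R) => c c0 z z0 J p_; field; rewrite ?c0 ?z0 ?rn.
Qed.

(** At time 0 the sum runs over 2q equally spaced phases and cancels unless the site lies on a comb
    of step 4q, displaced by 2q when signs alternate. This makes the initial data sparse enough to
    leave only one configuration, up to rotation. *)
Lemma wk0_zero q j a : (0 < q)%N -> odd `|a|%N = false -> wk q 0 j a <> 0 ->
  exists m : int, a + (if bL L then (2 * q)%:Z else 0) = (2 * (2 * q))%:Z * m.
Proof.
move=> q0 ev nz; apply: (@sin_zero_int R _ (2 * q)%N); first by lia.
apply: contrapT => /eqP s0; apply: nz; rewrite /wk.
set e := (if bL L then _ else 0 : int) in s0.
have n0 : (2 * q)%:R != 0 :> R by rewrite pnatr_eq0; lia.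
pose al : R := pi * (a + e)%:~R / (2 * q)%:R.
pose ph := theta_ q j.+1 (1 - q%:Z) * a%:~R.
have E (i : 'I_(2 * q)) : (fun p => sgn R (bL L) p * cos (theta_ q j.+1 p) ^+ 0 * fL L (theta_ q j.+1 p * a%:~R))
    (i%:Z + 1 - q%:Z) = sgn R (bL L) (1 - q%:Z) * fL L (al * i%:R + ph).
  rewrite /= expr0 mulr1 -addrA sgn_fL; congr (_ * fL L _).
  rewrite /ph !theta_E// /al /e intrD [(i%:Z + _)%:~R]intrD -pmulrn.
  case: (bL L); rewrite -?pmulrn.
    move: (pi : R) ((1 - q%:Z)%:~R : R) (a%:~R : R) (i%:R : R) (Jidx R T j.+1 / _).
    by move: ((2 * q)%:R : R) n0 => z z0 p b c d J; field.
  move: (pi : R) ((1 - q%:Z)%:~R : R) (a%:~R : R) (i%:R : R) (Jidx R T j.+1 / _).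
  by move: ((2 * q)%:R : R) n0 => z z0 p b c d J; field.
rewrite (eq_bigr _ (fun i _ => E i)) -mulr_sumr.
rewrite (@sum_periodic _ (fL L) (gL L)) ?mulr0//.
- by move=> x; exact: gL_prim.
- rewrite (_ : al / 2 = (a + e)%:~R * pi / (2 * (2 * q)%:R))//.
  by rewrite /al; move: (pi : R) ((2 * q)%:R : R) n0 => p z z0; field.
- have [k kE] : exists k, a + e = k * 2.
    exists ((a + e) %/ 2)%Z; rewrite /e; case: (bL L); lia.
  move=> x; rewrite (_ : al * _ = k%:~R * (2 * pi)) ?gL_shift//.
  by rewrite /al kE intrM; move: (pi : R) ((2 * q)%:R : R) n0 => p z z0; field.
Qed.

Lemma theta_La q j p : (0 < q)%N ->
  theta_ q j p * (cNn T N * (2 * q))%:Z%:~R = pi * (calN R T N * (p%:~R - 2^-1) + Jidx R T j).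
Proof.
move=> q0; rewrite theta_E// -pmulrn [(cNn T N * _)%:R]natrM -calNE; last by lia.
have c0 : calN R T N != 0 by rewrite gt_eqF ?calN_gt0.
have n0 : (2 * q)%:R != 0 :> R by rewrite pnatr_eq0; lia.
by move: (calN R T N) c0 ((2 * q)%:R : R) n0 (Jidx R T j) (pi : R) => c c0 z z0 J p_; field; rewrite ?c0 ?z0.
Qed.


Lemma wk_pos_interval q n n' (a : 'I_N -> int) : (0 < q)%N -> (T = C_N \/ T = Bv_N \/ T = D_N) ->
  chI (cNn T N * (2 * q))%:Z n a -> chI (cNn T N * (2 * q))%:Z n' a ->
  0 <= wdet (wk q) n a * wdet (wk q) n' a.
Proof.
move=> q0 HT.
(* The [N] teeth available in the interval: strictly between the walls in type C, odd multiples of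
   2q for [Bv_N], and including both reflecting walls in type D. *)
pose c (k : 'I_N) : int := match T with C_N => (2 * (2 * q))%:Z * (k%:Z + 1)
   | Bv_N => (2 * q)%:Z * (2 * k%:Z + 1) | _ => (2 * (2 * q))%:Z * k%:Z end.
(* At the upper wall all phases are multiples of pi: the sines vanish there, and the cosines are
   even about it. *)
have thint j p : exists k : int, theta_ q j.+1 p * (cNn T N * (2 * q))%:Z%:~R = k%:~R * pi.
  rewrite theta_La//; case: HT => [->|[->|->]] /=.
  - exists ((N%:Z + 1) * (2 * p - 1) + j%:Z + 1).
    rewrite !(intrD, intrM, mulrNz) -!pmulrn -[j.+1%:R]natr1; move: (pi : R) => P; by field.
  - exists (N%:Z * (2 * p - 1) + j%:Z).
    rewrite !(intrD, intrM, mulrNz) -!pmulrn -[j.+1%:R]natr1; move: (pi : R) => P; by field.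
  - exists ((N%:Z - 1) * (2 * p - 1) + j%:Z).
    rewrite !(intrD, intrM, mulrNz) -!pmulrn -[j.+1%:R]natr1; move: (pi : R) => P; by field.
apply: (@walk_interval_pos _ _ _ (wkS q) _ c).
- by case: HT => [->|[->|->]] /=; nia.
- by case: HT => [->|[->|->]] /=; lia.
- case: HT => [TE|[TE|TE]]; [left|left|right]; move=> m j.
  + by rewrite /wk big1// => i _; rewrite TE /= mulr0 sin0 mulr0.
  + by rewrite /wk big1// => i _; rewrite TE /= mulr0 sin0 mulr0.
  + by rewrite /wk; apply: eq_bigr => i _; rewrite TE /= mulrN1 cosN mulr1.
- case: HT => [TE|[TE|TE]]; [left|left|right]; move=> m j.
  + rewrite /wk big1// => i _; have [k E] := thint j (i%:Z + 1 - q%:Z).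
    by rewrite [X in fL _ X]E TE /= sin_intpi mulr0.
  + rewrite /wk big1// => i _; have [k E] := thint j (i%:Z + 1 - q%:Z).
    by rewrite [X in fL _ X]E TE /= sin_intpi mulr0.
  + rewrite /wk; apply: eq_bigr => i _; have [k E] := thint j (i%:Z + 1 - q%:Z).
    set La := (cNn T N * (2 * q))%:Z in E *; set th := theta_ _ _ _ in E *.
    rewrite (_ : th * (La + 1)%:~R = k%:~R * pi + th); last by rewrite intrD mulrDr mulr1 E.
    rewrite (_ : th * (La - 1)%:~R = k%:~R * pi - th); last by rewrite intrB mulrBr mulr1 E.
    by rewrite {2 4}TE /= cosD cosB sin_intpi; congr (_ * _); ring.
- move=> i k ik; rewrite /c; case: (T); nia.
- move=> z j /andP[z0 z1] ze nz; have [m] := wk0_zero q0 ze nz.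
  have X0 : 0 < (2 * (2 * q))%:Z by lia.
  case: HT => [TE|[TE|TE]].
  + have zn0 : z <> 0.
      by move=> E; apply: nz; rewrite /wk big1// => i _; rewrite E TE /= mulr0 sin0 mulr0.
    have znL : z <> (cNn T N * (2 * q))%:Z.
      move=> zE; apply: nz; rewrite /wk big1// => i _; have [k E] := thint j (i%:Z + 1 - q%:Z).
      by rewrite zE [X in fL _ X]E TE /= sin_intpi mulr0.
    have LE : (cNn T N * (2 * q))%:Z = (2 * (2 * q))%:Z * (N%:Z + 1) by rewrite TE /=; lia.
    rewrite {}LE in z1 znL; rewrite TE /= addr0 => E.
    have mr : 0 < m < N%:Z + 1.
      have m0 : 0 <= m by rewrite -(pmulr_rge0 _ X0) -E.
      have mL : m <= N%:Z + 1 by rewrite -(ler_pM2l X0) -E.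
      have m1 : m <> 0 by move=> e; apply: zn0; rewrite E e mulr0.
      have m2 : m <> N%:Z + 1 by move=> e; apply: znL; rewrite E e.
      by lia.
    have mN : (`|m|.-1 < N)%N by lia.
    by exists (Ordinal mN); rewrite /c TE E; congr (_ * _); rewrite /=; lia.
  + have LE : (cNn T N * (2 * q))%:Z = (2 * (2 * q))%:Z * N%:Z by rewrite TE /=; lia.
    rewrite {}LE in z1; rewrite TE /= => E.
    have mr : 0 < m <= N%:Z.
      have m0 : 0 < m by rewrite -(pmulr_rgt0 _ X0) -E; lia.
      have mL : m < N%:Z + 1 by rewrite -(ltr_pM2l X0) -E mulrDr mulr1; lia.
      by lia.
    have mN : (`|m|.-1 < N)%N by lia.
    exists (Ordinal mN); rewrite /c TE.
    have -> : (Ordinal mN)%:Z = m - 1 by rewrite /=; lia.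
    by lia.
  + have LE : (cNn T N * (2 * q))%:Z = (2 * (2 * q))%:Z * (N%:Z - 1) by rewrite TE /=; nia.
    rewrite {}LE in z1; rewrite TE /= addr0 => E.
    have mr : 0 <= m <= N%:Z - 1 by rewrite -(pmulr_rge0 _ X0) -E z0 -(ler_pM2l X0) -E.
    have mN : (`|m| < N)%N by lia.
    by exists (Ordinal mN); rewrite /c TE E; congr (_ * _); rewrite /=; lia.
Qed.

Lemma wk_pos_cyclic q n n' (a : 'I_N -> int) : (0 < q)%N -> T = A_N -> odd N ->
  chC ((2 * (2 * q))%:Z * N%:Z) n a -> chC ((2 * (2 * q))%:Z * N%:Z) n' a ->
  0 <= wdet (wk q) n a * wdet (wk q) n' a.
Proof.
move=> q0 TE No; apply: (@walk_cyclic_pos _ _ _ (wkS q)) => //.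
- by lia.
- by lia.
- move=> m j z; rewrite /wk; apply: eq_bigr => i _; set th := theta_ _ _ _.
  (* Here the parity of [N] enters: for odd [N] the phase over one period is a multiple of 2 pi, for
     even [N] an odd multiple of pi. *)
  have [k E] : exists k : int, th * ((2 * (2 * q))%:Z * N%:Z)%:~R = k%:~R * (2 * pi).
    exists (N%:Z * (i%:Z + 1 - q%:Z) + j%:Z - (N./2)%:Z).
    have := theta_La j.+1 (i%:Z + 1 - q%:Z) q0; rewrite -/th TE /= => E.
    have NE : N%:R = 2 * (N./2)%:R + 1 :> R.
      by rewrite -{1}(odd_double_half N) No natrD -mul2n natrM addrC.
    rewrite (_ : ((2 * (2 * q))%:Z * N%:Z)%:~R = 2 * (N * (2 * q))%:Z%:~R :> R); last first.
      by rewrite !PoszM !intrM; ring.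
    rewrite mulrCA E !(intrD, intrM, mulrNz) -!pmulrn -[j.+1%:R]natr1 NE.
    by move: (pi : R) (i%:R : R) (q%:R : R) (j%:R : R) (N./2%:R : R) => P x y u v; field.
  by rewrite intrD mulrDr E fL_shift.
- move=> z j ze /(wk0_zero q0 ze)[m]; rewrite TE /= addr0 => E; by exists m.
Qed.

End OneWalk.
End LatticeWalk.

(** * Diffusive limit of the walks *)

Section WalkLimit.
Variable R : realType.
Implicit Types (T : rtype) (L : ltype) (x y s d : R).

(** The numbers s / d^2 of steps and x / d of the site are rounded down to even integers, so that
    the walkers and the time always have equal parity. *)
Definition nst s d : nat := (2 * Num.truncn (s / (2 * d ^+ 2)))%N.
Definition ast x d : int := (2 * Num.truncn (x / (2 * d)))%N%:Z.

Lemma nst_bnd s d : 0 <= s -> 0 < d -> s - 2 * d ^+ 2 <= (nst s d)%:R * d ^+ 2 <= s.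
Proof.
move=> s0 d0; have dd : 0 < 2 * d ^+ 2 by rewrite mulr_gt0// exprn_gt0.
have := truncn_itv (divr_ge0 s0 (ltW dd)); rewrite /nst natrM.
move: (Num.truncn _) => m; rewrite -(natr1 m) ler_pdivlMr// ltr_pdivrMr// => /andP[h1 h2].
by move: (m%:R : R) h1 h2 => z h1 h2; apply/andP; split; lra.
Qed.

Lemma ast_bnd x d : 0 <= x -> 0 < d -> x - 2 * d <= (ast x d)%:~R * d <= x.
Proof.
move=> x0 d0; have dd : 0 < 2 * d by rewrite mulr_gt0.
have := truncn_itv (divr_ge0 x0 (ltW dd)); rewrite /ast -pmulrn natrM.
move: (Num.truncn _) => m; rewrite -(natr1 m) ler_pdivlMr// ltr_pdivrMr// => /andP[h1 h2].
by move: (m%:R : R) h1 h2 => z h1 h2; apply/andP; split; lra.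
Qed.

Lemma ast_mono x y d : 0 < d -> x <= y -> ast x d <= ast y d.
Proof.
move=> d0 xy; have dd : 0 < 2 * d by rewrite mulr_gt0.
have : (Num.truncn (x / (2 * d)) <= Num.truncn (y / (2 * d)))%N.
  by apply: le_truncn; rewrite ler_pM2r ?invr_gt0.
by rewrite /ast; lia.
Qed.

Variables (T : rtype) (N : nat) (r : R).
Hypotheses (N1 : (1 < N)%N) (r0 : 0 < r).
Local Notation L := (sharp T).
Local Notation h := (hT T N r).
Local Notation dl q := (dlt T N r q).

Lemma dlt_cvg q0 : (0 < q0)%N -> dl (i + q0)%N @[i --> \oo] --> 0.
Proof.
move=> q00; have c0 := calN_gt0 R T N1; have p0 := pi_gt0 R.
apply: (@cvg_dom _ _ (fun i => pi * r / calN R T N * harmonic i)); last first.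
  by rewrite -(mulr0 (pi * r / calN R T N)); apply: cvgMr; exact: cvg_harmonic.
move=> i; rewrite subr0 ger0_norm; last by apply/ltW/dlt_gt0 => //; lia.
rewrite /dlt /harmonic /= invfM mulrA ler_wpM2l//.
  by rewrite divr_ge0 ?mulr_ge0 ?ltW.
by rewrite lef_pV2 ?posrE ?ltr0n ?ler_nat//; lia.
Qed.

Lemma J_frac (j : 'I_N) : 0 <= Jidx R T j.+1 / calN R T N <= 1.
Proof.
have c0 := calN_gt0 R T N1; have /andP[J1 J2] := J_bnd R T j.
apply/andP; split; first by rewrite divr_ge0 ?(ltW c0)// (le_trans _ J1).
rewrite ler_pdivrMr// mul1r (le_trans J2)//.
have : j.+1%:R <= N%:R :> R by rewrite ler_nat.
have : 2 <= N%:R :> R by rewrite ler_nat.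
by rewrite {c0 J1 J2} => hz hy; case: (T) => /=; lra.
Qed.

(** The index plus its shift is at most q + 1/2, hence at most 3q/2. Angles thus stay away from pi,
    where powers of the cosine would not decay. *)
Lemma theta_le q (j : 'I_N) (p : int) : (0 < q)%N -> 1 - q%:Z <= p <= q%:Z ->
  `|theta_ T N r q j.+1 p| <= 3 * pi / 4.
Proof.
move=> q0 /andP[p1 p2]; rewrite theta_E//.
have qR : 1 <= q%:R :> R by rewrite ler1n.
have q2 : 0 < (2 * q)%:R :> R by rewrite ltr0n; lia.
rewrite normrM ger0_norm ?divr_ge0 ?pi_ge0 ?(ltW q2)// mulrAC ler_pdivrMr//.
rewrite (_ : 3 * pi / 4 * _ = pi * (3 * q%:R / 2)); last by rewrite natrM; move: (pi : R) => P; field.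
rewrite ler_wpM2l ?pi_ge0// ler_norml.
have /andP[J1 J2] := J_frac j.
have e1 : 1 - q%:R <= p%:~R :> R by rewrite (_ : 1 - q%:R = (1 - q%:Z)%:~R) ?ler_int// intrB -pmulrn.
have e2 : p%:~R <= q%:R :> R by rewrite (_ : q%:R = (q%:Z)%:~R) ?ler_int// -pmulrn.
by apply/andP; split; lra.
Qed.

Section WkCvg.
Variables (s x : R) (q0 : nat) (j : 'I_N).
Hypotheses (s0 : 0 < s) (x0 : 0 <= x) (q00 : (0 < q0)%N).
Hypothesis dsm : forall i, 4 * dl (i + q0)%N ^+ 2 <= s.

Let om_ p := om h (wT T r j.+1) p.
Let term i p : R := sgn R (bL L) p * cos (theta_ T N r (i + q0) j.+1 p) ^+ nst s (dl (i + q0)) *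
    fL L (theta_ T N r (i + q0) j.+1 p * (ast x (dl (i + q0)))%:~R).
Let trm i p : R := if (1 - (i + q0)%N%:Z <= p) && (p <= (i + q0)%N%:Z) then term i p else 0.

Let dpos i : 0 < dl (i + q0). Proof. by apply: dlt_gt0 => //; lia. Qed.

(** Time of the dominating Gaussian: [csin ^+ 2] comes from [cos_pow_le], and s/2 from n d^2 >= s -
    2 d^2 >= s/2, by [dsm]. *)
Let tq : R := csin R ^+ 2 * (s / 2).

Let trm_gb i : gb (2 * gA tq (h / 2 + `|wT T r j.+1|)) (gc tq h) (trm i).
Proof.
have tq0 : 0 <= tq by rewrite mulr_ge0 ?sqr_ge0// divr_ge0// ltW.
have hh : 0 < h <= h by rewrite hT_gt0//=.
move=> p; have g0 := gauss_le (w := wT T r j.+1) p tq0 hh (lexx _).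
have E0 : 0 <= gA tq (h / 2 + `|wT T r j.+1|) * gc tq h ^+ `|p|%N.
  by apply: le_trans g0; exact: expR_ge0.
rewrite -mulrA /trm; case: ifP => [pr|_]; last by rewrite normr0 mulr_ge0.
rewrite /term normrM [X in X * _]normrM sgn_norm mul1r mulrC; apply: ler_pM => //; first exact: fL_le2.
apply: le_trans (cos_pow_le _ (theta_le _ _ pr)) _; first by lia.
apply: le_trans g0; rewrite /eg ler_expR lerN2 /tq /theta_.
have /andP[n1 _] := nst_bnd (ltW s0) (dpos i).
have n2 : s / 2 <= (nst s (dl (i + q0)))%:R * dl (i + q0) ^+ 2 by have := dsm i; lra.
set o := om _ _ _; move: ((nst _ _)%:R : R) n2 => z n2.
have : 0 <= csin R ^+ 2 * o ^+ 2 * (z * dl (i + q0) ^+ 2 - s / 2) / 2.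
  by rewrite divr_ge0// mulr_ge0 ?subr_ge0// mulr_ge0 ?sqr_ge0.
move=> P; rewrite -subr_ge0; apply: le_trans P _.
by rewrite le_eqVlt; apply/orP; left; apply/eqP; move: (csin R) => c; field.
Qed.

Let da_cvg : dl (i + q0)%N * (ast x (dl (i + q0)%N))%:~R @[i --> \oo] --> x.
Proof.
apply: (@cvg_dom _ _ (fun i => 2 * dl (i + q0)%N)).
  move=> i; have /andP[h1 h2] := ast_bnd x0 (dpos i); rewrite ler_norml.
  by have := dpos i; move=> ?; apply/andP; split; lra.
by rewrite -(mulr0 2); apply: cvgMr; exact: dlt_cvg.
Qed.

Let nd_cvg : (nst s (dl (i + q0)%N))%:R * dl (i + q0)%N ^+ 2 @[i --> \oo] --> s.
Proof.
apply: (@cvg_dom _ _ (fun i => 2 * (dl (i + q0)%N * dl (i + q0)%N))).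
  move=> i; have /andP[h1 h2] := nst_bnd (ltW s0) (dpos i); rewrite ler_norml -expr2.
  by have := sqr_ge0 (dl (i + q0)); move=> ?; apply/andP; split; lra.
rewrite -(mulr0 2); apply: cvgMr; rewrite -(mulr0 0); apply: cvgM; exact: dlt_cvg.
Qed.

Lemma wk_cvg : wk T r (i + q0)%N (nst s (dl (i + q0))) j (ast x (dl (i + q0)%N)) @[i --> \oo] -->
  U L h (wT T r j.+1) s x.
Proof.
have E i : wk T r (i + q0)%N (nst s (dl (i + q0))) j (ast x (dl (i + q0)%N)) = zs (trm i).
  by rewrite /trm (zs_finite (term i)).
rewrite (eq_cvg _ _ E); have tq0 : 0 < tq.
  by rewrite mulr_gt0 ?exprn_gt0 ?csin_gt0// divr_gt0.
apply: (zs_tannery (gc01 tq0 (hT_gt0 T N1 r0)) trm_gb) => p.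
have cterm : term i p @[i --> \oo] --> sgn R (bL L) p * eg h (wT T r j.+1) s p * fL L (om_ p * x).
  apply: cvgM.
    by apply: cvgMr; apply: cvg_cos_pow => //; exact: dlt_cvg.
  apply: continuous_cvg; first exact: fL_cont.
  rewrite /theta_; under eq_fun do rewrite -mulrA.
  by apply: cvgMr; exact: da_cvg.
apply: cvg_trans cterm; apply: near_eq_cvg; near=> i.
rewrite /trm ifT//.
have : (`|p|.+1 <= i)%N by near: i; exact: nbhs_infty_ge.
by lia.
Unshelve. all: by end_near. Qed.

End WkCvg.

Lemma small_q (s : R) : 0 < s -> exists q0, (0 < q0)%N /\ forall q, (q0 <= q)%N -> 4 * dl q ^+ 2 <= s.
Proof.
move=> s0.
have cd : 4 * (dl (i + 1)%N * dl (i + 1)%N) @[i --> \oo] --> (0 : R).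
  by rewrite -(mulr0 4); apply: cvgMr; rewrite -(mulr0 0); apply: cvgM; exact: dlt_cvg.
have /(_ _ s0) [m _ hm] : forall e, 0 < e -> \forall i \near \oo, 4 * (dl (i + 1)%N * dl (i + 1)%N) < e.
  by move=> e e0; exact: (cvgr_lt _ cd).
exists m.+1; split=> // q mq; have := hm q.-1; rewrite /= addn1 prednK; last by lia.
by rewrite -expr2 => /(_ _)/ltW; apply; lia.
Qed.

Lemma det_U_pos (x : 'I_N -> R) (s s' : R) : 0 < s -> 0 < s' ->
  (T = A_N /\ odd N) \/ (T = C_N \/ T = Bv_N \/ T = D_N) ->
  (forall i k : 'I_N, (i <= k)%N -> x i <= x k) -> (forall i, 0 <= x i <= upper T r) ->
  0 <= \det (\matrix_(k < N, j < N) U L h (wT T r j.+1) s (x k)) *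
       \det (\matrix_(k < N, j < N) U L h (wT T r j.+1) s' (x k)).
Proof.
move=> s0 s0' HT xm xr.
have [q1 [q10 h1]] := small_q s0; have [q2 [q20 h2]] := small_q s0'.
pose q0 := (q1 + q2)%N.
have q00 : (0 < q0)%N by rewrite /q0; lia.
have d1 i : 4 * dl (i + q0)%N ^+ 2 <= s by apply: h1; rewrite /q0; lia.
have d2 i : 4 * dl (i + q0)%N ^+ 2 <= s' by apply: h2; rewrite /q0; lia.
pose aa i k := ast (x k) (dl (i + q0)%N).
have cdet u : 0 < u -> (forall i, 4 * dl (i + q0)%N ^+ 2 <= u) ->
    wdet (wk T r (i + q0)%N) (nst u (dl (i + q0)%N)) (aa i) @[i --> \oo] -->
    \det (\matrix_(k < N, j < N) U L h (wT T r j.+1) u (x k)).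
  move=> u0 hu; rewrite /wdet /determinant; apply: cvg_bigsum => p; apply: cvgMr.
  apply: cvg_bigprod => k; rewrite mxE.
  under eq_fun do rewrite mxE.
  by apply: wk_cvg => //; have /andP[] := xr k.
apply: (cvgr_to_ge (cvgM (cdet _ s0 d1) (cdet _ s0' d2))); apply: nearW => i /=.
have dp : 0 < dl (i + q0) by apply: dlt_gt0 => //; lia.
have ae k : odd `|aa i k|%N = false by rewrite /aa /ast; lia.
have ne u : odd (nst u (dl (i + q0))) = false by rewrite /nst; lia.
have am : nondec (aa i) by move=> k k' kk; apply: ast_mono => //; exact: xm.
have a0 k : 0 <= aa i k by rewrite /aa /ast.
have ale k (La : int) : upper T r = La%:~R * dl (i + q0) -> aa i k <= La.
  move=> E; have /andP[xk0 xk1] := xr k; have /andP[_ h3] := ast_bnd xk0 dp.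
  by rewrite -(ler_int R) -(ler_pM2r dp) -E; exact: le_trans h3 xk1.
have qi : (0 < i + q0)%N by lia.
have cn0 : calN R T N != 0 by rewrite gt_eqF ?calN_gt0.
have n0 : (2 * (i + q0))%:R != 0 :> R by rewrite pnatr_eq0; lia.
case: HT => [[TE No]|HT].
  have hc u : chC ((2 * (2 * (i + q0)))%:Z * N%:Z) (nst u (dl (i + q0))) (aa i).
    split=> // [k k'|k]; last by rewrite ae ne.
    suff : aa i k' <= (2 * (2 * (i + q0)))%:Z * N%:Z by have := a0 k; lia.
    apply: ale; rewrite TE /= intrM -!pmulrn natrM /dlt -/(calN R A_N N).
    move: cn0; rewrite TE => cn0; move: (calN R A_N N) cn0 ((2 * (i + q0))%:R : R) n0 (pi : R).
    by move=> c cn0 z z0 P; field; rewrite cn0 z0.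
  exact: (wk_pos_cyclic N1 r0 qi TE No (hc _) (hc _)).
have hc u : chI (cNn T N * (2 * (i + q0)))%:Z (nst u (dl (i + q0))) (aa i).
  split=> // k; last by rewrite ae ne.
  rewrite a0/=; apply: ale.
  have -> : upper T r = pi * r by case: HT => [->|[->|->]].
  rewrite -pmulrn natrM -calNE; last by lia.
  rewrite /dlt; move: (calN R T N) cn0 ((2 * (i + q0))%:R : R) n0 (pi : R).
  by move=> c cn0 z z0 P; field; rewrite cn0 z0.
exact: (wk_pos_interval N1 r0 qi HT (hc _) (hc _)).
Qed.

End WalkLimit.

(** * Positivity of the limit functional *)

Section Positivity.
Variables (R : realType) (ts rho t : R).
Hypotheses (rho0 : 0 < rho) (tts : 0 < t < ts).
Local Notation rN T N := (r_scale T rho N).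

(** The kernel matrix is a product of the matrix of the U_j at time t, a positive diagonal matrix,
    and the transposed matrix at time ts - t; the two outer determinants have equal signs by
    [det_U_pos]. *)
Lemma Dks_kN_ge0 T N s : (1 < N)%N -> (T = A_N /\ odd N) \/ (T = C_N \/ T = Bv_N \/ T = D_N) ->
  inB (nseq N (BT T (rN T N))) s -> sorted <%R s -> 0 <= Dks (kN' ts rho t T N) s.
Proof.
move=> N1 HT sB ss; have /andP[t0 tl] := tts; have t1 : 0 < ts - t by rewrite subr_gt0.
have ts0 : 0 < ts by exact: lt_trans tl.
have r0 : 0 < rN T N by apply: r_scale_gt0 => //; lia.
have sN : size s = N by rewrite (inB_size sB) size_nseq.
rewrite (Dks_size _ sN).
pose A u := \matrix_(k < N, j < N) U (sharp T) (hT T N (rN T N)) (wT T (rN T N) j.+1) u s`_k.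
pose d : 'rV[R]_N := \row_j (kap T N (rN T N) ts j.+1)^-1.
have -> : \matrix_(i < N, j < N) kN' ts rho t T N s`_i s`_j = A t *m diag_mx d *m (A (ts - t))^T.
  apply/matrixP => i k; rewrite !mxE /kN' N1 /kN; apply: eq_bigr => j _.
  by rewrite mul_mx_diag !mxE mulrAC.
rewrite !det_mulmx det_tr det_diag mulrAC mulr_ge0//; last first.
  by apply: prodr_ge0 => j _; rewrite mxE invr_ge0 ltW// kap_gt0.
apply: det_U_pos => //.
  move=> i k; rewrite leq_eqVlt => /orP[/eqP/val_inj ->//|ik].
  by apply: ltW; apply: (sorted_ltn_nth lt_trans 0 ss) => //; rewrite inE sN.
move=> i; have : BT T (rN T N) s`_i.
  by apply: (inB_nseq sB); rewrite mem_nth// sN.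
by case; rewrite /= in_itv.
Qed.

Lemma Efin_ge0 T N G : (1 < N)%N -> (T = A_N /\ odd N) \/ (T = C_N \/ T = Bv_N \/ T = D_N) ->
  (forall s, 0 <= G s) -> 0 <= Efin ts rho t T N G.
Proof.
move=> N1 HT G0; apply: rint_ge0 => s sB; case: (boolP (sorted _ s)) => ss; last by rewrite mul0r.
by rewrite mul1r mulr_ge0// Dks_kN_ge0.
Qed.

Lemma EE_klim_ge0 L M G : nice M G -> (forall s, 0 <= G s) -> 0 <= EE (@Slim R L) (klim ts rho t L) G.
Proof.
move=> nG G0.
have ge0 T (n : nat -> nat) : (forall i, (i < n i)%N) ->
    (forall i, (T = A_N /\ odd (n i)) \/ (T = C_N \/ T = Bv_N \/ T = D_N)) -> (forall i, (1 < n i)%N) ->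
    0 <= EE (@Slim R (sharp T)) (klim ts rho t (sharp T)) G.
  move=> ni HT n1; have cv := Efin_cvg rho0 tts (T := T) nG.
  have cn : n i @[i --> \oo] --> \oo.
    move=> A [m _ hm]; exists m => // k /= mk; apply: hm => /=; have := ni k; lia.
  have cc : Efin ts rho t T (n i) G @[i --> \oo] --> EE (@Slim R (sharp T)) (klim ts rho t (sharp T)) G.
    exact: (@cvg_comp _ _ _ n (fun N => Efin ts rho t T N G) _ _ _ cn cv).
  apply: (cvgr_to_ge cc); apply: nearW => i /=; exact: Efin_ge0.
case: L.
(* In type A the subsequence runs through odd [N] exceeding 1. *)
- apply: (ge0 A_N (fun i => (2 * i).+3)) => i; try lia; by left; split=> //=; lia.
- by apply: (ge0 Bv_N (fun i => i.+2)) => i //; right; right; left.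
- by apply: (ge0 C_N (fun i => i.+2)) => i //; right; left.
- by apply: (ge0 D_N (fun i => i.+2)) => i //; right; right; right.
Qed.

End Positivity.

Section LimitKernel.
Variable R : realType.

Lemma Slim_gap (L : ltype) (x : R) : ~ @Slim R L x -> exists u v : rat, ratr u < x < ratr v /\
  fine (lebesgue_measure (@Slim R L `&` `]ratr u, ratr v]%classic)) = 0.
Proof.
have gap : ~ (`[0, +oo[%classic : set R) x -> exists u v : rat, ratr u < x < ratr v /\
    fine (lebesgue_measure (`[0, +oo[%classic `&` `]ratr u, ratr v]%classic : set R)) = 0.
  move=> h; have x0 : x < 0 by rewrite ltNge; apply/negP => h2; apply: h; rewrite /= in_itv/= h2.
  have [v] := rat_in_itvoo x0; rewrite in_itv/= => /andP[v1 v2].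
  have x1 : x - 1 < x by lra.
  have [u] := rat_in_itvoo x1; rewrite in_itv/= => /andP[u1 u2].
  exists u, v; split; first by rewrite u2.
  rewrite (_ : _ `&` _ = set0) ?measure0//.
  by apply/seteqP; split=> y //= []; rewrite !in_itv /=; lra.
by case: L => // h; case: h.
Qed.

Lemma det_Klim (L : ltype) (ts rho t : R) n (x : 'I_n -> R) : 0 < rho -> 0 < t < ts ->
  \det (\matrix_(i < n, j < n) Klim L ts rho t (x i) (x j)) =
  cR (\det (\matrix_(i < n, j < n) klim ts rho t L (x i) (x j))).
Proof.
move=> rho0 tts; rewrite -[RHS]/(real_complex R _) -det_map_mx; congr (\det _).
by apply/matrixP => i j; rewrite !mxE Klim_real.
Qed.

Lemma bker_klimL (L : ltype) (ts rho t : R) : 0 < rho -> 0 < t < ts ->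
  bker (klim ts rho t L) (rho * KK ts rho t).
Proof.
by move=> rho0 tts; case: L; [apply: (bker_klim rho0 tts A_N)|apply: (bker_klim rho0 tts B_N)|
  apply: (bker_klim rho0 tts C_N)|apply: (bker_klim rho0 tts D_N)].
Qed.

End LimitKernel.

Theorem theorem3p6 (R : realType) (tstar rho : R) :
  0 < tstar -> 0 < rho ->
  forall (L : ltype) (t : R), 0 < t < tstar ->
  exists (d : measure_display) (Omega : measurableType d)
         (P : probability Omega R) (xi : Omega -> set R),
    point_process P (Slim L) xi /\
    determinantal P (Slim L) xi (Klim L tstar rho t) /\
    (forall T : rtype, sharp T = L -> fdd_conv T tstar rho t P xi).
Proof.
move=> ts0 rho0 L t tts.
have bk := bker_klimL L rho0 tts.
have [xi [pp [pfin pint]]] := process_exists (@Slim_meas R L) bk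
  (fun M G nG G0 => EE_klim_ge0 rho0 tts L nG G0) (@Slim_gap R L).
exists _, (measurableTypeR R), (Punit R), xi; split=> //; split.
  split=> [n x _|n a b ab]; first by rewrite det_Klim.
  rewrite pint// -iint_rint.
  - apply: eq_iint => s sB; rewrite (Dks_size _ (_ : size s = n)); last first.
      by rewrite (inB_size sB) size_map size_enum_ord.
    by rewrite (det_Klim L (fun i : 'I_n => s`_i) rho0 tts).
  - elim: (enum 'I_n) => //= i e IH; apply/bsets_cons; split=> //.
    by apply: bsetI; [exact: bset_itv|exact: Slim_meas].
  - exact: bnm_Dks bk.
(* The process depends on the limit type only: the expectations of every finite system with this
   [sharp] converge to the same functional, whichever system provided its positivity. *)
move=> T TL m a b k; rewrite pfin -TL.
have cv := Efin_cvg rho0 tts (T := T) (nice_cylind a b k).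
apply: cvg_trans cv; apply: near_eq_cvg; near=> N.
rewrite Pfin_Efin//; near: N; exact: nbhs_infty_gt.
Unshelve. all: by end_near. Qed.
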